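(* Let $0<c<\kappa\le1$. Then for every $g\in SO(3)$ there is an optimal decomposition of $g$ which is a subword of one of the following patterns, or of a pattern obtained from it by the indicated symmetries: (I) $R(t_XX)\,R(t_YY)\,R(-t_XX)\,R(-t_YY)$ with $0<t_X,t_Y\le\pi$, $\tan(t_X/2)=\kappa\tan(t_Y/2)$, and its images under the group $(X,Y)\mapsto\{\pm X,\pm Y\}$; (IV) $R(\hat t_YY)\,R(\hat t_XX)\,R(tW_+)\,R(\hat t_XX)\,R(\hat t_YY)$, $t\ge0$, and its images under the group $(X,Y)\mapsto\{-X,-Y\}$; (V) $R(\hat t_YY)\,R(\hat t_XX)\,R(tW_+)\,R(-\hat t_YY)\,R(-\hat t_XX)$, $t\ge0$, and its images under $(X,Y)\mapsto\{-X,-Y\}$; (VI) $R(\pi Y)\,R(tW_-)\,R(\pi Y)$, $t\ge0$, and its images under $(X,Y)\mapsto\{-X,-Y\}$; (VII) $R(\pi X)\,R(tW_-)\,R(\pi Y)$, $t\ge0$, and its images under $(X,Y)\mapsto\{-X,-Y\}$.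
   Context: Fix unit vectors $X,Y\in\mathbb R^3$ with angle $\alpha\in(0,\pi/2]$, $c=\cos\alpha\in[0,1)$, and $\kappa\in[0,1]$. For a unit vector $v$, $R(tv)\in SO(3)$ is rotation by angle $t$ about $v$ (counterclockwise viewed from the tip): $R(tv)=\cos t\,I+\sin t\,[v]_\times+(1-\cos t)vv^T$, $[v]_\times w=v\times w$; for nonzero non-unit $v$, $R(tv):=R((t|v|)\,v/|v|)$. For nonzero $C=aX+bY$, $\mathrm{cost}(C)=|a|+\kappa|b|$. A decomposition of $g\in SO(3)$ is a finite product $g=R(\tau_1C_1)\cdots R(\tau_nC_n)$ with $\tau_j\ge0$, $C_j$ nonzero in $\mathrm{span}\{X,Y\}$ (a factor $R(-\tau C)$, $\tau\ge0$, means $R(\tau(-C))$), with cost $\sum\tau_j\mathrm{cost}(C_j)$. Problem 1: minimize the cost over all decompositions of $g$; a decomposition is optimal if its cost equals the infimum. Set $W_+=(1+\kappa c)X-(\kappa+c)Y$, $W_-=(1-\kappa c)X+(\kappa-c)Y$, and (when $c+\kappa>0$) $\hat t_X=\arccos\frac{c-\kappa}{c+\kappa}$, $\hat t_Y=\arccos\left(-\frac{1-\kappa c}{1+\kappa c}\right)$, both in $[0,\pi]$. Subword: for a word $R(\tau_1C_1)\cdots R(\tau_nC_n)$ ($\tau_j\ge0$), a subword is $R(\tau_k'C_k)R(\tau_{k+1}C_{k+1})\cdots R(\tau_{m-1}C_{m-1})R(\tau_m'C_m)$ with $1\le k\le m\le n$, $0\le\tau_k'\le\tau_k$, $0\le\tau_m'\le\tau_m$.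 Symmetries of patterns: labels are $\pm X,\pm Y,\pm W_+,\pm W_-$; define label maps, each extended by $\sigma(-C)=-\sigma(C)$: $\nu:C\mapsto -C$; $\rho: X\mapsto X,\ Y\mapsto -Y,\ W_+\mapsto W_-,\ W_-\mapsto W_+$; $\varsigma: X\mapsto Y,\ Y\mapsto X,\ W_+\mapsto -W_+,\ W_-\mapsto W_-$. Applying $\nu$ or $\rho$ to a pattern replaces each label by its image and keeps the times. Applying $\varsigma$ replaces each label by its image and interchanges $t_X\leftrightarrow t_Y$ and $\hat t_X\leftrightarrow\hat t_Y$ in the times (times $\pi$ and free parameters $t$ unchanged), so that factors labelled $\pm X$ carry the $X$-time and factors labelled $\pm Y$ carry the $Y$-time; stated relations and ranges are kept verbatim. ''Under $(X,Y)\mapsto\{-X,-Y\}$'' means images under the group $\{\mathrm{id},\nu,\varsigma,\nu\varsigma\}$; ''under $(X,Y)\mapsto\{\pm X,\pm Y\}$'' means under the 8-element group generated by $\nu,\rho,\varsigma$. *)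

(* Defs.v *)
From Stdlib Require Import Reals List.
Open Scope R_scope.
Import ListNotations.

Record V3 := mkV { vx : R; vy : R; vz : R }.

Definition vadd (u v : V3) : V3 := mkV (vx u + vx v) (vy u + vy v) (vz u + vz v).
Definition vscale (a : R) (v : V3) : V3 := mkV (a * vx v) (a * vy v) (a * vz v).
Definition dot (u v : V3) : R := vx u * vx v + vy u * vy v + vz u * vz v.
Definition vnorm (v : V3) : R := sqrt (dot v v).

Record M3 := mkM { m11 : R; m12 : R; m13 : R;
                   m21 : R; m22 : R; m23 : R;
                   m31 : R; m32 : R; m33 : R }.

Definition mid3 : M3 := mkM 1 0 0 0 1 0 0 0 1.

Definition mmul (A B : M3) : M3 :=
  mkM (m11 A * m11 B + m12 A * m21 B + m13 A * m31 B)
      (m11 A * m12 B + m12 A * m22 B + m13 A * m32 B)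
      (m11 A * m13 B + m12 A * m23 B + m13 A * m33 B)
      (m21 A * m11 B + m22 A * m21 B + m23 A * m31 B)
      (m21 A * m12 B + m22 A * m22 B + m23 A * m32 B)
      (m21 A * m13 B + m22 A * m23 B + m23 A * m33 B)
      (m31 A * m11 B + m32 A * m21 B + m33 A * m31 B)
      (m31 A * m12 B + m32 A * m22 B + m33 A * m32 B)
      (m31 A * m13 B + m32 A * m23 B + m33 A * m33 B).

Definition mtrans (A : M3) : M3 :=
  mkM (m11 A) (m21 A) (m31 A) (m12 A) (m22 A) (m32 A) (m13 A) (m23 A) (m33 A).

Definition mdet (A : M3) : R :=
  m11 A * (m22 A * m33 A - m23 A * m32 A)
  - m12 A * (m21 A * m33 A - m23 A * m31 A)
  + m13 A * (m21 A * m32 A - m22 A * m31 A).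

Definition inSO3 (A : M3) : Prop := mmul (mtrans A) A = mid3 /\ mdet A = 1.

(** Rotation by angle t about a unit vector v (counterclockwise seen from the tip):
    cos t I + sin t [v]_x + (1 - cos t) v v^T. *)
Definition rot_unit (t : R) (v : V3) : M3 :=
  let x := vx v in let y := vy v in let z := vz v in
  let C := cos t in let S := sin t in let K := 1 - cos t in
  mkM (C + K * x * x)     (- S * z + K * x * y) (S * y + K * x * z)
      (S * z + K * y * x) (C + K * y * y)       (- S * x + K * y * z)
      (- S * y + K * z * x) (S * x + K * z * y) (C + K * z * z).

Definition rot (t : R) (v : V3) : M3 :=
  rot_unit (t * vnorm v) (vscale (/ vnorm v) v).

(** * Decompositions.  A factor R(tau C) with C = a X + b Y is stored as (tau, (a, b)). *)
Definition factor := (R * (R * R))%type.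

Definition fvec (X Y : V3) (ab : R * R) : V3 :=
  vadd (vscale (fst ab) X) (vscale (snd ab) Y).

Definition word_prod (X Y : V3) (w : list factor) : M3 :=
  fold_right (fun f acc => mmul (rot (fst f) (fvec X Y (snd f))) acc) mid3 w.

Definition fcost (kappa : R) (f : factor) : R :=
  fst f * (Rabs (fst (snd f)) + kappa * Rabs (snd (snd f))).

Definition word_cost (kappa : R) (w : list factor) : R :=
  fold_right (fun f acc => fcost kappa f + acc) 0 w.

Definition is_decomp (X Y : V3) (g : M3) (w : list factor) : Prop :=
  Forall (fun f => 0 <= fst f /\ fvec X Y (snd f) <> mkV 0 0 0) w /\
  word_prod X Y w = g.

Definition optimal (X Y : V3) (kappa : R) (g : M3) (w : list factor) : Prop :=
  is_decomp X Y g w /\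
  forall w', is_decomp X Y g w' -> word_cost kappa w <= word_cost kappa w'.

Definition subword (w' w : list factor) : Prop :=
  (exists l1 l2 tau tau' C,
      w = l1 ++ (tau, C) :: l2 /\ w' = [(tau', C)] /\ 0 <= tau' <= tau) \/
  (exists l1 mid l2 tau1 tau1' C1 tau2 tau2' C2,
      w = l1 ++ (tau1, C1) :: mid ++ (tau2, C2) :: l2 /\
      w' = (tau1', C1) :: mid ++ [(tau2', C2)] /\
      0 <= tau1' <= tau1 /\ 0 <= tau2' <= tau2).

Inductive base := BX | BY | BWp | BWm.
(* a label is (negated?, base) *)
Definition label := (bool * base)%type.
Inductive tspec := TX | TY | TPi | TFree.
Definition pattern := list (tspec * label).

(* coefficients (a,b) of the base labels w.r.t. X, Y, with c = cos alpha *)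
Definition base_coef (kappa c : R) (b : base) : R * R :=
  match b with
  | BX => (1, 0)
  | BY => (0, 1)
  | BWp => (1 + kappa * c, - (kappa + c))
  | BWm => (1 - kappa * c, kappa - c)
  end.

Definition label_coef (kappa c : R) (l : label) : R * R :=
  let ab := base_coef kappa c (snd l) in
  if fst l then (- fst ab, - snd ab) else ab.

Definition tval (tX tY t : R) (s : tspec) : R :=
  match s with TX => tX | TY => tY | TPi => PI | TFree => t end.

Definition eval_pattern (kappa c tX tY t : R) (p : pattern) : list factor :=
  map (fun st => (tval tX tY t (fst st), label_coef kappa c (snd st))) p.

Inductive sym := Nu | Rho | Vs.

Definition sym_label (s : sym) (l : label) : label :=
  let (n, b) := l in
  match s, b with
  | Nu, _ => (negb n, b)
  | Rho, BX => (n, BX)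
  | Rho, BY => (negb n, BY)
  | Rho, BWp => (n, BWm)
  | Rho, BWm => (n, BWp)
  | Vs, BX => (n, BY)
  | Vs, BY => (n, BX)
  | Vs, BWp => (negb n, BWp)
  | Vs, BWm => (n, BWm)
  end.

Definition sym_time (s : sym) (t : tspec) : tspec :=
  match s, t with
  | Vs, TX => TY
  | Vs, TY => TX
  | _, _ => t
  end.

Definition sym_pattern (s : sym) (p : pattern) : pattern :=
  map (fun st => (sym_time s (fst st), sym_label s (snd st))) p.

Definition syms_pattern (ss : list sym) (p : pattern) : pattern :=
  fold_right sym_pattern p ss.

(* group {id, nu, varsigma, nu varsigma} = group generated by nu, varsigma *)
Definition in_G4 (ss : list sym) : Prop := Forall (fun s => s = Nu \/ s = Vs) ss.
(* the 8-element group generated by nu, rho, varsigma: all words in them *)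
Definition in_G8 (ss : list sym) : Prop := True.


Definition pat_I : pattern :=
  [(TX, (false, BX)); (TY, (false, BY)); (TX, (true, BX)); (TY, (true, BY))].
Definition pat_IV : pattern :=
  [(TY, (false, BY)); (TX, (false, BX)); (TFree, (false, BWp));
   (TX, (false, BX)); (TY, (false, BY))].
Definition pat_V : pattern :=
  [(TY, (false, BY)); (TX, (false, BX)); (TFree, (false, BWp));
   (TY, (true, BY)); (TX, (true, BX))].
Definition pat_VI : pattern :=
  [(TPi, (false, BY)); (TFree, (false, BWm)); (TPi, (false, BY))].
Definition pat_VII : pattern :=
  [(TPi, (false, BX)); (TFree, (false, BWm)); (TPi, (false, BY))].

Definition hat_tX (kappa c : R) : R := acos ((c - kappa) / (c + kappa)).
Definition hat_tY (kappa c : R) : R := acos (- ((1 - kappa * c) / (1 + kappa * c))).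

(* tan(tX/2) = kappa tan(tY/2) for tX, tY in (0, pi]; at tX = pi or tY = pi
   (tan = +infinity) the relation is read as tX = tY = pi. *)
Definition rel_I (kappa tX tY : R) : Prop :=
  (tX < PI /\ tY < PI /\ tan (tX / 2) = kappa * tan (tY / 2)) \/ (tX = PI /\ tY = PI).

Definition allowed_word (kappa c : R) (w : list factor) : Prop :=
  (exists ss tX tY, in_G8 ss /\ 0 < tX <= PI /\ 0 < tY <= PI /\ rel_I kappa tX tY /\
      w = eval_pattern kappa c tX tY 0 (syms_pattern ss pat_I)) \/
  (exists ss t, in_G4 ss /\ 0 <= t /\
      w = eval_pattern kappa c (hat_tX kappa c) (hat_tY kappa c) t (syms_pattern ss pat_IV)) \/
  (exists ss t, in_G4 ss /\ 0 <= t /\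
      w = eval_pattern kappa c (hat_tX kappa c) (hat_tY kappa c) t (syms_pattern ss pat_V)) \/
  (exists ss t, in_G4 ss /\ 0 <= t /\
      w = eval_pattern kappa c 0 0 t (syms_pattern ss pat_VI)) \/
  (exists ss t, in_G4 ss /\ 0 <= t /\
      w = eval_pattern kappa c 0 0 t (syms_pattern ss pat_VII)).

(* Main.v *)
Require Import Defs.
From Stdlib Require Import Reals ZArith List Lra Lia Classical ClassicalEpsilon.
Import ListNotations.
Open Scope R_scope.

(** Fix g and n, and minimise cost - n tr(g^T h) over pairs (h, cost) in the closure of the set of
    words; the minimum is attained by a curve gamma in SO(3).  Its momentum gamma(s)^T lambda has
    coordinates x, y, z along X, Y, X x Y.  By the first-order condition (x, y) stays on the boundary
    of the rectangle |x| <= kx, |y| <= ky; the curve follows +-X or +-Y along an edge and +-W_+ or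
    +-W_- while it rests at a corner with z = 0.  Hence gamma is a finite word in these letters.
    Choose such a word with the fewest letters.  Along it x^2 + y^2 - 2 c x y + z^2 is constant, which
    fixes the times of all letters between two corners.  The second variation excludes five letters
    around the whole rectangle, and the third variation excludes continuing after a half loop through a
    corner with z = 0, where the momentum has changed sign.  The words that remain have finitely many
    shapes with bounded times, so a subsequence converges as n tends to infinity; the limit h maximises
    tr(g^T h E) at E = 1 over SO(3), hence equals g, and its cost is minimal.

    A frame carries weights kx for X and ky for Y (kx = 1, ky = kappa in the theorem), so that all
    symmetries of the patterns act on frames. *)

(** * Linear algebra in dimension three *)

(** The penalty replaces the constraint h = g, so the endpoint varies freely and the momentum is
    read off the penalty as the linear form v -> tr(B [v]), B = n h g^T; no multiplier has to be
    produced and no abnormal extremals arise. The minimising curve is only Lipschitz and is never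
    differentiated. Estimates with error O(d^2) over arcs of length d, summed over uniform grids,
    identify its arcs with one-parameter groups. The hypothesis c < kappa <= 1 puts W_+ and W_-
    strictly inside the quadrants of their corners. The sign of c separates the two kinds of corner:
    by the conserved quadratic form, a letter leaving a W_+ corner arrives at the next corner with
    z^2 = 4 c kx ky and may be followed by another, whereas one leaving a W_- corner would need z^2
    = -4 c kx ky and is the last. So W_+ has up to two letters on each side and W_- at most one. *)

Definition cross (u v : V3) : V3 :=
  mkV (vy u * vz v - vz u * vy v) (vz u * vx v - vx u * vz v) (vx u * vy v - vy u * vx v).
Definition vneg (v : V3) : V3 := vscale (-1) v.
Definition skew (v : V3) : M3 :=
  mkM 0 (- vz v) (vy v) (vz v) 0 (- vx v) (- vy v) (vx v) 0.
Definition mtr (A : M3) : R := m11 A + m22 A + m33 A.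
Definition madd (A B : M3) : M3 :=
  mkM (m11 A + m11 B) (m12 A + m12 B) (m13 A + m13 B)
      (m21 A + m21 B) (m22 A + m22 B) (m23 A + m23 B)
      (m31 A + m31 B) (m32 A + m32 B) (m33 A + m33 B).
Definition mscale (a : R) (A : M3) : M3 :=
  mkM (a * m11 A) (a * m12 A) (a * m13 A)
      (a * m21 A) (a * m22 A) (a * m23 A)
      (a * m31 A) (a * m32 A) (a * m33 A).
Definition msub (A B : M3) : M3 := madd A (mscale (-1) B).
Definition mv (A : M3) (v : V3) : V3 :=
  mkV (m11 A * vx v + m12 A * vy v + m13 A * vz v)
      (m21 A * vx v + m22 A * vy v + m23 A * vz v)
      (m31 A * vx v + m32 A * vy v + m33 A * vz v).
(* The vector representing the linear form [v |-> mtr (mmul B (skew v))]. *)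
Definition vee (B : M3) : V3 := mkV (m23 B - m32 B) (m31 B - m13 B) (m12 B - m21 B).

Ltac munf :=
  unfold msub, mid3, mmul, mtrans, madd, mscale, mv, vee, skew, mtr, mdet,
         vneg, cross, vadd, vscale, dot in *; simpl in *.
Ltac mdes :=
  repeat match goal with
  | A : M3 |- _ => destruct A
  | v : V3 |- _ => destruct v
  end.
Lemma M3_eq A B :
  m11 A = m11 B -> m12 A = m12 B -> m13 A = m13 B ->
  m21 A = m21 B -> m22 A = m22 B -> m23 A = m23 B ->
  m31 A = m31 B -> m32 A = m32 B -> m33 A = m33 B -> A = B.
Proof. destruct A, B; simpl; intros; subst; reflexivity. Qed.
Lemma V3_eq u v : vx u = vx v -> vy u = vy v -> vz u = vz v -> u = v.
Proof. destruct u, v; simpl; intros; subst; reflexivity. Qed.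

Ltac mring :=
  intros; mdes; first [apply M3_eq | apply V3_eq | idtac];
  unfold mtr, mdet, dot, msub, vneg; cbn; ring.

Lemma mmul_assoc A B C : mmul (mmul A B) C = mmul A (mmul B C).
Proof. mring. Qed.
Lemma mmul_1l A : mmul mid3 A = A.
Proof. mring. Qed.
Lemma mmul_1r A : mmul A mid3 = A.
Proof. mring. Qed.
Lemma mtrans_mul A B : mtrans (mmul A B) = mmul (mtrans B) (mtrans A).
Proof. mring. Qed.
Lemma mtrans_inv A : mtrans (mtrans A) = A.
Proof. mring. Qed.
Lemma mtrans_1 : mtrans mid3 = mid3.
Proof. reflexivity. Qed.
Lemma mtr_mulC A B : mtr (mmul A B) = mtr (mmul B A).
Proof. mring. Qed.
Lemma mtr_trans A : mtr (mtrans A) = mtr A.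
Proof. mring. Qed.
Lemma mtr_skew B v : mtr (mmul B (skew v)) = dot (vee B) v.
Proof. mring. Qed.
Lemma vee_trans B : vee (mtrans B) = vneg (vee B).
Proof. mring. Qed.
Lemma mv_mul A B v : mv (mmul A B) v = mv A (mv B v).
Proof. mring. Qed.
Lemma mv_1 v : mv mid3 v = v.
Proof. mring. Qed.
Lemma dot_mv A u v : dot u (mv A v) = dot (mv (mtrans A) u) v.
Proof. mring. Qed.
Lemma dot_addr u v w : dot u (vadd v w) = dot u v + dot u w.
Proof. mring. Qed.
Lemma dot_scaler u a v : dot u (vscale a v) = a * dot u v.
Proof. mring. Qed.
Lemma mv_add A u v : mv A (vadd u v) = vadd (mv A u) (mv A v).
Proof. mring. Qed.
Lemma mv_scale A a v : mv A (vscale a v) = vscale a (mv A v).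
Proof. mring. Qed.
Lemma mmul_addl A B C : mmul (madd A B) C = madd (mmul A C) (mmul B C).
Proof. mring. Qed.
Lemma mmul_addr A B C : mmul A (madd B C) = madd (mmul A B) (mmul A C).
Proof. mring. Qed.
Lemma mmul_scalel a A B : mmul (mscale a A) B = mscale a (mmul A B).
Proof. mring. Qed.
Lemma mmul_scaler a A B : mmul A (mscale a B) = mscale a (mmul A B).
Proof. mring. Qed.
Lemma mtr_add A B : mtr (madd A B) = mtr A + mtr B.
Proof. mring. Qed.
Lemma mtr_scale a A : mtr (mscale a A) = a * mtr A.
Proof. mring. Qed.


(** * The group SO(3) *)

(** The adjugate. Identities for rotations are proved as polynomial identities in the entries with
    [madj A], and [SO3_adj] then turns the adjugate into the transpose. *)
Definition madj (A : M3) : M3 :=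
  mkM (m22 A * m33 A - m23 A * m32 A) (m13 A * m32 A - m12 A * m33 A) (m12 A * m23 A - m13 A * m22 A)
      (m23 A * m31 A - m21 A * m33 A) (m11 A * m33 A - m13 A * m31 A) (m13 A * m21 A - m11 A * m23 A)
      (m21 A * m32 A - m22 A * m31 A) (m12 A * m31 A - m11 A * m32 A) (m11 A * m22 A - m12 A * m21 A).

Lemma mmul_adj A : mmul A (madj A) = mscale (mdet A) mid3.
Proof. mring. Qed.

Lemma mscale_1 A : mscale 1 A = A.
Proof. mring. Qed.

Lemma SO3_adj A : inSO3 A -> mtrans A = madj A.
Proof.
  intros [H1 H2].
  rewrite <- (mmul_1r (mtrans A)), <- (mscale_1 mid3), <- H2, <- mmul_adj, <- mmul_assoc, H1.
  apply mmul_1l.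
Qed.

Lemma SO3_rinv A : inSO3 A -> mmul A (mtrans A) = mid3.
Proof. intros H. rewrite (SO3_adj A H), mmul_adj. destruct H as [_ ->]. apply mscale_1. Qed.
Lemma SO3_linv A : inSO3 A -> mmul (mtrans A) A = mid3.
Proof. intros [H _]; exact H. Qed.

Lemma mdet_mul A B : mdet (mmul A B) = mdet A * mdet B.
Proof. mring. Qed.
Lemma mdet_trans A : mdet (mtrans A) = mdet A.
Proof. mring. Qed.

Lemma SO3_1 : inSO3 mid3.
Proof. split; [apply mmul_1r | unfold mdet; simpl; ring]. Qed.
Lemma SO3_mul A B : inSO3 A -> inSO3 B -> inSO3 (mmul A B).
Proof.
  intros [HA dA] [HB dB]; split.
  - rewrite mtrans_mul, mmul_assoc, <- (mmul_assoc (mtrans A)), HA, mmul_1l; exact HB.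
  - rewrite mdet_mul, dA, dB; ring.
Qed.
Lemma SO3_trans A : inSO3 A -> inSO3 (mtrans A).
Proof.
  intros H; split; [rewrite mtrans_inv; apply SO3_rinv; exact H |].
  rewrite mdet_trans; apply H.
Qed.

Lemma dot_SO3 A u v : inSO3 A -> dot (mv A u) (mv A v) = dot u v.
Proof. intros [H _]. rewrite dot_mv, <- mv_mul, H, mv_1. reflexivity. Qed.

Lemma mv_cross_adj A u v : cross (mv A u) (mv A v) = mv (mtrans (madj A)) (cross u v).
Proof. mring. Qed.

Lemma SO3_cross A u v : inSO3 A -> cross (mv A u) (mv A v) = mv A (cross u v).
Proof. intros H. rewrite mv_cross_adj, <- (SO3_adj A H), mtrans_inv. reflexivity. Qed.

Lemma vee_conj_adj A B : vee (mmul (mmul A B) (mtrans A)) = mv (mtrans (madj A)) (vee B).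
Proof. mring. Qed.

Lemma vee_conj A B : inSO3 A -> vee (mmul (mmul (mtrans A) B) A) = mv (mtrans A) (vee B).
Proof.
  intros H. pose proof (SO3_trans A H) as H'.
  rewrite <- (mtrans_inv A) at 2. rewrite vee_conj_adj, <- (SO3_adj _ H'), mtrans_inv.
  reflexivity.
Qed.

Lemma SO3_sqsum A : inSO3 A ->
  (m11 A ^ 2 + m12 A ^ 2 + m13 A ^ 2 = 1 /\ m21 A ^ 2 + m22 A ^ 2 + m23 A ^ 2 = 1
   /\ m31 A ^ 2 + m32 A ^ 2 + m33 A ^ 2 = 1).
Proof.
  intros H. pose proof (SO3_rinv A H) as E. destruct A.
  unfold mmul, mtrans, mid3 in E; simpl in *. injection E; intros.
  repeat split; lra.
Qed.

(** * Entrywise bounds *)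

(** The entrywise maximum norm as a relation. It is not submultiplicative: a product costs a factor
    3 and the trace of a product a factor 9, which is the source of these factors in later
    constants. *)
Definition mbd (A : M3) (r : R) : Prop :=
  (Rabs (m11 A) <= r /\ Rabs (m12 A) <= r /\ Rabs (m13 A) <= r) /\
  (Rabs (m21 A) <= r /\ Rabs (m22 A) <= r /\ Rabs (m23 A) <= r) /\
  (Rabs (m31 A) <= r /\ Rabs (m32 A) <= r /\ Rabs (m33 A) <= r).

Lemma mbd_le A r s : mbd A r -> r <= s -> mbd A s.
Proof. unfold mbd; intros; intuition lra. Qed.
Lemma mbd_pos A r : mbd A r -> 0 <= r.
Proof. unfold mbd; intros [[H _] _]. pose proof (Rabs_pos (m11 A)); lra. Qed.

Lemma Rabs_plus_le a b r s : Rabs a <= r -> Rabs b <= s -> Rabs (a + b) <= r + s.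
Proof. intros. eapply Rle_trans; [apply Rabs_triang | lra]. Qed.
Lemma Rabs_mult_le a b r s : Rabs a <= r -> Rabs b <= s -> Rabs (a * b) <= r * s.
Proof. intros. rewrite Rabs_mult. apply Rmult_le_compat; auto using Rabs_pos. Qed.

Lemma mbd_add A B r s : mbd A r -> mbd B s -> mbd (madd A B) (r + s).
Proof. unfold mbd; simpl; intros; intuition (apply Rabs_plus_le; assumption). Qed.
Lemma mbd_scale a A r s : Rabs a <= s -> mbd A r -> mbd (mscale a A) (s * r).
Proof. unfold mbd; simpl; intros; intuition (apply Rabs_mult_le; assumption). Qed.
Lemma mbd_mul A B r s : mbd A r -> mbd B s -> mbd (mmul A B) (3 * (r * s)).
Proof.
  unfold mbd; simpl; intros.
  replace (3 * (r * s)) with (r * s + r * s + r * s) by ring.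
  intuition (repeat apply Rabs_plus_le; apply Rabs_mult_le; assumption).
Qed.
Lemma mbd_trans A r : mbd A r -> mbd (mtrans A) r.
Proof. unfold mbd; simpl; tauto. Qed.

Lemma sq_le1 x r : x ^ 2 <= 1 -> 1 <= r -> Rabs x <= r.
Proof. intros. apply Rabs_le; split; nra. Qed.

Lemma mbd_SO3 A : inSO3 A -> mbd A 1.
Proof.
  intros H. destruct (SO3_sqsum A H) as (H1 & H2 & H3).
  pose proof (fun x => pow2_ge_0 x) as P.
  unfold mbd; repeat split; apply sq_le1; try lra;
  match goal with |- ?x ^ 2 <= 1 => idtac end;
  pose proof (P (m11 A)); pose proof (P (m12 A)); pose proof (P (m13 A));
  pose proof (P (m21 A)); pose proof (P (m22 A)); pose proof (P (m23 A));
  pose proof (P (m31 A)); pose proof (P (m32 A)); pose proof (P (m33 A)); lra.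
Qed.

Lemma mtr_bd A r : mbd A r -> Rabs (mtr A) <= 3 * r.
Proof.
  unfold mbd, mtr; intros. replace (3 * r) with (r + r + r) by ring.
  repeat apply Rabs_plus_le; tauto.
Qed.

Lemma mtr_mul_bd A B r s : mbd A r -> mbd B s -> Rabs (mtr (mmul A B)) <= 9 * (r * s).
Proof.
  intros. replace (9 * (r * s)) with (3 * (3 * (r * s))) by ring.
  apply mtr_bd, mbd_mul; auto.
Qed.

Lemma mbd_exists A : exists r, 0 < r /\ mbd A r.
Proof.
  exists (1 + Rabs (m11 A) + Rabs (m12 A) + Rabs (m13 A) + Rabs (m21 A) + Rabs (m22 A)
     + Rabs (m23 A) + Rabs (m31 A) + Rabs (m32 A) + Rabs (m33 A)).
  pose proof (Rabs_pos (m11 A)); pose proof (Rabs_pos (m12 A)); pose proof (Rabs_pos (m13 A)).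
  pose proof (Rabs_pos (m21 A)); pose proof (Rabs_pos (m22 A)); pose proof (Rabs_pos (m23 A)).
  pose proof (Rabs_pos (m31 A)); pose proof (Rabs_pos (m32 A)); pose proof (Rabs_pos (m33 A)).
  split; [lra | unfold mbd; repeat split; lra].
Qed.

Lemma msub_0 A B : (forall e, 0 < e -> mbd (msub A B) e) -> A = B.
Proof.
  intros H.
  assert (Z : forall x, (forall e, 0 < e -> Rabs x <= e) -> x = 0).
  { intros x Hx. destruct (Req_dec x 0) as [|Hn]; auto.
    pose proof (Rabs_pos_lt x Hn). specialize (Hx (Rabs x / 2)). lra. }
  assert (Z' : forall x y, (forall e, 0 < e -> Rabs (x + -1 * y) <= e) -> x = y).
  { intros x y Hxy. pose proof (Z _ Hxy). lra. }
  apply M3_eq; apply Z'; intros e He; destruct (H e He) as (H1 & H2 & H3);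
  simpl in *; tauto.
Qed.

Lemma msub_self A : msub A A = mscale 0 mid3.
Proof. mring. Qed.

Lemma msub_trans A B C : msub A C = madd (msub A B) (msub B C).
Proof. mring. Qed.

Lemma msub_mul A B C D :
  msub (mmul A B) (mmul C D) = madd (mmul (msub A C) B) (mmul C (msub B D)).
Proof. mring. Qed.

Lemma mbd_0 e : 0 <= e -> mbd (mscale 0 mid3) e.
Proof.
  intros. unfold mbd; simpl. repeat split; rewrite ?Rmult_0_l, ?Rmult_0_r, Rabs_R0; auto.
Qed.

Lemma SO3_closed A : (forall e, 0 < e -> exists B, inSO3 B /\ mbd (msub A B) e) -> inSO3 A.
Proof.
  intros H. split.
  - apply msub_0. intros e He.
    destruct (H (Rmin 1 (e / 9))) as (B & HB & HAB).
    { apply Rmin_pos; lra. }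
    rewrite <- (SO3_linv B HB), msub_mul.
    assert (bA : mbd A 2).
    { replace A with (madd (msub A B) B) by (mring).
      replace 2 with (1 + 1) by ring. apply mbd_add; [|apply mbd_SO3; auto].
      eapply mbd_le; [exact HAB | apply Rmin_l]. }
    assert (b1 : mbd (msub (mtrans A) (mtrans B)) (Rmin 1 (e / 9))).
    { replace (msub (mtrans A) (mtrans B)) with (mtrans (msub A B)) by mring.
      apply mbd_trans; auto. }
    pose proof (mbd_SO3 _ (SO3_trans B HB)) as bB.
    pose proof (mbd_mul _ _ _ _ b1 bA). pose proof (mbd_mul _ _ _ _ bB HAB).
    eapply mbd_le; [apply mbd_add; eassumption|].
    pose proof (Rmin_r 1 (e / 9)). lra.
  - apply Rminus_diag_uniq. apply NNPP; intros Hn.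
    pose proof (Rabs_pos_lt _ Hn) as Hp.
    set (d := Rabs (mdet A - 1)) in *.
    destruct (H (Rmin 1 (d / 1000))) as (B & HB & HAB).
    { apply Rmin_pos; lra. }
    pose proof (Rmin_l 1 (d/1000)); pose proof (Rmin_r 1 (d/1000)).
    assert (bA : mbd A 2).
    { replace A with (madd (msub A B) B) by (mring).
      replace 2 with (1 + 1) by ring. apply mbd_add; [|apply mbd_SO3; auto].
      eapply mbd_le; [exact HAB | lra]. }
    pose proof (mbd_SO3 B HB) as bB. destruct HB as [_ dB].
    set (r := Rmin 1 (d / 1000)) in *.
    (* The difference of determinants is telescoped in the entries of A - B. With entries of A at
       most 2 and of B at most 1, each of the three cofactor terms contributes 14 r; the remaining
       30 r are slack. *)
    assert (G : Rabs (mdet A - mdet B) <= 72 * r); [|rewrite dB in G; fold d in G; lra].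
    clear - HAB bA bB H0.
    replace (mdet A - mdet B) with
      ((m11 A + -1 * m11 B) * (m22 A * m33 A + - m23 A * m32 A)
       + m11 B * (((m22 A + -1 * m22 B) * m33 A + m22 B * (m33 A + -1 * m33 B))
                  + - ((m23 A + -1 * m23 B) * m32 A + m23 B * (m32 A + -1 * m32 B)))
       + - ((m12 A + -1 * m12 B) * (m21 A * m33 A + - m23 A * m31 A)
       + m12 B * (((m21 A + -1 * m21 B) * m33 A + m21 B * (m33 A + -1 * m33 B))
                  + - ((m23 A + -1 * m23 B) * m31 A + m23 B * (m31 A + -1 * m31 B))))
       + ((m13 A + -1 * m13 B) * (m21 A * m32 A + - m22 A * m31 A)
       + m13 B * (((m21 A + -1 * m21 B) * m32 A + m21 B * (m32 A + -1 * m32 B))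
                  + - ((m22 A + -1 * m22 B) * m31 A + m22 B * (m31 A + -1 * m31 B)))))
      by (unfold mdet; ring).
    replace (72 * r) with ((r * (2 * 2 + 2 * 2) + 1 * ((r * 2 + 1 * r) + (r * 2 + 1 * r)))
       + (r * (2 * 2 + 2 * 2) + 1 * ((r * 2 + 1 * r) + (r * 2 + 1 * r)))
       + (r * (2 * 2 + 2 * 2) + 1 * ((r * 2 + 1 * r) + (r * 2 + 1 * r))) + 30 * r) by ring.
    assert (0 <= 30 * r) by (pose proof (mbd_pos _ _ HAB); lra).
    unfold mbd, msub in *; simpl in *.
    match goal with |- ?a <= ?b + _ => enough (a <= b) by lra end.
    repeat first [ apply Rabs_plus_le | rewrite Rabs_Ropp | apply Rabs_mult_le];
      rewrite ?Rabs_Ropp; tauto.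
Qed.

Lemma SO3_involution A v :
  inSO3 A -> mv A v = vneg v -> v <> mkV 0 0 0 -> mtrans A = A.
Proof.
  intros H E Hv.
  (* -1 is an eigenvalue: det (A + I) = 2 + 2 tr A vanishes, hence |A - A^T|^2 = 6 - 2 tr A^2 = 0. *)
  assert (D : mdet (madd A mid3) = 0).
  { apply NNPP; intros Hd. apply Hv.
    assert (Z : mv (madd A mid3) v = mkV 0 0 0).
    { replace (mv (madd A mid3) v) with (vadd (mv A v) v) by mring. rewrite E.
      destruct v; munf; f_equal; ring. }
    assert (Z2 : vscale (mdet (madd A mid3)) v = mkV 0 0 0).
    { replace (vscale (mdet (madd A mid3)) v)
        with (mv (madj (madd A mid3)) (mv (madd A mid3) v)).
      - rewrite Z; generalize (madj (madd A mid3)); mring.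
      - clear. mring. }
    destruct v as [a b d]; unfold vscale in Z2; simpl in Z2. injection Z2; intros.
    f_equal; eapply Rmult_eq_reg_l; try exact Hd; lra. }
  pose proof (SO3_adj A H) as Adj. destruct H as [H1 H2].
  assert (T : mtr A = -1).
  { assert (mdet (madd A mid3) = mdet A + mtr (madj A) + mtr A + 1) by (clear; mring).
    rewrite <- Adj, mtr_trans in H. lra. }
  assert (T2 : mtr (mmul A A) = mtr A * mtr A - 2 * mtr (madj A)) by (clear; mring).
  rewrite <- Adj, mtr_trans, T in T2.
  assert (T3 : mtr (mmul (mtrans A) A) = 3) by (rewrite H1; unfold mtr; simpl; ring).
  assert (S : (m12 A - m21 A) ^ 2 + (m13 A - m31 A) ^ 2 + (m23 A - m32 A) ^ 2 = 0).
  { transitivity (mtr (mmul (mtrans A) A) - mtr (mmul A A)); [clear; mring | lra]. }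
  pose proof (pow2_ge_0 (m12 A - m21 A)); pose proof (pow2_ge_0 (m13 A - m31 A));
  pose proof (pow2_ge_0 (m23 A - m32 A)).
  assert (Q : forall x y, (x - y) ^ 2 = 0 -> x = y).
  { intros x y Hxy. apply Rminus_diag_uniq. apply Rsqr_0_uniq. unfold Rsqr. lra. }
  assert (m12 A = m21 A) by (apply Q; lra).
  assert (m13 A = m31 A) by (apply Q; lra).
  assert (m23 A = m32 A) by (apply Q; lra).
  apply M3_eq; simpl; auto.
Qed.

(** * Rotations *)

Lemma vnorm_sq v : vnorm v * vnorm v = dot v v.
Proof. unfold vnorm. apply sqrt_sqrt. unfold dot. nra. Qed.
Lemma vnorm_ge0 v : 0 <= vnorm v.
Proof. apply sqrt_pos. Qed.
Lemma dot_self_0 v : dot v v = 0 -> v = mkV 0 0 0.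
Proof. destruct v; unfold dot; simpl; intros; f_equal; nra. Qed.
Lemma vnorm_pos v : v <> mkV 0 0 0 -> 0 < vnorm v.
Proof.
  intros H. destruct (vnorm_ge0 v) as [|E]; auto. exfalso; apply H, dot_self_0.
  rewrite <- vnorm_sq, <- E; ring.
Qed.
Lemma vnorm_unit v : dot v v = 1 -> vnorm v = 1.
Proof. intros H. unfold vnorm. rewrite H. apply sqrt_1. Qed.

Lemma sin2_cos2' t : sin t * sin t = 1 - cos t * cos t.
Proof. pose proof (sin2_cos2 t). unfold Rsqr in *. lra. Qed.

Lemma rot_unit_SO3 t u : dot u u = 1 -> inSO3 (rot_unit t u).
Proof.
  destruct u as [x y z]; unfold dot; simpl; intros H.
  assert (Hz : z * z = 1 - x * x - y * y) by lra.
  pose proof (sin2_cos2' t) as Hs.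
  split.
  - unfold rot_unit, mmul, mtrans, mid3; simpl. f_equal; ring [Hz Hs].
  - unfold rot_unit, mdet; simpl. ring [Hz Hs].
Qed.

Lemma rot_unit_add s t u :
  dot u u = 1 -> rot_unit (s + t) u = mmul (rot_unit s u) (rot_unit t u).
Proof.
  destruct u as [x y z]; unfold dot; simpl; intros H.
  assert (Hz : z * z = 1 - x * x - y * y) by lra.
  unfold rot_unit, mmul; simpl. rewrite cos_plus, sin_plus. f_equal; ring [Hz].
Qed.

Lemma rot_unit_0 u : rot_unit 0 u = mid3.
Proof. unfold rot_unit, mid3. rewrite cos_0, sin_0. f_equal; ring. Qed.

Lemma rot_unit_opp t u : rot_unit (- t) u = mtrans (rot_unit t u).
Proof. unfold rot_unit, mtrans; simpl. rewrite cos_neg, sin_neg. f_equal; ring. Qed.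

Lemma rot_unit_vneg t u : rot_unit t (vneg u) = rot_unit (- t) u.
Proof. unfold rot_unit, vneg; simpl. rewrite cos_neg, sin_neg. f_equal; ring. Qed.

Lemma rot_unit_2pi t u : rot_unit (t - 2 * PI) u = rot_unit t u.
Proof.
  assert (C : cos (t - 2 * PI) = cos t).
  { rewrite cos_minus, cos_2PI, sin_2PI; ring. }
  assert (S : sin (t - 2 * PI) = sin t).
  { rewrite sin_minus, cos_2PI, sin_2PI; ring. }
  unfold rot_unit. rewrite C, S. reflexivity.
Qed.

Lemma vdir_unit v : v <> mkV 0 0 0 -> dot (vscale (/ vnorm v) v) (vscale (/ vnorm v) v) = 1.
Proof.
  intros H. pose proof (vnorm_pos v H).
  replace (dot _ _) with (/ vnorm v * / vnorm v * dot v v) by mring.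
  rewrite <- vnorm_sq. field. lra.
Qed.

Lemma rot_unit_eq t u : dot u u = 1 -> rot t u = rot_unit t u.
Proof.
  intros H. unfold rot. rewrite (vnorm_unit u H), Rinv_1, Rmult_1_r.
  f_equal. mring.
Qed.

Lemma vnorm_0 : vnorm (mkV 0 0 0) = 0.
Proof. unfold vnorm, dot; simpl. rewrite Rmult_0_l, !Rplus_0_l. apply sqrt_0. Qed.

(** The angle is [t * 0], so whatever [/ 0] means a zero vector generates the identity. Later
    identities for [rot] treat this case separately and then hold for all vectors. *)
Lemma rot_vec0 t : rot t (mkV 0 0 0) = mid3.
Proof. unfold rot. rewrite vnorm_0, Rmult_0_r. apply rot_unit_0. Qed.

Lemma V3_dec (v w : V3) : v = w \/ v <> w.
Proof. apply classic. Qed.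

Lemma rot_SO3 t v : inSO3 (rot t v).
Proof.
  destruct (V3_dec v (mkV 0 0 0)) as [->|H].
  - rewrite rot_vec0; apply SO3_1.
  - apply rot_unit_SO3, vdir_unit, H.
Qed.
Lemma rot_0 v : rot 0 v = mid3.
Proof. unfold rot. rewrite Rmult_0_l. apply rot_unit_0. Qed.
Lemma rot_add s t v : rot (s + t) v = mmul (rot s v) (rot t v).
Proof.
  destruct (V3_dec v (mkV 0 0 0)) as [->|H].
  - rewrite !rot_vec0, mmul_1l; reflexivity.
  - unfold rot. rewrite Rmult_plus_distr_r. apply rot_unit_add, vdir_unit, H.
Qed.
Lemma rot_opp t v : rot (- t) v = mtrans (rot t v).
Proof. unfold rot. rewrite <- rot_unit_opp. f_equal. ring. Qed.
Lemma vnorm_neg v : vnorm (vneg v) = vnorm v.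
Proof. unfold vnorm. f_equal. mring. Qed.
Lemma rot_vneg t v : rot t (vneg v) = rot (- t) v.
Proof.
  unfold rot. rewrite vnorm_neg.
  replace (vscale (/ vnorm v) (vneg v)) with (vneg (vscale (/ vnorm v) v)) by mring.
  rewrite rot_unit_vneg. f_equal. ring.
Qed.
Lemma vnorm_scale a v : 0 <= a -> vnorm (vscale a v) = a * vnorm v.
Proof.
  intros Ha. unfold vnorm. replace (dot _ _) with ((a * a) * dot v v) by mring.
  rewrite sqrt_mult; [|nra|unfold dot; nra]. f_equal. apply sqrt_square; auto.
Qed.
Lemma rot_vscale t a v : 0 < a -> rot t (vscale a v) = rot (t * a) v.
Proof.
  intros Ha. destruct (V3_dec v (mkV 0 0 0)) as [->|H].
  - rewrite rot_vec0. replace (vscale a (mkV 0 0 0)) with (mkV 0 0 0) by mring.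
    apply rot_vec0.
  - unfold rot. pose proof (vnorm_pos v H). rewrite vnorm_scale by lra. f_equal; [ring|].
    rewrite Rinv_mult. destruct v; unfold vscale; simpl. f_equal; field; split; try lra.
Qed.

(** Rodrigues' formula writes [rot_unit] through [skew u], its square and [dot u u]; conjugation by
    a rotation sends [skew u] to [skew (mv Q u)] and keeps the length. *)
Lemma mv_rot_unit_conj Q t u : inSO3 Q -> dot u u = 1 ->
  mmul (mmul Q (rot_unit t u)) (mtrans Q) = rot_unit t (mv Q u).
Proof.
  intros H Hu.
  assert (E : forall w, rot_unit t w =
    madd (mscale (cos t) mid3) (madd (mscale (sin t) (skew w))
      (mscale (1 - cos t) (madd (mmul (skew w) (skew w)) (mscale (dot w w) mid3))))).
  { clear. intros [x y z]. unfold rot_unit. generalize (cos t) (sin t); intros C S.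
    apply M3_eq; cbn; unfold dot; cbn; ring. }
  assert (S : mmul (mmul Q (skew u)) (mtrans Q) = skew (mv Q u)).
  { transitivity (skew (mv (mtrans (madj Q)) u)).
    - clear. mring.
    - rewrite <- (SO3_adj Q H), mtrans_inv. reflexivity. }
  rewrite !E, (dot_SO3 Q u u H), <- S.
  rewrite !mmul_addr, !mmul_addl, !mmul_scaler, !mmul_scalel, !mmul_addr, !mmul_addl,
    !mmul_scaler, !mmul_scalel, mmul_1r, (SO3_rinv Q H).
  do 4 f_equal. rewrite !mmul_assoc. do 2 f_equal.
  rewrite <- (mmul_assoc (mtrans Q) Q), (SO3_linv Q H), mmul_1l. reflexivity.
Qed.

Lemma rot_conj Q t v : inSO3 Q ->
  mmul (mmul Q (rot t v)) (mtrans Q) = rot t (mv Q v).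
Proof.
  intros H. destruct (V3_dec v (mkV 0 0 0)) as [->|Hv].
  - replace (mv Q (mkV 0 0 0)) with (mkV 0 0 0) by mring.
    rewrite rot_vec0, mmul_1r. apply SO3_rinv, H.
  - unfold rot. assert (N : vnorm (mv Q v) = vnorm v).
    { unfold vnorm. rewrite (dot_SO3 Q v v H). reflexivity. }
    rewrite N, <- mv_scale. apply mv_rot_unit_conj; [exact H | apply vdir_unit, Hv].
Qed.

Lemma rot_comm_through Q t v : inSO3 Q -> mmul Q (rot t v) = mmul (rot t (mv Q v)) Q.
Proof.
  intros H. rewrite <- (rot_conj Q t v H), !mmul_assoc, (SO3_linv Q H), mmul_1r. reflexivity.
Qed.

Lemma mv_rot_unit t u w : mv (rot_unit t u) w =
  vadd (vscale (cos t) w) (vadd (vscale (sin t) (cross u w))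
    (vscale ((1 - cos t) * dot u w) u)).
Proof. destruct u, w; unfold rot_unit; munf; f_equal; ring. Qed.


(** * Taylor bounds *)

Lemma sin_le_x t : 0 <= t -> sin t <= t.
Proof. intros [H| <-]; [left; apply sin_lt_x; auto | rewrite sin_0; lra]. Qed.
Lemma Rabs_sin_le t : Rabs (sin t) <= Rabs t.
Proof.
  assert (P : forall t, 0 <= t -> Rabs (sin t) <= t).
  { intros s Hs. apply Rabs_le; split; [|apply sin_le_x; auto].
    destruct (Rle_dec s PI) as [h|h].
    - pose proof (sin_ge_0 s Hs h). lra.
    - pose proof (SIN_bound s). pose proof PI_RGT_0. pose proof PI2_1. lra. }
  destruct (Rle_dec 0 t).
  - rewrite (Rabs_right t) by lra. auto.
  - rewrite (Rabs_left t) by lra. rewrite <- Rabs_Ropp, <- sin_neg. apply P; lra.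
Qed.
Lemma cos_half t : cos t = 1 - 2 * (sin (t / 2) * sin (t / 2)).
Proof. replace t with (2 * (t / 2)) at 1 by field. rewrite cos_2a_sin. ring. Qed.
Lemma Rsq_Rabs x : x * x = Rabs x * Rabs x.
Proof. rewrite <- Rabs_mult. symmetry; apply Rabs_right. nra. Qed.
Lemma one_minus_cos_le2 t : 1 - cos t <= t * t / 2.
Proof.
  rewrite cos_half. pose proof (Rabs_sin_le (t / 2)) as H.
  pose proof (Rsq_Rabs (sin (t/2))). pose proof (Rsq_Rabs (t/2)).
  pose proof (Rabs_pos (sin (t/2))). nra.
Qed.
Lemma one_minus_cos_ge0 t : 0 <= 1 - cos t.
Proof. pose proof (COS_bound t); lra. Qed.
Lemma one_minus_cos_le1 t : 1 - cos t <= Rabs t.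
Proof.
  rewrite cos_half. pose proof (Rabs_sin_le (t / 2)) as H.
  assert (Rabs (sin (t/2)) <= 1) by (apply Rabs_le; pose proof (SIN_bound (t/2)); lra).
  pose proof (Rsq_Rabs (sin (t/2))). pose proof (Rabs_pos (sin (t/2))).
  assert (Rabs (t/2) = Rabs t / 2).
  { unfold Rdiv. rewrite Rabs_mult. f_equal. apply Rabs_right; lra. }
  nra.
Qed.

Lemma sin_lower t : 0 <= t -> t <= PI -> t - t * t * t / 6 <= sin t.
Proof.
  intros H1 H2. destruct (pre_sin_bound t 0 H1) as [H _]; [pose proof PI_4; lra|].
  unfold sin_approx, sin_term in H. simpl in H. nra.
Qed.
Lemma sin_upper t : 0 <= t -> t <= PI -> sin t <= t - t * t * t / 6 + t * t * t * t * t / 120.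
Proof.
  intros H1 H2. destruct (pre_sin_bound t 0 H1) as [_ H]; [pose proof PI_4; lra|].
  unfold sin_approx, sin_term in H. simpl in H. nra.
Qed.

Lemma sin_sub_le2 t : 0 <= t -> Rabs (sin t - t) <= 2 * (t * t).
Proof.
  intros H. destruct (Rle_dec t 1).
  - pose proof (sin_le_x t H). assert (t <= PI) by (pose proof PI2_1; lra).
    pose proof (sin_lower t H H1). apply Rabs_le. split; nra.
  - pose proof (SIN_bound t). apply Rabs_le; split; nra.
Qed.

Lemma rot_unit_form t u : dot u u = 1 ->
  rot_unit t u = madd mid3 (madd (mscale (sin t) (skew u))
                   (mscale (1 - cos t) (mmul (skew u) (skew u)))).
Proof.
  destruct u as [x y z]; unfold dot; cbn; intros H.
  assert (Hz : z * z = 1 - x * x - y * y) by lra. clear H.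
  unfold rot_unit. generalize (cos t) (sin t); intros C S.
  apply M3_eq; cbn; ring [Hz].
Qed.

Lemma skew_scale a v : skew (vscale a v) = mscale a (skew v).
Proof. mring. Qed.
Lemma skew_add u v : skew (vadd u v) = madd (skew u) (skew v).
Proof. mring. Qed.

Lemma mscale_mscale a b A : mscale a (mscale b A) = mscale (a * b) A.
Proof. mring. Qed.

Lemma mbd_skew v r : Rabs (vx v) <= r -> Rabs (vy v) <= r -> Rabs (vz v) <= r -> mbd (skew v) r.
Proof.
  intros. pose proof (Rabs_pos (vx v)).
  unfold mbd; simpl; rewrite ?Rabs_Ropp, ?Rabs_R0; intuition lra.
Qed.
Lemma mbd_skew_unit u : dot u u = 1 -> mbd (skew u) 1.
Proof.
  destruct u; unfold dot; simpl; intros. apply mbd_skew; simpl; apply sq_le1; nra.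
Qed.
Lemma mbd_skew2_unit u : dot u u = 1 -> mbd (mmul (skew u) (skew u)) 3.
Proof.
  intros H. eapply mbd_le; [apply mbd_mul; apply mbd_skew_unit; exact H | lra].
Qed.

Lemma vdir_scale v : v <> mkV 0 0 0 -> vscale (vnorm v) (vscale (/ vnorm v) v) = v.
Proof.
  intros H. pose proof (vnorm_pos v H). destruct v; unfold vscale; simpl. f_equal; field; lra.
Qed.

(** The constant is 1 from the sine term plus 3 from the cosine term, because the entries of the
    squared [skew] matrix are bounded by 3. *)
Lemma rot_near1 t v : 0 <= t -> mbd (msub (rot t v) mid3) (4 * (t * vnorm v)).
Proof.
  intros Ht. destruct (V3_dec v (mkV 0 0 0)) as [->|H].
  { rewrite rot_vec0, vnorm_0, msub_self. apply mbd_0; lra. }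
  pose proof (vnorm_pos v H). pose proof (vdir_unit v H) as U.
  assert (P : 0 <= t * vnorm v) by nra.
  unfold rot. rewrite rot_unit_form by exact U.
  set (th := t * vnorm v) in *. set (u := vscale (/ vnorm v) v) in *. clearbody th u.
  replace (msub _ _) with (madd (mscale (sin th) (skew u))
     (mscale (1 - cos th) (mmul (skew u) (skew u))))
    by (generalize (sin th) (1 - cos th) (mmul (skew u) (skew u)) (skew u); clear; mring).
  replace (4 * th) with (th * 1 + th * 3) by ring.
  apply mbd_add; apply mbd_scale.
  - rewrite <- (Rabs_right th) at 2 by lra. apply Rabs_sin_le.
  - apply mbd_skew_unit; auto.
  - rewrite Rabs_right by (apply Rle_ge, one_minus_cos_ge0).
    rewrite <- (Rabs_right th) at 2 by lra. apply one_minus_cos_le1.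
  - apply mbd_skew2_unit; auto.
Qed.

Lemma rot_near2 t v : 0 <= t ->
  mbd (msub (rot t v) (madd mid3 (mscale t (skew v)))) (4 * ((t * vnorm v) * (t * vnorm v))).
Proof.
  intros Ht. destruct (V3_dec v (mkV 0 0 0)) as [->|H].
  { rewrite rot_vec0, vnorm_0.
    replace (msub _ _) with (mscale 0 mid3) by (unfold skew; munf; f_equal; ring).
    apply mbd_0; lra. }
  pose proof (vnorm_pos v H). pose proof (vdir_unit v H) as U. pose proof (vdir_scale v H) as D.
  assert (P : 0 <= t * vnorm v) by nra.
  unfold rot. rewrite rot_unit_form by exact U.
  assert (SK : skew v = mscale (vnorm v) (skew (vscale (/ vnorm v) v)))
    by (rewrite <- skew_scale, D; reflexivity).
  rewrite SK, mscale_mscale.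
  set (th := t * vnorm v) in *. set (u := vscale (/ vnorm v) v) in *. clearbody th u.
  replace (msub _ _) with (madd (mscale (sin th - th) (skew u))
     (mscale (1 - cos th) (mmul (skew u) (skew u))))
    by (generalize (sin th) (1 - cos th) (mmul (skew u) (skew u)) (skew u); clear; mring).
  assert (B : mbd (madd (mscale (sin th - th) (skew u))
     (mscale (1 - cos th) (mmul (skew u) (skew u)))) (2 * (th * th) * 1 + th * th / 2 * 3)).
  { apply mbd_add; apply mbd_scale.
    - apply sin_sub_le2; auto.
    - apply mbd_skew_unit; auto.
    - rewrite Rabs_right by (apply Rle_ge, one_minus_cos_ge0). apply one_minus_cos_le2.
    - apply mbd_skew2_unit; auto. }
  eapply mbd_le; [exact B | nra].
Qed.

(** * Third-order expansions of matrix-valued functions *)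

Definition poly3 (A1 A2 A3 : M3) (e : R) : M3 :=
  madd mid3 (madd (mscale e A1) (madd (mscale (e * e) A2) (mscale (e * e * e) A3))).

(** Order three is what the corner argument requires, where the first two variations vanish. Only e
    >= 0 is considered: the variations insert letters, and times cannot be negative. *)
Definition Ex3 (F : R -> M3) (A1 A2 A3 : M3) : Prop :=
  exists M d, 0 < d <= 1 /\ forall e, 0 <= e <= d ->
    mbd (msub (F e) (poly3 A1 A2 A3 e)) (M * (e * e * e * e)).

Lemma Ex3_mul F G A1 A2 A3 B1 B2 B3 :
  Ex3 F A1 A2 A3 -> Ex3 G B1 B2 B3 ->
  Ex3 (fun e => mmul (F e) (G e)) (madd A1 B1) (madd A2 (madd (mmul A1 B1) B2))
      (madd A3 (madd (mmul A2 B1) (madd (mmul A1 B2) B3))).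
Proof.
  intros (M & d & Hd & HF) (M' & d' & Hd' & HG).
  (* [T4], [T5], [T6] are the coefficients of orders four to six in the product of the two
     polynomials; all of them go into the remainder. *)
  set (T4 := madd (mmul A3 B1) (madd (mmul A2 B2) (mmul A1 B3))).
  set (T5 := madd (mmul A3 B2) (mmul A2 B3)). set (T6 := mmul A3 B3).
  destruct (mbd_exists T4) as (t4 & p4 & b4). destruct (mbd_exists T5) as (t5 & p5 & b5).
  destruct (mbd_exists T6) as (t6 & p6 & b6).
  destruct (mbd_exists A1) as (a1 & q1 & c1). destruct (mbd_exists A2) as (a2 & q2 & c2).
  destruct (mbd_exists A3) as (a3 & q3 & c3).
  destruct (mbd_exists B1) as (a1' & q1' & c1'). destruct (mbd_exists B2) as (a2' & q2' & c2').
  destruct (mbd_exists B3) as (a3' & q3' & c3').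
  assert (PB : forall Z1 Z2 Z3 z1 z2 z3 e, 0 <= e <= 1 -> mbd Z1 z1 -> mbd Z2 z2 -> mbd Z3 z3 ->
     mbd (poly3 Z1 Z2 Z3 e) (1 + (z1 + (z2 + z3)))).
  { intros Z1 Z2 Z3 z1 z2 z3 e He H1 H2 H3. unfold poly3.
    pose proof (mbd_pos _ _ H1). pose proof (mbd_pos _ _ H2). pose proof (mbd_pos _ _ H3).
    apply mbd_add; [apply mbd_SO3, SO3_1|].
    assert (S : forall z k, 0 <= k <= 1 -> forall Z, mbd Z z -> mbd (mscale k Z) z).
    { intros z k Hk Z HZ. replace z with (1 * z) by ring. apply mbd_scale; auto.
      rewrite Rabs_right; lra. }
    repeat apply mbd_add; apply S; auto; nra. }
  set (m := Rabs M). set (m' := Rabs M').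
  set (bG := m' + (1 + (a1' + (a2' + a3')))).
  exists (3 * (m * bG) + 3 * ((1 + (a1 + (a2 + a3))) * m') + (t4 + t5 + t6)), (Rmin d d').
  split. { split; [apply Rmin_pos; lra | pose proof (Rmin_l d d'); lra]. }
  intros e He. pose proof (Rmin_l d d'); pose proof (Rmin_r d d').
  assert (e1 : 0 <= e <= 1) by lra.
  set (e4 := e * e * e * e).
  assert (E4 : 0 <= e4 <= 1) by (unfold e4; assert (0 <= e * e <= 1) by nra; nra).
  assert (hF : mbd (msub (F e) (poly3 A1 A2 A3 e)) (m * e4)).
  { eapply mbd_le; [apply HF; lra|]. fold e4. unfold m. apply Rmult_le_compat_r; [lra|apply Rle_abs]. }
  assert (hG : mbd (msub (G e) (poly3 B1 B2 B3 e)) (m' * e4)).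
  { eapply mbd_le; [apply HG; lra|]. fold e4. unfold m'. apply Rmult_le_compat_r; [lra|apply Rle_abs]. }
  assert (0 <= m) by apply Rabs_pos. assert (0 <= m') by apply Rabs_pos.
  assert (gB : mbd (G e) bG).
  { replace (G e) with (madd (msub (G e) (poly3 B1 B2 B3 e)) (poly3 B1 B2 B3 e))
      by (generalize (poly3 B1 B2 B3 e) (G e); clear; mring).
    apply mbd_add; [eapply mbd_le; [exact hG|nra] | apply PB; auto]. }
  pose proof (PB A1 A2 A3 a1 a2 a3 e e1 c1 c2 c3) as pA.
  replace (msub _ _) with
    (madd (madd (mmul (msub (F e) (poly3 A1 A2 A3 e)) (G e))
                (mmul (poly3 A1 A2 A3 e) (msub (G e) (poly3 B1 B2 B3 e))))
          (madd (mscale e4 T4) (madd (mscale (e4 * e) T5) (mscale (e4 * (e * e)) T6)))).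
  2:{ rewrite <- (msub_mul (F e) (G e)).
      transitivity (madd (msub (mmul (F e) (G e)) (mmul (poly3 A1 A2 A3 e) (poly3 B1 B2 B3 e)))
        (msub (mmul (poly3 A1 A2 A3 e) (poly3 B1 B2 B3 e))
         (poly3 (madd A1 B1) (madd A2 (madd (mmul A1 B1) B2))
           (madd A3 (madd (mmul A2 B1) (madd (mmul A1 B2) B3))) e))).
      - f_equal. unfold e4, T4, T5, T6, poly3.
        clear. apply M3_eq; cbn; ring.
      - generalize (mmul (F e) (G e)) (mmul (poly3 A1 A2 A3 e) (poly3 B1 B2 B3 e)).
        intros. rewrite <- msub_trans. reflexivity. }
  assert (S : forall z k, 0 <= k <= e4 -> forall Z, mbd Z z -> mbd (mscale k Z) (e4 * z)).
  { intros z k Hk Z HZ. apply mbd_scale; auto. rewrite Rabs_right; lra. }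
  pose proof (mbd_mul _ _ _ _ hF gB) as x1. pose proof (mbd_mul _ _ _ _ pA hG) as x2.
  assert (E2 : 0 <= e * e <= 1) by nra.
  assert (k5 : 0 <= e4 * e <= e4) by nra. assert (k6 : 0 <= e4 * (e * e) <= e4) by nra.
  pose proof (S t4 e4 ltac:(lra) T4 b4) as x3.
  pose proof (S t5 (e4 * e) k5 T5 b5) as x4.
  pose proof (S t6 (e4 * (e * e)) k6 T6 b6) as x5.
  eapply mbd_le; [repeat apply mbd_add; eassumption|]. fold e4. apply Req_le; ring.
Qed.

Lemma Ex3_rot v :
  Ex3 (fun e => rot e v) (skew v) (mscale (/2) (mmul (skew v) (skew v)))
      (mscale (/6) (mmul (skew v) (mmul (skew v) (skew v)))).
Proof.
  destruct (V3_dec v (mkV 0 0 0)) as [->|H].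
  { exists 0, 1. split; [lra|]. intros e He. rewrite rot_vec0.
    replace (msub _ _) with (mscale 0 mid3)
      by (unfold poly3, skew; apply M3_eq; cbn; ring).
    apply mbd_0; lra. }
  pose proof (vnorm_pos v H) as Pn. pose proof (vdir_unit v H) as U.
  pose proof (vdir_scale v H) as D. set (n := vnorm v) in *.
  set (u := vscale (/ n) v) in *.
  exists (n * n * n * n), (Rmin 1 (/ n)). split.
  { split; [apply Rmin_pos; [lra | apply Rinv_0_lt_compat; auto] | apply Rmin_l]. }
  intros e He. pose proof (Rmin_l 1 (/ n)); pose proof (Rmin_r 1 (/ n)).
  assert (T1 : 0 <= e * n <= 1).
  { split; [nra|]. apply Rle_trans with (/ n * n); [apply Rmult_le_compat_r; lra|].
    rewrite Rinv_l; lra. }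
  unfold rot. fold n u. rewrite rot_unit_form by exact U. rewrite <- D at 1 2 3 4 5 6.
  set (th := e * n) in *.
  (* For a unit vector the cube of [skew u] is its negative, so the cubic coefficient matches the
     cubic term of the sine and only scalar remainders of sine and cosine are left. *)
  assert (K3 : mmul (skew u) (mmul (skew u) (skew u)) = mscale (-1) (skew u)).
  { clear - U. destruct u as [x y z]. unfold dot in U; simpl in U.
    assert (Hz : z * z = 1 - x * x - y * y) by lra. apply M3_eq; cbn; ring [Hz]. }
  rewrite !skew_scale, !mmul_scaler, !mmul_scalel, !mmul_scaler, K3.
  replace (msub _ _) with
    (madd (mscale (sin th - th + th * th * th / 6) (skew u))
          (mscale (1 - cos th - th * th / 2) (mmul (skew u) (skew u)))).
  2:{ unfold poly3, th. generalize (sin (e * n)) (cos (e * n)); intros S C.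
      generalize (mmul (skew u) (skew u)) (skew u). clear. intros A B.
      apply M3_eq; unfold msub; cbn; field. }
  assert (PI1 : th <= PI) by (pose proof PI2_1; lra).
  pose proof (sin_lower th ltac:(lra) PI1) as s1.
  pose proof (sin_upper th ltac:(lra) PI1) as s2.
  pose proof (one_minus_cos_le2 th) as c2.
  (* The fourth-order bound for the cosine is the square of the cubic bound for the sine at half the
     angle. *)
  assert (c1 : th * th / 2 - th * th * th * th / 24 <= 1 - cos th).
  { rewrite cos_half. pose proof (sin_lower (th / 2) ltac:(lra) ltac:(lra)) as s3.
    assert (0 <= th / 2 - th / 2 * (th / 2) * (th / 2) / 6) by nra.
    assert (sq : forall a b, 0 <= a -> a <= b -> a * a <= b * b) by (intros; nra).
    pose proof (sq _ _ H2 s3). nra. }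
  assert (T4 : 0 <= th * th * th * th) by (assert (0 <= th * th) by nra; nra).
  assert (T5 : th * th * th * th * th <= th * th * th * th) by nra.
  replace (n * n * n * n * (e * e * e * e)) with (th * th * th * th) by (unfold th; ring).
  assert (Hb : mbd (madd (mscale (sin th - th + th * th * th / 6) (skew u))
          (mscale (1 - cos th - th * th / 2) (mmul (skew u) (skew u))))
     (th * th * th * th / 120 * 1 + th * th * th * th / 24 * 3)).
  { apply mbd_add; apply mbd_scale.
    - apply Rabs_le; split; lra.
    - apply mbd_skew_unit; auto.
    - apply Rabs_le; split; lra.
    - apply mbd_skew2_unit; auto. }
  eapply mbd_le; [exact Hb|lra].
Qed.

(** * Sequential compactness *)

Definition tends (u : nat -> R) (l : R) : Prop :=
  forall e, 0 < e -> exists N, forall n, (N <= n)%nat -> Rabs (u n - l) <= e.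

(** Subsequences are only asked to satisfy n <= phi n. This preserves limits, is stable under
    composition, and spares the construction of increasing index maps. *)
Lemma tends_sub u l phi : tends u l -> (forall n, (n <= phi n)%nat) -> tends (fun n => u (phi n)) l.
Proof.
  intros H P e He. destruct (H e He) as [N HN]. exists N. intros n Hn. apply HN.
  specialize (P n). lia.
Qed.

Lemma archi e : 0 < e -> exists N, forall n, (N <= n)%nat -> / (INR n + 1) <= e.
Proof.
  intros He. destruct (archimed_cor1 e He) as (N & H1 & H2). exists N. intros n Hn.
  left. apply Rle_lt_trans with (/ INR N); auto.
  apply Rinv_le_contravar; [apply lt_0_INR; lia|]. apply le_INR in Hn. lra.
Qed.

Lemma inv_INR_pos n : 0 < / (INR n + 1).
Proof. apply Rinv_0_lt_compat. pose proof (pos_INR n); lra. Qed.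

Lemma bounded_subseq (u : nat -> R) B : (forall n, Rabs (u n) <= B) ->
  exists phi l, (forall n, (n <= phi n)%nat) /\ tends (fun n => u (phi n)) l.
Proof.
  intros H.
  destruct (Bolzano_Weierstrass u (fun c => - B <= c <= B)) as [l Hl].
  { apply compact_P3. }
  { intros n. specialize (H n). revert H; unfold Rabs; destruct Rcase_abs; lra. }
  assert (C : forall n : nat, exists p, (n <= p)%nat /\ Rabs (u p - l) <= / (INR n + 1)).
  { intros n. destruct (Hl (disc l (mkposreal _ (inv_INR_pos n))) n) as (p & Hp & Hd).
    - exists (mkposreal _ (inv_INR_pos n)). intros x Hx; exact Hx.
    - exists p. split; auto. unfold disc in Hd; simpl in Hd. lra. }
  exists (fun n => proj1_sig (constructive_indefinite_description _ (C n))), l.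
  split.
  - intros n. destruct constructive_indefinite_description; simpl; tauto.
  - intros e He. destruct (archi e He) as [N HN]. exists N. intros n Hn.
    destruct constructive_indefinite_description as [p [? Hp]]; simpl.
    specialize (HN n Hn). lra.
Qed.

Lemma bounded_subseq_fam d (u : nat -> nat -> R) B : (forall n i, Rabs (u n i) <= B) ->
  exists phi l, (forall n, (n <= phi n)%nat) /\
    forall i, (i < d)%nat -> tends (fun n => u (phi n) i) (l i).
Proof.
  intros H. induction d as [|d (phi & l & Hp & Hl)].
  - exists (fun n => n), (fun _ => 0). split; [auto | intros; lia].
  - destruct (bounded_subseq (fun n => u (phi n) d) B) as (psi & m & Hq & Hm).
    { intros; apply H. }
    exists (fun n => phi (psi n)), (fun i => if Nat.eqb i d then m else l i). split.
    + intros n. specialize (Hp (psi n)); specialize (Hq n); lia.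
    + intros i Hi. destruct (Nat.eqb_spec i d) as [->|].
      * exact Hm.
      * apply (tends_sub (fun n => u (phi n) i)); auto. apply Hl; lia.
Qed.

Definition mtends (u : nat -> M3) (A : M3) : Prop :=
  forall e, 0 < e -> exists N, forall n, (N <= n)%nat -> mbd (msub (u n) A) e.

Lemma mtends_sub u l phi : mtends u l -> (forall n, (n <= phi n)%nat) -> mtends (fun n => u (phi n)) l.
Proof.
  intros H P e He. destruct (H e He) as [N HN]. exists N. intros n Hn. apply HN.
  specialize (P n). lia.
Qed.

Definition mget (A : M3) (i : nat) : R :=
  nth i [m11 A; m12 A; m13 A; m21 A; m22 A; m23 A; m31 A; m32 A; m33 A] 0.

Lemma SO3_subseq (u : nat -> M3) : (forall n, inSO3 (u n)) ->
  exists phi A, (forall n, (n <= phi n)%nat) /\ mtends (fun n => u (phi n)) A /\ inSO3 A.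
Proof.
  intros H.
  destruct (bounded_subseq_fam 9 (fun n i => mget (u n) i) 1) as (phi & l & Hp & Hl).
  { intros n i. destruct (mbd_SO3 _ (H n)) as ((?&?&?)&(?&?&?)&(?&?&?)).
    do 9 (destruct i as [|i]; [assumption|]). unfold mget.
    rewrite nth_overflow by (simpl; lia). rewrite Rabs_R0; lra. }
  set (A := mkM (l 0%nat) (l 1%nat) (l 2%nat) (l 3%nat) (l 4%nat) (l 5%nat) (l 6%nat) (l 7%nat) (l 8%nat)).
  assert (T : mtends (fun n => u (phi n)) A).
  { intros e He.
    assert (F : exists N, forall n, (N <= n)%nat -> forall i, (i < 9)%nat ->
       Rabs (mget (u (phi n)) i - l i) <= e).
    { assert (G : forall k, (k <= 9)%nat -> exists N, forall n, (N <= n)%nat -> forall i, (i < k)%nat ->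
       Rabs (mget (u (phi n)) i - l i) <= e).
      { induction k; intros Hk; [exists 0%nat; intros; lia|].
        destruct IHk as [N1 HN1]; [lia|]. destruct (Hl k Hk e He) as [N2 HN2].
        exists (max N1 N2). intros n Hn i Hi. destruct (Nat.eq_dec i k) as [->|].
        - apply HN2; lia.
        - apply HN1; lia. }
      apply (G 9%nat); lia. }
    destruct F as [N HN]. exists N. intros n Hn. specialize (HN n Hn).
    unfold mbd, msub; simpl.
    pose proof (HN 0%nat ltac:(lia)); pose proof (HN 1%nat ltac:(lia)); pose proof (HN 2%nat ltac:(lia)).
    pose proof (HN 3%nat ltac:(lia)); pose proof (HN 4%nat ltac:(lia)); pose proof (HN 5%nat ltac:(lia)).
    pose proof (HN 6%nat ltac:(lia)); pose proof (HN 7%nat ltac:(lia)); pose proof (HN 8%nat ltac:(lia)).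
    unfold mget in *; simpl in *.
    assert (E : forall x y, x + -1 * y = x - y) by (intros; ring). rewrite !E. tauto. }
  exists phi, A. split; [exact Hp | split; [exact T |]].
  apply SO3_closed. intros e He. destruct (T e He) as [N HN].
  exists (u (phi N)). split; auto. specialize (HN N (le_n N)).
  replace (msub A (u (phi N))) with (mscale (-1) (msub (u (phi N)) A))
    by (generalize (u (phi N)) A; mring).
  replace e with (1 * e) by ring. apply mbd_scale; auto. apply Rabs_le; lra.
Qed.

(** * Frames, words and their costs *)

Record frame := mkF { fX : V3; fY : V3; kx : R; ky : R }.
Definition cc (F : frame) : R := dot (fX F) (fY F).
Definition fN (F : frame) : V3 := cross (fX F) (fY F).

(** [gcx] and [gcy] are the symmetric form of c < kappa <= 1. They make the coefficients of W_+ and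
    W_- nonzero with the signs of their corners ([Wm_coef_pos], [Wp_coef_pos]). The sign of [cc] is
    left open because [Rho] changes it. *)
Record gframe (F : frame) : Prop := {
  gX : dot (fX F) (fX F) = 1; gY : dot (fY F) (fY F) = 1;
  gkx : 0 < kx F; gky : 0 < ky F;
  gcx : Rabs (cc F) * kx F < ky F; gcy : Rabs (cc F) * ky F < kx F }.

Lemma gcc F : gframe F -> -1 < cc F < 1.
Proof.
  intros [_ _ H1 H2 H3 H4].
  assert (H : Rabs (cc F) < 1).
  { pose proof (Rabs_pos (cc F)). apply Rnot_le_lt; intros ?. nra. }
  apply Rabs_def2 in H; lra.
Qed.

Definition fv (F : frame) (ab : R * R) : V3 := fvec (fX F) (fY F) ab.
Definition ucost (F : frame) (ab : R * R) : R := kx F * Rabs (fst ab) + ky F * Rabs (snd ab).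
Definition wp (F : frame) (w : list factor) : M3 := word_prod (fX F) (fY F) w.
Fixpoint wc (F : frame) (w : list factor) : R :=
  match w with [] => 0 | f :: w => fst f * ucost F (snd f) + wc F w end.
(** Together with [wb] the total displacement of a word: to first order in the cost the product is I
    + [wa X + wb Y], whatever the order of the letters ([wp_near]). *)
Fixpoint wa (w : list factor) : R :=
  match w with [] => 0 | f :: w => fst f * fst (snd f) + wa w end.
Fixpoint wb (w : list factor) : R :=
  match w with [] => 0 | f :: w => fst f * snd (snd f) + wb w end.
(** Unlike decompositions, these words may contain zero vectors, which act as the identity. Every
    decomposition is such a competitor, and [lv_nz] restores the nonvanishing for the final word. *)
Definition nnw (w : list factor) : Prop := Forall (fun f => 0 <= fst f) w.

Lemma ucost_ge0 F ab : gframe F -> 0 <= ucost F ab.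
Proof.
  intros G. destruct G. unfold ucost.
  pose proof (Rabs_pos (fst ab)); pose proof (Rabs_pos (snd ab)). nra.
Qed.
Lemma wp_cons F f w : wp F (f :: w) = mmul (rot (fst f) (fv F (snd f))) (wp F w).
Proof. reflexivity. Qed.
Lemma wp_app F w1 w2 : wp F (w1 ++ w2) = mmul (wp F w1) (wp F w2).
Proof.
  induction w1 as [|f w IH]; [symmetry; apply mmul_1l|].
  rewrite <- app_comm_cons, !wp_cons, IH, mmul_assoc. reflexivity.
Qed.
Lemma wc_app F w1 w2 : wc F (w1 ++ w2) = wc F w1 + wc F w2.
Proof. induction w1 as [|f w IH]; simpl; [ring | rewrite IH; ring]. Qed.
Lemma wp_SO3 F w : inSO3 (wp F w).
Proof.
  induction w as [|f w IH]; [apply SO3_1|]. rewrite wp_cons. apply SO3_mul; auto using rot_SO3.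
Qed.
Lemma wc_ge0 F w : gframe F -> nnw w -> 0 <= wc F w.
Proof.
  intros G. induction 1 as [|f w Hf Hw IH]; simpl; [lra|].
  pose proof (ucost_ge0 F (snd f) G). nra.
Qed.
Lemma nnw_app w1 w2 : nnw (w1 ++ w2) <-> nnw w1 /\ nnw w2.
Proof. apply Forall_app. Qed.

Definition fneg (f : factor) : factor := (fst f, (- fst (snd f), - snd (snd f))).
Definition wrev (w : list factor) : list factor := map fneg (rev w).

Lemma fv_neg F a b : fv F (- a, - b) = vneg (fv F (a, b)).
Proof. unfold fv, fvec; simpl. mring. Qed.

Lemma wrev_cons f w : wrev (f :: w) = wrev w ++ [fneg f].
Proof. unfold wrev; simpl. rewrite map_app. reflexivity. Qed.
Lemma wp_wrev F w : wp F (wrev w) = mtrans (wp F w).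
Proof.
  induction w as [|f w IH]; [reflexivity|].
  rewrite wrev_cons, wp_app, (wp_cons F f w), mtrans_mul, IH. f_equal.
  destruct f as [t [a b]]; unfold wp; simpl. fold (fv F (-a,-b)) (fv F (a,b)).
  rewrite fv_neg, rot_vneg, rot_opp, mmul_1r. reflexivity.
Qed.
Lemma wc_wrev F w : wc F (wrev w) = wc F w.
Proof.
  induction w as [|f w IH]; [reflexivity|].
  rewrite wrev_cons, wc_app, IH. simpl. unfold ucost; simpl. rewrite !Rabs_Ropp. ring.
Qed.
Lemma nnw_wrev w : nnw w -> nnw (wrev w).
Proof.
  induction w as [|f w IH]; [auto|]. rewrite wrev_cons. intros H; inversion H; subst.
  apply nnw_app; split; [auto|]. constructor; [assumption|constructor].
Qed.

Lemma word_split F w s : gframe F -> nnw w -> 0 <= s <= wc F w ->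
  exists w1 w2, nnw w1 /\ nnw w2 /\ wp F w = mmul (wp F w1) (wp F w2) /\
    wc F w1 = s /\ wc F w2 = wc F w - s.
Proof.
  intros G Hw. revert s. induction Hw as [|f w Hf Hw IH]; simpl; intros s Hs.
  - exists [], []. split; [constructor|]. split; [constructor|].
    split; [symmetry; apply mmul_1l | simpl; lra].
  - pose proof (ucost_ge0 F (snd f) G) as U.
    destruct (Rle_dec s (fst f * ucost F (snd f))) as [h|h].
    (* If the letter costs nothing then s = 0 and the first part is empty; otherwise the cut is at
       time s divided by the unit cost. *)
    + destruct (Req_dec (ucost F (snd f)) 0) as [Z|Z].
      * exists [], (f :: w). split; [constructor|]. split; [constructor; auto|].
        split; [symmetry; apply mmul_1l|]. simpl. rewrite Z in *. split; lra.
      * assert (Hq : 0 <= s / ucost F (snd f)).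
        { apply Rmult_le_pos; [lra | left; apply Rinv_0_lt_compat; lra]. }
        assert (Hq2 : s / ucost F (snd f) <= fst f).
        { apply Rmult_le_reg_r with (ucost F (snd f)); [lra|].
          unfold Rdiv. rewrite Rmult_assoc, Rinv_l; lra. }
        exists [(s / ucost F (snd f), snd f)], ((fst f - s / ucost F (snd f), snd f) :: w).
        split; [|split; [|split; [|split]]].
        -- constructor; [exact Hq|constructor].
        -- constructor; auto; simpl; lra.
        -- rewrite !wp_cons. simpl fst; simpl snd.
           change (wp F []) with mid3. rewrite mmul_1r, <- mmul_assoc, <- rot_add.
           do 2 f_equal. ring.
        -- simpl. field; auto.
        -- simpl. field; auto.
    + destruct (IH (s - fst f * ucost F (snd f))) as (w1 & w2 & H1 & H2 & H3 & H4 & H5); [lra|].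
      exists (f :: w1), w2. split; [constructor; auto|]. split; [auto|]. split; [|split].
      * rewrite !wp_cons, H3, mmul_assoc; reflexivity.
      * simpl; lra.
      * lra.
Qed.

Lemma unit_coord u : dot u u = 1 -> Rabs (vx u) <= 1 /\ Rabs (vy u) <= 1 /\ Rabs (vz u) <= 1.
Proof. destruct u; unfold dot; simpl; intros; repeat split; apply sq_le1; nra. Qed.

Definition DD (F : frame) : R := / kx F + / ky F.

Lemma coef_le_ucost F a b : gframe F -> Rabs a + Rabs b <= DD F * ucost F (a, b).
Proof.
  intros [_ _ H1 H2 _ _]. unfold DD, ucost; simpl.
  pose proof (Rabs_pos a); pose proof (Rabs_pos b).
  pose proof (Rinv_0_lt_compat _ H1); pose proof (Rinv_0_lt_compat _ H2).
  assert (E1 : / kx F * kx F = 1) by (apply Rinv_l; lra).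
  assert (E2 : / ky F * ky F = 1) by (apply Rinv_l; lra).
  replace ((/ kx F + / ky F) * (kx F * Rabs a + ky F * Rabs b)) with
    ((/ kx F * kx F) * Rabs a + (/ ky F * ky F) * Rabs b + / ky F * kx F * Rabs a + / kx F * ky F * Rabs b) by ring.
  rewrite E1, E2.
  assert (0 <= / ky F * kx F * Rabs a) by (repeat apply Rmult_le_pos; lra).
  assert (0 <= / kx F * ky F * Rabs b) by (repeat apply Rmult_le_pos; lra). lra.
Qed.

Lemma vnorm_fv_le F a b : gframe F -> vnorm (fv F (a, b)) <= Rabs a + Rabs b.
Proof.
  intros G. pose proof (gcc F G) as C. destruct G.
  assert (E : dot (fv F (a, b)) (fv F (a, b)) = a * a + b * b + 2 * cc F * (a * b)).
  { transitivity (a * a * dot (fX F) (fX F) + b * b * dot (fY F) (fY F) + 2 * cc F * (a * b)).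
    - unfold fv, fvec, cc; simpl. generalize (fX F) (fY F); mring.
    - rewrite gX0, gY0; ring. }
  pose proof (vnorm_sq (fv F (a, b))) as S. rewrite E in S.
  pose proof (vnorm_ge0 (fv F (a,b))). pose proof (Rabs_pos a); pose proof (Rabs_pos b).
  pose proof (Rsq_Rabs a); pose proof (Rsq_Rabs b).
  assert (cc F * (a * b) <= Rabs a * Rabs b).
  { rewrite <- Rabs_mult. apply Rle_trans with (Rabs (cc F * (a * b))); [apply Rle_abs|].
    rewrite Rabs_mult. pose proof (Rabs_pos (a * b)).
    assert (Rabs (cc F) <= 1) by (apply Rabs_le; lra). nra. }
  apply Rsqr_incr_0_var; [unfold Rsqr; nra | lra].
Qed.

Lemma mbd_skew_fv F a b : gframe F -> mbd (skew (fv F (a, b))) (Rabs a + Rabs b).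
Proof.
  intros G. destruct (unit_coord _ (gX F G)) as (x1 & x2 & x3).
  destruct (unit_coord _ (gY F G)) as (y1 & y2 & y3).
  replace (Rabs a + Rabs b) with (Rabs a * 1 + Rabs b * 1) by ring.
  apply mbd_skew; unfold fv, fvec; simpl; apply Rabs_plus_le; apply Rabs_mult_le; lra.
Qed.

(** The letters commute up to second order in the cost. In the induction the cross term of the first
    letter with the rest is bounded by 36 D^2 times the product of the two costs, which fits into
    the 72 that the square of the sum provides. *)
Lemma wp_near F w : gframe F -> nnw w ->
  kx F * Rabs (wa w) + ky F * Rabs (wb w) <= wc F w /\
  mbd (msub (wp F w) mid3) (12 * DD F * wc F w) /\
  mbd (msub (wp F w) (madd mid3 (skew (fv F (wa w, wb w)))))
      (36 * (DD F * DD F) * (wc F w * wc F w)).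
Proof.
  intros G. induction 1 as [|f w Hf Hw (I1 & I2 & I3)].
  - simpl wc; simpl wa; simpl wb. split; [|split].
    + rewrite Rabs_R0; lra.
    + change (wp F []) with mid3. rewrite msub_self. apply mbd_0; lra.
    + change (wp F []) with mid3.
      replace (msub _ _) with (mscale 0 mid3).
      * apply mbd_0; lra.
      * unfold fv, fvec; simpl. generalize (fX F) (fY F). mring.
  - destruct f as [t [a b]]. simpl in Hf. rewrite wp_cons. simpl fst; simpl snd.
    assert (EW : wc F ((t, (a, b)) :: w) = t * ucost F (a, b) + wc F w) by reflexivity.
    assert (EA : wa ((t, (a, b)) :: w) = t * a + wa w) by reflexivity.
    assert (EB : wb ((t, (a, b)) :: w) = t * b + wb w) by reflexivity.
    rewrite EW, EA, EB. clear EW EA EB.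
    pose proof (wc_ge0 F w G Hw) as Wc. pose proof (ucost_ge0 F (a, b) G) as Uc.
    pose proof (coef_le_ucost F a b G) as CU. pose proof (vnorm_fv_le F a b G) as NU.
    pose proof (mbd_skew_fv F a b G) as SU. pose proof (vnorm_ge0 (fv F (a, b))) as N0.
    assert (D0 : 0 < DD F).
    { destruct G. unfold DD. pose proof (Rinv_0_lt_compat _ gkx0); pose proof (Rinv_0_lt_compat _ gky0); lra. }
    set (D := DD F) in *. set (U := ucost F (a, b)) in *. set (n := vnorm (fv F (a, b))) in *.
    set (q := wc F w) in *.
    assert (U1 : 0 <= t * U) by nra.
    assert (TN : t * n <= D * (t * U)).
    { replace (D * (t * U)) with (t * (D * U)) by ring. apply Rmult_le_compat_l; lra. }
    assert (TN0 : 0 <= t * n) by nra.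
    pose proof (rot_near1 t (fv F (a, b)) Hf) as R1. fold n in R1.
    pose proof (rot_near2 t (fv F (a, b)) Hf) as R2. fold n in R2.
    pose proof (mbd_SO3 _ (wp_SO3 F w)) as B1.
    split; [|split].
    + apply Rle_trans with (kx F * (t * Rabs a + Rabs (wa w)) + ky F * (t * Rabs b + Rabs (wb w))).
      * destruct G. apply Rplus_le_compat; apply Rmult_le_compat_l; try lra;
        (eapply Rle_trans; [apply Rabs_triang|]); rewrite Rabs_mult, (Rabs_right t) by lra; lra.
      * unfold U, ucost; simpl. lra.
    + replace (msub _ _) with (madd (mmul (msub (rot t (fv F (a, b))) mid3) (wp F w)) (msub (wp F w) mid3))
        by (generalize (rot t (fv F (a, b))) (wp F w); mring).
      pose proof (mbd_mul _ _ _ _ R1 B1) as R1'.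
      eapply mbd_le; [apply mbd_add; eassumption|]. nra.
    + replace (msub _ _) with
        (madd (mmul (msub (rot t (fv F (a, b))) (madd mid3 (mscale t (skew (fv F (a, b)))))) (wp F w))
          (madd (mmul (mscale t (skew (fv F (a, b)))) (msub (wp F w) mid3))
                (msub (wp F w) (madd mid3 (skew (fv F (wa w, wb w))))))).
      2:{ replace (skew (fv F (t * a + wa w, t * b + wb w))) with
            (madd (mscale t (skew (fv F (a, b)))) (skew (fv F (wa w, wb w)))).
          - generalize (rot t (fv F (a, b))) (wp F w) (mscale t (skew (fv F (a, b)))) (skew (fv F (wa w, wb w))). mring.
          - rewrite <- skew_scale, <- skew_add. f_equal. unfold fv, fvec; simpl.
            generalize (fX F) (fY F) (wa w) (wb w). mring. }
      pose proof (mbd_mul _ _ _ _ R2 B1) as R2'.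
      assert (SS : mbd (mscale t (skew (fv F (a, b)))) (t * (D * U))).
      { apply mbd_scale; [rewrite Rabs_right; lra|]. eapply mbd_le; [exact SU|lra]. }
      pose proof (mbd_mul _ _ _ _ SS I2) as R3.
      eapply mbd_le; [apply mbd_add; [exact R2' | apply mbd_add; [exact R3 | exact I3]]|].
      assert (SQ : (t * n) * (t * n) <= (D * (t * U)) * (D * (t * U))) by nra.
      assert (0 <= D * D) by nra.
      assert (Z1 : 0 <= D * D * (t * U * (t * U))) by (apply Rmult_le_pos; nra).
      assert (Z2 : 0 <= D * D * (t * U * q)) by (apply Rmult_le_pos; nra).
      replace (36 * (D * D) * ((t * U + q) * (t * U + q))) with
        (36 * (D * D * (t * U * (t * U))) + 72 * (D * D * (t * U * q)) + 36 * (D * D) * (q * q)) by ring.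
      replace (3 * (t * (D * U) * (12 * D * q))) with (36 * (D * D * (t * U * q))) by ring.
      replace (D * (t * U) * (D * (t * U))) with (D * D * (t * U * (t * U))) in SQ by ring.
      lra.
Qed.

(** * Limits of words *)

(* The closure of the set of pairs (product, cost) of words; minima exist on it. *)
Definition K (F : frame) (h : M3) (c : R) : Prop :=
  forall e, 0 < e -> exists w, nnw w /\ mbd (msub (wp F w) h) e /\ wc F w <= c + e.

Lemma le_eps x y k : 0 <= k -> (forall e, 0 < e <= 1 -> x <= y + k * e) -> x <= y.
Proof.
  intros Hk H. apply Rnot_lt_le; intros Hn.
  set (e := Rmin 1 ((x - y) / (2 * (k + 1)))).
  assert (0 < (x - y) / (2 * (k + 1))) by (apply Rdiv_lt_0_compat; lra).
  assert (He : 0 < e <= 1) by (unfold e; split; [apply Rmin_pos; lra | apply Rmin_l]).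
  specialize (H e He).
  assert (k * e <= (x - y) / 2).
  { apply Rle_trans with (k * ((x - y) / (2 * (k + 1)))).
    - apply Rmult_le_compat_l; auto. apply Rmin_r.
    - apply Rmult_le_reg_r with (2 * (k + 1)); [lra|].
      replace (k * ((x - y) / (2 * (k + 1))) * (2 * (k + 1))) with (k * (x - y)) by (field; lra).
      replace ((x - y) / 2 * (2 * (k + 1))) with ((x - y) * (k + 1)) by field. nra. }
  lra.
Qed.

Lemma msub_opp A B r : mbd (msub A B) r -> mbd (msub B A) r.
Proof.
  intros H. replace (msub B A) with (mscale (-1) (msub A B)) by mring.
  replace r with (1 * r) by ring. apply mbd_scale; auto. apply Rabs_le; lra.
Qed.

Lemma K_word F w : nnw w -> K F (wp F w) (wc F w).
Proof.
  intros H e He. exists w. split; auto. split; [|lra].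
  rewrite msub_self. apply mbd_0; lra.
Qed.
Lemma K_mono F h c c' : K F h c -> c <= c' -> K F h c'.
Proof.
  intros H Hc e He. destruct (H e He) as (w & H1 & H2 & H3). exists w. split; [auto|split; [auto|lra]].
Qed.
Lemma K_ge0 F h c : gframe F -> K F h c -> 0 <= c.
Proof.
  intros G H. apply (le_eps 0 c 1); [lra|]. intros e He.
  destruct (H e ltac:(lra)) as (w & H1 & H2 & H3). pose proof (wc_ge0 F w G H1). lra.
Qed.
Lemma K_SO3 F h c : K F h c -> inSO3 h.
Proof.
  intros H. apply SO3_closed. intros e He. destruct (H e He) as (w & H1 & H2 & H3).
  exists (wp F w). split; [apply wp_SO3 | apply msub_opp, H2].
Qed.
Lemma K_closed F h c :
  (forall e, 0 < e -> exists h' c', K F h' c' /\ mbd (msub h' h) e /\ c' <= c + e) -> K F h c.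
Proof.
  intros H e He. destruct (H (e / 2)) as (h' & c' & H1 & H2 & H3); [lra|].
  destruct (H1 (e / 2)) as (w & W1 & W2 & W3); [lra|].
  exists w. split; auto. split; [|lra].
  rewrite (msub_trans _ h'). replace e with (e / 2 + e / 2) by field. apply mbd_add; auto.
Qed.
Lemma mmul_near A B C D a b :
  inSO3 A -> inSO3 D -> mbd (msub A C) a -> mbd (msub B D) b -> mbd C 1 ->
  mbd (msub (mmul A B) (mmul C D)) (3 * a + 3 * b + 3 * (a * b)).
Proof.
  intros HA HD H1 H2 H3. rewrite msub_mul.
  replace (mmul (msub A C) B) with (madd (mmul (msub A C) D) (mmul (msub A C) (msub B D)))
    by (generalize A B C D; clear; mring).
  pose proof (mbd_mul _ _ _ _ H1 (mbd_SO3 _ HD)). pose proof (mbd_mul _ _ _ _ H1 H2).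
  pose proof (mbd_mul _ _ _ _ H3 H2).
  eapply mbd_le; [apply mbd_add; [apply mbd_add; eassumption | eassumption]|]. lra.
Qed.
Lemma K_mul F g h c d : K F g c -> K F h d -> K F (mmul g h) (c + d).
Proof.
  intros Hg Hh e He. pose proof (K_SO3 _ _ _ Hg) as Sg. pose proof (K_SO3 _ _ _ Hh) as Sh.
  set (e' := Rmin 1 (e / 9)).
  assert (E' : 0 < e') by (apply Rmin_pos; lra).
  pose proof (Rmin_l 1 (e / 9)); pose proof (Rmin_r 1 (e / 9)); fold e' in H, H0.
  destruct (Hg e' E') as (w1 & A1 & A2 & A3). destruct (Hh e' E') as (w2 & B1 & B2 & B3).
  exists (w1 ++ w2). split; [apply nnw_app; auto|]. rewrite wp_app, wc_app. split; [|lra].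
  eapply mbd_le; [apply mmul_near; eauto using wp_SO3, mbd_SO3|]. nra.
Qed.
Lemma K_trans F h c : K F h c -> K F (mtrans h) c.
Proof.
  intros H e He. destruct (H e He) as (w & H1 & H2 & H3). exists (wrev w).
  rewrite wp_wrev, wc_wrev. split; [apply nnw_wrev; auto|]. split; auto.
  replace (msub _ _) with (mtrans (msub (wp F w) h)) by (generalize (wp F w); mring).
  apply mbd_trans; auto.
Qed.

Lemma DD_pos F : gframe F -> 0 < DD F.
Proof.
  intros G. unfold DD.
  pose proof (Rinv_0_lt_compat _ (gkx F G)); pose proof (Rinv_0_lt_compat _ (gky F G)); lra.
Qed.

Lemma K_0 F h : gframe F -> K F h 0 -> h = mid3.
Proof.
  intros G H. pose proof (DD_pos F G) as D0. apply msub_0. intros e He.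
  set (e' := e / (12 * DD F + 1)).
  assert (E' : 0 < e') by (apply Rdiv_lt_0_compat; nra).
  destruct (H e' E') as (w & H1 & H2 & H3).
  destruct (wp_near F w G H1) as (_ & N & _).
  rewrite (msub_trans _ (wp F w)). eapply mbd_le; [apply mbd_add; [apply msub_opp, H2 | exact N]|].
  replace e with (e' + 12 * DD F * e') by (unfold e'; field; nra).
  assert (12 * DD F * wc F w <= 12 * DD F * e') by (apply Rmult_le_compat_l; lra). lra.
Qed.

Lemma K_near1 F h c : gframe F -> K F h c -> 0 < c -> mbd (msub h mid3) ((24 * DD F + 1) * c).
Proof.
  intros G H Hc. destruct (H c Hc) as (w & H1 & H2 & H3).
  destruct (wp_near F w G H1) as (_ & N & _). pose proof (DD_pos F G).
  rewrite (msub_trans _ (wp F w)). eapply mbd_le; [apply mbd_add; [apply msub_opp, H2 | exact N]|].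
  assert (12 * DD F * wc F w <= 12 * DD F * (2 * c)) by (apply Rmult_le_compat_l; lra). lra.
Qed.

Lemma K_near2 F h c : gframe F -> K F h c -> 0 < c <= 1 -> exists a b,
  kx F * Rabs a + ky F * Rabs b <= c + c * c /\
  mbd (msub h (madd mid3 (skew (fv F (a, b))))) ((144 * (DD F * DD F) + 1) * (c * c)).
Proof.
  (* Accuracy c^2 keeps the error of the approximating word at the order of the quadratic remainder
     in [wp_near]. *)
  intros G H Hc. destruct (H (c * c) ltac:(nra)) as (w & H1 & H2 & H3).
  destruct (wp_near F w G H1) as (N1 & _ & N). pose proof (DD_pos F G).
  pose proof (wc_ge0 F w G H1) as W0.
  exists (wa w), (wb w). split; [lra|].
  rewrite (msub_trans _ (wp F w)). eapply mbd_le; [apply mbd_add; [apply msub_opp, H2 | exact N]|].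
  assert (W2 : wc F w <= 2 * c) by nra.
  assert (W3 : wc F w * wc F w <= (2 * c) * (2 * c)) by (apply Rmult_le_compat; lra).
  assert (36 * (DD F * DD F) * (wc F w * wc F w) <= 36 * (DD F * DD F) * ((2 * c) * (2 * c)))
    by (apply Rmult_le_compat_l; [nra|lra]). lra.
Qed.

(** The approximating words are cut at cost s; both families of pieces converge along a subsequence,
    by compactness of SO(3). *)
Lemma K_split F h c s : gframe F -> K F h c -> 0 <= s <= c ->
  exists h1 h2, h = mmul h1 h2 /\ K F h1 s /\ K F h2 (c - s).
Proof.
  intros G H Hs.
  assert (C : forall n : nat, exists w12 : list factor * list factor,
     nnw (fst w12) /\ nnw (snd w12) /\
     mbd (msub (mmul (wp F (fst w12)) (wp F (snd w12))) h) (/ (INR n + 1)) /\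
     wc F (fst w12) <= s /\ wc F (snd w12) <= c - s + / (INR n + 1)).
  { intros n. destruct (H _ (inv_INR_pos n)) as (w & W1 & W2 & W3).
    pose proof (wc_ge0 F w G W1) as W0.
    (* An approximating word may cost less than s; then it is kept whole and the second piece is
       free. *)
    destruct (word_split F w (Rmin s (wc F w)) G W1) as (w1 & w2 & A1 & A2 & A3 & A4 & A5).
    { split; [apply Rmin_glb; lra | apply Rmin_r]. }
    exists (w1, w2); simpl. rewrite <- A3. do 3 (split; [assumption|]). split.
    - rewrite A4. apply Rmin_l.
    - rewrite A5. unfold Rmin. destruct Rle_dec; pose proof (inv_INR_pos n); lra. }
  set (ww := fun n => proj1_sig (constructive_indefinite_description _ (C n))).
  assert (W : forall n, nnw (fst (ww n)) /\ nnw (snd (ww n)) /\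
     mbd (msub (mmul (wp F (fst (ww n))) (wp F (snd (ww n)))) h) (/ (INR n + 1)) /\
     wc F (fst (ww n)) <= s /\ wc F (snd (ww n)) <= c - s + / (INR n + 1)).
  { intros n. unfold ww. destruct constructive_indefinite_description; simpl; auto. }
  clearbody ww. clear C.
  destruct (SO3_subseq (fun n => wp F (fst (ww n)))) as (phi & h1 & P1 & T1 & S1).
  { intros; apply wp_SO3. }
  destruct (SO3_subseq (fun n => wp F (snd (ww (phi n))))) as (psi & h2 & P2 & T2 & S2).
  { intros; apply wp_SO3. }
  apply (mtends_sub _ _ psi) in T1; auto. simpl in T1.
  assert (PP : forall n, (n <= phi (psi n))%nat).
  { intros n. specialize (P1 (psi n)); specialize (P2 n); lia. }
  exists h1, h2. split; [|split].
  - apply msub_0. intros e He.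
    set (e' := Rmin 1 (e / 10)).
    assert (E' : 0 < e') by (apply Rmin_pos; lra).
    pose proof (Rmin_l 1 (e / 10)) as L1; pose proof (Rmin_r 1 (e / 10)) as L2; fold e' in L1, L2.
    destruct (T1 e' E') as [N1 HN1]. destruct (T2 e' E') as [N2 HN2]. destruct (archi e' E') as [N3 HN3].
    set (n := (N1 + N2 + N3)%nat).
    specialize (HN1 n ltac:(lia)). specialize (HN2 n ltac:(lia)).
    specialize (HN3 (phi (psi n)) ltac:(specialize (PP n); lia)).
    destruct (W (phi (psi n))) as (_ & _ & W3 & _).
    rewrite (msub_trans _ (mmul (wp F (fst (ww (phi (psi n))))) (wp F (snd (ww (phi (psi n))))))).
    eapply mbd_le; [apply mbd_add; [apply msub_opp, W3|]|].
    + apply mmul_near; try exact HN1; try exact HN2; auto using wp_SO3, mbd_SO3.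
    + nra.
  - apply K_closed. intros e He. destruct (T1 e He) as [N HN].
    exists (wp F (fst (ww (phi (psi N))))), s. split; [|split; [apply HN; lia|lra]].
    eapply K_mono; [apply K_word; apply W | apply W].
  - apply K_closed. intros e He. destruct (T2 e He) as [N1 HN]. destruct (archi e He) as [N2 HN2].
    set (n := (N1 + N2)%nat).
    exists (wp F (snd (ww (phi (psi n))))), (c - s + e).
    split; [|split; [apply HN; lia|lra]].
    eapply K_mono; [apply K_word; apply W|].
    destruct (W (phi (psi n))) as (_ & _ & _ & _ & W5).
    specialize (HN2 (phi (psi n)) ltac:(specialize (PP n); lia)). lra.
Qed.

Lemma msub_tr G A B : mtr (mmul G (msub A B)) = mtr (mmul G A) - mtr (mmul G B).
Proof. mring. Qed.

(** The trace term is bounded on SO(3), so the costs along a maximising sequence stay bounded and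
    both coordinates converge along a subsequence. No word need attain the supremum yet, so the
    limit is only in [K]. *)
Lemma K_minimizer F Gm : gframe F -> exists h0 c0, K F h0 c0 /\
  forall h c, K F h c -> mtr (mmul Gm h) - c <= mtr (mmul Gm h0) - c0.
Proof.
  intros G. destruct (mbd_exists Gm) as (r & Hr & Br).
  set (val := fun w => mtr (mmul Gm (wp F w)) - wc F w).
  assert (TB : forall w, Rabs (mtr (mmul Gm (wp F w))) <= 9 * r).
  { intros w. replace (9 * r) with (9 * (r * 1)) by ring.
    apply mtr_mul_bd; auto. apply mbd_SO3, wp_SO3. }
  destruct (completeness (fun x => exists w, nnw w /\ x = val w)) as [m [U L]].
  { exists (9 * r). intros x (w & W & ->). pose proof (wc_ge0 F w G W).
    pose proof (TB w) as T. unfold val. pose proof (Rle_abs (mtr (mmul Gm (wp F w)))).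
    lra. }
  { exists (val []), []. split; [constructor | reflexivity]. }
  assert (C : forall n : nat, exists w, nnw w /\ m - / (INR n + 1) <= val w).
  { intros n. apply NNPP; intros Hn. pose proof (inv_INR_pos n).
    assert (m <= m - / (INR n + 1)); [|lra].
    apply L. intros x (w & W & ->). apply Rnot_lt_le; intros ?. apply Hn. exists w. split; auto; lra. }
  set (ww := fun n => proj1_sig (constructive_indefinite_description _ (C n))).
  assert (W : forall n, nnw (ww n) /\ m - / (INR n + 1) <= val (ww n)).
  { intros n. unfold ww. destruct constructive_indefinite_description; simpl; auto. }
  clearbody ww. clear C.
  assert (CB : forall n, Rabs (wc F (ww n)) <= 9 * r + Rabs m + 1).
  { intros n. destruct (W n) as [W1 W2]. pose proof (wc_ge0 F _ G W1).
    rewrite Rabs_right by lra. unfold val in W2. pose proof (TB (ww n)).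
    pose proof (Rle_abs (mtr (mmul Gm (wp F (ww n))))).
    pose proof (Rle_abs (- m)). rewrite Rabs_Ropp in H2.
    assert (/ (INR n + 1) <= 1).
    { rewrite <- Rinv_1. apply Rinv_le_contravar; pose proof (pos_INR n); lra. }
    lra. }
  destruct (SO3_subseq (fun n => wp F (ww n))) as (phi & h0 & P1 & T1 & S1).
  { intros; apply wp_SO3. }
  destruct (bounded_subseq (fun n => wc F (ww (phi n))) _ (fun n => CB (phi n))) as (psi & c0 & P2 & T2).
  apply (mtends_sub _ _ psi) in T1; auto. simpl in T1.
  assert (PP : forall n, (n <= phi (psi n))%nat).
  { intros n. specialize (P1 (psi n)); specialize (P2 n); lia. }
  assert (M : m <= mtr (mmul Gm h0) - c0).
  { apply (le_eps _ _ (9 * r + 2)); [lra|]. intros e He.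
    destruct (T1 e ltac:(lra)) as [N1 HN1]. destruct (T2 e ltac:(lra)) as [N2 HN2].
    destruct (archi e ltac:(lra)) as [N3 HN3].
    set (n := (N1 + N2 + N3)%nat).
    specialize (HN1 n ltac:(lia)). specialize (HN2 n ltac:(lia)).
    specialize (HN3 (phi (psi n)) ltac:(specialize (PP n); lia)).
    destruct (W (phi (psi n))) as (_ & W2). unfold val in W2.
    pose proof (mtr_mul_bd _ _ _ _ Br HN1) as TT. rewrite msub_tr in TT.
    match type of TT with Rabs ?x <= _ => pose proof (Rle_abs x) end.
    match type of HN2 with Rabs ?x <= _ => pose proof (Rle_abs (- x)) as Q; rewrite Rabs_Ropp in Q end.
    lra. }
  exists h0, c0. split.
  - apply K_closed. intros e He.
    destruct (T1 e He) as [N1 HN1]. destruct (T2 e He) as [N2 HN2].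
    set (n := (N1 + N2)%nat).
    specialize (HN1 n ltac:(lia)). specialize (HN2 n ltac:(lia)).
    exists (wp F (ww (phi (psi n)))), (wc F (ww (phi (psi n)))).
    split; [apply K_word, W | split; [exact HN1|]].
    match type of HN2 with Rabs ?x <= _ => pose proof (Rle_abs x) end. lra.
  - intros h c HK. apply Rle_trans with m; auto.
    apply (le_eps _ _ (9 * r + 1)); [lra|]. intros e He.
    destruct (HK e ltac:(lra)) as (w & W1 & W2 & W3).
    pose proof (U (val w) ltac:(exists w; split; auto)) as Uw. unfold val in Uw.
    pose proof (mtr_mul_bd _ _ _ _ Br W2) as TT. rewrite msub_tr in TT.
    match type of TT with Rabs ?x <= _ => pose proof (Rle_abs (- x)) as Q; rewrite Rabs_Ropp in Q end.
    lra.
Qed.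

(** * Minimizing curves *)

Lemma K_mid F g h c : gframe F -> inSO3 g -> inSO3 h -> K F (mmul (mtrans g) h) c ->
  exists m, inSO3 m /\ K F (mmul (mtrans g) m) (c / 2) /\ K F (mmul (mtrans m) h) (c / 2).
Proof.
  intros G Sg Sh H. pose proof (K_ge0 _ _ _ G H).
  destruct (K_split F _ c (c / 2) G H) as (h1 & h2 & E & K1 & K2); [lra|].
  pose proof (K_SO3 _ _ _ K1) as S1.
  exists (mmul g h1). split; [apply SO3_mul; auto|]. split.
  - rewrite <- mmul_assoc, (SO3_linv g Sg), mmul_1l. exact K1.
  - rewrite mtrans_mul, mmul_assoc, E, <- mmul_assoc, (SO3_linv h1 S1), mmul_1l.
    replace (c / 2) with (c - c / 2) by field. exact K2.
Qed.

Definition kmid (F : frame) (g h : M3) (c : R) : M3 :=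
  epsilon (inhabits mid3) (fun m =>
    inSO3 m /\ K F (mmul (mtrans g) m) (c / 2) /\ K F (mmul (mtrans m) h) (c / 2)).

(** The curve at cost i c0 / 2^n: each level keeps the previous points at even indices and inserts
    midpoints at odd ones. Past its end the curve stays at h0, so that the step estimates hold for
    every index. *)
Fixpoint dyad (F : frame) (h0 : M3) (c0 : R) (n : nat) : nat -> M3 :=
  match n with
  | O => fun i => match i with O => mid3 | _ => h0 end
  | S n => fun i => if Nat.even i then dyad F h0 c0 n (Nat.div2 i)
                    else kmid F (dyad F h0 c0 n (Nat.div2 i))
                              (dyad F h0 c0 n (S (Nat.div2 i))) (c0 / 2 ^ n)
  end.

Lemma dyad_S F h0 c0 n i : dyad F h0 c0 (S n) i =
  if Nat.even i then dyad F h0 c0 n (Nat.div2 i)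
  else kmid F (dyad F h0 c0 n (Nat.div2 i)) (dyad F h0 c0 n (S (Nat.div2 i))) (c0 / 2 ^ n).
Proof. reflexivity. Qed.

Lemma dyad_double F h0 c0 n i : dyad F h0 c0 (S n) (2 * i) = dyad F h0 c0 n i.
Proof. rewrite dyad_S, Nat.even_mul, Nat.div2_double. reflexivity. Qed.

Lemma dyad_odd F h0 c0 n i : dyad F h0 c0 (S n) (S (2 * i)) =
  kmid F (dyad F h0 c0 n i) (dyad F h0 c0 n (S i)) (c0 / 2 ^ n).
Proof.
  rewrite dyad_S, Nat.even_succ, Nat.odd_mul, Nat.div2_succ_double. reflexivity.
Qed.

Lemma dyad_step F h0 c0 : gframe F -> K F h0 c0 -> forall n i,
  inSO3 (dyad F h0 c0 n i) /\
  K F (mmul (mtrans (dyad F h0 c0 n i)) (dyad F h0 c0 n (S i))) (c0 / 2 ^ n).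
Proof.
  intros G H. pose proof (K_ge0 _ _ _ G H) as C0. pose proof (K_SO3 _ _ _ H) as S0.
  induction n as [|n IH]; intros i.
  - simpl. replace (c0 / 1) with c0 by field. destruct i as [|i].
    + split; [apply SO3_1|]. rewrite mtrans_1, mmul_1l. exact H.
    + split; [exact S0|]. rewrite (SO3_linv h0 S0).
      eapply K_mono; [apply (K_word F []); constructor | simpl; lra].
  - assert (E : c0 / 2 ^ S n = c0 / 2 ^ n / 2) by (simpl; field; apply pow_nonzero; lra).
    destruct (Nat.Even_or_Odd i) as [[j ->]|[j ->]].
    + rewrite dyad_double, dyad_odd. destruct (IH j) as [S1 K1]. destruct (IH (S j)) as [S2 _].
      assert (P : exists m, inSO3 m /\ K F (mmul (mtrans (dyad F h0 c0 n j)) m) (c0 / 2 ^ n / 2)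
        /\ K F (mmul (mtrans m) (dyad F h0 c0 n (S j))) (c0 / 2 ^ n / 2)) by (apply K_mid; auto).
      pose proof (epsilon_spec (inhabits mid3) _ P) as (Q1 & Q2 & Q3). rewrite E. unfold kmid. split; auto.
    + replace (S (2 * j + 1)) with (2 * S j)%nat by lia. replace (2 * j + 1)%nat with (S (2 * j)) by lia.
      rewrite dyad_double, dyad_odd. destruct (IH j) as [S1 K1]. destruct (IH (S j)) as [S2 _].
      assert (P : exists m, inSO3 m /\ K F (mmul (mtrans (dyad F h0 c0 n j)) m) (c0 / 2 ^ n / 2)
        /\ K F (mmul (mtrans m) (dyad F h0 c0 n (S j))) (c0 / 2 ^ n / 2)) by (apply K_mid; auto).
      pose proof (epsilon_spec (inhabits mid3) _ P) as (Q1 & Q2 & Q3). rewrite E. unfold kmid. split; auto.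
Qed.

Lemma K_chain F g m h c d : inSO3 m -> K F (mmul (mtrans g) m) c -> K F (mmul (mtrans m) h) d ->
  K F (mmul (mtrans g) h) (c + d).
Proof.
  intros S H1 H2. pose proof (K_mul _ _ _ _ _ H1 H2) as H.
  rewrite mmul_assoc, <- (mmul_assoc m), (SO3_rinv m S), mmul_1l in H. exact H.
Qed.

Lemma dyad_chain F h0 c0 : gframe F -> K F h0 c0 -> forall n i k,
  K F (mmul (mtrans (dyad F h0 c0 n i)) (dyad F h0 c0 n (i + k))) (INR k * (c0 / 2 ^ n)).
Proof.
  intros G H n i k. induction k as [|k IH].
  - rewrite Nat.add_0_r. destruct (dyad_step F h0 c0 G H n i) as [S _]. rewrite (SO3_linv _ S).
    simpl. eapply K_mono; [apply (K_word F []); constructor | simpl; lra].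
  - rewrite S_INR. replace ((INR k + 1) * (c0 / 2 ^ n)) with (INR k * (c0 / 2 ^ n) + c0 / 2 ^ n) by ring.
    destruct (dyad_step F h0 c0 G H n (i + k)) as [S KS].
    apply (K_chain F _ (dyad F h0 c0 n (i + k))); auto.
    replace (i + Datatypes.S k)%nat with (Datatypes.S (i + k)) by lia. exact KS.
Qed.

Lemma dyad_refine F h0 c0 n k i : dyad F h0 c0 (k + n) (2 ^ k * i) = dyad F h0 c0 n i.
Proof.
  induction k as [|k IH]; [simpl; f_equal; lia|].
  replace (2 ^ S k * i)%nat with (2 * (2 ^ k * i))%nat by (simpl; lia).
  change (S k + n)%nat with (S (k + n)). rewrite dyad_double. exact IH.
Qed.

Lemma floor_nat x : 0 <= x -> exists k : nat, INR k <= x < INR k + 1.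
Proof.
  intros Hx. destruct (base_Int_part x) as [H1 H2].
  assert (0 <= Int_part x)%Z.
  { apply le_IZR. assert (IZR (-1) < IZR (Int_part x)) by lra. apply lt_IZR in H. apply IZR_le. lia. }
  exists (Z.to_nat (Int_part x)). rewrite INR_IZR_INZ, Z2Nat.id by auto. lra.
Qed.

Lemma pow2_large x : exists n : nat, x < 2 ^ n.
Proof.
  destruct (Pow_x_infinity 2 ltac:(rewrite Rabs_right; lra) (Rabs x + 1)) as [N HN].
  exists N. specialize (HN N (le_n N)). rewrite Rabs_right in HN.
  - pose proof (Rle_abs x). lra.
  - left. apply pow_lt; lra.
Qed.

(** The point is a limit of dyadic points just before s. Its distances to all dyadic points are
    recorded, since [K_curve] chooses the points for different s independently and can compare them
    only through dyadic ones. *)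
Lemma dyad_point F h0 c0 s : gframe F -> K F h0 c0 -> 0 <= s -> 0 < c0 -> exists m, inSO3 m /\
  (forall n i, INR i * (c0 / 2 ^ n) <= s -> K F (mmul (mtrans (dyad F h0 c0 n i)) m) (s - INR i * (c0 / 2 ^ n))) /\
  (forall n i, s <= INR i * (c0 / 2 ^ n) -> K F (mmul (mtrans m) (dyad F h0 c0 n i)) (INR i * (c0 / 2 ^ n) - s)).
Proof.
  intros G H Hs Hc.
  assert (P2 : forall n, 0 < 2 ^ n) by (intros; apply pow_lt; lra).
  assert (D0 : forall n, 0 < c0 / 2 ^ n) by (intros; apply Rdiv_lt_0_compat; auto).
  assert (FL : forall n, exists k : nat, INR k * (c0 / 2 ^ n) <= s < INR k * (c0 / 2 ^ n) + c0 / 2 ^ n).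
  { intros n. destruct (floor_nat (s / (c0 / 2 ^ n))) as [k [K1 K2]].
    - apply Rmult_le_pos; [auto | left; apply Rinv_0_lt_compat; auto].
    - exists k. specialize (D0 n).
      assert (E : s / (c0 / 2 ^ n) * (c0 / 2 ^ n) = s) by (field; split; [apply Rgt_not_eq, P2|lra]).
      split; [rewrite <- E; apply Rmult_le_compat_r; lra|].
      rewrite <- E. replace (INR k * (c0 / 2 ^ n) + c0 / 2 ^ n) with ((INR k + 1) * (c0 / 2 ^ n)) by ring.
      apply Rmult_lt_compat_r; lra. }
  set (fl := fun n => proj1_sig (constructive_indefinite_description _ (FL n))).
  assert (HF : forall n, INR (fl n) * (c0 / 2 ^ n) <= s < INR (fl n) * (c0 / 2 ^ n) + c0 / 2 ^ n).
  { intros n. unfold fl. destruct constructive_indefinite_description; auto. }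
  clearbody fl.
  destruct (SO3_subseq (fun n => dyad F h0 c0 n (fl n))) as (phi & m & Pp & T & Sm).
  { intros. apply dyad_step; auto. }
  exists m. split; auto.
  assert (SC : forall n k i, INR i * (c0 / 2 ^ n) = INR (2 ^ k * i) * (c0 / 2 ^ (k + n))).
  { intros. rewrite mult_INR, pow_INR, pow_add. replace (INR 2) with 2 by (simpl; ring).
    field. split; apply Rgt_not_eq, P2. }
  assert (SD : forall e, 0 < e -> exists N, forall n, (N <= n)%nat -> c0 / 2 ^ n <= e).
  { intros e He. destruct (pow2_large (c0 / e)) as [N HN]. exists N. intros n Hn.
    apply Rmult_le_reg_r with (2 ^ n); auto. unfold Rdiv. rewrite Rmult_assoc, Rinv_l, Rmult_1_r by (apply Rgt_not_eq, P2).
    apply Rle_trans with (e * 2 ^ N); [|apply Rmult_le_compat_l; [lra | apply Rle_pow; [lra|lia]]].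
    left. replace c0 with (e * (c0 / e)) by (field; lra). apply Rmult_lt_compat_l; auto. }
  split; intros n i Hi.
  - apply K_closed. intros e He. destruct (T (e / 3) ltac:(lra)) as [N HN].
    set (q := (N + n)%nat). specialize (HN q ltac:(lia)).
    assert (Hq : (n <= phi q)%nat) by (specialize (Pp q); lia).
    set (k := (phi q - n)%nat).
    assert (Ek : (k + n = phi q)%nat) by lia.
    set (j := (2 ^ k * i)%nat).
    assert (Hj : (j <= fl (phi q))%nat).
    { rewrite (SC n k i), Ek in Hi. fold j in Hi. destruct (HF (phi q)) as [_ HF2].
      apply Nat.lt_succ_r. apply INR_lt. rewrite S_INR. specialize (D0 (phi q)).
      apply Rmult_lt_reg_r with (c0 / 2 ^ phi q); auto. lra. }
    pose proof (dyad_chain F h0 c0 G H (phi q) j (fl (phi q) - j)) as CH.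
    replace (j + (fl (phi q) - j))%nat with (fl (phi q)) in CH by lia.
    unfold j in CH at 1. rewrite <- Ek in CH at 1. rewrite dyad_refine in CH.
    exists (mmul (mtrans (dyad F h0 c0 n i)) (dyad F h0 c0 (phi q) (fl (phi q)))),
      (INR (fl (phi q) - j) * (c0 / 2 ^ phi q)).
    split; [exact CH|]. split.
    + replace (msub _ _) with (mmul (mtrans (dyad F h0 c0 n i)) (msub (dyad F h0 c0 (phi q) (fl (phi q))) m))
        by (generalize (mtrans (dyad F h0 c0 n i)) (dyad F h0 c0 (phi q) (fl (phi q))) m; clear; mring).
      eapply mbd_le; [apply mbd_mul; [apply mbd_SO3, SO3_trans, dyad_step; auto | exact HN]|]. lra.
    + rewrite minus_INR by auto. rewrite (SC n k i), Ek. fold j. destruct (HF (phi q)). lra.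
  - apply K_closed. intros e He. destruct (T (e / 3) ltac:(lra)) as [N HN].
    destruct (SD e He) as [N' HN'].
    set (q := (N + N' + n)%nat). specialize (HN q ltac:(lia)).
    assert (Hq : (n <= phi q)%nat) by (specialize (Pp q); lia).
    specialize (HN' (phi q) ltac:(specialize (Pp q); lia)).
    set (k := (phi q - n)%nat).
    assert (Ek : (k + n = phi q)%nat) by lia.
    set (j := (2 ^ k * i)%nat).
    assert (Hj : (fl (phi q) <= j)%nat).
    { rewrite (SC n k i), Ek in Hi. fold j in Hi. destruct (HF (phi q)) as [HF1 _].
      apply INR_le. specialize (D0 (phi q)).
      apply Rmult_le_reg_r with (c0 / 2 ^ phi q); auto. lra. }
    pose proof (dyad_chain F h0 c0 G H (phi q) (fl (phi q)) (j - fl (phi q))) as CH.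
    replace (fl (phi q) + (j - fl (phi q)))%nat with j in CH by lia.
    unfold j in CH at 1. rewrite <- Ek in CH at 3. rewrite dyad_refine in CH.
    exists (mmul (mtrans (dyad F h0 c0 (phi q) (fl (phi q)))) (dyad F h0 c0 n i)),
      (INR (j - fl (phi q)) * (c0 / 2 ^ phi q)).
    split; [exact CH|]. split.
    + replace (msub _ _) with (mmul (mtrans (msub (dyad F h0 c0 (phi q) (fl (phi q))) m)) (dyad F h0 c0 n i))
        by (generalize (dyad F h0 c0 n i) (dyad F h0 c0 (phi q) (fl (phi q))) m; clear; mring).
      eapply mbd_le; [apply mbd_mul; [apply mbd_trans, HN | apply mbd_SO3, dyad_step; auto]|]. lra.
    + rewrite minus_INR by auto. rewrite (SC n k i), Ek. fold j. destruct (HF (phi q)). lra.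
Qed.

Lemma K_curve F h0 c0 : gframe F -> K F h0 c0 -> 0 < c0 -> exists gam : R -> M3,
  (forall s, 0 <= s -> inSO3 (gam s)) /\ gam 0 = mid3 /\ gam c0 = h0 /\
  forall s t, 0 <= s <= t -> t <= c0 -> K F (mmul (mtrans (gam s)) (gam t)) (t - s).
Proof.
  intros G H Hc.
  assert (P2 : forall n, 0 < 2 ^ n) by (intros; apply pow_lt; lra).
  set (P := fun s m => inSO3 m /\
  (forall n i, INR i * (c0 / 2 ^ n) <= s -> K F (mmul (mtrans (dyad F h0 c0 n i)) m) (s - INR i * (c0 / 2 ^ n))) /\
  (forall n i, s <= INR i * (c0 / 2 ^ n) -> K F (mmul (mtrans m) (dyad F h0 c0 n i)) (INR i * (c0 / 2 ^ n) - s))).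
  set (gam := fun s => epsilon (inhabits mid3) (P s)).
  assert (HP : forall s, 0 <= s -> P s (gam s)).
  { intros s Hs. unfold gam. apply epsilon_spec. apply dyad_point; auto. }
  clearbody gam. exists gam.
  split; [intros s Hs; apply (HP s Hs)|].
  split; [|split].
  - destruct (HP 0 ltac:(lra)) as (_ & A & _). specialize (A 0%nat 0%nat). simpl in A.
    assert (B := A ltac:(lra)). rewrite mtrans_1, mmul_1l in B. apply (K_0 F); auto.
    eapply K_mono; [exact B | lra].
  - destruct (HP c0 ltac:(lra)) as (S & _ & A). specialize (A 0%nat 1%nat). simpl in A.
    assert (B := A ltac:(lra)). replace (1 * (c0 / 1) - c0) with 0 in B by field.
    apply (K_0 F) in B; auto.
    rewrite <- (mmul_1r (gam c0)), <- B, <- mmul_assoc, (SO3_rinv _ S), mmul_1l. reflexivity.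
  - intros s t Hst Ht. destruct (Req_dec s t) as [<-|Hne].
    { destruct (HP s ltac:(lra)) as (S & _). rewrite (SO3_linv _ S).
      eapply K_mono; [apply (K_word F []); constructor | simpl; lra]. }
    (* The grid is made finer than t - s, so that a dyadic parameter lies between s and t and links
       the two points. *)
    destruct (pow2_large (2 * (c0 / (t - s)))) as [n Hn].
    assert (D0 : 0 < c0 / 2 ^ n) by (apply Rdiv_lt_0_compat; auto).
    assert (SM : c0 / 2 ^ n < t - s).
    { apply Rmult_lt_reg_r with (2 ^ n); auto. unfold Rdiv. rewrite Rmult_assoc, Rinv_l, Rmult_1_r by (apply Rgt_not_eq, P2).
      replace c0 with ((t - s) * (c0 / (t - s))) by (field; lra). apply Rmult_lt_compat_l; [lra|].
      assert (0 < c0 / (t - s)) by (apply Rdiv_lt_0_compat; lra). lra. }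
    destruct (floor_nat (s / (c0 / 2 ^ n))) as [k [K1 K2]].
    { apply Rmult_le_pos; [lra | left; apply Rinv_0_lt_compat; auto]. }
    assert (E : s / (c0 / 2 ^ n) * (c0 / 2 ^ n) = s) by (field; split; [apply Rgt_not_eq, P2|lra]).
    assert (I1 : s <= INR (S k) * (c0 / 2 ^ n)).
    { rewrite S_INR. rewrite <- E. apply Rmult_le_compat_r; lra. }
    assert (I2 : INR (S k) * (c0 / 2 ^ n) <= t).
    { rewrite S_INR. assert (INR k * (c0 / 2 ^ n) <= s); [rewrite <- E; apply Rmult_le_compat_r; lra|]. lra. }
    destruct (HP s ltac:(lra)) as (S1 & _ & A1). destruct (HP t ltac:(lra)) as (S2 & A2 & _).
    replace (t - s) with ((INR (S k) * (c0 / 2 ^ n) - s) + (t - INR (S k) * (c0 / 2 ^ n))) by ring.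
    apply (K_chain F _ (dyad F h0 c0 n (S k))); auto. apply dyad_step; auto.
Qed.

(** * Symmetries *)

(** A symmetry renames the axes and moves no rotation: the relabelled word in the new frame has the
    same product and cost ([wp_sym], [wc_sym]), so statements about a fixed group element transfer
    directly. *)
Definition symF (s : sym) (F : frame) : frame :=
  match s with
  | Nu => mkF (vneg (fX F)) (vneg (fY F)) (kx F) (ky F)
  | Rho => mkF (fX F) (vneg (fY F)) (kx F) (ky F)
  | Vs => mkF (fY F) (fX F) (ky F) (kx F)
  end.
Definition symab (s : sym) (ab : R * R) : R * R :=
  match s with
  | Nu => (- fst ab, - snd ab)
  | Rho => (fst ab, - snd ab)
  | Vs => (snd ab, fst ab)
  end.
(** The coefficients of W_+ and W_- made homogeneous in the weights. With the normalisation kx = 1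
    the exchange of X and Y would leave the family of frames; in this form [gcoef_sym] holds for all
    three generators. *)
Definition gbase (F : frame) (b : base) : R * R :=
  match b with
  | BX => (1, 0)
  | BY => (0, 1)
  | BWp => (kx F + ky F * cc F, - (ky F + kx F * cc F))
  | BWm => (kx F - ky F * cc F, ky F - kx F * cc F)
  end.
Definition gcoef (F : frame) (l : label) : R * R :=
  if fst l then (- fst (gbase F (snd l)), - snd (gbase F (snd l))) else gbase F (snd l).

Lemma cc_sym s F : cc (symF s F) = match s with Rho => - cc F | _ => cc F end.
Proof. destruct s; unfold cc; simpl; generalize (fX F) (fY F); mring. Qed.

Lemma gcoef_sym s F l : gcoef (symF s F) (sym_label s l) = symab s (gcoef F l).
Proof.
  unfold gcoef, gbase. rewrite cc_sym. generalize (cc F); intros q.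
  destruct F, l as [n b]; destruct s, b, n; simpl; f_equal; ring.
Qed.
Lemma fv_sym s F ab : fv (symF s F) (symab s ab) = fv F ab.
Proof.
  destruct s, ab; unfold fv, fvec; simpl; generalize (fX F) (fY F); mring.
Qed.
Lemma ucost_sym s F ab : ucost (symF s F) (symab s ab) = ucost F ab.
Proof. destruct s, ab; unfold ucost; simpl; rewrite ?Rabs_Ropp; ring. Qed.
Lemma symF_inv s F : symF s (symF s F) = F.
Proof.
  assert (E : forall v, vneg (vneg v) = v) by mring.
  destruct s, F; simpl; rewrite ?E; reflexivity.
Qed.
Lemma sym_label_inv s l : sym_label s (sym_label s l) = l.
Proof. destruct s, l as [[] []]; reflexivity. Qed.
Lemma gframe_sym s F : gframe F -> gframe (symF s F).
Proof.
  intros [H1 H2 H3 H4 H5 H6].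
  assert (E : forall v, dot (vneg v) (vneg v) = dot v v) by mring.
  assert (A : Rabs (cc (symF s F)) = Rabs (cc F)).
  { rewrite cc_sym. destruct s; rewrite ?Rabs_Ropp; reflexivity. }
  constructor; rewrite ?A; destruct s; simpl; rewrite ?E; auto.
Qed.

Definition symw (s : sym) (w : list factor) : list factor :=
  map (fun f => (fst f, symab s (snd f))) w.
Lemma wp_sym s F w : wp (symF s F) (symw s w) = wp F w.
Proof.
  induction w as [|f w IH]; [reflexivity|].
  change (symw s (f :: w)) with ((fst f, symab s (snd f)) :: symw s w).
  rewrite !wp_cons, IH. simpl fst; simpl snd. rewrite fv_sym. reflexivity.
Qed.
Lemma wc_sym s F w : wc (symF s F) (symw s w) = wc F w.
Proof.
  induction w as [|f w IH]; [reflexivity|]. simpl. rewrite IH, ucost_sym. reflexivity.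
Qed.
Lemma nnw_sym s w : nnw w -> nnw (symw s w).
Proof. induction 1; constructor; auto. Qed.
Lemma K_sym s F h c : K F h c -> K (symF s F) h c.
Proof.
  intros H e He. destruct (H e He) as (w & H1 & H2 & H3).
  exists (symw s w). rewrite wp_sym, wc_sym. auto using nnw_sym.
Qed.

Definition lword (F : frame) (w : list factor) : Prop :=
  Forall (fun f => exists l, snd f = gcoef F l) w.
Definition Wd (F : frame) (h : M3) (t : R) : Prop :=
  exists w, nnw w /\ lword F w /\ wp F w = h /\ wc F w = t.

Lemma Wd_nil F : Wd F mid3 0.
Proof. exists []. split; [constructor|]. split; [constructor|]. split; reflexivity. Qed.
Lemma Wd_mul F g h s t : Wd F g s -> Wd F h t -> Wd F (mmul g h) (s + t).
Proof.
  intros (w1 & A1 & A2 & A3 & A4) (w2 & B1 & B2 & B3 & B4). exists (w1 ++ w2).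
  rewrite wp_app, wc_app, A3, A4, B3, B4. split; [apply nnw_app; auto|].
  split; [apply Forall_app; auto|]. auto.
Qed.
Lemma Wd_trans F h t : Wd F h t -> Wd F (mtrans h) t.
Proof.
  intros (w & A1 & A2 & A3 & A4). exists (wrev w). rewrite wp_wrev, wc_wrev, A3, A4.
  split; [apply nnw_wrev; auto|]. split; auto.
  unfold wrev. apply Forall_map. apply Forall_rev. eapply Forall_impl; [|exact A2].
  intros [t' [a b]] [[n bb] E]. exists (negb n, bb). simpl in *.
  destruct n; unfold gcoef in *; simpl in *; rewrite <- E || (injection E; intros -> ->);
  simpl; rewrite ?Ropp_involutive; try reflexivity. destruct (gbase F bb); reflexivity.
Qed.
Lemma Wd_letter F l t : 0 <= t -> Wd F (rot t (fv F (gcoef F l))) (t * ucost F (gcoef F l)).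
Proof.
  intros H. exists [(t, gcoef F l)]. split; [constructor; [auto|constructor]|].
  split; [constructor; [eexists; reflexivity|constructor]|].
  split; [rewrite wp_cons; apply mmul_1r | simpl; ring].
Qed.
Lemma Wd_sym s F h t : Wd (symF s F) h t -> Wd F h t.
Proof.
  intros (w & A1 & A2 & A3 & A4). exists (symw s w).
  assert (E1 : wp F (symw s w) = h) by (rewrite <- (symF_inv s F) at 1; rewrite wp_sym; auto).
  assert (E2 : wc F (symw s w) = t) by (rewrite <- (symF_inv s F) at 1; rewrite wc_sym; auto).
  split; [apply nnw_sym; auto|]. split; auto.
  unfold symw, lword. apply Forall_map. eapply Forall_impl; [|exact A2].
  intros f [l E]. exists (sym_label s l). simpl. rewrite E.
  rewrite <- (symF_inv s F) at 2. rewrite gcoef_sym. reflexivity.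
Qed.

(** * Extremal curves *)

(** [ec_opt] compares the curve with the one whose arc from s to t is replaced by E. With endpoint h
    and penalty matrix Gm, the new endpoint is gam(s) E gam(t)^T h, so B = h Gm. Written with B
    alone the condition is stable under reversal ([EC_rev]) and symmetries. *)
Record EC (F : frame) (B : M3) (L : R) (gam : R -> M3) : Prop := {
  ec_SO3 : forall s, 0 <= s <= L -> inSO3 (gam s);
  ec_K : forall s t, 0 <= s <= t -> t <= L -> K F (mmul (mtrans (gam s)) (gam t)) (t - s);
  ec_opt : forall s t E e, 0 <= s <= t -> t <= L -> K F E e ->
    mtr (mmul B (mmul (gam s) (mmul E (mtrans (gam t))))) <= mtr B + e - (t - s) }.

Lemma EC_sym s F B L gam : EC F B L gam -> EC (symF s F) B L gam.
Proof.
  intros [H1 H2 H3]. constructor; auto.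
  - intros. apply K_sym; auto.
  - intros. apply H3; auto. apply (K_sym s) in H4. rewrite symF_inv in H4. exact H4.
Qed.

Lemma EC_rev F B L gam : EC F B L gam -> EC F (mtrans B) L (fun s => gam (L - s)).
Proof.
  intros [H1 H2 H3]. constructor.
  - intros; apply H1; lra.
  - intros s t Hs Ht. replace (t - s) with ((L - s) - (L - t)) by ring.
    replace (mmul (mtrans (gam (L - s))) (gam (L - t))) with
      (mtrans (mmul (mtrans (gam (L - t))) (gam (L - s)))) by (rewrite mtrans_mul, mtrans_inv; reflexivity).
    apply K_trans, H2; lra.
  - intros s t E e Hs Ht HK. specialize (H3 (L - t) (L - s) (mtrans E) e ltac:(lra) ltac:(lra) (K_trans _ _ _ HK)).
    rewrite mtr_trans. rewrite <- mtr_trans.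
    rewrite !mtrans_mul, !mtrans_inv, mtr_mulC, !mmul_assoc. lra.
Qed.

(** The differential at E = I of the trace in [ec_opt] with t = s: inserting a short rotation about
    v at time s changes that trace at the rate [dot (lam s) v]. *)
Definition lam (B : M3) (gam : R -> M3) (s : R) : V3 := mv (mtrans (gam s)) (vee B).
Definition lx F B gam s := dot (lam B gam s) (fX F).
Definition ly F B gam s := dot (lam B gam s) (fY F).
Definition lz F B gam s := dot (lam B gam s) (fN F).

Lemma lam_step B gam s t : inSO3 (gam s) ->
  lam B gam t = mv (mtrans (mmul (mtrans (gam s)) (gam t))) (lam B gam s).
Proof.
  intros H. unfold lam. rewrite mtrans_mul, mtrans_inv, <- mv_mul, mmul_assoc, (SO3_rinv _ H), mmul_1r.
  reflexivity.
Qed.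

Lemma mtr_conj G A : inSO3 G -> mtr (mmul (mmul (mtrans G) A) G) = mtr A.
Proof. intros H. rewrite mtr_mulC, <- mmul_assoc, (SO3_rinv G H), mmul_1l. reflexivity. Qed.

Lemma first_order B v k : (exists d, 0 < d /\ forall e, 0 <= e <= d -> mtr (mmul B (rot e v)) <= mtr B + e * k) ->
  dot (vee B) v <= k.
Proof.
  intros (d & Hd & H). destruct (mbd_exists B) as (r & Hr & Br).
  set (n := vnorm v). apply (le_eps _ _ (9 * (r * (4 * (n * n))) * Rmin 1 d)).
  { pose proof (vnorm_ge0 v). fold n in H0. repeat apply Rmult_le_pos; try lra; try nra. left; apply Rmin_pos; lra. }
  intros e He. set (q := e * Rmin 1 d).
  assert (Q : 0 < q <= d).
  { unfold q. pose proof (Rmin_l 1 d); pose proof (Rmin_r 1 d). assert (0 < Rmin 1 d) by (apply Rmin_pos; lra). split; nra. }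
  specialize (H q ltac:(lra)).
  pose proof (rot_near2 q v ltac:(lra)) as N. fold n in N.
  pose proof (mtr_mul_bd _ _ _ _ Br N) as T. rewrite msub_tr, mmul_addr, mtr_add, mmul_1r, mmul_scaler, mtr_scale, mtr_skew in T.
  match type of T with Rabs ?x <= _ => pose proof (Rle_abs (- x)) as Q'; rewrite Rabs_Ropp in Q' end.
  apply Rmult_le_reg_l with q; [lra|].
  replace (q * (k + 9 * (r * (4 * (n * n))) * Rmin 1 d * e)) with (q * k + 9 * (r * (4 * (q * n * (q * n))))) by (unfold q; ring).
  lra.
Qed.

Lemma lam_pairing F B L gam s v k : EC F B L gam -> 0 <= s <= L ->
  (forall e, 0 <= e -> K F (rot e v) (e * k)) -> dot (lam B gam s) v <= k.
Proof.
  intros [H1 _ H3] Hs HK. specialize (H1 s Hs).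
  unfold lam. rewrite <- (vee_conj (gam s) B H1). apply first_order. exists 1. split; [lra|].
  intros e He. specialize (H3 s s (rot e v) (e * k) ltac:(lra) ltac:(lra) (HK e ltac:(lra))).
  rewrite (mtr_conj _ _ H1).
  replace (mtr (mmul (mmul (mmul (mtrans (gam s)) B) (gam s)) (rot e v))) with
    (mtr (mmul B (mmul (gam s) (mmul (rot e v) (mtrans (gam s)))))); [lra|].
  rewrite (mtr_mulC (mmul (mmul (mtrans (gam s)) B) (gam s))).
  rewrite <- !mmul_assoc, mtr_mulC, <- !mmul_assoc, mtr_mulC, <- !mmul_assoc. reflexivity.
Qed.

Lemma K_rot_fv F a b e : 0 <= e -> K F (rot e (fv F (a, b))) (e * ucost F (a, b)).
Proof.
  intros He. pose proof (K_word F [(e, (a, b))]) as H. rewrite wp_cons in H. simpl in H.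
  unfold wp in H; simpl in H. rewrite mmul_1r, Rplus_0_r in H. apply H. constructor; [auto|constructor].
Qed.

Lemma fv_10 F : fv F (1, 0) = fX F.
Proof. unfold fv, fvec; simpl. generalize (fX F) (fY F); mring. Qed.
Lemma fv_01 F : fv F (0, 1) = fY F.
Proof. unfold fv, fvec; simpl. generalize (fX F) (fY F); mring. Qed.
Lemma ucost_10 F : ucost F (1, 0) = kx F.
Proof. unfold ucost; simpl. rewrite Rabs_R1, Rabs_R0; ring. Qed.
Lemma dot_fv v F a b : dot v (fv F (a, b)) = a * dot v (fX F) + b * dot v (fY F).
Proof. unfold fv, fvec; simpl. generalize (fX F) (fY F); mring. Qed.

Lemma lx_bd F B L gam s : EC F B L gam -> 0 <= s <= L -> Rabs (lx F B gam s) <= kx F.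
Proof.
  intros H Hs. apply Rabs_le; split.
  - pose proof (lam_pairing F B L gam s _ _ H Hs (K_rot_fv F (-1) 0)) as P.
    rewrite dot_fv in P. unfold ucost in P; simpl in P. rewrite Rabs_R0 in P.
    rewrite (Rabs_left (-1)) in P by lra. unfold lx. lra.
  - pose proof (lam_pairing F B L gam s _ _ H Hs (K_rot_fv F 1 0)) as P.
    rewrite dot_fv, ucost_10 in P. unfold lx. lra.
Qed.
Lemma ly_bd F B L gam s : EC F B L gam -> 0 <= s <= L -> Rabs (ly F B gam s) <= ky F.
Proof.
  intros H Hs. apply (lx_bd (symF Vs F) B L gam s); auto. apply EC_sym; auto.
Qed.

Lemma Rabs_dot_le u v r s : Rabs (vx u) <= r -> Rabs (vy u) <= r -> Rabs (vz u) <= r ->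
  Rabs (vx v) <= s -> Rabs (vy v) <= s -> Rabs (vz v) <= s -> Rabs (dot u v) <= 3 * (r * s).
Proof.
  intros. unfold dot. replace (3 * (r * s)) with (r * s + r * s + r * s) by ring.
  repeat apply Rabs_plus_le; apply Rabs_mult_le; auto.
Qed.

Lemma Rabs_mv_le A r v s : mbd A r -> Rabs (vx v) <= s -> Rabs (vy v) <= s -> Rabs (vz v) <= s ->
  Rabs (vx (mv A v)) <= 3 * (r * s) /\ Rabs (vy (mv A v)) <= 3 * (r * s) /\ Rabs (vz (mv A v)) <= 3 * (r * s).
Proof.
  unfold mbd; intros H1 H2 H3 H4. replace (3 * (r * s)) with (r * s + r * s + r * s) by ring.
  unfold mv; simpl; repeat split; repeat apply Rabs_plus_le; apply Rabs_mult_le; tauto.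
Qed.

Lemma dot_mv_bd A r u v p q : mbd A r -> Rabs (vx u) <= p -> Rabs (vy u) <= p -> Rabs (vz u) <= p ->
  Rabs (vx v) <= q -> Rabs (vy v) <= q -> Rabs (vz v) <= q ->
  Rabs (dot (mv A u) v) <= 9 * (r * p * q).
Proof.
  intros HA u1 u2 u3 v1 v2 v3. destruct (Rabs_mv_le A r u p HA u1 u2 u3) as (w1 & w2 & w3).
  replace (9 * (r * p * q)) with (3 * (3 * (r * p) * q)) by ring. apply Rabs_dot_le; auto.
Qed.

Lemma N_coord F : gframe F -> Rabs (vx (fN F)) <= 2 /\ Rabs (vy (fN F)) <= 2 /\ Rabs (vz (fN F)) <= 2.
Proof.
  intros G. destruct (unit_coord _ (gX F G)) as (x1 & x2 & x3).
  destruct (unit_coord _ (gY F G)) as (y1 & y2 & y3).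
  unfold fN, cross; simpl. replace 2 with (1 * 1 + 1 * 1) by ring.
  repeat split; apply Rabs_plus_le; rewrite ?Rabs_Ropp; apply Rabs_mult_le; auto.
Qed.

(** The maximum principle in discrete form. Over an arc of length d the curve moves by a X + b Y up
    to O(d^2); the third condition says that the momentum gains the whole cost d on it; the last
    three discretise x' = -b z, y' = a z and z' = a (c x - y) + b (x - c y). *)
Definition step_est F B L gam (M : R) (ca cb : R -> R -> R) : Prop :=
  0 < M /\ forall s t, 0 <= s < t -> t <= L -> t - s <= 1 ->
  let d := t - s in let a := ca s t in let b := cb s t in
  kx F * Rabs a + ky F * Rabs b <= d + M * (d * d) /\
  mbd (msub (mmul (mtrans (gam s)) (gam t)) (madd mid3 (skew (fv F (a, b))))) (M * (d * d)) /\
  d - M * (d * d) <= a * lx F B gam s + b * ly F B gam s /\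
  Rabs (lx F B gam t - lx F B gam s + b * lz F B gam s) <= M * (d * d) /\
  Rabs (ly F B gam t - ly F B gam s - a * lz F B gam s) <= M * (d * d) /\
  Rabs (lz F B gam t - lz F B gam s - (a * (cc F * lx F B gam s - ly F B gam s)
        + b * (lx F B gam s - cc F * ly F B gam s))) <= M * (d * d).

Lemma skew_pair F l a b : gframe F ->
  dot (mv (skew (fv F (a, b))) l) (fX F) = b * dot l (fN F) /\
  dot (mv (skew (fv F (a, b))) l) (fY F) = - (a * dot l (fN F)) /\
  dot (mv (skew (fv F (a, b))) l) (fN F) =
    - (a * (cc F * dot l (fX F) - dot l (fY F)) + b * (dot l (fX F) - cc F * dot l (fY F))).
Proof.
  intros [H1 H2 _ _ _ _]. unfold cc, fN, fv, fvec; simpl. destruct (fX F) as [x1 x2 x3], (fY F) as [y1 y2 y3], l as [p q r].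
  unfold dot in *; simpl in *.
  assert (Hx : x3 * x3 = 1 - x1 * x1 - x2 * x2) by lra.
  assert (Hy : y3 * y3 = 1 - y1 * y1 - y2 * y2) by lra.
  repeat split; try ring. ring [Hx Hy].
Qed.

Lemma EC_step_est F B L gam : gframe F -> EC F B L gam -> exists M ca cb, step_est F B L gam M ca cb.
Proof.
  intros G H. destruct (mbd_exists B) as (r & Hr & Br).
  set (M1 := 144 * (DD F * DD F) + 1).
  assert (HM1 : 1 <= M1) by (unfold M1; pose proof (DD_pos F G); nra).
  assert (VB : exists p, 0 < p /\ Rabs (vx (vee B)) <= p /\ Rabs (vy (vee B)) <= p /\ Rabs (vz (vee B)) <= p).
  { exists (1 + Rabs (vx (vee B)) + Rabs (vy (vee B)) + Rabs (vz (vee B))).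
    pose proof (Rabs_pos (vx (vee B))); pose proof (Rabs_pos (vy (vee B))); pose proof (Rabs_pos (vz (vee B))).
    repeat split; lra. }
  destruct VB as (p & Hp & p1 & p2 & p3).
  set (M := 9 * (9 * r * M1) + 9 * (M1 * (3 * p) * 2) + M1).
  assert (HM : M1 <= M).
  { unfold M. assert (0 < r * M1) by nra. assert (0 < M1 * p) by nra. lra. }
  assert (C : forall s t, exists ab : R * R, 0 <= s < t -> t <= L -> t - s <= 1 ->
    let d := t - s in let a := fst ab in let b := snd ab in
    kx F * Rabs a + ky F * Rabs b <= d + M * (d * d) /\
    mbd (msub (mmul (mtrans (gam s)) (gam t)) (madd mid3 (skew (fv F (a, b))))) (M * (d * d)) /\
    d - M * (d * d) <= a * lx F B gam s + b * ly F B gam s /\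
    Rabs (lx F B gam t - lx F B gam s + b * lz F B gam s) <= M * (d * d) /\
    Rabs (ly F B gam t - ly F B gam s - a * lz F B gam s) <= M * (d * d) /\
    Rabs (lz F B gam t - lz F B gam s - (a * (cc F * lx F B gam s - ly F B gam s)
        + b * (lx F B gam s - cc F * ly F B gam s))) <= M * (d * d)).
  { intros s t. destruct (classic (0 <= s < t /\ t <= L /\ t - s <= 1)) as [(Hs & Ht & Hd)|Hn];
      [|exists (0, 0); intros; exfalso; apply Hn; auto].
    pose proof (ec_SO3 _ _ _ _ H s ltac:(lra)) as Ss.
    pose proof (ec_K _ _ _ _ H s t ltac:(lra) Ht) as Kst.
    destruct (K_near2 F _ _ G Kst ltac:(lra)) as (a & b & Hab & Hm).
    exists (a, b). intros _ _ _. set (d := t - s) in *. cbv zeta. simpl fst; simpl snd.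
    set (E := mmul (mtrans (gam s)) (gam t)) in *.
    fold M1 in Hm.
    assert (D2 : 0 <= d * d) by nra.
    assert (MD : M1 * (d * d) <= M * (d * d)) by (apply Rmult_le_compat_r; auto).
    assert (Lt : lam B gam t = mv (mtrans E) (lam B gam s)) by (apply lam_step; auto).
    set (l := lam B gam s) in *.
    assert (lbd : Rabs (vx l) <= 3 * (1 * p) /\ Rabs (vy l) <= 3 * (1 * p) /\ Rabs (vz l) <= 3 * (1 * p)).
    { unfold l, lam. apply Rabs_mv_le; auto. apply mbd_SO3, SO3_trans; auto. }
    rewrite Rmult_1_l in lbd. destruct lbd as (l1 & l2 & l3).
    set (S := skew (fv F (a, b))) in *.
    assert (Hm' : mbd (msub (mtrans E) (madd mid3 (mscale (-1) S))) (M1 * (d * d))).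
    { replace (msub (mtrans E) (madd mid3 (mscale (-1) S))) with (mtrans (msub E (madd mid3 S))).
      - apply mbd_trans; auto.
      - unfold S. generalize (fv F (a, b)) E. mring. }
    assert (LIN : forall v, Rabs (vx v) <= 2 -> Rabs (vy v) <= 2 -> Rabs (vz v) <= 2 ->
      Rabs (dot (mv (mtrans E) l) v - (dot l v - dot (mv S l) v)) <= M * (d * d)).
    { intros v v1 v2 v3.
      replace (dot (mv (mtrans E) l) v - (dot l v - dot (mv S l) v))
        with (dot (mv (msub (mtrans E) (madd mid3 (mscale (-1) S))) l) v)
        by (generalize S (mtrans E); intros; mring).
      eapply Rle_trans; [apply (dot_mv_bd _ _ _ _ (3 * p) 2 Hm'); auto|].
      unfold M. assert (0 <= r * M1 * (d * d)) by (apply Rmult_le_pos; nra).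
      assert (0 <= M1 * (d * d)) by nra. lra. }
    destruct (skew_pair F l a b G) as (SX & SY & SN). fold S in SX, SY, SN.
    destruct (unit_coord _ (gX F G)) as (x1 & x2 & x3).
    destruct (unit_coord _ (gY F G)) as (y1 & y2 & y3).
    destruct (N_coord F G) as (n1 & n2 & n3).
    split; [nra|]. split; [eapply mbd_le; eauto|]. split; [|split; [|split]].
    (* Deleting the arc, that is E = I, saves d; optimality bounds the saving by the loss in the
       trace, which is a x + b y to first order. *)
    - pose proof (ec_opt _ _ _ _ H s t mid3 0 ltac:(lra) Ht) as O.
      assert (K0 : K F mid3 0) by (apply (K_word F []); constructor). specialize (O K0).
      rewrite mmul_1l in O.
      set (Bs := mmul (mmul (mtrans (gam s)) B) (gam s)).
      assert (EB : mtr (mmul B (mmul (gam s) (mtrans (gam t)))) = mtr (mmul Bs (mtrans E))).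
      { unfold Bs, E. rewrite mtrans_mul, mtrans_inv.
        rewrite (mtr_mulC _ (mmul (mtrans (gam t)) (gam s))).
        rewrite !mmul_assoc, <- (mmul_assoc (gam s) (mtrans (gam s))), (SO3_rinv _ Ss), mmul_1l.
        rewrite <- mmul_assoc, (mtr_mulC (mmul B (gam s))). reflexivity. }
      rewrite EB in O.
      assert (BsB : mbd Bs (9 * r)).
      { unfold Bs. eapply mbd_le; [apply mbd_mul; [apply mbd_mul; [apply mbd_SO3, SO3_trans; eauto | exact Br] | apply mbd_SO3; exact Ss]|]. lra. }
      pose proof (mtr_mul_bd _ _ _ _ BsB Hm') as T.
      rewrite msub_tr, mmul_addr, mtr_add, mmul_1r, mmul_scaler, mtr_scale in T. unfold S in T.
      rewrite mtr_skew in T. unfold Bs in T at 2 3. rewrite (vee_conj _ _ Ss), (mtr_conj _ _ Ss) in T.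
      fold (lam B gam s) in T. fold l in T. rewrite dot_fv in T.
      match type of T with Rabs ?x <= _ => pose proof (Rle_abs (- x)) as Q'; rewrite Rabs_Ropp in Q' end.
      unfold lx, ly. fold l. fold d in O.
      assert (9 * (9 * r * (M1 * (d * d))) <= M * (d * d)).
      { unfold M. assert (0 <= M1 * p * (d * d)) by (apply Rmult_le_pos; nra). assert (0 <= M1 * (d * d)) by nra. lra. }
      lra.
    - unfold lx, lz. rewrite Lt. fold l. specialize (LIN (fX F) ltac:(lra) ltac:(lra) ltac:(lra)).
      rewrite SX in LIN. match goal with |- Rabs ?x <= _ => match type of LIN with Rabs ?y <= _ => replace x with y by ring end end. exact LIN.
    - unfold ly, lz. rewrite Lt. fold l. specialize (LIN (fY F) ltac:(lra) ltac:(lra) ltac:(lra)).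
      rewrite SY in LIN. match goal with |- Rabs ?x <= _ => match type of LIN with Rabs ?y <= _ => replace x with y by ring end end. exact LIN.
    - unfold lx, ly, lz. rewrite Lt. fold l. specialize (LIN (fN F) ltac:(lra) ltac:(lra) ltac:(lra)).
      rewrite SN in LIN. match goal with |- Rabs ?x <= _ => match type of LIN with Rabs ?y <= _ => replace x with y by ring end end. exact LIN. }
  exists M, (fun s t => fst (proj1_sig (constructive_indefinite_description _ (C s t)))),
    (fun s t => snd (proj1_sig (constructive_indefinite_description _ (C s t)))).
  split; [lra|]. intros s t Hs Ht Hd. cbv zeta.
  destruct (constructive_indefinite_description _ (C s t)) as [ab P]. simpl proj1_sig. apply P; auto.
Qed.

(** * Identification of arcs with rotations by polygonal approximation *)

Fixpoint rsum (f : nat -> R) (n : nat) : R :=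
  match n with O => 0 | S n => rsum f n + f n end.

Lemma rsum_le f g n : (forall i, (i < n)%nat -> f i <= g i) -> rsum f n <= rsum g n.
Proof.
  induction n; intros H; simpl; [lra|]. specialize (H n) as Hn. assert (f n <= g n) by (apply Hn; lia).
  assert (rsum f n <= rsum g n) by (apply IHn; intros; apply H; lia). lra.
Qed.
Lemma rsum_const k n : rsum (fun _ => k) n = INR n * k.
Proof. induction n; [simpl; ring|]. rewrite S_INR. simpl. rewrite IHn. ring. Qed.
Lemma rsum_add f g n : rsum (fun i => f i + g i) n = rsum f n + rsum g n.
Proof. induction n; simpl; [ring | rewrite IHn; ring]. Qed.
Lemma rsum_scal k f n : rsum (fun i => k * f i) n = k * rsum f n.
Proof. induction n; simpl; [ring | rewrite IHn; ring]. Qed.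
Lemma rsum_tele f n : rsum (fun i => f (S i) - f i) n = f n - f O.
Proof. induction n; simpl; [ring | rewrite IHn; ring]. Qed.

Definition sig (s0 s1 : R) (m j : nat) : R := s0 + INR j * ((s1 - s0) / INR m).

Lemma sig_0 s0 s1 m : sig s0 s1 m 0 = s0.
Proof. unfold sig; simpl; ring. Qed.
Lemma sig_m s0 s1 m : (0 < m)%nat -> sig s0 s1 m m = s1.
Proof. intros H. unfold sig. field. apply Rgt_not_eq, lt_0_INR; auto. Qed.
Lemma sig_S s0 s1 m j : sig s0 s1 m (S j) = sig s0 s1 m j + (s1 - s0) / INR m.
Proof. unfold sig. rewrite S_INR. ring. Qed.
Lemma sig_bounds s0 s1 m j : s0 <= s1 -> (j <= m)%nat -> (0 < m)%nat ->
  s0 <= sig s0 s1 m j <= s1.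
Proof.
  intros H Hj Hm. pose proof (lt_0_INR m Hm) as P.
  assert (0 <= (s1 - s0) / INR m) by (apply Rmult_le_pos; [lra | left; apply Rinv_0_lt_compat; auto]).
  pose proof (pos_INR j). apply le_INR in Hj.
  assert (Q : INR j * ((s1 - s0) / INR m) <= INR m * ((s1 - s0) / INR m)) by (apply Rmult_le_compat_r; auto).
  replace (INR m * ((s1 - s0) / INR m)) with (s1 - s0) in Q by (field; lra).
  assert (0 <= INR j * ((s1 - s0) / INR m)) by (apply Rmult_le_pos; auto). unfold sig. lra.
Qed.

(** If on grids of m steps the increments differ from those of the constant direction (p, q) by
    O(1/m) in total, the arc is exactly that rotation: the global error is the sum of the local
    ones, because left and right factors in SO(3) do not amplify it beyond a constant. *)
Lemma euler_run F gam L s0 s1 p q M : gframe F ->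
  (forall s, 0 <= s <= L -> inSO3 (gam s)) -> 0 <= s0 < s1 -> s1 <= L -> 0 <= M ->
  (exists N0, forall m, (N0 <= m)%nat -> (0 < m)%nat -> exists al be : nat -> R,
     (forall j, (j < m)%nat ->
        mbd (msub (mmul (mtrans (gam (sig s0 s1 m j))) (gam (sig s0 s1 m (S j))))
                  (madd mid3 (skew (fv F (al j, be j)))))
            (M * ((s1 - s0) / INR m * ((s1 - s0) / INR m)))) /\
     rsum (fun j => Rabs (al j - p * ((s1 - s0) / INR m)) + Rabs (be j - q * ((s1 - s0) / INR m))) m <= M / INR m) ->
  mmul (mtrans (gam s0)) (gam s1) = rot (s1 - s0) (fv F (p, q)).
Proof.
  intros G HS Hs Hs1 HM (N0 & H). apply msub_0. intros e He.
  set (C := fv F (p, q)). set (n := vnorm C). set (T := s1 - s0) in *.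
  set (K0 := 9 * (M * (T * T) + M + 4 * (n * n) * (T * T))).
  assert (n0 : 0 <= n) by apply vnorm_ge0.
  assert (K0p : 0 <= K0) by (unfold K0; assert (0 <= T * T) by nra; assert (0 <= n * n) by nra; nra).
  destruct (archi (e / (K0 + 1))) as [N1 HN1]. { apply Rdiv_lt_0_compat; lra. }
  set (m := (S (N0 + N1))). assert (Hm : (0 < m)%nat) by lia.
  destruct (H m ltac:(lia) Hm) as (al & be & Hst & Hsum).
  pose proof (lt_0_INR m Hm) as Pm.
  set (d := T / INR m) in *.
  assert (d0 : 0 < d) by (apply Rdiv_lt_0_compat; unfold T; lra).
  (* Follow the curve up to the j-th grid point and the constant rotation from there on; [u 0] is
     the rotation and [u m] the arc. *)
  set (u := fun j => mmul (mmul (mtrans (gam s0)) (gam (sig s0 s1 m j))) (rot ((INR m - INR j) * d) C)).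
  set (dj := fun j => 9 * (M * (d * d) + (Rabs (al j - p * d) + Rabs (be j - q * d)) + 4 * ((d * n) * (d * n)))).
  assert (SS : forall j, (j <= m)%nat -> inSO3 (gam (sig s0 s1 m j))).
  { intros j Hj. apply HS. pose proof (sig_bounds s0 s1 m j ltac:(lra) Hj Hm). lra. }
  assert (S0 : inSO3 (gam s0)) by (apply HS; lra).
  assert (ST : forall j, (j <= m)%nat -> mbd (msub (u j) (u O)) (rsum dj j)).
  { induction j as [|j IH]; intros Hj.
    - rewrite msub_self. apply mbd_0; simpl; lra.
    - rewrite (msub_trans _ (u j)). simpl rsum. rewrite Rplus_comm. apply mbd_add; [|apply IH; lia].
      pose proof (SS j ltac:(lia)) as Sj.
      set (E := mmul (mtrans (gam (sig s0 s1 m j))) (gam (sig s0 s1 m (S j)))).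
      assert (U1 : u (S j) = mmul (mmul (mmul (mtrans (gam s0)) (gam (sig s0 s1 m j))) E) (rot ((INR m - INR (S j)) * d) C)).
      { unfold u, E. f_equal. rewrite !mmul_assoc, <- (mmul_assoc (gam (sig s0 s1 m j))), (SO3_rinv _ Sj), mmul_1l. reflexivity. }
      assert (U0 : u j = mmul (mmul (mmul (mtrans (gam s0)) (gam (sig s0 s1 m j))) (rot d C)) (rot ((INR m - INR (S j)) * d) C)).
      { unfold u. rewrite (mmul_assoc _ (rot d C)), <- rot_add. do 2 f_equal. rewrite S_INR. ring. }
      rewrite U1, U0.
      set (P := mmul (mtrans (gam s0)) (gam (sig s0 s1 m j))). set (Q := rot ((INR m - INR (S j)) * d) C).
      replace (msub (mmul (mmul P E) Q) (mmul (mmul P (rot d C)) Q)) with (mmul (mmul P (msub E (rot d C))) Q)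
        by (generalize P Q E (rot d C); clear; mring).
      assert (SP : mbd P 1) by (apply mbd_SO3, SO3_mul; [apply SO3_trans; auto | auto]).
      assert (SQ : mbd Q 1) by (apply mbd_SO3, rot_SO3).
      assert (ER : mbd (msub E (rot d C)) (M * (d * d) + (Rabs (al j - p * d) + Rabs (be j - q * d)) + 4 * ((d * n) * (d * n)))).
      { replace (msub E (rot d C)) with
          (madd (madd (msub E (madd mid3 (skew (fv F (al j, be j)))))
                      (skew (fv F (al j - p * d, be j - q * d))))
                (msub (madd mid3 (mscale d (skew C))) (rot d C))).
        - apply mbd_add; [apply mbd_add|].
          + apply Hst; lia.
          + apply mbd_skew_fv; auto.
          + apply msub_opp. apply rot_near2; lra.
        - replace (skew (fv F (al j - p * d, be j - q * d))) with (msub (skew (fv F (al j, be j))) (mscale d (skew C))).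
          + generalize E (skew (fv F (al j, be j))) (mscale d (skew C)) (rot d C). clear. mring.
          + unfold C, fv, fvec; simpl. generalize (fX F) (fY F) (al j) (be j) d p q. clear. mring. }
      eapply mbd_le; [apply mbd_mul; [apply mbd_mul; [exact SP | exact ER] | exact SQ]|].
      unfold dj. lra. }
  specialize (ST m (le_n m)).
  assert (UM : u m = mmul (mtrans (gam s0)) (gam s1)).
  { unfold u. rewrite sig_m by auto. replace ((INR m - INR m) * d) with 0 by ring. rewrite rot_0, mmul_1r. reflexivity. }
  assert (U0 : u O = rot T C).
  { unfold u. rewrite sig_0, (SO3_linv _ S0), mmul_1l. f_equal. unfold d. change (INR 0) with 0. field. lra. }
  rewrite UM, U0 in ST. eapply mbd_le; [exact ST|].
  apply Rle_trans with (K0 / INR m).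
  - unfold dj. rewrite rsum_scal.
    assert (E1 : rsum (fun i => M * (d * d) + (Rabs (al i - p * d) + Rabs (be i - q * d)) + 4 * (d * n * (d * n))) m
      = INR m * (M * (d * d)) + rsum (fun j => Rabs (al j - p * d) + Rabs (be j - q * d)) m + INR m * (4 * (d * n * (d * n)))).
    { rewrite rsum_add, rsum_add, !rsum_const. reflexivity. }
    rewrite E1.
    replace (K0 / INR m) with (9 * (INR m * (M * (d * d)) + M / INR m + INR m * (4 * (d * n * (d * n)))))
      by (unfold K0, d; field; lra). lra.
  - specialize (HN1 (N0 + N1)%nat ltac:(lia)).
    assert (E : INR m = INR (N0 + N1) + 1) by (unfold m; apply S_INR). rewrite <- E in HN1.
    apply Rle_trans with (K0 * (e / (K0 + 1))).
    + apply Rmult_le_compat_l; auto.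
    + apply Rmult_le_reg_r with (K0 + 1); [lra|].
      replace (K0 * (e / (K0 + 1)) * (K0 + 1)) with (K0 * e) by (field; lra). lra.
Qed.

(** It suffices to control b. As 0 <= x <= kx, the increment can earn its full cost only if kx a = d
    up to O(d^2) + O(|b|); a negative a would earn nothing. *)
Lemma X_run F B L gam M ca cb s0 s1 C0 N0 : gframe F -> EC F B L gam -> step_est F B L gam M ca cb ->
  0 <= s0 < s1 -> s1 <= L -> (forall s, s0 <= s <= s1 -> 0 <= lx F B gam s) -> 0 <= C0 ->
  (forall m, (N0 <= m)%nat -> (0 < m)%nat -> (s1 - s0) / INR m <= 1 ->
     rsum (fun j => Rabs (cb (sig s0 s1 m j) (sig s0 s1 m (S j)))) m <= C0 / INR m) ->
  mmul (mtrans (gam s0)) (gam s1) = rot ((s1 - s0) / kx F) (fX F).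
Proof.
  intros G H (HM & HS) Hs Hs1 Hx HC Hb. pose proof (gkx F G) as Kx. pose proof (gky F G) as Ky.
  set (T := s1 - s0).
  set (M' := (4 * M * (T * T) + 3 * ky F * C0) / kx F + C0 + M).
  assert (T2 : 0 <= T * T) by (unfold T; nra).
  assert (A1 : 0 <= (4 * M * (T * T) + 3 * ky F * C0) / kx F).
  { apply Rmult_le_pos; [|left; apply Rinv_0_lt_compat; auto]. assert (0 <= M * (T * T)) by nra.
    assert (0 <= ky F * C0) by nra. lra. }
  assert (E : fX F = vscale (kx F) (fv F (/ kx F, 0))).
  { unfold fv, fvec; simpl. destruct (fX F), (fY F); unfold vscale, vadd; simpl; f_equal; field; lra. }
  rewrite E. rewrite rot_vscale by auto. replace (T / kx F * kx F) with T by (field; lra).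
  apply (euler_run F gam L s0 s1 (/ kx F) 0 M'); auto; try lra.
  { intros; apply (ec_SO3 _ _ _ _ H); auto. }
  { unfold M'; lra. }
  destruct (archi (/ (T + 1))) as [N1 HN1]. { apply Rinv_0_lt_compat; unfold T; lra. }
  exists (S (N0 + N1)). intros m Hm Hm0. pose proof (lt_0_INR m Hm0) as Pm.
  fold T. set (d := T / INR m).
  assert (d0 : 0 < d) by (apply Rdiv_lt_0_compat; unfold T; lra).
  assert (d1 : d <= 1).
  { specialize (HN1 (m - 1)%nat ltac:(lia)). rewrite minus_INR in HN1 by lia. simpl (INR 1) in HN1.
    replace (INR m - 1 + 1) with (INR m) in HN1 by ring.
    unfold d, Rdiv. apply Rle_trans with (T * / (T + 1)); [apply Rmult_le_compat_l; unfold T in *; lra|].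
    apply Rmult_le_reg_r with (T + 1); [unfold T in *; lra|]. rewrite Rmult_assoc, Rinv_l by (unfold T in *; lra). lra. }
  exists (fun j => ca (sig s0 s1 m j) (sig s0 s1 m (S j))), (fun j => cb (sig s0 s1 m j) (sig s0 s1 m (S j))).
  assert (ST : forall j, (j < m)%nat -> let s := sig s0 s1 m j in let t := sig s0 s1 m (S j) in
     s0 <= s <= s1 /\ 0 <= s < t /\ t <= L /\ t - s = d).
  { intros j Hj s t. pose proof (sig_bounds s0 s1 m j ltac:(lra) ltac:(lia) Hm0).
    pose proof (sig_bounds s0 s1 m (S j) ltac:(lra) ltac:(lia) Hm0).
    assert (t = s + d) by apply sig_S. fold s in H0. fold t in H1. repeat split; lra. }
  assert (MM : M <= M') by (unfold M'; lra).
  split.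
  - intros j Hj. destruct (ST j Hj) as (B0 & B1 & B2 & B3).
    destruct (HS _ _ B1 B2 ltac:(rewrite B3; auto)) as (_ & Q & _). rewrite B3 in Q.
    eapply mbd_le; [exact Q|]. apply Rmult_le_compat_r; nra.
  - specialize (Hb m ltac:(lia) Hm0 d1).
    apply Rle_trans with (rsum (fun j => (4 * M * (d * d)) / kx F + (3 * ky F / kx F + 1) * Rabs (cb (sig s0 s1 m j) (sig s0 s1 m (S j)))) m).
    + apply rsum_le. intros j Hj. destruct (ST j Hj) as (B0 & B1 & B2 & B3).
      destruct (HS _ _ B1 B2 ltac:(rewrite B3; auto)) as (Q1 & _ & Q2 & _). rewrite B3 in Q1, Q2.
      set (a := ca _ _) in *. set (b := cb _ _) in *.
      rewrite Rmult_0_l, Rminus_0_r. specialize (Hx _ B0).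
      pose proof (lx_bd F B L gam _ H (conj (Rle_trans _ _ _ (proj1 Hs) (proj1 B0)) (Rle_trans _ _ _ (proj2 B0) Hs1))) as Lx.
      pose proof (ly_bd F B L gam _ H (conj (Rle_trans _ _ _ (proj1 Hs) (proj1 B0)) (Rle_trans _ _ _ (proj2 B0) Hs1))) as Ly.
      set (x := lx F B gam _) in *. set (y := ly F B gam _) in *.
      rewrite (Rabs_right x) in Lx by lra.
      assert (BY : b * y <= ky F * Rabs b).
      { apply Rle_trans with (Rabs (b * y)); [apply Rle_abs|]. rewrite Rabs_mult, Rmult_comm.
        apply Rmult_le_compat_r; auto using Rabs_pos. }
      assert (KA : kx F * Rabs (a - / kx F * d) <= 4 * M * (d * d) + 3 * ky F * Rabs b).
      { assert (KD : kx F * (a - / kx F * d) = kx F * a - d) by (field; lra).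
        assert (KA : kx F * Rabs (a - / kx F * d) = Rabs (kx F * a - d)).
        { rewrite <- KD, Rabs_mult, (Rabs_right (kx F)); lra. }
        rewrite KA. pose proof (Rabs_pos b). pose proof (Rabs_pos a). assert (0 <= ky F * Rabs b) by nra.
        assert (d2 : 0 <= d * d) by nra. assert (0 <= M * (d * d)) by nra.
        destruct (Rle_dec 0 a) as [Ha|Ha].
        - rewrite (Rabs_right a) in Q1 by lra. assert (a * x <= a * kx F) by nra. apply Rabs_le; lra.
        - rewrite (Rabs_left a) in Q1 by lra. assert (a * x <= 0) by nra. assert (kx F * a <= 0) by nra. apply Rabs_le; lra. }
      apply Rmult_le_reg_l with (kx F); auto.
      replace (kx F * (4 * M * (d * d) / kx F + (3 * ky F / kx F + 1) * Rabs b)) with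
        (4 * M * (d * d) + 3 * ky F * Rabs b + kx F * Rabs b) by (field; lra). lra.
    + rewrite rsum_add, rsum_const, rsum_scal.
      apply Rle_trans with (INR m * (4 * M * (d * d) / kx F) + (3 * ky F / kx F + 1) * (C0 / INR m)).
      * apply Rplus_le_compat_l, Rmult_le_compat_l; auto.
        assert (0 <= 3 * ky F / kx F) by (apply Rmult_le_pos; [lra | left; apply Rinv_0_lt_compat; auto]). lra.
      * replace (INR m * (4 * M * (d * d) / kx F) + (3 * ky F / kx F + 1) * (C0 / INR m)) with
          ((M' - M) / INR m) by (unfold M', d; field; split; lra).
        apply Rmult_le_compat_r; [left; apply Rinv_0_lt_compat; auto | lra].
Qed.

Lemma EC_lip F B L gam : gframe F -> EC F B L gam -> exists La, 0 < La /\
  forall s t, 0 <= s <= L -> 0 <= t <= L ->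
    Rabs (lx F B gam t - lx F B gam s) <= La * Rabs (t - s) /\
    Rabs (ly F B gam t - ly F B gam s) <= La * Rabs (t - s) /\
    Rabs (lz F B gam t - lz F B gam s) <= La * Rabs (t - s) /\
    mbd (msub (gam t) (gam s)) (La * Rabs (t - s)).
Proof.
  intros G H. set (A := 24 * DD F + 1). assert (A0 : 0 < A) by (unfold A; pose proof (DD_pos F G); lra).
  set (p := 1 + Rabs (vx (vee B)) + Rabs (vy (vee B)) + Rabs (vz (vee B))).
  pose proof (Rabs_pos (vx (vee B))) as q1; pose proof (Rabs_pos (vy (vee B))) as q2; pose proof (Rabs_pos (vz (vee B))) as q3.
  set (La := 9 * (A * (3 * p) * 2) + 3 * A).
  assert (Lp : 0 < La) by (unfold La; assert (0 < A * p) by (unfold p; nra); lra).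
  assert (ORD : forall s t, 0 <= s <= L -> 0 <= t <= L -> s < t ->
    Rabs (lx F B gam t - lx F B gam s) <= La * Rabs (t - s) /\
    Rabs (ly F B gam t - ly F B gam s) <= La * Rabs (t - s) /\
    Rabs (lz F B gam t - lz F B gam s) <= La * Rabs (t - s) /\
    mbd (msub (gam t) (gam s)) (La * Rabs (t - s))).
  { intros s t Hs Ht Hst. rewrite (Rabs_right (t - s)) by lra. set (d := t - s).
    assert (d0 : 0 < d) by (unfold d; lra).
    pose proof (ec_SO3 _ _ _ _ H s ltac:(lra)) as Ss.
    pose proof (ec_K _ _ _ _ H s t ltac:(lra) ltac:(lra)) as Kst.
    pose proof (K_near1 F _ _ G Kst d0) as N. fold A in N. fold d in N.
    set (E := mmul (mtrans (gam s)) (gam t)) in *.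
    assert (Lt : lam B gam t = mv (mtrans E) (lam B gam s)) by (apply lam_step; auto).
    set (l := lam B gam s) in *.
    assert (lbd : Rabs (vx l) <= 3 * (1 * p) /\ Rabs (vy l) <= 3 * (1 * p) /\ Rabs (vz l) <= 3 * (1 * p)).
    { unfold l, lam. apply Rabs_mv_le; try (unfold p; lra). apply mbd_SO3, SO3_trans; auto. }
    rewrite Rmult_1_l in lbd. destruct lbd as (l1 & l2 & l3).
    assert (LIN : forall v, Rabs (vx v) <= 2 -> Rabs (vy v) <= 2 -> Rabs (vz v) <= 2 ->
      Rabs (dot (mv (mtrans E) l) v - dot l v) <= La * d).
    { intros v v1 v2 v3.
      replace (dot (mv (mtrans E) l) v - dot l v) with (dot (mv (mtrans (msub E mid3)) l) v)
        by (generalize E; intros; mring).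
      eapply Rle_trans; [apply (dot_mv_bd _ _ _ _ (3 * p) 2 (mbd_trans _ _ N)); auto|].
      unfold La. assert (0 <= A * d) by nra. lra. }
    destruct (unit_coord _ (gX F G)) as (x1 & x2 & x3).
    destruct (unit_coord _ (gY F G)) as (y1 & y2 & y3).
    destruct (N_coord F G) as (n1 & n2 & n3).
    unfold lx, ly, lz. rewrite Lt. fold l.
    repeat (split; [apply LIN; lra|]).
    replace (msub (gam t) (gam s)) with (mmul (gam s) (msub E mid3)).
    - eapply mbd_le; [apply mbd_mul; [apply mbd_SO3, Ss | exact N]|]. unfold La.
      assert (0 <= A * p * d) by (apply Rmult_le_pos; unfold p; nra). lra.
    - transitivity (msub (mmul (gam s) E) (gam s)); [generalize (gam s) E; clear; mring|].
      f_equal. unfold E. rewrite <- mmul_assoc, (SO3_rinv _ Ss), mmul_1l. reflexivity. }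
  exists La. split; auto. intros s t Hs Ht. destruct (Rtotal_order s t) as [h|[->|h]].
  - apply ORD; auto.
  - rewrite !Rminus_diag, Rabs_R0, Rmult_0_r. rewrite msub_self. repeat (split; [lra|]). apply mbd_0; lra.
  - destruct (ORD t s Ht Hs h) as (P1 & P2 & P3 & P4). rewrite Rabs_minus_sym in P1, P2, P3.
    rewrite (Rabs_minus_sym t s). repeat (split; [assumption|]). apply msub_opp; auto.
Qed.

Lemma lip_gap f a b La k : a <= b -> 0 < La ->
  (forall s t, a <= s <= b -> a <= t <= b -> Rabs (f t - f s) <= La * Rabs (t - s)) ->
  (forall s, a <= s <= b -> f s < k) -> exists eta, 0 < eta /\ forall s, a <= s <= b -> f s <= k - eta.
Proof.
  intros Hab HL Hf Hk. apply NNPP; intros Hn.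
  assert (C : forall n : nat, exists x, a <= x <= b /\ k - / (INR n + 1) < f x).
  { intros n. apply NNPP; intros Hc. apply Hn. exists (/ (INR n + 1)). split; [apply inv_INR_pos|].
    intros s Hs. apply Rnot_lt_le; intros ?. apply Hc. exists s; auto. }
  set (x := fun n => proj1_sig (constructive_indefinite_description _ (C n))).
  assert (X : forall n, a <= x n <= b /\ k - / (INR n + 1) < f (x n)).
  { intros n. unfold x. destruct constructive_indefinite_description; auto. }
  clearbody x. clear C.
  destruct (bounded_subseq x (Rabs a + Rabs b)) as (phi & l & P & T).
  { intros n. destruct (X n) as [X1 _]. pose proof (Rle_abs a); pose proof (Rle_abs b).
    pose proof (Rle_abs (- a)); pose proof (Rle_abs (-b)). rewrite Rabs_Ropp in *. apply Rabs_le.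
    pose proof (Rabs_pos a); pose proof (Rabs_pos b). lra. }
  assert (Hl : a <= l <= b).
  { split; apply (le_eps _ _ 1); try lra; intros e He; destruct (T e ltac:(lra)) as [N HN];
    specialize (HN N (le_n N)); destruct (X (phi N)) as [X1 _].
    - pose proof (Rle_abs (x (phi N) - l)). lra.
    - pose proof (Rle_abs (- (x (phi N) - l))). rewrite Rabs_Ropp in H. lra. }
  specialize (Hk l Hl). assert (k <= f l); [|lra].
  apply (le_eps _ _ (La + 1)); [lra|]. intros e He. destruct (T e ltac:(lra)) as [N HN].
  destruct (archi e ltac:(lra)) as [N2 HN2].
  set (n := (N + N2)%nat). specialize (HN n ltac:(lia)).
  specialize (HN2 (phi n) ltac:(specialize (P n); lia)).
  destruct (X (phi n)) as [X1 X2]. specialize (Hf l (x (phi n)) Hl X1).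
  pose proof (Rle_abs (f (x (phi n)) - f l)).
  assert (La * Rabs (x (phi n) - l) <= La * e) by (apply Rmult_le_compat_l; lra). lra.
Qed.

(** With |y| <= ky - eta, motion along Y earns eta less per unit than it costs, so eta |b| <= 2 M
    d^2 on each step. *)
Lemma edge_run F B L gam s0 s1 : gframe F -> EC F B L gam -> 0 <= s0 < s1 -> s1 <= L ->
  (forall s, s0 <= s <= s1 -> 0 <= lx F B gam s) ->
  (forall s, s0 <= s <= s1 -> Rabs (ly F B gam s) < ky F) ->
  mmul (mtrans (gam s0)) (gam s1) = rot ((s1 - s0) / kx F) (fX F).
Proof.
  intros G H Hs Hs1 Hx Hy. destruct (EC_step_est F B L gam G H) as (M & ca & cb & SE).
  destruct (EC_lip F B L gam G H) as (La & HL & Lip).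
  destruct (lip_gap (fun s => Rabs (ly F B gam s)) s0 s1 La (ky F)) as (eta & He & Hg); auto; try lra.
  { intros s t Hs' Ht'. eapply Rle_trans; [apply Rabs_triang_inv2 | apply Lip; lra]. }
  pose proof SE as (HM & HS).
  pose proof (gkx F G) as Kx. pose proof (gky F G) as Ky.
  set (C0 := 2 * M / eta * ((s1 - s0) * (s1 - s0))).
  assert (CM : 0 < 2 * M / eta) by (apply Rdiv_lt_0_compat; lra).
  apply (X_run F B L gam M ca cb s0 s1 C0 0%nat); auto.
  { unfold C0. apply Rmult_le_pos; nra. }
  intros m _ Hm Hd. pose proof (lt_0_INR m Hm) as Pm.
  set (d := (s1 - s0) / INR m) in *. assert (d0 : 0 < d) by (apply Rdiv_lt_0_compat; lra).
  apply Rle_trans with (rsum (fun _ => 2 * M / eta * (d * d)) m).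
  - apply rsum_le. intros j Hj.
    pose proof (sig_bounds s0 s1 m j ltac:(lra) ltac:(lia) Hm) as Bj.
    pose proof (sig_bounds s0 s1 m (S j) ltac:(lra) ltac:(lia) Hm) as BSj.
    pose proof (sig_S s0 s1 m j) as SSj. fold d in SSj.
    destruct (HS (sig s0 s1 m j) (sig s0 s1 m (S j))) as (Q1 & _ & Q2 & _); try lra.
    replace (sig s0 s1 m (S j) - sig s0 s1 m j) with d in Q1, Q2 by lra.
    set (a := ca _ _) in *. set (b := cb _ _) in *.
    specialize (Hg _ Bj). simpl in Hg.
    pose proof (lx_bd F B L gam (sig s0 s1 m j) H ltac:(lra)) as Lx.
    set (x := lx F B gam _) in *. set (y := ly F B gam _) in *.
    assert (a * x <= kx F * Rabs a).
    { apply Rle_trans with (Rabs (a * x)); [apply Rle_abs|]. rewrite Rabs_mult, Rmult_comm.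
      apply Rmult_le_compat_r; auto using Rabs_pos. }
    assert (b * y <= (ky F - eta) * Rabs b).
    { apply Rle_trans with (Rabs (b * y)); [apply Rle_abs|]. rewrite Rabs_mult, Rmult_comm.
      apply Rmult_le_compat_r; auto using Rabs_pos. }
    apply Rmult_le_reg_l with eta; auto.
    replace (eta * (2 * M / eta * (d * d))) with (2 * M * (d * d)) by (field; lra). lra.
  - rewrite rsum_const. apply Req_le. unfold C0, d. field. split; lra.
Qed.

(* The bound [x <= kx] keeps the curve from using [Y] next to a corner with [z < 0]. *)
Lemma corner_run F B L gam s0 : gframe F -> EC F B L gam -> 0 <= s0 <= L ->
  lx F B gam s0 = kx F -> ly F B gam s0 = ky F -> lz F B gam s0 < 0 ->
  exists dl, 0 < dl /\ forall s1, s0 < s1 <= s0 + dl -> s1 <= L ->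
  mmul (mtrans (gam s0)) (gam s1) = rot ((s1 - s0) / kx F) (fX F).
Proof.
  intros G H Hs0 X0 Y0 Z0. destruct (EC_step_est F B L gam G H) as (M & ca & cb & SE).
  destruct (EC_lip F B L gam G H) as (La & HL & Lip).
  pose proof (gkx F G) as Kx. pose proof (gky F G) as Ky. pose proof SE as (HM & HS).
  set (zeta := - lz F B gam s0 / 2). assert (Hz : 0 < zeta) by (unfold zeta; lra).
  set (dl := Rmin (Rmin (kx F / 2) (ky F / 2)) zeta / La).
  assert (Hdl : 0 < dl) by (apply Rdiv_lt_0_compat; auto; repeat apply Rmin_pos; lra).
  exists dl. split; auto. intros s1 Hs1 HL1.
  assert (Dl : La * dl = Rmin (Rmin (kx F / 2) (ky F / 2)) zeta) by (unfold dl; field; lra).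
  pose proof (Rmin_l (Rmin (kx F / 2) (ky F / 2)) zeta) as m1. pose proof (Rmin_r (Rmin (kx F / 2) (ky F / 2)) zeta) as m2.
  pose proof (Rmin_l (kx F / 2) (ky F / 2)) as m3. pose proof (Rmin_r (kx F / 2) (ky F / 2)) as m4.
  assert (NB : forall s, s0 <= s <= s1 -> kx F / 2 <= lx F B gam s /\ ky F / 2 <= ly F B gam s /\
     -3 * zeta <= lz F B gam s <= - zeta).
  { intros s Hs. destruct (Lip s0 s ltac:(lra) ltac:(lra)) as (L1 & L2 & L3 & _).
    assert (La * Rabs (s - s0) <= La * dl) by (apply Rmult_le_compat_l; [lra|rewrite Rabs_right; lra]).
    pose proof (Rle_abs (-(lx F B gam s - lx F B gam s0))) as e1.
    pose proof (Rle_abs (-(ly F B gam s - ly F B gam s0))) as e2.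
    pose proof (Rle_abs (-(lz F B gam s - lz F B gam s0))) as e3.
    pose proof (Rle_abs (lz F B gam s - lz F B gam s0)) as e4.
    rewrite Rabs_Ropp in e1, e2, e3. unfold zeta in *. lra. }
  set (Cb := 2 * M / ky F). assert (HCb : 0 < Cb) by (apply Rdiv_lt_0_compat; lra).
  set (C2 := M + 4 * zeta * Cb).
  set (T := s1 - s0).
  set (C0 := C2 * (T * T) / zeta).
  assert (HC2 : 0 < C2) by (unfold C2; nra).
  apply (X_run F B L gam M ca cb s0 s1 C0 0%nat); auto; try lra.
  { intros s Hs. destruct (NB s Hs). lra. }
  { unfold C0. assert (0 <= T * T) by nra. apply Rmult_le_pos; [nra | left; apply Rinv_0_lt_compat; auto]. }
  intros m _ Hm Hd. pose proof (lt_0_INR m Hm) as Pm. fold T in Hd.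
  set (d := T / INR m) in *. assert (d0 : 0 < d) by (apply Rdiv_lt_0_compat; unfold T; lra).
  apply Rmult_le_reg_l with zeta; auto. rewrite <- rsum_scal.
  (* Because x' = -b z with z <= - zeta, every step with b > 0 raises x by about zeta b at least.
     These increments telescope to x(s1) - kx <= 0. Steps with b < 0 are O(d^2) by themselves, since
     y > 0. *)
  apply Rle_trans with (rsum (fun j => (lx F B gam (sig s0 s1 m (S j)) - lx F B gam (sig s0 s1 m j)) + C2 * (d * d)) m).
  - apply rsum_le. intros j Hj.
    pose proof (sig_bounds s0 s1 m j ltac:(lra) ltac:(lia) Hm) as Bj.
    pose proof (sig_bounds s0 s1 m (S j) ltac:(lra) ltac:(lia) Hm) as BSj.
    pose proof (sig_S s0 s1 m j) as SSj. fold T in SSj. fold d in SSj.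
    destruct (HS (sig s0 s1 m j) (sig s0 s1 m (S j))) as (Q1 & _ & Q2 & Q3 & _); try lra.
    replace (sig s0 s1 m (S j) - sig s0 s1 m j) with d in Q1, Q2, Q3 by lra.
    set (a := ca _ _) in *. set (b := cb _ _) in *.
    destruct (NB _ Bj) as (N1 & N2 & N3).
    pose proof (lx_bd F B L gam (sig s0 s1 m j) H ltac:(lra)) as Lx.
    set (x := lx F B gam (sig s0 s1 m j)) in *. set (y := ly F B gam (sig s0 s1 m j)) in *.
    set (z := lz F B gam (sig s0 s1 m j)) in *. set (x' := lx F B gam (sig s0 s1 m (S j))) in *.
    assert (AX : a * x <= kx F * Rabs a).
    { apply Rle_trans with (Rabs (a * x)); [apply Rle_abs|]. rewrite Rabs_mult, Rmult_comm.
      apply Rmult_le_compat_r; auto using Rabs_pos. }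
    pose proof (Rle_abs (- (x' - x + b * z))) as q1. rewrite Rabs_Ropp in q1.
    assert (d2 : 0 < d * d) by nra.
    assert (SB : b < 0 -> Rabs b <= Cb * (d * d)).
    { intros hb. rewrite (Rabs_left b) in * by auto. assert (b * y <= b * (ky F / 2)) by nra.
      apply Rmult_le_reg_l with (ky F); auto.
      replace (ky F * (Cb * (d * d))) with (2 * M * (d * d)) by (unfold Cb; field; lra). assert (0 < M * (d * d)) by nra. lra. }
    destruct (Rle_dec 0 b) as [hb|hb].
    + rewrite (Rabs_right b) by lra. assert (b * z <= b * - zeta) by nra. unfold C2.
      assert (0 <= 4 * zeta * Cb * (d * d)) by (apply Rmult_le_pos; nra). lra.
    + specialize (SB ltac:(lra)).
      assert (b * z <= Rabs b * (3 * zeta)) by (rewrite (Rabs_left b) by lra; nra).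
      assert (zeta * Rabs b <= zeta * (Cb * (d * d))) by (apply Rmult_le_compat_l; lra).
      unfold C2. lra.
  - rewrite rsum_add, rsum_const.
    rewrite (rsum_tele (fun j => lx F B gam (sig s0 s1 m j))). rewrite sig_m, sig_0 by auto.
    pose proof (lx_bd F B L gam s1 H ltac:(lra)) as Lx1. pose proof (Rle_abs (lx F B gam s1)).
    replace (zeta * (C0 / INR m)) with (INR m * (C2 * (d * d))) by (unfold C0, d; field; lra). lra.
Qed.

(** At rest in the corner the direction solves two linear equations: a kx + b ky = d from the cost,
    and b u = a v from z' = 0. Their determinant [w] is positive and equals the unit cost of W_-,
    whose coefficients are (u, v). *)
Lemma W_run F B L gam s0 s1 : gframe F -> EC F B L gam -> 0 <= s0 < s1 -> s1 <= L ->
  (forall s, s0 <= s <= s1 -> lx F B gam s = kx F /\ ly F B gam s = ky F /\ lz F B gam s = 0) ->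
  Wd F (mmul (mtrans (gam s0)) (gam s1)) (s1 - s0).
Proof.
  intros G H Hs Hs1 HQ. destruct (EC_step_est F B L gam G H) as (M & ca & cb & (HM & HS)).
  pose proof (gkx F G) as Kx. pose proof (gky F G) as Ky.
  set (u := kx F - ky F * cc F). set (v := ky F - kx F * cc F).
  assert (Hu : 0 < u).
  { unfold u. pose proof (gcy F G). pose proof (Rle_abs (cc F)). nra. }
  assert (Hv : 0 < v).
  { unfold v. pose proof (gcx F G). pose proof (Rle_abs (cc F)). nra. }
  set (w := u * kx F + v * ky F). assert (Hw : 0 < w) by (unfold w; nra).
  assert (WC : ucost F (gcoef F (false, BWm)) = w).
  { unfold gcoef, gbase, ucost; simpl. fold u v. rewrite !Rabs_right by lra. unfold w; ring. }
  assert (EQ : mmul (mtrans (gam s0)) (gam s1) = rot ((s1 - s0) / w) (fv F (gcoef F (false, BWm)))).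
  { assert (E : fv F (gcoef F (false, BWm)) = vscale w (fv F (u / w, v / w))).
    { unfold gcoef, gbase; simpl. fold u v. unfold fv, fvec; simpl.
      destruct (fX F), (fY F); unfold vscale, vadd; simpl; f_equal; field; lra. }
    rewrite E, rot_vscale by auto. replace ((s1 - s0) / w * w) with (s1 - s0) by (field; lra).
    set (T := s1 - s0).
    set (C1 := (3 * M * (u + v + kx F + ky F)) / w).
    assert (C10 : 0 <= C1) by (apply Rmult_le_pos; [nra | left; apply Rinv_0_lt_compat; auto]).
    set (M' := M + C1 * (T * T)).
    assert (T2 : 0 <= T * T) by nra.
    apply (euler_run F gam L s0 s1 _ _ M'); auto; try lra.
    { intros; apply (ec_SO3 _ _ _ _ H); auto. }
    { unfold M'. nra. }
    destruct (archi (/ (T + 1))) as [N1 HN1]. { apply Rinv_0_lt_compat; unfold T; lra. }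
    exists (S N1). intros m Hm Hm0. pose proof (lt_0_INR m Hm0) as Pm.
    fold T. set (d := T / INR m).
    assert (d0 : 0 < d) by (apply Rdiv_lt_0_compat; unfold T; lra).
    assert (d1 : d <= 1).
    { specialize (HN1 (m - 1)%nat ltac:(lia)). rewrite minus_INR in HN1 by lia. simpl (INR 1) in HN1.
      replace (INR m - 1 + 1) with (INR m) in HN1 by ring.
      unfold d, Rdiv. apply Rle_trans with (T * / (T + 1)); [apply Rmult_le_compat_l; unfold T in *; lra|].
      apply Rmult_le_reg_r with (T + 1); [unfold T in *; lra|]. rewrite Rmult_assoc, Rinv_l by (unfold T in *; lra). lra. }
    exists (fun j => ca (sig s0 s1 m j) (sig s0 s1 m (S j))), (fun j => cb (sig s0 s1 m j) (sig s0 s1 m (S j))).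
    assert (ST : forall j, (j < m)%nat -> let s := sig s0 s1 m j in let t := sig s0 s1 m (S j) in
       s0 <= s <= s1 /\ 0 <= s < t /\ t <= L /\ t - s = d /\ s0 <= t <= s1).
    { intros j Hj s t. pose proof (sig_bounds s0 s1 m j ltac:(lra) ltac:(lia) Hm0).
      pose proof (sig_bounds s0 s1 m (S j) ltac:(lra) ltac:(lia) Hm0).
      assert (t = s + d) by apply sig_S. fold s in H0. fold t in H1. repeat split; lra. }
    split.
    - intros j Hj. destruct (ST j Hj) as (B0 & B1 & B2 & B3 & _).
      destruct (HS _ _ B1 B2 ltac:(rewrite B3; auto)) as (_ & Q & _). rewrite B3 in Q.
      eapply mbd_le; [exact Q|]. apply Rmult_le_compat_r; [nra|]. unfold M'. nra.
    - apply Rle_trans with (rsum (fun _ => C1 * (d * d)) m).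
      + apply rsum_le. intros j Hj. destruct (ST j Hj) as (B0 & B1 & B2 & B3 & B4).
        destruct (HS _ _ B1 B2 ltac:(rewrite B3; auto)) as (Q1 & _ & Q2 & _ & _ & Q3). rewrite B3 in Q1, Q2, Q3.
        destruct (HQ _ B0) as (X0 & Y0 & Z0). destruct (HQ _ B4) as (_ & _ & Z1).
        rewrite X0, Y0 in Q2. rewrite X0, Y0, Z0, Z1 in Q3.
        set (a := ca _ _) in *. set (b := cb _ _) in *.
        (* The residuals of the two equations, both O(d^2); [EA] and [EB] invert the system. *)
        set (r2 := a * kx F + b * ky F - d). set (r1 := - (a * v) + b * u).
        assert (R1 : Rabs r1 <= M * (d * d)).
        { rewrite <- Rabs_Ropp. unfold r1, u, v. match goal with |- Rabs ?x <= _ => match type of Q3 with Rabs ?y <= _ => replace x with y by ring end end. exact Q3. }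
        assert (R2 : Rabs r2 <= M * (d * d)).
        { unfold r2. pose proof (Rle_abs a); pose proof (Rle_abs b).
          assert (a * kx F <= kx F * Rabs a) by nra. assert (b * ky F <= ky F * Rabs b) by nra. apply Rabs_le; lra. }
        assert (EA : a - u / w * d = / w * (u * r2 - ky F * r1)) by (unfold r1, r2, w; field; fold w; lra).
        assert (EB : b - v / w * d = / w * (v * r2 + kx F * r1)) by (unfold r1, r2, w; field; fold w; lra).
        rewrite EA, EB, !Rabs_mult, (Rabs_right (/ w)) by (left; apply Rinv_0_lt_compat; auto).
        assert (Z1' : Rabs (u * r2 - ky F * r1) <= u * (M * (d * d)) + ky F * (M * (d * d))).
        { apply Rabs_plus_le; rewrite ?Rabs_Ropp; apply Rabs_mult_le; auto; rewrite Rabs_right; lra. }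
        assert (Z2' : Rabs (v * r2 + kx F * r1) <= v * (M * (d * d)) + kx F * (M * (d * d))).
        { apply Rabs_plus_le; rewrite ?Rabs_Ropp; apply Rabs_mult_le; auto; rewrite Rabs_right; lra. }
        rewrite <- Rmult_plus_distr_l.
        apply Rle_trans with (/ w * (M * (d * d) * (u + v + kx F + ky F))).
        * apply Rmult_le_compat_l; [left; apply Rinv_0_lt_compat; auto | lra].
        * unfold C1. replace (3 * M * (u + v + kx F + ky F) / w * (d * d)) with (/ w * (3 * (M * (d * d) * (u + v + kx F + ky F)))) by (field; lra).
          apply Rmult_le_compat_l; [left; apply Rinv_0_lt_compat; auto|].
          assert (0 <= M * (d * d) * (u + v + kx F + ky F)) by (apply Rmult_le_pos; [nra|lra]). lra.
      + rewrite rsum_const. replace (INR m * (C1 * (d * d))) with ((M' - M) / INR m) by (unfold M', d; field; lra).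
        apply Rmult_le_compat_r; [left; apply Rinv_0_lt_compat; auto | lra]. }
  rewrite EQ.
  assert (T0 : 0 <= (s1 - s0) / w) by (apply Rmult_le_pos; [lra | left; apply Rinv_0_lt_compat; auto]).
  pose proof (Wd_letter F (false, BWm) _ T0) as R. rewrite WC in R.
  replace ((s1 - s0) / w * w) with (s1 - s0) in R by (field; lra). exact R.
Qed.

(** An edge usually begins and ends in corners, where |y| = ky. Short pieces of length d are cut off
    at both ends, and Lipschitz continuity lets d tend to 0. *)
Lemma edge_run_open F B L gam s0 s1 : gframe F -> EC F B L gam -> 0 <= s0 < s1 -> s1 <= L ->
  (forall s, s0 <= s <= s1 -> 0 <= lx F B gam s) ->
  (forall s, s0 < s < s1 -> Rabs (ly F B gam s) < ky F) ->
  mmul (mtrans (gam s0)) (gam s1) = rot ((s1 - s0) / kx F) (fX F).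
Proof.
  intros G H Hs Hs1 Hx Hy. destruct (EC_lip F B L gam G H) as (La & HL & Lip).
  pose proof (gkx F G) as Kx. set (T := s1 - s0).
  assert (S : forall s, s0 <= s <= s1 -> inSO3 (gam s)) by (intros; apply (ec_SO3 _ _ _ _ H); lra).
  apply msub_0. intros e He.
  set (K0 := 6 * La + 8 / kx F + 18 * La * La + 1).
  assert (0 < 8 / kx F) by (apply Rdiv_lt_0_compat; lra).
  assert (K0p : 0 < K0) by (unfold K0; nra).
  set (d := Rmin (T / 4) (Rmin 1 (e / (36 * K0)))).
  assert (d0 : 0 < d).
  { unfold d. repeat apply Rmin_pos; try lra; try (unfold T; lra). apply Rdiv_lt_0_compat; lra. }
  assert (d1 : d <= T / 4) by apply Rmin_l.
  assert (d2 : d <= 1) by (eapply Rle_trans; [apply Rmin_r | apply Rmin_l]).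
  assert (d3 : d <= e / (36 * K0)) by (eapply Rle_trans; [apply Rmin_r | apply Rmin_r]).
  set (a := s0 + d). set (b := s1 - d).
  assert (E : mmul (mtrans (gam a)) (gam b) = rot ((b - a) / kx F) (fX F)).
  { apply (edge_run F B L gam); auto; try (unfold a, b, T in *; lra).
    - intros; apply Hx; unfold a, b in *; lra.
    - intros; apply Hy; unfold a, b in *; lra. }
  assert (Sa : inSO3 (gam a)) by (apply S; unfold a, T in *; lra).
  assert (Sb : inSO3 (gam b)) by (apply S; unfold b, T in *; lra).
  rewrite (msub_trans _ (mmul (mtrans (gam a)) (gam b))). rewrite E at 2.
  assert (N1 : mbd (msub (mmul (mtrans (gam s0)) (gam s1)) (mmul (mtrans (gam a)) (gam b)))
     (3 * (La * d) + 3 * (La * d) + 3 * (La * d * (La * d)))).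
  { assert (Rd : Rabs (s0 - a) = d) by (unfold a; replace (s0 - (s0 + d)) with (- d) by ring; rewrite Rabs_Ropp; apply Rabs_right; lra).
    assert (Rd' : Rabs (s1 - b) = d) by (unfold b; replace (s1 - (s1 - d)) with d by ring; apply Rabs_right; lra).
    apply mmul_near; auto.
    - apply SO3_trans, S; lra.
    - replace (msub (mtrans (gam s0)) (mtrans (gam a))) with (mtrans (msub (gam s0) (gam a))) by (generalize (gam s0) (gam a); clear; mring).
      apply mbd_trans. rewrite <- Rd. apply Lip; unfold a, T in *; lra.
    - rewrite <- Rd'. apply Lip; unfold b, T in *; lra.
    - apply mbd_SO3, SO3_trans; auto. }
  assert (N2 : mbd (msub (rot ((b - a) / kx F) (fX F)) (rot (T / kx F) (fX F))) (3 * (4 * (2 * d / kx F * 1) * 1))).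
  { apply msub_opp. replace (T / kx F) with (2 * d / kx F + (b - a) / kx F) by (unfold a, b, T; field; lra).
    rewrite rot_add.
    replace (msub _ _) with (mmul (msub (rot (2 * d / kx F) (fX F)) mid3) (rot ((b - a) / kx F) (fX F)))
      by (generalize (rot (2 * d / kx F) (fX F)) (rot ((b - a) / kx F) (fX F)); clear; mring).
    apply mbd_mul; [|apply mbd_SO3, rot_SO3]. rewrite <- (vnorm_unit (fX F) (gX F G)).
    apply rot_near1. apply Rmult_le_pos; [lra | left; apply Rinv_0_lt_compat; auto]. }
  eapply mbd_le; [apply mbd_add; [exact N1 | exact N2]|].
  apply Rle_trans with (36 * K0 * d).
  - unfold K0. assert (La * d * (La * d) <= La * La * d) by (assert (0 <= La * La * d) by (apply Rmult_le_pos; nra); nra).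
    replace (3 * (4 * (2 * d / kx F * 1) * 1)) with (3 * (8 / kx F * d)) by (field; lra).
    assert (0 <= 8 / kx F * d) by (apply Rmult_le_pos; lra).
    assert (0 <= La * La * d) by (apply Rmult_le_pos; nra). assert (0 <= La * d) by nra. lra.
  - apply Rle_trans with (36 * K0 * (e / (36 * K0))); [apply Rmult_le_compat_l; lra|].
    apply Req_le. field. lra.
Qed.

(** In the interior of the rectangle every increment would earn at most a fraction [th] < 1 of its
    cost, so deleting a short arc would be an improvement. *)
Lemma on_boundary F B L gam s : gframe F -> EC F B L gam -> 0 <= s < L ->
  Rabs (lx F B gam s) = kx F \/ Rabs (ly F B gam s) = ky F.
Proof.
  intros G H Hs. destruct (EC_step_est F B L gam G H) as (M & ca & cb & (HM & HS)).
  pose proof (lx_bd F B L gam s H ltac:(lra)) as Lx. pose proof (ly_bd F B L gam s H ltac:(lra)) as Ly.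
  pose proof (gkx F G) as Kx. pose proof (gky F G) as Ky.
  apply NNPP; intros Hn. apply not_or_and in Hn. destruct Hn as [n1 n2].
  set (x := Rabs (lx F B gam s)) in *. set (y := Rabs (ly F B gam s)) in *.
  set (th := Rmax (x / kx F) (y / ky F)).
  assert (th1 : th < 1).
  { assert (D : forall p k, 0 < k -> p < k -> p / k < 1).
    { intros p k Hk Hp. apply Rmult_lt_reg_r with k; auto. unfold Rdiv. rewrite Rmult_assoc, Rinv_l; lra. }
    unfold th. apply Rmax_lub_lt; apply D; auto; lra. }
  assert (x <= th * kx F).
  { apply Rle_trans with (x / kx F * kx F); [apply Req_le; field; lra|]. apply Rmult_le_compat_r; [lra|apply Rmax_l]. }
  assert (y <= th * ky F).
  { apply Rle_trans with (y / ky F * ky F); [apply Req_le; field; lra|]. apply Rmult_le_compat_r; [lra|apply Rmax_r]. }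
  assert (th0 : 0 <= th).
  { apply Rle_trans with (x / kx F); [|apply Rmax_l]. apply Rmult_le_pos; [apply Rabs_pos | left; apply Rinv_0_lt_compat; auto]. }
  set (d := Rmin (Rmin 1 (L - s)) ((1 - th) / (4 * M))).
  assert (d0 : 0 < d) by (unfold d; repeat apply Rmin_pos; try lra; apply Rdiv_lt_0_compat; lra).
  pose proof (Rmin_l (Rmin 1 (L - s)) ((1 - th) / (4 * M))) as e1. pose proof (Rmin_r (Rmin 1 (L - s)) ((1 - th) / (4 * M))) as e2.
  pose proof (Rmin_l 1 (L - s)) as e3. pose proof (Rmin_r 1 (L - s)) as e4. fold d in e1, e2.
  destruct (HS s (s + d)) as (Q1 & _ & Q2 & _); try lra.
  replace (s + d - s) with d in Q1, Q2 by ring.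
  set (a := ca _ _) in *. set (b := cb _ _) in *.
  assert (A1 : a * lx F B gam s <= Rabs a * (th * kx F)).
  { apply Rle_trans with (Rabs (a * lx F B gam s)); [apply Rle_abs|]. rewrite Rabs_mult. fold x.
    apply Rmult_le_compat_l; auto using Rabs_pos. }
  assert (A2 : b * ly F B gam s <= Rabs b * (th * ky F)).
  { apply Rle_trans with (Rabs (b * ly F B gam s)); [apply Rle_abs|]. rewrite Rabs_mult. fold y.
    apply Rmult_le_compat_l; auto using Rabs_pos. }
  assert (A3 : th * (kx F * Rabs a + ky F * Rabs b) <= th * (d + M * (d * d))) by (apply Rmult_le_compat_l; auto).
  assert (A4 : 4 * M * d <= 1 - th).
  { apply Rle_trans with (4 * M * ((1 - th) / (4 * M))); [apply Rmult_le_compat_l; lra|]. apply Req_le. field. lra. }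
  assert (A5 : d * (4 * M * d) <= d * (1 - th)) by (apply Rmult_le_compat_l; lra).
  assert (0 < M * (d * d)) by nra. nra.
Qed.

(** * The conserved quadratic form and corners with z = 0 *)

Lemma gram F l : gframe F ->
  dot l l * (1 - cc F * cc F) =
  dot l (fX F) * dot l (fX F) + dot l (fY F) * dot l (fY F)
  - 2 * cc F * dot l (fX F) * dot l (fY F) + dot l (fN F) * dot l (fN F).
Proof.
  intros [H1 H2 _ _ _ _].
  assert (E : dot l (fN F) * dot l (fN F) =
    dot l l * (dot (fX F) (fX F) * dot (fY F) (fY F) - cc F * cc F)
    - dot l (fX F) * (dot l (fX F) * dot (fY F) (fY F) - cc F * dot l (fY F))
    + dot l (fY F) * (cc F * dot l (fX F) - dot l (fY F) * dot (fX F) (fX F))).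
  { unfold cc, fN. generalize (fX F) (fY F). mring. }
  rewrite E, H1, H2. ring.
Qed.

(** By [gram] this is 1 - c^2 times the squared length of the momentum, which rotations preserve. *)
Definition Qf (c x y z : R) : R := x * x + y * y - 2 * c * x * y + z * z.

Lemma Q_const F B L gam s t : gframe F -> EC F B L gam -> 0 <= s <= L -> 0 <= t <= L ->
  Qf (cc F) (lx F B gam s) (ly F B gam s) (lz F B gam s) =
  Qf (cc F) (lx F B gam t) (ly F B gam t) (lz F B gam t).
Proof.
  intros G H Hs Ht. unfold Qf, lx, ly, lz. rewrite <- !(gram F _ G). f_equal.
  unfold lam. rewrite !dot_SO3; auto; apply SO3_trans; apply (ec_SO3 _ _ _ _ H); auto.
Qed.

(** Along X the coordinate x is constant and the point (y - c x, z) rotates clockwise about the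
    origin. *)
Lemma mv_rotX_dotY F l t : gframe F ->
  dot (mv (mtrans (rot t (fX F))) l) (fX F) = dot l (fX F) /\
  dot (mv (mtrans (rot t (fX F))) l) (fY F) = cc F * dot l (fX F)
    + (dot l (fY F) - cc F * dot l (fX F)) * cos t + dot l (fN F) * sin t /\
  dot (mv (mtrans (rot t (fX F))) l) (fN F) = dot l (fN F) * cos t
    - (dot l (fY F) - cc F * dot l (fX F)) * sin t.
Proof.
  intros [H1 H2 _ _ _ _]. rewrite (rot_unit_eq t (fX F) H1), <- rot_unit_opp, !mv_rot_unit, cos_neg, sin_neg.
  unfold cc, fN. destruct (fX F) as [x1 x2 x3], (fY F) as [y1 y2 y3], l as [p q r].
  unfold dot, cross, vadd, vscale in *; simpl in *. generalize (cos t) (sin t); intros C S.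
  assert (Hx : x3 * x3 = 1 - x1 * x1 - x2 * x2) by lra.
  repeat split; ring [Hx].
Qed.

(** Near a corner with z = 0 the curve could a priori leave and return infinitely often. On an
    interval with x, y > 0 and angles at most 1 (this is [Hdk]), it is shown that a curve that has
    left the corner stays away; then the arc is one rest in the corner followed by one edge. *)
Section CornerZero.
Variables (F : frame) (B : M3) (L : R) (gam : R -> M3) (s0 d La : R).
Hypotheses (G : gframe F) (H : EC F B L gam) (Hs0 : 0 <= s0) (Hd : 0 < d) (HdL : s0 + d < L)
  (HL : 0 < La)
  (Lip : forall s t, 0 <= s <= L -> 0 <= t <= L ->
    Rabs (lx F B gam t - lx F B gam s) <= La * Rabs (t - s) /\
    Rabs (ly F B gam t - ly F B gam s) <= La * Rabs (t - s))
  (X0 : lx F B gam s0 = kx F) (Y0 : ly F B gam s0 = ky F) (Z0 : lz F B gam s0 = 0)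
  (PX : forall s, s0 <= s <= s0 + d -> 0 < lx F B gam s)
  (PY : forall s, s0 <= s <= s0 + d -> 0 < ly F B gam s)
  (Hdk : d <= kx F).

Lemma cz_le s : s0 <= s <= s0 + d -> lx F B gam s <= kx F /\ ly F B gam s <= ky F.
Proof.
  intros Hs. pose proof (lx_bd F B L gam s H ltac:(lra)). pose proof (ly_bd F B L gam s H ltac:(lra)).
  pose proof (Rle_abs (lx F B gam s)); pose proof (Rle_abs (ly F B gam s)). lra.
Qed.
Lemma cz_bdry s : s0 <= s <= s0 + d -> ly F B gam s < ky F -> lx F B gam s = kx F.
Proof.
  intros Hs Hy. destruct (on_boundary F B L gam s G H ltac:(lra)) as [E|E].
  - rewrite Rabs_right in E; auto. left; apply PX; auto.
  - rewrite Rabs_right in E; [lra|]. left; apply PY; auto.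
Qed.
Lemma cz_corner s : s0 <= s <= s0 + d -> lx F B gam s = kx F -> ly F B gam s = ky F -> lz F B gam s = 0.
Proof.
  intros Hs Hx Hy. pose proof (Q_const F B L gam s0 s G H ltac:(lra) ltac:(lra)) as E.
  unfold Qf in E. rewrite X0, Y0, Z0, Hx, Hy in E. nra.
Qed.

Lemma cz_run s t : s0 <= s < t -> t <= s0 + d -> (forall r, s < r < t -> ly F B gam r < ky F) ->
  mmul (mtrans (gam s)) (gam t) = rot ((t - s) / kx F) (fX F).
Proof.
  intros Hs Ht Hr. apply (edge_run_open F B L gam); auto; try lra.
  - intros r Hr'. left; apply PX; lra.
  - intros r Hr'. rewrite Rabs_right; [apply Hr; auto | left; apply PY; lra].
Qed.

Lemma cz_lx_limit s t : s0 <= s < t -> t <= s0 + d -> (forall r, s < r < t -> ly F B gam r < ky F) ->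
  lx F B gam s = kx F.
Proof.
  intros Hs Ht Hr. apply Rle_antisym; [apply cz_le; lra|].
  apply (le_eps _ _ (La * (t - s))); [apply Rmult_le_pos; lra|]. intros e He.
  set (r := s + e * ((t - s) / 2)).
  assert (s < r < t) by (unfold r; split; nra).
  rewrite <- (cz_bdry r ltac:(lra) (Hr r H0)).
  destruct (Lip s r ltac:(lra) ltac:(lra)) as [L1 _].
  pose proof (Rle_abs (lx F B gam r - lx F B gam s)). rewrite (Rabs_right (r - s)) in L1 by lra.
  assert (La * (r - s) <= La * (t - s) * e).
  { unfold r. replace (s + e * ((t - s) / 2) - s) with (e * ((t - s) / 2)) by ring.
    assert (0 <= La * (t - s) * e) by (apply Rmult_le_pos; nra). nra. }
  lra.
Qed.

(** s is the last time up to t with y = ky; that x = kx there follows by continuity from the edge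
    just after it. *)
Lemma cz_leave t : s0 <= t <= s0 + d -> ly F B gam t < ky F ->
  exists s, s0 <= s < t /\ lx F B gam s = kx F /\ ly F B gam s = ky F /\
    forall r, s < r <= t -> ly F B gam r < ky F.
Proof.
  intros Ht Hy.
  destruct (completeness (fun s => s0 <= s <= t /\ ly F B gam s = ky F)) as [s [U Lb]].
  { exists t. intros s [Hs _]; lra. }
  { exists s0. split; [lra | exact Y0]. }
  assert (B1 : s0 <= s) by (apply U; split; [lra | exact Y0]).
  assert (B2 : s <= t) by (apply Lb; intros r [Hr _]; lra).
  assert (Ys : ly F B gam s = ky F).
  { apply Rle_antisym; [apply cz_le; lra|]. apply (le_eps _ _ La); [lra|]. intros e He.
    assert (NU : exists r, (s0 <= r <= t /\ ly F B gam r = ky F) /\ s - e < r).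
    { apply NNPP; intros Hn. assert (s <= s - e); [|lra]. apply Lb. intros r Hr.
      apply Rnot_lt_le; intros ?. apply Hn. exists r; auto. }
    destruct NU as (r & (Hr1 & Hr2) & Hr3). rewrite <- Hr2.
    assert (r <= s) by (apply U; auto).
    destruct (Lip s r ltac:(lra) ltac:(lra)) as [_ L2].
    pose proof (Rle_abs (ly F B gam r - ly F B gam s)). rewrite (Rabs_left1 (r - s)) in L2 by lra. nra. }
  assert (B3 : s < t) by (destruct B2 as [|E]; auto; rewrite E in Ys; lra).
  assert (R : forall r, s < r <= t -> ly F B gam r < ky F).
  { intros r Hr. destruct (cz_le r ltac:(lra)) as [_ [h|h]]; auto. exfalso.
    assert (r <= s) by (apply U; split; [lra|auto]). lra. }
  exists s. split; [lra|]. split; [|auto].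
  apply (cz_lx_limit s t); auto; try lra. intros; apply R; lra.
Qed.

(** Between the last departure s and the first return v the curve follows X from a corner with z =
    0, so y(v) = c kx + (ky - c kx) cos th, which is less than ky for 0 < th <= 1. *)
Lemma cz_noreturn t t' : s0 <= t <= t' -> t' <= s0 + d -> ly F B gam t < ky F -> ly F B gam t' < ky F.
Proof.
  intros Ht Ht' Hy. destruct (cz_le t' ltac:(lra)) as [_ [h|Yt']]; auto. exfalso.
  destruct (cz_leave t ltac:(lra) Hy) as (s & Hs & Xs & Ys & Hr).
  (* The first return is an infimum, obtained as minus the supremum of the reflected set. *)
  destruct (completeness (fun r => t <= - r <= t' /\ ly F B gam (- r) = ky F)) as [q [U Lb]].
  { exists (- t). intros r [Hr' _]; lra. }
  { exists (- t'). rewrite Ropp_involutive. split; [lra | exact Yt']. }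
  set (v := - q). assert (Ev : q = - v) by (unfold v; ring).
  assert (B1 : v <= t') by (assert (- t' <= q); [apply U; rewrite Ropp_involutive; split; [lra|auto] | unfold v; lra]).
  assert (B2 : t <= v) by (assert (q <= - t); [apply Lb; intros r [Hr' _]; lra | unfold v; lra]).
  assert (Yv : ly F B gam v = ky F).
  { apply Rle_antisym; [apply cz_le; lra|]. apply (le_eps _ _ La); [lra|]. intros e He.
    assert (NU : exists r, (t <= - r <= t' /\ ly F B gam (- r) = ky F) /\ q - e < r).
    { apply NNPP; intros Hn. assert (q <= q - e); [|lra]. apply Lb. intros r Hr'.
      apply Rnot_lt_le; intros ?. apply Hn. exists r; auto. }
    destruct NU as (r & (Hr1 & Hr2) & Hr3). rewrite <- Hr2.
    assert (r <= q) by (apply U; auto).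
    destruct (Lip v (- r) ltac:(lra) ltac:(lra)) as [_ L2].
    pose proof (Rle_abs (ly F B gam (- r) - ly F B gam v)). rewrite (Rabs_right (- r - v)) in L2 by lra. nra. }
  assert (R : forall r, s < r < v -> ly F B gam r < ky F).
  { intros r Hr'. destruct (Rle_dec r t) as [h|h]; [apply Hr; lra|].
    destruct (cz_le r ltac:(lra)) as [_ [h'|h']]; auto. exfalso.
    assert (- r <= q) by (apply U; rewrite Ropp_involutive; split; [lra|auto]). lra. }
  assert (E : mmul (mtrans (gam s)) (gam v) = rot ((v - s) / kx F) (fX F)) by (apply cz_run; auto; lra).
  assert (Lv : lam B gam v = mv (mtrans (rot ((v - s) / kx F) (fX F))) (lam B gam s)).
  { rewrite <- E. apply lam_step. apply (ec_SO3 _ _ _ _ H); lra. }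
  destruct (mv_rotX_dotY F (lam B gam s) ((v - s) / kx F) G) as (_ & RY & _). rewrite <- Lv in RY.
  fold (ly F B gam v) (lx F B gam s) (ly F B gam s) (lz F B gam s) in RY.
  rewrite (cz_corner s ltac:(lra) Xs Ys), Yv, Xs, Ys in RY.
  pose proof (gkx F G) as Kx.
  set (th := (v - s) / kx F) in *.
  assert (t0 : 0 < th) by (apply Rdiv_lt_0_compat; lra).
  assert (t1 : th <= 1).
  { unfold th. apply Rmult_le_reg_r with (kx F); auto. unfold Rdiv. rewrite Rmult_assoc, Rinv_l; lra. }
  assert (cos th < cos 0) by (apply cos_decreasing_1; pose proof PI2_1; lra). rewrite cos_0 in H0.
  pose proof (gcx F G). pose proof (Rle_abs (cc F)). assert (cc F * kx F < ky F) by nra. nra.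
Qed.

Lemma cz_run_Wd t : s0 <= t <= s0 + d -> ly F B gam t < ky F ->
  exists s, s0 <= s < t /\ lx F B gam s = kx F /\ ly F B gam s = ky F /\
    Wd F (mmul (mtrans (gam s)) (gam t)) (t - s).
Proof.
  intros Ht Hy. destruct (cz_leave t Ht Hy) as (s & Hs & Xs & Ys & Hr).
  exists s. split; auto. split; auto. split; auto.
  rewrite (cz_run s t); auto; try lra; [|intros; apply Hr; lra].
  pose proof (gkx F G) as Kx.
  assert (T0 : 0 <= (t - s) / kx F) by (apply Rmult_le_pos; [lra | left; apply Rinv_0_lt_compat; auto]).
  pose proof (Wd_letter F (false, BX) _ T0) as R. unfold gcoef, gbase in R; simpl in R.
  rewrite fv_10, ucost_10 in R. replace ((t - s) / kx F * kx F) with (t - s) in R by (field; lra). exact R.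
Qed.
End CornerZero.

Lemma Wd_chain F (gam : R -> M3) r s t x y : inSO3 (gam s) -> Wd F (mmul (mtrans (gam r)) (gam s)) x ->
  Wd F (mmul (mtrans (gam s)) (gam t)) y -> Wd F (mmul (mtrans (gam r)) (gam t)) (x + y).
Proof.
  intros S H1 H2. pose proof (Wd_mul _ _ _ _ _ H1 H2) as H.
  rewrite mmul_assoc, <- (mmul_assoc (gam s)), (SO3_rinv _ S), mmul_1l in H. exact H.
Qed.

Lemma corner_zero F B L gam s0 : gframe F -> EC F B L gam -> 0 <= s0 < L ->
  lx F B gam s0 = kx F -> ly F B gam s0 = ky F -> lz F B gam s0 = 0 ->
  exists dl, 0 < dl /\ forall s1, s0 < s1 <= s0 + dl -> s1 <= L ->
  Wd F (mmul (mtrans (gam s0)) (gam s1)) (s1 - s0).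
Proof.
  intros G H Hs0 X0 Y0 Z0. destruct (EC_lip F B L gam G H) as (La & HL & Lip).
  pose proof (gkx F G) as Kx. pose proof (gky F G) as Ky.
  set (m := Rmin (kx F) (ky F)).
  assert (Hm : 0 < m) by (apply Rmin_pos; auto).
  set (d := Rmin (m / (2 * La)) (Rmin m ((L - s0) / 2))).
  assert (d0 : 0 < d).
  { unfold d. repeat apply Rmin_pos; try lra. apply Rdiv_lt_0_compat; lra. }
  assert (d1 : d <= m / (2 * La)) by apply Rmin_l.
  assert (d2 : d <= m) by (eapply Rle_trans; [apply Rmin_r | apply Rmin_l]).
  assert (d3 : d <= (L - s0) / 2) by (eapply Rle_trans; [apply Rmin_r | apply Rmin_r]).
  pose proof (Rmin_l (kx F) (ky F)) as m1. pose proof (Rmin_r (kx F) (ky F)) as m2. fold m in m1, m2.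
  assert (La * d <= m / 2).
  { apply Rle_trans with (La * (m / (2 * La))); [apply Rmult_le_compat_l; lra|]. apply Req_le; field; lra. }
  assert (PP : forall s, s0 <= s <= s0 + d -> 0 < lx F B gam s /\ 0 < ly F B gam s).
  { intros s Hs. destruct (Lip s0 s ltac:(lra) ltac:(lra)) as (L1 & L2 & _).
    rewrite (Rabs_right (s - s0)) in L1, L2 by lra.
    assert (La * (s - s0) <= La * d) by (apply Rmult_le_compat_l; lra).
    pose proof (Rle_abs (-(lx F B gam s - lx F B gam s0))) as e1.
    pose proof (Rle_abs (-(ly F B gam s - ly F B gam s0))) as e2. rewrite Rabs_Ropp in e1, e2. lra. }
  assert (Lip2 : forall s t, 0 <= s <= L -> 0 <= t <= L ->
    Rabs (lx F B gam t - lx F B gam s) <= La * Rabs (t - s) /\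
    Rabs (ly F B gam t - ly F B gam s) <= La * Rabs (t - s)) by (intros s t Hs Ht; split; apply Lip; auto).
  set (F' := symF Vs F). assert (G' : gframe F') by (apply gframe_sym; auto).
  assert (H' : EC F' B L gam) by (apply EC_sym; auto).
  assert (Z0' : lz F' B gam s0 = 0).
  { unfold lz in *. transitivity (- dot (lam B gam s0) (fN F)); [|lra].
    unfold F', fN; simpl. generalize (fX F) (fY F) (lam B gam s0). mring. }
  (* on the set where both coordinates are extreme, the corner has been reached all along *)
  assert (ST : forall s, s0 <= s <= s0 + d -> lx F B gam s = kx F -> ly F B gam s = ky F ->
    forall r, s0 <= r <= s -> lx F B gam r = kx F /\ ly F B gam r = ky F /\ lz F B gam r = 0).
  { intros s Hs Xs Ys r Hr.
    assert (Yr : ly F B gam r = ky F).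
    { destruct (proj2 (cz_le F B L gam s0 d H ltac:(lra) ltac:(lra) r ltac:(lra))) as [h|h]; auto.
      exfalso. assert (ly F B gam s < ky F); [|lra].
      apply (cz_noreturn F B L gam s0 d La G H) with (t := r); auto; try lra; intros; apply PP; auto. }
    assert (Xr : lx F B gam r = kx F).
    { destruct (proj1 (cz_le F B L gam s0 d H ltac:(lra) ltac:(lra) r ltac:(lra))) as [h|h]; auto.
      exfalso. assert (ly F' B gam s < ky F') by
      (apply (cz_noreturn F' B L gam s0 d La G' H') with (t := r); auto; try (simpl; lra);
        [intros; split; apply Lip2; auto | intros; apply PP; auto | intros; apply PP; auto]).
      assert (ly F' B gam s = lx F B gam s) by reflexivity. simpl in H1. lra. }
    split; auto. split; auto. apply (cz_corner F B L gam s0 d); auto; lra. }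
  assert (WW : forall s, s0 <= s <= s0 + d -> lx F B gam s = kx F -> ly F B gam s = ky F ->
    Wd F (mmul (mtrans (gam s0)) (gam s)) (s - s0)).
  { intros s Hs Xs Ys. destruct (Req_dec s s0) as [->|Hne].
    - rewrite Rminus_diag, SO3_linv; [apply Wd_nil|]. apply (ec_SO3 _ _ _ _ H); lra.
    - apply (W_run F B L gam); auto; try lra. intros r Hr. apply (ST s); auto; lra. }
  exists d. split; auto. intros s1 Hs1 HL1.
  destruct (cz_le F B L gam s0 d H ltac:(lra) ltac:(lra) s1 ltac:(lra)) as [[hx|hx] [hy|hy]].
  - exfalso. assert (lx F B gam s1 = kx F); [|lra].
    apply (cz_bdry F B L gam s0 d G H); auto; try lra; intros; apply PP; auto.
  - destruct (cz_run_Wd F' B L gam s0 d La G' H') with (t := s1) as (s & Hs & Xs & Ys & W); auto; try (simpl; lra).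
    + intros; split; apply Lip2; auto.
    + intros; apply PP; auto.
    + intros; apply PP; auto.
    + replace (s1 - s0) with ((s - s0) + (s1 - s)) by ring.
      apply (Wd_chain F gam s0 s s1); [apply (ec_SO3 _ _ _ _ H); lra | apply WW; auto; lra | apply (Wd_sym Vs); exact W].
  - destruct (cz_run_Wd F B L gam s0 d La G H) with (t := s1) as (s & Hs & Xs & Ys & W); auto; try lra.
    + intros; apply PP; auto.
    + intros; apply PP; auto.
    + replace (s1 - s0) with ((s - s0) + (s1 - s)) by ring.
      apply (Wd_chain F gam s0 s s1); [apply (ec_SO3 _ _ _ _ H); lra | apply WW; auto; lra | exact W].
  - apply WW; auto; lra.
Qed.

(** * From local words to a word for the whole curve *)

Definition RL (F : frame) (L : R) (gam : R -> M3) (s : R) : Prop :=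
  exists d, 0 < d /\ forall t, s < t <= s + d -> t <= L ->
    Wd F (mmul (mtrans (gam s)) (gam t)) (t - s).

Lemma RL_sym sy F L gam s : RL (symF sy F) L gam s -> RL F L gam s.
Proof.
  intros (d & Hd & H). exists d. split; auto. intros. apply (Wd_sym sy); auto.
Qed.

Lemma Wd_X F t : gframe F -> 0 <= t -> Wd F (rot (t / kx F) (fX F)) t.
Proof.
  intros G Ht. pose proof (gkx F G) as Kx.
  assert (T0 : 0 <= t / kx F) by (apply Rmult_le_pos; [lra | left; apply Rinv_0_lt_compat; auto]).
  pose proof (Wd_letter F (false, BX) _ T0) as R. unfold gcoef, gbase in R; simpl in R.
  rewrite fv_10, ucost_10 in R. replace (t / kx F * kx F) with t in R by (field; lra). exact R.
Qed.

Lemma lx_sym sy F B gam s : lx (symF sy F) B gam s =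
  match sy with Nu => - lx F B gam s | Rho => lx F B gam s | Vs => ly F B gam s end.
Proof.
  destruct sy; try reflexivity. unfold lx; simpl. generalize (fX F) (lam B gam s). mring.
Qed.
Lemma ly_sym sy F B gam s : ly (symF sy F) B gam s =
  match sy with Nu | Rho => - ly F B gam s | Vs => lx F B gam s end.
Proof.
  destruct sy; try reflexivity; unfold ly; simpl; generalize (fY F) (lam B gam s); mring.
Qed.
Lemma lz_sym sy F B gam s : lz (symF sy F) B gam s =
  match sy with Nu => lz F B gam s | _ => - lz F B gam s end.
Proof.
  destruct sy; unfold lz, fN; simpl; generalize (fX F) (fY F) (lam B gam s); mring.
Qed.

Lemma RL_edge F B L gam s : gframe F -> EC F B L gam -> 0 <= s < L ->
  lx F B gam s = kx F -> Rabs (ly F B gam s) < ky F -> RL F L gam s.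
Proof.
  intros G H Hs Hx Hy. destruct (EC_lip F B L gam G H) as (La & HL & Lip).
  pose proof (gkx F G) as Kx.
  set (r := Rmin (kx F) (ky F - Rabs (ly F B gam s))).
  assert (Hr : 0 < r) by (apply Rmin_pos; lra).
  pose proof (Rmin_l (kx F) (ky F - Rabs (ly F B gam s))) as r1.
  pose proof (Rmin_r (kx F) (ky F - Rabs (ly F B gam s))) as r2. fold r in r1, r2.
  assert (d0 : 0 < r / (2 * La)) by (apply Rdiv_lt_0_compat; lra).
  exists (r / (2 * La)). split; auto. intros t Ht HtL.
  rewrite (edge_run F B L gam s t); auto; try lra.
  - apply Wd_X; auto; lra.
  - intros q Hq. destruct (Lip s q ltac:(lra) ltac:(lra)) as (L1 & _).
    rewrite (Rabs_right (q - s)) in L1 by lra.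
    assert (La * (q - s) <= La * (r / (2 * La))) by (apply Rmult_le_compat_l; lra).
    replace (La * (r / (2 * La))) with (r / 2) in H0 by (field; lra).
    pose proof (Rle_abs (-(lx F B gam q - lx F B gam s))) as e1. rewrite Rabs_Ropp in e1. lra.
  - intros q Hq. destruct (Lip s q ltac:(lra) ltac:(lra)) as (_ & L1 & _).
    rewrite (Rabs_right (q - s)) in L1 by lra.
    assert (La * (q - s) <= La * (r / (2 * La))) by (apply Rmult_le_compat_l; lra).
    replace (La * (r / (2 * La))) with (r / 2) in H0 by (field; lra).
    pose proof (Rabs_triang_inv (ly F B gam q) (ly F B gam s)). lra.
Qed.

Lemma RL_corner F B L gam s : gframe F -> EC F B L gam -> 0 <= s < L ->
  lx F B gam s = kx F -> ly F B gam s = ky F -> RL F L gam s.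
Proof.
  intros G H Hs Hx Hy. destruct (Rtotal_order (lz F B gam s) 0) as [h|[h|h]].
  - destruct (corner_run F B L gam s G H ltac:(lra) Hx Hy h) as (d & Hd & E).
    exists d. split; auto. intros t Ht HtL. rewrite E by auto. apply Wd_X; auto; lra.
  - destruct (corner_zero F B L gam s G H Hs Hx Hy h) as (d & Hd & E). exists d. split; auto.
  - apply (RL_sym Vs).
    pose proof (gframe_sym Vs F G) as G'.
    destruct (corner_run (symF Vs F) B L gam s G' (EC_sym Vs _ _ _ _ H) ltac:(lra)) as (d & Hd & E).
    + rewrite lx_sym; exact Hy.
    + rewrite ly_sym; exact Hx.
    + rewrite lz_sym; lra.
    + exists d. split; auto. intros t Ht HtL. rewrite E by auto. apply Wd_X; auto; lra.
Qed.

Lemma Rabs_cases x k : Rabs x = k -> x = k \/ x = - k.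
Proof. unfold Rabs. destruct Rcase_abs; intros <-; [right; ring | left; reflexivity]. Qed.

Lemma RL_all F B L gam s : gframe F -> EC F B L gam -> 0 <= s < L -> RL F L gam s.
Proof.
  assert (E : forall F, gframe F -> EC F B L gam -> 0 <= s < L ->
     Rabs (lx F B gam s) = kx F -> Rabs (ly F B gam s) < ky F -> RL F L gam s).
  { clear. intros F G H Hs Hx Hy. destruct (Rabs_cases _ _ Hx) as [h|h].
    - apply (RL_edge F B); auto.
    - apply (RL_sym Nu), (RL_edge _ B); auto using gframe_sym, EC_sym.
      + rewrite lx_sym, h; simpl; ring.
      + rewrite ly_sym, Rabs_Ropp; exact Hy. }
  assert (C : forall F, gframe F -> EC F B L gam -> 0 <= s < L ->
     lx F B gam s = kx F -> Rabs (ly F B gam s) = ky F -> RL F L gam s).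
  { clear. intros F G H Hs Hx Hy. destruct (Rabs_cases _ _ Hy) as [h|h].
    - apply (RL_corner F B); auto.
    - apply (RL_sym Rho), (RL_corner _ B); auto using gframe_sym, EC_sym.
      rewrite ly_sym, h; simpl; ring. }
  intros G H Hs.
  pose proof (lx_bd F B L gam s H ltac:(lra)) as Lx. pose proof (ly_bd F B L gam s H ltac:(lra)) as Ly.
  destruct (Rle_lt_or_eq_dec _ _ Ly) as [hy|hy].
  - apply E; auto. destruct (on_boundary F B L gam s G H Hs); auto; lra.
  - destruct (Rle_lt_or_eq_dec _ _ Lx) as [hx|hx].
    + apply (RL_sym Vs), E; auto using gframe_sym, EC_sym.
    + destruct (Rabs_cases _ _ hx) as [h|h].
      * apply C; auto.
      * apply (RL_sym Nu), C; auto using gframe_sym, EC_sym.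
        -- rewrite lx_sym, h; simpl; ring.
        -- rewrite ly_sym, Rabs_Ropp; exact hy.
Qed.

(** Continuous induction on the times up to which the curve is a word. Finiteness of the word comes
    from here: to the right of every time, and by reversal to its left, one local word suffices. *)
Lemma curve_word F B L gam : gframe F -> EC F B L gam -> 0 < L ->
  Wd F (mmul (mtrans (gam 0)) (gam L)) L.
Proof.
  intros G H HL.
  assert (S : forall s, 0 <= s <= L -> inSO3 (gam s)) by (intros; apply (ec_SO3 _ _ _ _ H); auto).
  set (P := fun t => 0 <= t <= L /\ Wd F (mmul (mtrans (gam 0)) (gam t)) t).
  assert (P0 : P 0).
  { split; [lra|]. rewrite SO3_linv by (apply S; lra). apply Wd_nil. }
  destruct (completeness P) as [t [U Lb]].
  { exists L. intros x [Hx _]; lra. }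
  { exists 0; exact P0. }
  assert (B1 : 0 <= t) by (apply U; exact P0).
  assert (B2 : t <= L) by (apply Lb; intros x [Hx _]; lra).
  assert (Pt : P t).
  { destruct B1 as [B1| <-]; [|exact P0].
    (* The supremum itself is reached: the local statement for the reversed curve covers a left
       neighbourhood of t. *)
    destruct (RL_all F (mtrans B) L (fun s => gam (L - s)) (L - t) G (EC_rev _ _ _ _ H) ltac:(lra)) as (d & Hd & RLd).
    set (d' := Rmin d t). assert (Hd' : 0 < d') by (apply Rmin_pos; lra).
    assert (NU : exists r, P r /\ t - d' < r).
    { apply NNPP; intros Hn. assert (t <= t - d'); [|lra]. apply Lb. intros r Hr.
      apply Rnot_lt_le; intros ?. apply Hn. exists r; auto. }
    destruct NU as (r & Pr & Hr). assert (r <= t) by (apply U; auto).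
    destruct H0 as [Hlt| <-]; [|exact Pr]. destruct Pr as [Hr0 Wr].
    split; [lra|]. replace t with (r + (t - r)) at 2 by ring.
    apply (Wd_chain F gam 0 r t); [apply S; lra | exact Wr |].
    assert (Dd : d' <= d) by apply Rmin_l.
    specialize (RLd (L - r) ltac:(lra) ltac:(lra)).
    replace (L - (L - t)) with t in RLd by ring. replace (L - (L - r)) with r in RLd by ring.
    apply Wd_trans in RLd. rewrite mtrans_mul, mtrans_inv in RLd.
    replace (L - r - (L - t)) with (t - r) in RLd by ring. exact RLd. }
  destruct B2 as [B2| ->]; [|apply Pt].
  exfalso. destruct (RL_all F B L gam t G H ltac:(lra)) as (d & Hd & RLd).
  set (r := Rmin (t + d) L). assert (t < r) by (unfold r; apply Rmin_glb_lt; lra).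
  assert (r <= t + d) by apply Rmin_l. assert (r <= L) by apply Rmin_r.
  assert (P r); [|assert (r <= t) by (apply U; auto); lra].
  split; [lra|]. replace r with (t + (r - t)) at 2 by ring.
  apply (Wd_chain F gam 0 t r); [apply S; lra | apply Pt | apply RLd; lra].
Qed.

(* Optimality of a word [w] with respect to the penalised cost [cost - mtr (Gm h)], written with
   [B = h0 Gm] so that it restricts to factors of [w]. *)
Definition OptW (F : frame) (B : M3) (w : list factor) : Prop :=
  nnw w /\ forall w', nnw w' ->
    mtr (mmul B (mmul (wp F w') (mtrans (wp F w)))) <= mtr B + wc F w' - wc F w.

(** The minimiser in the closure turns out to be an actual word. From here on curves disappear, and
    all conditions are stated for words. *)
Lemma penalised_minimum F Gm : gframe F -> exists w,
  lword F w /\ OptW F (mmul (wp F w) Gm) w /\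
  forall w', nnw w' -> wc F w - mtr (mmul Gm (wp F w)) <= wc F w' - mtr (mmul Gm (wp F w')).
Proof.
  intros G. destruct (K_minimizer F Gm G) as (h0 & c0 & K0 & Hmin).
  assert (W : Wd F h0 c0).
  { destruct (K_ge0 _ _ _ G K0) as [c0p| <-].
    - destruct (K_curve F h0 c0 G K0 c0p) as (gam & S & E0 & E1 & KK).
      assert (C : EC F (mmul h0 Gm) c0 gam).
      { constructor.
        - intros; apply S; lra.
        - intros; apply KK; auto.
        - intros s t E e Hs Ht HK.
          pose proof (KK 0 s ltac:(lra) ltac:(lra)) as A1. rewrite E0, mtrans_1, mmul_1l in A1.
          pose proof (KK t c0 ltac:(lra) ltac:(lra)) as A2. rewrite E1 in A2.
          pose proof (K_mul _ _ _ _ _ A1 (K_mul _ _ _ _ _ HK A2)) as A3.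
          specialize (Hmin _ _ A3).
          rewrite (mtr_mulC h0 Gm).
          replace (mtr (mmul (mmul h0 Gm) (mmul (gam s) (mmul E (mtrans (gam t)))))) with
            (mtr (mmul Gm (mmul (gam s) (mmul E (mmul (mtrans (gam t)) h0))))); [lra|].
          rewrite (mmul_assoc h0), (mtr_mulC h0). rewrite !mmul_assoc. reflexivity. }
      pose proof (curve_word F _ c0 gam G C c0p) as R. rewrite E0, E1, mtrans_1, mmul_1l in R. exact R.
    - rewrite (K_0 F h0 G K0). apply Wd_nil. }
  destruct W as (w & W1 & W2 & W3 & W4). exists w. split; auto.
  assert (MIN : forall w', nnw w' -> wc F w - mtr (mmul Gm (wp F w)) <= wc F w' - mtr (mmul Gm (wp F w'))).
  { intros w' Hw'. specialize (Hmin _ _ (K_word F w' Hw')). rewrite W3, W4. lra. }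
  split; auto. split; auto. intros w' Hw'. specialize (MIN w' Hw').
  rewrite (mtr_mulC (wp F w) Gm).
  replace (mtr (mmul (mmul (wp F w) Gm) (mmul (wp F w') (mtrans (wp F w))))) with (mtr (mmul Gm (wp F w'))); [lra|].
  rewrite (mmul_assoc (wp F w)), (mtr_mulC (wp F w)), !mmul_assoc, SO3_linv, mmul_1r by apply wp_SO3.
  reflexivity.
Qed.

(** * First-order conditions for optimal words *)

(** B as seen after the factor P: [vee (mconj B P)] is the momentum there. A tail of an optimal word
    is optimal for this matrix, so matrices serve as states of the word, with coordinates [sx],
    [sy], [sz]. *)
Definition mconj (B P : M3) : M3 := mmul (mmul (mtrans P) B) P.
Definition sx (F : frame) (B : M3) : R := dot (vee B) (fX F).
Definition sy (F : frame) (B : M3) : R := dot (vee B) (fY F).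
Definition sz (F : frame) (B : M3) : R := dot (vee B) (fN F).

Lemma mconj_mul B P Q : mconj B (mmul P Q) = mconj (mconj B P) Q.
Proof. unfold mconj. rewrite mtrans_mul, !mmul_assoc. reflexivity. Qed.
Lemma mtr_mconj B P : inSO3 P -> mtr (mconj B P) = mtr B.
Proof. apply mtr_conj. Qed.
Lemma mtr_conj_mul B P E : mtr (mmul B (mmul P (mmul E (mtrans P)))) = mtr (mmul (mconj B P) E).
Proof.
  unfold mconj. rewrite <- !mmul_assoc, (mtr_mulC _ (mtrans P)), <- !mmul_assoc. reflexivity.
Qed.

Lemma OptW_eq F B w1 w2 : nnw w2 -> wp F w1 = wp F w2 -> wc F w2 <= wc F w1 ->
  OptW F B w1 -> OptW F B w2.
Proof.
  intros N2 E1 E2 [N1 H]. split; auto. intros w' Hw'. rewrite <- E1. specialize (H w' Hw'). lra.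
Qed.

Lemma OptW_window F B w1 w2 w3 : OptW F B (w1 ++ w2 ++ w3) -> OptW F (mconj B (wp F w1)) w2.
Proof.
  intros [N H]. apply nnw_app in N. destruct N as [N1 N]. apply nnw_app in N. destruct N as [N2 N3].
  split; auto. intros w' Hw'.
  assert (N' : nnw (w1 ++ w' ++ w3)) by (apply nnw_app; split; auto; apply nnw_app; auto).
  specialize (H _ N'). rewrite !wp_app, !wc_app in H.
  rewrite mtr_mconj by apply wp_SO3.
  replace (mtr (mmul (mconj B (wp F w1)) (mmul (wp F w') (mtrans (wp F w2))))) with
    (mtr (mmul B (mmul (mmul (wp F w1) (mmul (wp F w') (wp F w3))) (mtrans (mmul (wp F w1) (mmul (wp F w2) (wp F w3))))))); [lra|].
  rewrite <- mtr_conj_mul. do 2 f_equal. rewrite !mtrans_mul, !mmul_assoc. f_equal. f_equal.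
  rewrite <- (mmul_assoc (wp F w3)), (SO3_rinv _ (wp_SO3 F w3)), mmul_1l. reflexivity.
Qed.

Lemma OptW_tail F B f w : OptW F B (f :: w) -> OptW F (mconj B (rot (fst f) (fv F (snd f)))) w.
Proof.
  intros H. pose proof (OptW_window F B [f] w []) as W. rewrite app_nil_r in W. specialize (W H).
  rewrite wp_cons in W. change (wp F []) with mid3 in W. rewrite mmul_1r in W. exact W.
Qed.
Lemma OptW_init F B w1 w2 : OptW F B (w1 ++ w2) -> OptW F B w1.
Proof.
  intros H. pose proof (OptW_window F B [] w1 w2 H) as W. change (wp F []) with mid3 in W.
  unfold mconj in W. rewrite mtrans_1, mmul_1l, mmul_1r in W. exact W.
Qed.

Lemma OptW_sym s F B w : OptW F B w -> OptW (symF s F) B (symw s w).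
Proof.
  intros [N H]. split; [apply nnw_sym; auto|]. intros w' Hw'.
  specialize (H (symw s w') (nnw_sym s w' Hw')).
  assert (E : forall v, wp F (symw s v) = wp (symF s F) v).
  { intros v. rewrite <- (symF_inv s F) at 1. apply wp_sym. }
  assert (E' : forall v, wc F (symw s v) = wc (symF s F) v).
  { intros v. rewrite <- (symF_inv s F) at 1. apply wc_sym. }
  rewrite E, E' in H. rewrite wp_sym, wc_sym. exact H.
Qed.

Lemma OptW_rev F B w : OptW F B w -> OptW F (mtrans (mconj B (wp F w))) (wrev w).
Proof.
  intros [N H]. split; [apply nnw_wrev; auto|]. intros w' Hw'.
  specialize (H (wrev w') (nnw_wrev w' Hw')). rewrite wp_wrev, wc_wrev in H.
  rewrite wp_wrev, wc_wrev, mtrans_inv, mtr_trans, mtr_mconj by apply wp_SO3.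
  set (P := wp F w) in *. set (V := wp F w') in *.
  assert (SP : inSO3 P) by apply wp_SO3.
  replace (mtr (mmul (mtrans (mconj B P)) (mmul V P))) with (mtr (mmul B (mmul (mtrans V) (mtrans P)))); [lra|].
  unfold mconj. rewrite <- (mtr_trans (mmul (mtrans _) _)). rewrite !mtrans_mul, !mtrans_inv.
  rewrite (mtr_mulC (mmul (mtrans P) (mtrans V))). rewrite !mmul_assoc, mtr_mulC.
  rewrite !mmul_assoc, <- (mmul_assoc P), (SO3_rinv P SP), mmul_1l, mtr_mulC, mmul_assoc. reflexivity.
Qed.

Lemma wc_cons F f w : wc F (f :: w) = fst f * ucost F (snd f) + wc F w.
Proof. reflexivity. Qed.

Lemma OptW_insert F B w a b : OptW F B w -> dot (vee B) (fv F (a, b)) <= ucost F (a, b).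
Proof.
  intros [N H]. apply first_order. exists 1. split; [lra|]. intros e He.
  specialize (H ((e, (a, b)) :: w)). rewrite wp_cons, wc_cons in H. simpl fst in H; simpl snd in H.
  rewrite mmul_assoc, (SO3_rinv _ (wp_SO3 F w)), mmul_1r in H.
  assert (nnw ((e, (a, b)) :: w)) by (constructor; [simpl; lra | auto]). specialize (H H0). lra.
Qed.

Lemma OptW_bd F B w : OptW F B w -> Rabs (sx F B) <= kx F /\ Rabs (sy F B) <= ky F.
Proof.
  intros H. unfold sx, sy.
  pose proof (OptW_insert F B w 1 0 H) as P1. pose proof (OptW_insert F B w (-1) 0 H) as P2.
  pose proof (OptW_insert F B w 0 1 H) as P3. pose proof (OptW_insert F B w 0 (-1) H) as P4.
  rewrite dot_fv in *. unfold ucost in *; simpl in *.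
  rewrite Rabs_R0, ?Rabs_R1 in *. rewrite (Rabs_left (-1)) in P2, P4 by lra.
  split; apply Rabs_le; lra.
Qed.

Lemma OptW_letter F B t a b w : OptW F B ((t, (a, b)) :: w) -> 0 < t ->
  dot (vee B) (fv F (a, b)) = ucost F (a, b).
Proof.
  intros H Ht. apply Rle_antisym; [eapply OptW_insert; eauto|].
  destruct H as [N H]. inversion N as [|f' w'' N1 N2]; subst.
  assert (Q : dot (vee B) (vneg (fv F (a, b))) <= - ucost F (a, b)).
  { apply first_order. exists t. split; auto. intros e He.
    specialize (H ((t - e, (a, b)) :: w)). rewrite !wp_cons, !wc_cons in H. simpl fst in H; simpl snd in H.
    assert (N' : nnw ((t - e, (a, b)) :: w)) by (constructor; [simpl; lra | auto]). specialize (H N').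
    replace (t - e) with (- e + t) in H by ring. rewrite rot_add, mtrans_mul in H.
    rewrite !mmul_assoc, <- (mmul_assoc (wp F w)), (SO3_rinv _ (wp_SO3 F w)), mmul_1l in H.
    rewrite (SO3_rinv _ (rot_SO3 t _)), mmul_1r in H. rewrite rot_vneg. lra. }
  unfold vneg in Q. rewrite dot_scaler in Q. lra.
Qed.

Lemma OptW_split F B s t ab w : 0 <= s -> 0 <= t -> OptW F B ((s + t, ab) :: w) ->
  OptW F B ((s, ab) :: (t, ab) :: w).
Proof.
  intros Hs Ht H. pose proof (proj1 H) as N. inversion N; subst.
  apply (OptW_eq F B ((s + t, ab) :: w)); auto.
  - constructor; [auto | constructor; auto].
  - rewrite !wp_cons. simpl fst; simpl snd. rewrite rot_add, mmul_assoc. reflexivity.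
  - rewrite !wc_cons. simpl fst; simpl snd. lra.
Qed.

Lemma rot_period t v : v <> mkV 0 0 0 -> rot (t - 2 * PI / vnorm v) v = rot t v.
Proof.
  intros H. pose proof (vnorm_pos v H). unfold rot.
  rewrite <- (rot_unit_2pi (t * vnorm v)). f_equal. field. lra.
Qed.

(** A rotation by more than pi equals the opposite rotation by the complementary angle, which costs
    the same per unit of time; past a full turn, the turn is simply removed. *)
Lemma OptW_le_pi F B t a b w : gframe F -> OptW F B ((t, (a, b)) :: w) -> 0 < ucost F (a, b) ->
  fv F (a, b) <> mkV 0 0 0 -> t * vnorm (fv F (a, b)) <= PI.
Proof.
  intros G [N H] U V. pose proof (vnorm_pos _ V) as n0. set (n := vnorm (fv F (a, b))) in *.
  inversion N as [|f' w'' N1 N2]; subst. simpl in N1.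
  apply Rnot_lt_le; intros Hlt. pose proof PI_RGT_0 as Pi.
  assert (TR : forall t' ab, 0 <= t' -> rot t' (fv F ab) = rot t (fv F (a, b)) -> ucost F ab = ucost F (a, b) -> t <= t').
  { intros t' ab Ht' E EU. specialize (H ((t', ab) :: w)).
    assert (N' : nnw ((t', ab) :: w)) by (constructor; auto). specialize (H N').
    rewrite !wp_cons, !wc_cons in H. simpl fst in H; simpl snd in H. rewrite E, EU in H.
    rewrite SO3_rinv, mmul_1r in H by (apply SO3_mul; [apply rot_SO3 | apply wp_SO3]).
    apply Rmult_le_reg_r with (ucost F (a, b)); auto. lra. }
  assert (PP : 0 < 2 * PI / n) by (apply Rdiv_lt_0_compat; lra).
  destruct (Rle_dec t (2 * PI / n)) as [h|h].
  - assert (t <= 2 * PI / n - t).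
    { apply (TR (2 * PI / n - t) (- a, - b)); [lra | |].
      - rewrite fv_neg, rot_vneg. replace (- (2 * PI / n - t)) with (t - 2 * PI / n) by ring. apply rot_period; auto.
      - unfold ucost; simpl. rewrite !Rabs_Ropp. reflexivity. }
    assert (t * n <= (2 * PI / n - t) * n) by (apply Rmult_le_compat_r; lra).
    replace ((2 * PI / n - t) * n) with (2 * PI - t * n) in H1 by (field; lra). lra.
  - assert (t <= t - 2 * PI / n); [|lra].
    apply (TR (t - 2 * PI / n) (a, b)); [lra | apply rot_period; auto | reflexivity].
Qed.

Lemma vee_mconj B t v : vee (mconj B (rot t v)) = mv (mtrans (rot t v)) (vee B).
Proof. apply vee_conj, rot_SO3. Qed.

(** The momentum is moved by transposed rotations, so the right derivative of its pairing with u at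
    0 is [- dot (mv (skew v) l) u]; it cannot be positive where the bound k is attained. *)
Lemma deriv_le l v u k t : 0 < t -> dot l u = k ->
  (forall s, 0 <= s <= t -> dot (mv (mtrans (rot s v)) l) u <= k) -> 0 <= dot (mv (skew v) l) u.
Proof.
  intros Ht E H.
  assert (BD : exists p, 0 < p /\ forall A r, mbd A r -> Rabs (dot (mv A l) u) <= p * r).
  { set (m := 1 + Rabs (vx l) + Rabs (vy l) + Rabs (vz l)). set (m' := 1 + Rabs (vx u) + Rabs (vy u) + Rabs (vz u)).
    pose proof (Rabs_pos (vx l)); pose proof (Rabs_pos (vy l)); pose proof (Rabs_pos (vz l)).
    pose proof (Rabs_pos (vx u)); pose proof (Rabs_pos (vy u)); pose proof (Rabs_pos (vz u)).
    exists (9 * (m * m')). split; [unfold m, m'; nra|]. intros A r HA.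
    replace (9 * (m * m') * r) with (9 * (r * m * m')) by ring. apply dot_mv_bd; auto; unfold m, m'; lra. }
  destruct BD as (p & Hp & BD). set (n := vnorm v).
  enough (- dot (mv (skew v) l) u <= 0) by lra.
  apply (le_eps _ _ (p * (4 * (n * n)) * Rmin 1 t)).
  { pose proof (vnorm_ge0 v). apply Rmult_le_pos; [|left; apply Rmin_pos; lra]. apply Rmult_le_pos; [lra|]. unfold n. nra. }
  intros e He. set (q := e * Rmin 1 t).
  assert (Q : 0 < q <= t).
  { unfold q. pose proof (Rmin_l 1 t); pose proof (Rmin_r 1 t). assert (0 < Rmin 1 t) by (apply Rmin_pos; lra). split; nra. }
  specialize (H q ltac:(lra)).
  pose proof (BD _ _ (mbd_trans _ _ (rot_near2 q v ltac:(lra)))) as N. fold n in N.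
  replace (dot (mv (mtrans (msub (rot q v) (madd mid3 (mscale q (skew v))))) l) u) with
    (dot (mv (mtrans (rot q v)) l) u - dot l u + q * dot (mv (skew v) l) u) in N
    by (generalize (rot q v); intros; mring).
  match type of N with Rabs ?x <= _ => pose proof (Rle_abs (- x)) as Q'; rewrite Rabs_Ropp in Q' end.
  apply Rmult_le_reg_l with q; [lra|].
  replace (q * (0 + p * (4 * (n * n)) * Rmin 1 t * e)) with (p * (4 * (q * n * (q * n)))) by (unfold q; ring).
  assert (0 <= p * (4 * (q * n * (q * n)))) by (apply Rmult_le_pos; nra). nra.
Qed.

Lemma OptW_inside F B t ab w s : OptW F B ((t, ab) :: w) -> 0 <= s <= t ->
  OptW F (mconj B (rot s (fv F ab))) ((t - s, ab) :: w).
Proof.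
  intros H Hs. replace t with (s + (t - s)) in H by ring.
  apply OptW_split in H; try lra. apply OptW_tail in H. exact H.
Qed.

(** The momentum may not leave the rectangle: on each side the derivatives x' = -b z and y' = a z
    must not point outwards. *)
Lemma OptW_start F B t a b w : gframe F -> OptW F B ((t, (a, b)) :: w) -> 0 < t ->
  (sx F B = kx F -> 0 <= b * sz F B) /\ (sx F B = - kx F -> b * sz F B <= 0) /\
  (sy F B = ky F -> a * sz F B <= 0) /\ (sy F B = - ky F -> 0 <= a * sz F B).
Proof.
  intros G H Ht. destruct (skew_pair F (vee B) a b G) as (SX & SY & _).
  assert (BD : forall s, 0 <= s <= t -> Rabs (dot (mv (mtrans (rot s (fv F (a, b)))) (vee B)) (fX F)) <= kx F
     /\ Rabs (dot (mv (mtrans (rot s (fv F (a, b)))) (vee B)) (fY F)) <= ky F).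
  { intros s Hs. pose proof (OptW_bd _ _ _ (OptW_inside F B t (a, b) w s H Hs)) as Q.
    unfold sx, sy in Q. rewrite vee_mconj in Q. exact Q. }
  assert (NG : forall A l u, dot (mv A l) (vneg u) = - dot (mv A l) u) by (clear; mring).
  assert (NG' : forall l u, dot l (vneg u) = - dot l u) by (clear; mring).
  unfold sx, sy, sz. repeat split; intros E.
  - rewrite <- SX. apply (deriv_le _ _ _ (kx F) t); auto. intros s Hs. destruct (BD s Hs) as [Q _].
    eapply Rle_trans; [apply Rle_abs | exact Q].
  - assert (0 <= dot (mv (skew (fv F (a, b))) (vee B)) (vneg (fX F))).
    { apply (deriv_le _ _ _ (kx F) t); auto; [rewrite NG', E; ring|]. intros s Hs. destruct (BD s Hs) as [Q _].
      rewrite NG. eapply Rle_trans; [apply Rle_abs | rewrite Rabs_Ropp; exact Q]. }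
    rewrite NG, SX in H0. lra.
  - assert (0 <= dot (mv (skew (fv F (a, b))) (vee B)) (fY F)).
    { apply (deriv_le _ _ _ (ky F) t); auto. intros s Hs. destruct (BD s Hs) as [_ Q].
      eapply Rle_trans; [apply Rle_abs | exact Q]. }
    rewrite SY in H0. lra.
  - assert (0 <= dot (mv (skew (fv F (a, b))) (vee B)) (vneg (fY F))).
    { apply (deriv_le _ _ _ (ky F) t); auto; [rewrite NG', E; ring|]. intros s Hs. destruct (BD s Hs) as [_ Q].
      rewrite NG. eapply Rle_trans; [apply Rle_abs | rewrite Rabs_Ropp; exact Q]. }
    rewrite NG, SY in H0. lra.
Qed.

(* Time reversal composed with [Nu] keeps the letters, reverses their order and negates z. *)
Lemma OptW_revnu F B w : OptW F B w ->
  OptW (symF Nu F) (mtrans (mconj B (wp F w))) (rev w).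
Proof.
  intros H. apply OptW_rev, (OptW_sym Nu) in H.
  replace (rev w) with (symw Nu (wrev w)); auto.
  unfold symw, wrev. rewrite map_map. rewrite <- (map_id (rev w)) at 2. apply map_ext.
  intros [t [a b]]. unfold fneg; simpl. rewrite !Ropp_involutive. reflexivity.
Qed.

Lemma state_revnu F B : sx (symF Nu F) (mtrans B) = sx F B /\ sy (symF Nu F) (mtrans B) = sy F B /\
  sz (symF Nu F) (mtrans B) = - sz F B.
Proof.
  unfold sx, sy, sz, fN. rewrite vee_trans. simpl. generalize (vee B) (fX F) (fY F). clear.
  intros; repeat split; mring.
Qed.

Lemma wp_single F t ab : wp F [(t, ab)] = rot t (fv F ab).
Proof. rewrite wp_cons. apply mmul_1r. Qed.

Lemma OptW_end F B t a b w : gframe F -> OptW F B ((t, (a, b)) :: w) -> 0 < t ->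
  let B' := mconj B (rot t (fv F (a, b))) in
  (sx F B' = kx F -> b * sz F B' <= 0) /\ (sx F B' = - kx F -> 0 <= b * sz F B') /\
  (sy F B' = ky F -> 0 <= a * sz F B') /\ (sy F B' = - ky F -> a * sz F B' <= 0).
Proof.
  intros G H Ht B'. apply (OptW_init F B [(t, (a, b))] w) in H. apply OptW_revnu in H. simpl rev in H.
  rewrite wp_single in H. fold B' in H.
  destruct (state_revnu F B') as (E1 & E2 & E3).
  pose proof (OptW_start _ _ _ _ _ _ (gframe_sym Nu F G) H Ht) as (Q1 & Q2 & Q3 & Q4).
  rewrite E1, E2, E3 in *. simpl in *.
  repeat split; intros E; [specialize (Q1 E) | specialize (Q2 E) | specialize (Q3 E) | specialize (Q4 E)]; lra.
Qed.

(** * Higher-order conditions *)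

(** The first nonvanishing coefficient is positive and e is chosen so small that the later terms
    take at most half of it; j records its order. *)
Lemma pos_expansion (Fn : R -> M3) B M1 M2 M3' j d : Ex3 Fn M1 M2 M3' -> 0 < d ->
  mtr (mmul B M1) = 0 ->
  (j = 2%nat /\ 0 < mtr (mmul B M2)) \/ (j = 3%nat /\ mtr (mmul B M2) = 0 /\ 0 < mtr (mmul B M3')) ->
  exists e, 0 < e <= d /\ mtr B < mtr (mmul B (Fn e)).
Proof.
  intros (M & d' & Hd' & H) Hd E1 Hj. destruct (mbd_exists B) as (r & Hr & Br).
  set (c2 := mtr (mmul B M2)) in *. set (c3 := mtr (mmul B M3')) in *.
  set (m := 9 * (r * Rabs M)). assert (m0 : 0 <= m) by (unfold m; pose proof (Rabs_pos M); nra).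
  assert (LB : forall e, 0 <= e <= d' -> mtr B + e * e * c2 + e * e * e * c3 - m * (e * e * e * e) <= mtr (mmul B (Fn e))).
  { intros e He. specialize (H e He).
    assert (0 <= e * e * e * e) by (assert (0 <= e * e) by nra; nra).
    apply (mbd_le _ _ (Rabs M * (e * e * e * e))) in H; [|apply Rmult_le_compat_r; auto; apply Rle_abs].
    pose proof (mtr_mul_bd _ _ _ _ Br H) as T. rewrite msub_tr in T. unfold poly3 in T.
    rewrite !mmul_addr, !mmul_scaler, !mtr_add, !mtr_scale, mmul_1r, E1 in T. fold c2 c3 in T.
    match type of T with Rabs ?x <= _ => pose proof (Rle_abs (- x)) as Q'; rewrite Rabs_Ropp in Q' end.
    unfold m. lra. }
  destruct Hj as [[_ P2]|(_ & Z2 & P3)].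
  - set (q := Rabs c3 + m + 1). assert (q0 : 0 < q) by (unfold q; pose proof (Rabs_pos c3); lra).
    set (e := Rmin (Rmin d d') (c2 / (2 * q))).
    assert (e0 : 0 < e) by (repeat apply Rmin_pos; try lra; apply Rdiv_lt_0_compat; lra).
    assert (e1 : e <= d) by (eapply Rle_trans; [apply Rmin_l | apply Rmin_l]).
    assert (e2 : e <= d') by (eapply Rle_trans; [apply Rmin_l | apply Rmin_r]).
    assert (e3 : e * q <= c2 / 2).
    { apply Rle_trans with (c2 / (2 * q) * q); [apply Rmult_le_compat_r; [lra | apply Rmin_r]|]. apply Req_le; field; lra. }
    exists e. split; [lra|]. specialize (LB e ltac:(lra)).
    pose proof (Rle_abs (- c3)) as A3. rewrite Rabs_Ropp in A3.
    assert (E2 : 0 < e * e) by nra.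
    assert (- (e * c3) + m * (e * e) <= e * q) by (unfold q; assert (m * (e * e) <= m * e) by (apply Rmult_le_compat_l; nra); nra).
    assert (0 < e * e * (c2 + e * c3 - m * (e * e))) by (apply Rmult_lt_0_compat; lra). lra.
  - set (e := Rmin (Rmin d d') (c3 / (2 * (m + 1)))).
    assert (e0 : 0 < e) by (repeat apply Rmin_pos; try lra; apply Rdiv_lt_0_compat; lra).
    assert (e1 : e <= d) by (eapply Rle_trans; [apply Rmin_l | apply Rmin_l]).
    assert (e2 : e <= d') by (eapply Rle_trans; [apply Rmin_l | apply Rmin_r]).
    assert (e3 : e * (m + 1) <= c3 / 2).
    { apply Rle_trans with (c3 / (2 * (m + 1)) * (m + 1)); [apply Rmult_le_compat_r; [lra | apply Rmin_r]|]. apply Req_le; field; lra. }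
    exists e. split; [lra|]. specialize (LB e ltac:(lra)). rewrite Z2 in LB.
    assert (0 < e * e * e) by (apply Rmult_lt_0_compat; nra).
    assert (0 < e * e * e * (c3 - m * e)) by (apply Rmult_lt_0_compat; lra). lra.
Qed.

(* exp([W]) exp(-[P]) exp(-[R]) with W = P + R is exp([D]) with
   D = [P,R]/2 + ([R,[P,R]] - [P,[P,R]])/12 + [W,[P,R]]/4 up to fourth order. *)
Lemma corner_cut B P R mu d : vee B = vscale mu (vadd P R) -> 0 < mu -> cross P R <> mkV 0 0 0 -> 0 < d ->
  exists e, 0 < e <= d /\
    mtr B < mtr (mmul B (mmul (rot e (vadd P R)) (mmul (rot e (vneg P)) (rot e (vneg R))))).
Proof.
  intros HB Hmu Hc Hd. set (W := vadd P R).
  pose proof (Ex3_mul _ _ _ _ _ _ _ _ (Ex3_rot W) (Ex3_mul _ _ _ _ _ _ _ _ (Ex3_rot (vneg P)) (Ex3_rot (vneg R)))) as E.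
  eapply (pos_expansion _ B _ _ _ 3); [exact E | exact Hd | |].
  - replace (madd _ _) with (mscale 0 mid3) by (unfold W; clear; mring).
    rewrite mmul_scaler, mtr_scale; ring.
  - right. split; auto. set (N := cross P R).
    assert (NN : 0 < dot N N).
    { pose proof (vnorm_pos N Hc). rewrite <- vnorm_sq. nra. }
    assert (P1 : dot P N = 0) by (unfold N; clear; mring).
    assert (P2 : dot R N = 0) by (unfold N; clear; mring).
    split.
    + match goal with |- mtr (mmul B ?M) = 0 => replace M with (skew (vscale (/2) N)) end.
      * rewrite mtr_skew, HB. replace (dot _ _) with (mu / 2 * (dot P N + dot R N)) by (generalize N; clear; intros; destruct P, R, N; unfold dot, vscale, vadd; simpl; field).
        rewrite P1, P2; ring.
      * unfold N, W. clear. destruct P, R. apply M3_eq; cbn; field.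
    + match goal with |- 0 < mtr (mmul B ?M) =>
        replace M with (skew (vadd (vscale (/12) (cross (vadd R (vneg P)) N)) (vscale (/4) (cross W N)))) end.
      * rewrite mtr_skew, HB. fold W.
        replace (dot (vscale mu W) (vadd (vscale (/ 12) (cross (vadd R (vneg P)) N)) (vscale (/ 4) (cross W N))))
          with (mu / 6 * dot N N) by (unfold W, N; clear; destruct P, R; unfold dot, vscale, vadd, vneg, cross; simpl; field).
        apply Rmult_lt_0_compat; lra.
      * unfold N, W. clear. destruct P, R. apply M3_eq; cbn; field.
Qed.

(* A complete half loop, along which the momentum changes sign, can be shortened at its end:
   the common direction of momentum commutes past the half loop up to sign. *)
Lemma half_loop_end F B t1 ab1 t2 ab2 t3 ab3 w al be mu : gframe F ->
  OptW F B ((t1, ab1) :: (t2, ab2) :: (t3, ab3) :: w) -> 0 < t2 -> 0 < t3 -> 0 < al -> 0 < be -> 0 < mu ->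
  let abW := (al * fst ab2 + be * fst ab3, al * snd ab2 + be * snd ab3) in
  ucost F abW = al * ucost F ab2 + be * ucost F ab3 ->
  vee (mconj B (wp F [(t1, ab1); (t2, ab2)])) = vscale mu (fv F abW) ->
  vee B = vscale (- mu) (fv F abW) ->
  cross (fv F ab2) (fv F ab3) <> mkV 0 0 0 -> False.
Proof.
  intros G [N H] H2 H3 Hal Hbe Hmu abW EU V1 V0 HC.
  inversion N as [|f1 w1 N1 N']; subst. inversion N' as [|f2 w2 N2 N'']; subst. inversion N'' as [|f3 w3 N3 N4]; subst.
  simpl in N1, N2, N3.
  set (h := wp F [(t1, ab1); (t2, ab2)]) in *. assert (Sh : inSO3 h) by apply wp_SO3.
  set (W := fv F abW) in *. set (P := vscale al (fv F ab2)). set (R := vscale be (fv F ab3)).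
  assert (EW : W = vadd P R).
  { unfold W, abW, P, R, fv, fvec; simpl. generalize (fX F) (fY F) (fst ab2) (snd ab2) (fst ab3) (snd ab3). clear. mring. }
  (* The momentum is -mu W before the half loop and mu W after it; since h transports it, h reverses
     W. *)
  assert (HW : mv (mtrans h) W = vneg W).
  { pose proof (vee_conj h B Sh) as Q. fold (mconj B h) in Q. rewrite V1, V0, mv_scale in Q.
    assert (Q' : vscale (/ mu) (vscale mu W) = vscale (/ mu) (vscale (- mu) (mv (mtrans h) W))) by (rewrite Q; reflexivity).
    replace (vscale (/ mu) (vscale mu W)) with W in Q' by (destruct W; unfold vscale; simpl; f_equal; field; lra).
    replace (vscale (/ mu) (vscale (- mu) (mv (mtrans h) W))) with (vneg (mv (mtrans h) W)) in Q'
      by (destruct (mv (mtrans h) W); unfold vneg, vscale; simpl; f_equal; field; lra).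
    rewrite Q' at 2. generalize (mv (mtrans h) W). mring. }
  assert (CR : cross P R <> mkV 0 0 0).
  { intros E. apply HC.
    assert (E' : vscale (/ (al * be)) (cross P R) = cross (fv F ab2) (fv F ab3)).
    { unfold P, R. destruct (fv F ab2), (fv F ab3); unfold cross, vscale; simpl; f_equal; field; split; lra. }
    rewrite <- E', E. mring. }
  set (d := Rmin (t2 / al) (t3 / be)).
  assert (Hd : 0 < d) by (apply Rmin_pos; apply Rdiv_lt_0_compat; auto).
  rewrite EW in V1.
  destruct (corner_cut (mconj B h) P R mu d V1 Hmu CR Hd) as (e & He & Hlt).
  assert (d1 : e * al <= t2).
  { apply Rle_trans with (t2 / al * al); [apply Rmult_le_compat_r; [lra|] | apply Req_le; field; lra].
    eapply Rle_trans; [apply He | apply Rmin_l]. }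
  assert (d2 : e * be <= t3).
  { apply Rle_trans with (t3 / be * be); [apply Rmult_le_compat_r; [lra|] | apply Req_le; field; lra].
    eapply Rle_trans; [apply He | apply Rmin_r]. }
  (* A letter -W is put in front and exactly its cost is taken off the second and third letters.
     Slid through h it becomes W, so that the factors of [corner_cut] appear at the junction. *)
  set (w' := (e, (- fst abW, - snd abW)) :: (t1, ab1) :: (t2 - e * al, ab2) :: (t3 - e * be, ab3) :: w).
  assert (Nw : nnw w') by (repeat (constructor; [simpl; lra|]); auto).
  specialize (H w' Nw).
  assert (CO : wc F w' = wc F ((t1, ab1) :: (t2, ab2) :: (t3, ab3) :: w)).
  { unfold w'. rewrite !wc_cons.
    assert (U : ucost F (- fst abW, - snd abW) = ucost F abW) by (unfold ucost; simpl; rewrite !Rabs_Ropp; reflexivity).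
    cbn [fst snd]. rewrite U, EU. ring. }
  assert (PR : mmul (wp F w') (mtrans (wp F ((t1, ab1) :: (t2, ab2) :: (t3, ab3) :: w))) =
     mmul h (mmul (mmul (rot e (vadd P R)) (mmul (rot e (vneg P)) (rot e (vneg R)))) (mtrans h))).
  { change ((t1, ab1) :: (t2, ab2) :: (t3, ab3) :: w) with ([(t1, ab1); (t2, ab2)] ++ ((t3, ab3) :: w)).
    rewrite wp_app. fold h. unfold w'. rewrite wp_cons. cbn [fst snd].
    replace (fv F (- fst abW, - snd abW)) with (vneg W) by (rewrite fv_neg; reflexivity).
    assert (Eh : wp F ((t1, ab1) :: (t2 - e * al, ab2) :: (t3 - e * be, ab3) :: w) =
      mmul h (mmul (rot e (vneg P)) (mmul (rot e (vneg R)) (wp F ((t3, ab3) :: w))))).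
    { unfold h. rewrite !wp_cons. cbn [fst snd]. change (wp F []) with mid3. rewrite mmul_1r.
      unfold P, R. rewrite !rot_vneg.
      replace (t2 - e * al) with (t2 + - (e * al)) by ring. replace (t3 - e * be) with (- (e * be) + t3) by ring.
      rewrite !rot_add.
      assert (SC : forall a v, 0 < a -> rot (- e) (vscale a v) = rot (- (e * a)) v).
      { intros a v Ha. rewrite rot_vscale by auto. f_equal. ring. }
      rewrite !SC by auto. rewrite !mmul_assoc. reflexivity. }
    rewrite Eh, <- mmul_assoc.
    assert (SL : mmul (rot e (vneg W)) h = mmul h (rot e W)).
    { replace W with (mv (mtrans h) (vneg W)) at 2.
      - rewrite rot_comm_through by auto. rewrite <- mv_mul, (SO3_rinv h Sh), mv_1. reflexivity.
      - replace (mv (mtrans h) (vneg W)) with (vneg (mv (mtrans h) W)) by (generalize h W; clear; mring). rewrite HW. generalize W; clear; mring. }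
    rewrite SL, <- EW, mtrans_mul, !mmul_assoc.
    rewrite <- (mmul_assoc (wp F ((t3, ab3) :: w))), (SO3_rinv _ (wp_SO3 F _)), mmul_1l. reflexivity. }
  rewrite PR, mtr_conj_mul, CO in H. rewrite mtr_mconj in Hlt by auto. lra.
Qed.

Lemma flowX F B t : gframe F ->
  let B' := mconj B (rot t (fX F)) in
  sx F B' = sx F B /\
  sy F B' = cc F * sx F B + (sy F B - cc F * sx F B) * cos t + sz F B * sin t /\
  sz F B' = sz F B * cos t - (sy F B - cc F * sx F B) * sin t.
Proof. intros G B'. unfold B', sx, sy, sz. rewrite vee_mconj. apply mv_rotX_dotY; auto. Qed.

Lemma sx_sym s F B : sx (symF s F) B = match s with Nu => - sx F B | Rho => sx F B | Vs => sy F B end.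
Proof. destruct s; try reflexivity. unfold sx; simpl. generalize (fX F) (vee B). mring. Qed.
Lemma sy_sym s F B : sy (symF s F) B = match s with Nu | Rho => - sy F B | Vs => sx F B end.
Proof. destruct s; try reflexivity; unfold sy; simpl; generalize (fY F) (vee B); mring. Qed.
Lemma sz_sym s F B : sz (symF s F) B = match s with Nu => sz F B | _ => - sz F B end.
Proof. destruct s; unfold sz, fN; simpl; generalize (fX F) (fY F) (vee B); mring. Qed.

Lemma flowY F B t : gframe F ->
  let B' := mconj B (rot t (fY F)) in
  sy F B' = sy F B /\
  sx F B' = cc F * sy F B + (sx F B - cc F * sy F B) * cos t - sz F B * sin t /\
  sz F B' = sz F B * cos t + (sx F B - cc F * sy F B) * sin t.
Proof.
  intros G B'. pose proof (flowX (symF Vs F) B t (gframe_sym Vs F G)) as H. cbv zeta in H.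
  change (fX (symF Vs F)) with (fY F) in H. fold B' in H.
  rewrite !sx_sym, !sy_sym, !sz_sym, !cc_sym in H. cbn iota in H. lra.
Qed.

Lemma fv_m10 F : fv F (-1, 0) = vneg (fX F).
Proof. unfold fv, fvec; simpl. generalize (fX F) (fY F); mring. Qed.
Lemma fv_0m1 F : fv F (0, -1) = vneg (fY F).
Proof. unfold fv, fvec; simpl. generalize (fX F) (fY F); mring. Qed.

Definition comb (F : frame) (p q r : R) : V3 :=
  vadd (vscale p (fX F)) (vadd (vscale q (fY F)) (vscale r (fN F))).

Lemma comb_rotX F p q r t : gframe F ->
  mv (rot t (fX F)) (comb F p q r) =
  comb F (p + q * cc F * (1 - cos t) + r * sin t * cc F) (q * cos t - r * sin t) (q * sin t + r * cos t).
Proof.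
  intros [H1 H2 _ _ _ _]. rewrite (rot_unit_eq t (fX F) H1), mv_rot_unit. generalize (cos t) (sin t); intros C S.
  unfold comb, cc, fN. destruct (fX F) as [x1 x2 x3], (fY F) as [y1 y2 y3].
  unfold dot in *; simpl in *.
  assert (Hx : x3 * x3 = 1 - x1 * x1 - x2 * x2) by lra.
  apply V3_eq; cbn; ring [Hx].
Qed.
Lemma comb_rotY F p q r t : gframe F ->
  mv (rot t (fY F)) (comb F p q r) =
  comb F (p * cos t + r * sin t) (q + p * cc F * (1 - cos t) - r * sin t * cc F) (- p * sin t + r * cos t).
Proof.
  intros G. pose proof (comb_rotX (symF Vs F) q p (- r) t (gframe_sym Vs F G)) as H.
  change (fX (symF Vs F)) with (fY F) in H. rewrite cc_sym in H.
  assert (E : forall a b c, comb (symF Vs F) a b c = comb F b a (- c)).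
  { intros. unfold comb, fN; simpl. generalize (fX F) (fY F); mring. }
  rewrite !E in H. rewrite Ropp_involutive in H. rewrite H. f_equal; ring.
Qed.
Lemma comb_triple F l p q r p' q' r' : gframe F ->
  dot l (cross (comb F p q r) (comb F p' q' r')) =
  ((p * r' - r * p') * cc F + (q * r' - r * q')) * dot l (fX F)
  + (- (p * r' - r * p') - (q * r' - r * q') * cc F) * dot l (fY F)
  + (p * q' - q * p') * dot l (fN F).
Proof.
  intros [H1 H2 _ _ _ _]. unfold comb, cc, fN. destruct (fX F) as [x1 x2 x3], (fY F) as [y1 y2 y3], l as [l1 l2 l3].
  unfold dot in *; simpl in *.
  assert (Hx : x3 * x3 = 1 - x1 * x1 - x2 * x2) by lra.
  assert (Hy : y3 * y3 = 1 - y1 * y1 - y2 * y2) by lra.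
  ring [Hx Hy].
Qed.
Lemma comb_scale F a p q r : vscale a (comb F p q r) = comb F (a * p) (a * q) (a * r).
Proof. unfold comb. generalize (fX F) (fY F) (fN F). mring. Qed.
Lemma comb_add F p q r p' q' r' : vadd (comb F p q r) (comb F p' q' r') = comb F (p + p') (q + q') (r + r').
Proof. unfold comb. generalize (fX F) (fY F) (fN F). mring. Qed.
Lemma comb_X F : fX F = comb F 1 0 0.
Proof. unfold comb. generalize (fX F) (fY F) (fN F). mring. Qed.
Lemma comb_Y F : fY F = comb F 0 1 0.
Proof. unfold comb. generalize (fX F) (fY F) (fN F). mring. Qed.

Lemma rot_vscale_any t a v : rot t (vscale a v) = rot (t * a) v.
Proof.
  destruct (Rtotal_order a 0) as [h|[->|h]].
  - replace (vscale a v) with (vneg (vscale (- a) v)) by mring.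
    rewrite rot_vneg, rot_vscale by lra. f_equal; ring.
  - replace (vscale 0 v) with (mkV 0 0 0) by mring. rewrite rot_vec0, Rmult_0_r, rot_0. reflexivity.
  - apply rot_vscale; auto.
Qed.

(** By the Baker-Campbell-Hausdorff formula the second-order term is half the sum of the brackets of
    v_i and v_j over i < j. Those with v5 cancel, as v5 is minus the sum S of the others and S x S =
    0. *)
Lemma second_order B v1 v2 v3 v4 v5 d : vadd v1 (vadd v2 (vadd v3 (vadd v4 v5))) = mkV 0 0 0 -> 0 < d ->
  0 < dot (vee B) (vadd (cross v1 v2) (vadd (cross v1 v3) (vadd (cross v1 v4)
       (vadd (cross v2 v3) (vadd (cross v2 v4) (cross v3 v4)))))) ->
  exists e, 0 < e <= d /\ mtr B < mtr (mmul B (mmul (rot e v1) (mmul (rot e v2) (mmul (rot e v3) (mmul (rot e v4) (rot e v5)))))).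
Proof.
  intros H0 Hd HQ.
  assert (E5 : v5 = vneg (vadd v1 (vadd v2 (vadd v3 v4)))).
  { destruct v1, v2, v3, v4, v5; unfold vadd, vneg, vscale in *; simpl in *. injection H0; intros. f_equal; lra. }
  clear H0. subst v5.
  pose proof (Ex3_mul _ _ _ _ _ _ _ _ (Ex3_rot v1) (Ex3_mul _ _ _ _ _ _ _ _ (Ex3_rot v2)
    (Ex3_mul _ _ _ _ _ _ _ _ (Ex3_rot v3) (Ex3_mul _ _ _ _ _ _ _ _ (Ex3_rot v4)
       (Ex3_rot (vneg (vadd v1 (vadd v2 (vadd v3 v4))))))))) as E.
  eapply (pos_expansion _ B _ _ _ 2); [exact E | exact Hd | |].
  - replace (madd _ _) with (mscale 0 mid3) by (clear; mring).
    rewrite mmul_scaler, mtr_scale; ring.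
  - left. split; auto.
    match goal with |- 0 < mtr (mmul B ?M) => replace M with (skew (vscale (/2) (vadd (cross v1 v2) (vadd (cross v1 v3) (vadd (cross v1 v4)
       (vadd (cross v2 v3) (vadd (cross v2 v4) (cross v3 v4)))))))) end.
    + rewrite mtr_skew, dot_scaler. lra.
    + clear. destruct v1, v2, v3, v4. apply M3_eq; cbn; field.
Qed.

Lemma trig_unique u v C S C' S' p q : 0 < u * u + v * v ->
  u * C - v * S = p -> v * C + u * S = q -> u * C' - v * S' = p -> v * C' + u * S' = q -> C = C' /\ S = S'.
Proof.
  intros H H1 H2 H3 H4.
  assert (E1 : (u * u + v * v) * (C - C') = 0).
  { replace ((u * u + v * v) * (C - C')) with
      (u * ((u * C - v * S) - (u * C' - v * S')) + v * ((v * C + u * S) - (v * C' + u * S'))) by ring.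
    rewrite H1, H2, H3, H4. ring. }
  assert (E2 : (u * u + v * v) * (S - S') = 0).
  { replace ((u * u + v * v) * (S - S')) with
      (u * ((v * C + u * S) - (v * C' + u * S')) - v * ((u * C - v * S) - (u * C' - v * S'))) by ring.
    rewrite H1, H2, H3, H4. ring. }
  apply Rmult_integral in E1, E2. lra.
Qed.

Lemma quad_pos A Bq C : (0 < A \/ 0 < C) \/ ((A < 0 \/ C < 0) /\ A * C < Bq * Bq) ->
  exists s t, 0 < A * (s * s) + 2 * Bq * (s * t) + C * (t * t).
Proof.
  intros [[H|H]|[[H|H] D]].
  - exists 1, 0. lra.
  - exists 0, 1. lra.
  - exists Bq, (- A). nra.
  - exists (- C), Bq. nra.
Qed.

(** Up to a positive factor the second variation of [five_cycle]; S and T are the tangents of half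
    the full X- and Y-times. *)
Lemma cycle_form_pos c S T : 0 < S -> 0 < T -> c <> 0 -> -1 < c * S * T < 1 ->
  let m := c * S * T in exists s t,
  0 < (1 + m) * (S * S * T * T - 1 - 2 * m - m * (T * T) - m * (S * S)) * (s * s)
      + 2 * ((1 + S * S) * (1 - m * m)) * (s * t)
      + (1 - m) * (S * S * T * T - 1 + 2 * m + m * (T * T) + m * (S * S)) * (t * t).
Proof.
  intros HS HT Hc Hm m. fold m in Hm. apply quad_pos.
  assert (ST : 0 < S * T) by nra.
  assert (mne : m <> 0).
  { unfold m. replace (c * S * T) with (c * (S * T)) by ring. apply Rmult_integral_contrapositive_currified; lra. }
  assert (S2 : 0 < S * S) by nra. assert (T2 : 0 < T * T) by nra.
  (* For S T >= 1 one diagonal coefficient is positive, which one depends on the sign of m; c <> 0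
     is needed at equality. For S T < 1 a diagonal coefficient is negative, but the form is
     indefinite: the square of the mixed coefficient minus the product of the diagonal ones is (1 -
     m^2) D, with D > 0. *)
  destruct (Rle_dec 1 (S * S * T * T)) as [h|h].
  - left. destruct (Rle_dec 0 m) as [hm|hm].
    + right. assert (0 < m) by lra. apply Rmult_lt_0_compat; [lra|]. nra.
    + left. apply Rmult_lt_0_compat; [lra|]. nra.
  - right. split.
    + destruct (Rle_dec 0 m) as [hm|hm].
      * left. assert (0 < m) by lra. assert (0 < (1 + m) * - (S * S * T * T - 1 - 2 * m - m * (T * T) - m * (S * S))).
        { apply Rmult_lt_0_compat; [lra|]. nra. } lra.
      * right. assert (0 < (1 - m) * - (S * S * T * T - 1 + 2 * m + m * (T * T) + m * (S * S))).
        { apply Rmult_lt_0_compat; [lra|]. nra. } lra.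
    + set (D := (1 + T * T) * (S * S) * (2 + S * S - S * S * (T * T) + 2 * (m * m) + c * c * (T * T) * (3 + T * T))).
      assert (HD : 0 < D).
      { unfold D. apply Rmult_lt_0_compat; [nra|]. assert (0 <= c * c * (T * T) * (3 + T * T)) by (apply Rmult_le_pos; [apply Rmult_le_pos; nra|nra]).
        nra. }
      assert (E : (1 + S * S) * (1 - m * m) * ((1 + S * S) * (1 - m * m))
        - (1 + m) * (S * S * T * T - 1 - 2 * m - m * (T * T) - m * (S * S)) * ((1 - m) * (S * S * T * T - 1 + 2 * m + m * (T * T) + m * (S * S)))
        = (1 - m * m) * D) by (unfold D, m; ring).
      assert (0 < (1 - m * m) * D) by (apply Rmult_lt_0_compat; nra). lra.
Qed.

(** Changes of the times are carried to the junction after the first letter: the first letter is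
    changed at its end, the others at their beginnings, and each change becomes a rotation about the
    axis transported through the letters in between. *)
Lemma vary_five F B t1 t2 t3 t4 t5 U1 U2 U3 U4 U5 w x1 x2 x3 x4 x5 e : gframe F ->
  OptW F B ((t1, U1) :: (t2, U2) :: (t3, U3) :: (t4, U4) :: (t5, U5) :: w) ->
  0 <= t1 + e * x1 -> 0 <= t2 + e * x2 -> 0 <= t3 + e * x3 -> 0 <= t4 + e * x4 -> 0 <= t5 + e * x5 ->
  x1 * ucost F U1 + x2 * ucost F U2 + x3 * ucost F U3 + x4 * ucost F U4 + x5 * ucost F U5 = 0 ->
  let R2 := rot t2 (fv F U2) in let R3 := rot t3 (fv F U3) in let R4 := rot t4 (fv F U4) in
  let B1 := mconj B (rot t1 (fv F U1)) in
  mtr (mmul B1 (mmul (rot e (vscale x1 (fv F U1))) (mmul (rot e (vscale x2 (fv F U2)))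
    (mmul (rot e (vscale x3 (mv R2 (fv F U3)))) (mmul (rot e (vscale x4 (mv R2 (mv R3 (fv F U4)))))
       (rot e (vscale x5 (mv R2 (mv R3 (mv R4 (fv F U5))))))))))) <= mtr B1.
Proof.
  intros G [N H] P1 P2 P3 P4 P5 HC R2 R3 R4 B1.
  set (w' := (t1 + e * x1, U1) :: (t2 + e * x2, U2) :: (t3 + e * x3, U3) :: (t4 + e * x4, U4) :: (t5 + e * x5, U5) :: w).
  assert (Nw : nnw w).
  { do 5 (inversion N as [|? ? _ N']; subst; clear N; rename N' into N). exact N. }
  assert (N' : nnw w') by (repeat (constructor; [assumption|]); exact Nw).
  specialize (H w' N').
  assert (EC' : wc F w' = wc F ((t1, U1) :: (t2, U2) :: (t3, U3) :: (t4, U4) :: (t5, U5) :: w)).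
  { unfold w'. rewrite !wc_cons. cbn [fst snd].
    transitivity (t1 * ucost F U1 + (t2 * ucost F U2 + (t3 * ucost F U3 + (t4 * ucost F U4 + (t5 * ucost F U5 + wc F w))))
      + e * (x1 * ucost F U1 + x2 * ucost F U2 + x3 * ucost F U3 + x4 * ucost F U4 + x5 * ucost F U5)); [ring|].
    rewrite HC. ring. }
  rewrite EC' in H. clear EC'.
  set (R1 := rot t1 (fv F U1)) in *. set (R5 := rot t5 (fv F U5)).
  assert (S1 : inSO3 R1) by apply rot_SO3. assert (S2 : inSO3 R2) by apply rot_SO3.
  assert (S3 : inSO3 R3) by apply rot_SO3. assert (S4 : inSO3 R4) by apply rot_SO3. assert (S5 : inSO3 R5) by apply rot_SO3.
  unfold B1. rewrite mtr_mconj by auto.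
  replace (mtr (mmul (mconj B R1) _)) with
    (mtr (mmul B (mmul (wp F w') (mtrans (wp F ((t1, U1) :: (t2, U2) :: (t3, U3) :: (t4, U4) :: (t5, U5) :: w)))))); [lra|].
  rewrite <- mtr_conj_mul. do 2 f_equal.
  unfold w'. rewrite !wp_cons. cbn [fst snd]. fold R1 R2 R3 R4 R5.
  rewrite !rot_vscale_any.
  assert (A1 : rot (t1 + e * x1) (fv F U1) = mmul R1 (rot (e * x1) (fv F U1))) by apply rot_add.
  assert (A2 : forall t x V, rot (t + e * x) (fv F V) = mmul (rot (e * x) (fv F V)) (rot t (fv F V))).
  { intros. rewrite Rplus_comm. apply rot_add. }
  rewrite A1, !A2. fold R2 R3 R4 R5.
  rewrite <- !rot_conj by auto.
  rewrite !mtrans_mul. rewrite !mmul_assoc. do 3 f_equal.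
  repeat (match goal with
    | |- context [mmul (wp F w) (mmul (mtrans (wp F w)) ?X)] => rewrite <- (mmul_assoc (wp F w) (mtrans (wp F w)) X), (SO3_rinv _ (wp_SO3 F w)), mmul_1l
    | HS : inSO3 ?Q |- context [mmul ?Q (mmul (mtrans ?Q) ?X)] => rewrite <- (mmul_assoc Q (mtrans Q) X), (SO3_rinv _ HS), mmul_1l
    | HS : inSO3 ?Q |- context [mmul (mtrans ?Q) (mmul ?Q ?X)] => rewrite <- (mmul_assoc (mtrans Q) Q X), (SO3_linv _ HS), mmul_1l
    end). reflexivity.
Qed.

(* Some variation of the five times has zero first and positive second variation. *)
Lemma five_cycle F B t1 t2 t3 t4 t5 w a b : gframe F -> cc F <> 0 ->
  OptW F B ((t1, (1, 0)) :: (t2, (0, 1)) :: (t3, (-1, 0)) :: (t4, (0, -1)) :: (t5, (1, 0)) :: w) ->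
  0 < t1 -> 0 < t2 -> 0 < t3 -> 0 < t4 -> 0 < t5 -> 0 < a -> 0 < b ->
  let B1 := mconj B (rot t1 (fX F)) in let B2 := mconj B1 (rot t2 (fY F)) in
  let B3 := mconj B2 (rot t3 (vneg (fX F))) in let B4 := mconj B3 (rot t4 (vneg (fY F))) in
  sx F B1 = kx F -> sy F B1 = ky F -> sz F B1 = b ->
  sx F B2 = - kx F -> sy F B2 = ky F -> sz F B2 = a ->
  sx F B3 = - kx F -> sy F B3 = - ky F -> sz F B3 = b ->
  sx F B4 = kx F -> sy F B4 = - ky F -> sz F B4 = a -> False.
Proof.
  intros G Hc HO T1 T2 T3 T4 T5 Ha Hb B1 B2 B3 B4 x1 y1 z1 x2 y2 z2 x3 y3 z3 x4 y4 z4.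
  pose proof (gkx F G) as Kx. pose proof (gky F G) as Ky. set (c := cc F) in *.
  assert (QQ : b * b - a * a = 4 * c * kx F * ky F).
  { assert (Q1 : Qf c (sx F B1) (sy F B1) (sz F B1) = Qf c (sx F B2) (sy F B2) (sz F B2)).
    { unfold Qf, sx, sy, sz. rewrite <- !(gram F _ G). f_equal. unfold B2. rewrite vee_mconj.
      rewrite dot_SO3; auto. apply SO3_trans, rot_SO3. }
    rewrite x1, y1, z1, x2, y2, z2 in Q1. unfold Qf in Q1. lra. }
  (* All data become rational in S, T and c. Conservation gives b^2 - a^2 = 4 c kx ky, hence m = (b
     - a) / (a + b), P a = 1 - m and P b = 1 + m; T and S are the half-angle tangents of the Y- and
     X-times. *)
  set (P := 2 / (a + b)). assert (HP : 0 < P) by (apply Rdiv_lt_0_compat; lra).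
  set (T := kx F * P). set (S := ky F * P). set (m := c * S * T).
  assert (HT : 0 < T) by (unfold T; nra). assert (HS : 0 < S) by (unfold S; nra).
  assert (EkX : kx F = T / P) by (unfold T; field; lra). assert (EkY : ky F = S / P) by (unfold S; field; lra).
  assert (Em : m = (b - a) * P / 2).
  { unfold m, S, T. replace (c * (ky F * P) * (kx F * P)) with (4 * c * kx F * ky F * P * P / 4) by field.
    rewrite <- QQ. unfold P. field. lra. }
  assert (PE : (a + b) * P = 2) by (unfold P; field; lra).
  assert (Ea : a = (1 - m) / P) by (apply Rmult_eq_reg_r with P; [|lra]; replace ((1 - m) / P * P) with (1 - m) by (field; lra); lra).
  assert (Eb : b = (1 + m) / P) by (apply Rmult_eq_reg_r with P; [|lra]; replace ((1 + m) / P * P) with (1 + m) by (field; lra); lra).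
  assert (Hm : -1 < m < 1) by (assert (0 < a * P) by nra; assert (0 < b * P) by nra; lra).
  set (C2 := (1 - T * T) / (1 + T * T)). set (S2 := 2 * T / (1 + T * T)).
  set (C3 := (1 - S * S) / (1 + S * S)). set (S3 := 2 * S / (1 + S * S)).
  assert (DT : 1 + T * T <> 0) by nra. assert (DS : 1 + S * S <> 0) by nra.
  assert (TR2 : cos t2 = C2 /\ sin t2 = S2).
  { destruct (flowY F B1 t2 G) as (_ & FX & FZ). fold B2 c in FX, FZ. rewrite x1, y1, z1, x2 in FX. rewrite x1, y1, z1, z2 in FZ.
    apply (trig_unique (kx F - c * ky F) b _ _ _ _ (- kx F - c * ky F) a).
    - nra.
    - lra.
    - lra.
    - unfold C2, S2. rewrite Eb, EkX, EkY. unfold m. field. split; auto; lra.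
    - unfold C2, S2. rewrite Ea, Eb, EkX, EkY. unfold m. field. split; auto; lra. }
  assert (TR3 : cos t3 = C3 /\ sin t3 = S3).
  { pose proof (flowX F B2 (- t3) G) as (_ & FY & FZ). rewrite <- rot_vneg in FY, FZ. fold B3 c in FY, FZ.
    rewrite cos_neg, sin_neg, x2, y2, z2, y3 in FY. rewrite cos_neg, sin_neg, x2, y2, z2, z3 in FZ.
    apply (trig_unique (ky F + c * kx F) a _ _ _ _ (c * kx F - ky F) b).
    - nra.
    - lra.
    - lra.
    - unfold C3, S3. rewrite Ea, EkX, EkY. unfold m. field. split; auto; lra.
    - unfold C3, S3. rewrite Ea, Eb, EkX, EkY. unfold m. field. split; auto; lra. }
  assert (TR4 : cos t4 = C2 /\ sin t4 = S2).
  { pose proof (flowY F B3 (- t4) G) as (_ & FX & FZ). rewrite <- rot_vneg in FX, FZ. fold B4 c in FX, FZ.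
    rewrite cos_neg, sin_neg, x3, y3, z3, x4 in FX. rewrite cos_neg, sin_neg, x3, y3, z3, z4 in FZ.
    apply (trig_unique (kx F - c * ky F) b _ _ _ _ (- kx F - c * ky F) a).
    - nra.
    - lra.
    - lra.
    - unfold C2, S2. rewrite Eb, EkX, EkY. unfold m. field. split; auto; lra.
    - unfold C2, S2. rewrite Ea, Eb, EkX, EkY. unfold m. field. split; auto; lra. }
  destruct TR2 as [c2 s2]. destruct TR3 as [c3 s3]. destruct TR4 as [c4 s4].
  destruct (cycle_form_pos c S T HS HT Hc Hm) as (s & t & Hpos). cbv zeta in Hpos. fold m in Hpos.
  (* The vanishing first variation is the vector equation [SUM], three scalar equations for five
     changes of times. This is a two-parameter family of solutions with denominators cleared; it
     also leaves the cost unchanged ([CS]). *)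
  set (q1 := s * (S * (1 + T * T))).
  set (q2 := s * (T * (-1 + S * S - 2 * m)) + t * (T * (1 + S * S))).
  set (q3 := s * (S * (1 - T * T + 2 * m)) - t * (S * (1 - T * T - 2 * m))).
  set (q4 := - s * (T * (1 + S * S)) + t * (T * (1 - S * S - 2 * m))).
  set (q5 := - t * (S * (1 + T * T))).
  assert (EX3 : fv F (-1, 0) = comb F (-1) 0 0) by (rewrite fv_m10; unfold comb; generalize (fX F) (fY F) (fN F); clear; mring).
  assert (EX4 : fv F (0, -1) = comb F 0 (-1) 0) by (rewrite fv_0m1; unfold comb; generalize (fX F) (fY F) (fN F); clear; mring).
  assert (EX1 : fv F (1, 0) = comb F 1 0 0) by (rewrite fv_10; apply comb_X).
  assert (EX2 : fv F (0, 1) = comb F 0 1 0) by (rewrite fv_01; apply comb_Y).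
  set (R2 := rot t2 (fv F (0, 1))). set (R3 := rot t3 (fv F (-1, 0))). set (R4 := rot t4 (fv F (0, -1))).
  assert (MR2 : forall p q r, mv R2 (comb F p q r) = comb F (p * C2 + r * S2) (q + p * c * (1 - C2) - r * S2 * c) (- p * S2 + r * C2)).
  { intros. unfold R2. rewrite fv_01, comb_rotY, c2, s2 by auto. reflexivity. }
  assert (MR3 : forall p q r, mv R3 (comb F p q r) = comb F (p + q * c * (1 - C3) - r * S3 * c) (q * C3 + r * S3) (- q * S3 + r * C3)).
  { intros. unfold R3. rewrite fv_m10, rot_vneg, comb_rotX, cos_neg, sin_neg, c3, s3 by auto. fold c. f_equal; ring. }
  assert (MR4 : forall p q r, mv R4 (comb F p q r) = comb F (p * C2 - r * S2) (q + p * c * (1 - C2) + r * S2 * c) (p * S2 + r * C2)).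
  { intros. unfold R4. rewrite fv_0m1, rot_vneg, comb_rotY, cos_neg, sin_neg, c4, s4 by auto. fold c. f_equal; ring. }
  set (v1 := vscale q1 (fv F (1, 0))). set (v2 := vscale q2 (fv F (0, 1))).
  set (v3 := vscale q3 (mv R2 (fv F (-1, 0)))). set (v4 := vscale q4 (mv R2 (mv R3 (fv F (0, -1))))).
  set (v5 := vscale q5 (mv R2 (mv R3 (mv R4 (fv F (1, 0)))))).
  assert (W1 : v1 = comb F q1 0 0) by (unfold v1; rewrite EX1, comb_scale; f_equal; ring).
  assert (W2 : v2 = comb F 0 q2 0) by (unfold v2; rewrite EX2, comb_scale; f_equal; ring).
  set (p3 := - C2). set (r3 := - c * (1 - C2)). set (n3 := S2).
  assert (W3 : v3 = comb F (q3 * p3) (q3 * r3) (q3 * n3)).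
  { unfold v3. rewrite EX3, MR2, comb_scale. unfold p3, r3, n3. f_equal; ring. }
  set (p4 := - c * (1 - C3) * C2 + S3 * S2). set (r4 := - C3 - c * c * (1 - C3) * (1 - C2) - c * S3 * S2).
  set (n4 := c * (1 - C3) * S2 + S3 * C2).
  assert (W4 : v4 = comb F (q4 * p4) (q4 * r4) (q4 * n4)).
  { unfold v4. rewrite EX4, MR3, MR2, comb_scale. unfold p4, r4, n4. f_equal; ring. }
  assert (SUM : vadd v1 (vadd v2 (vadd v3 (vadd v4 v5))) = mkV 0 0 0).
  { unfold v5. rewrite EX1, MR4, MR3, MR2, comb_scale, W1, W2, W3, W4, !comb_add.
    transitivity (comb F 0 0 0); [|unfold comb; generalize (fX F) (fY F) (fN F); clear; mring].
    f_equal; unfold p3, r3, n3, p4, r4, n4, q1, q2, q3, q4, q5, m, C2, S2, C3, S3; field; auto. }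
  (* On this family the bracket sum is 2 S T / P times the form of [cycle_form_pos]. *)
  assert (QP : 0 < dot (vee B1) (vadd (cross v1 v2) (vadd (cross v1 v3) (vadd (cross v1 v4)
       (vadd (cross v2 v3) (vadd (cross v2 v4) (cross v3 v4))))))).
  { rewrite !dot_addr, W1, W2, W3, W4, !comb_triple by auto.
    fold (sx F B1) (sy F B1) (sz F B1). rewrite x1, y1, z1, Eb, EkX, EkY. fold c.
    match type of Hpos with 0 < ?E => match goal with |- 0 < ?X => replace X with (2 * S * T / P * E) end end.
    - apply Rmult_lt_0_compat; auto. apply Rdiv_lt_0_compat; auto. nra.
    - unfold p3, r3, n3, p4, r4, n4, q1, q2, q3, q4, m, C2, S2, C3, S3. field. repeat split; auto; lra. }
  set (qm := 1 + Rabs q1 + Rabs q2 + Rabs q3 + Rabs q4 + Rabs q5).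
  pose proof (Rabs_pos q1) as a1; pose proof (Rabs_pos q2) as a2; pose proof (Rabs_pos q3) as a3; pose proof (Rabs_pos q4) as a4; pose proof (Rabs_pos q5) as a5.
  set (tm := Rmin t1 (Rmin t2 (Rmin t3 (Rmin t4 t5)))).
  assert (tm0 : 0 < tm) by (repeat apply Rmin_pos; auto).
  assert (tm1 : tm <= t1) by apply Rmin_l.
  assert (tm2 : tm <= t2) by (eapply Rle_trans; [apply Rmin_r | apply Rmin_l]).
  assert (tm3 : tm <= t3) by (eapply Rle_trans; [apply Rmin_r | eapply Rle_trans; [apply Rmin_r | apply Rmin_l]]).
  assert (tm4 : tm <= t4) by (eapply Rle_trans; [apply Rmin_r | eapply Rle_trans; [apply Rmin_r | eapply Rle_trans; [apply Rmin_r | apply Rmin_l]]]).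
  assert (tm5 : tm <= t5) by (eapply Rle_trans; [apply Rmin_r | eapply Rle_trans; [apply Rmin_r | eapply Rle_trans; [apply Rmin_r | apply Rmin_r]]]).
  destruct (second_order B1 v1 v2 v3 v4 v5 (tm / qm) SUM) as (e & He & Hlt); auto.
  { apply Rdiv_lt_0_compat; unfold qm; lra. }
  assert (EQ : e * qm <= tm).
  { apply Rle_trans with (tm / qm * qm); [apply Rmult_le_compat_r; [unfold qm; lra | apply He]|]. apply Req_le; field; unfold qm; lra. }
  assert (BND : forall q, Rabs q <= qm -> - tm <= e * q).
  { intros q Hq. pose proof (Rle_abs (- q)) as A. rewrite Rabs_Ropp in A.
    assert (e * - q <= e * qm) by (apply Rmult_le_compat_l; lra). lra. }
  pose proof (vary_five F B t1 t2 t3 t4 t5 _ _ _ _ _ w q1 q2 q3 q4 q5 e G HO) as VF. cbv zeta in VF.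
  fold R2 R3 R4 in VF. fold v1 v2 v3 v4 v5 in VF. 
  assert (EB : mconj B (rot t1 (fv F (1, 0))) = B1) by (unfold B1; rewrite fv_10; reflexivity). rewrite EB in VF.
  assert (b1 : 0 <= t1 + e * q1) by (pose proof (BND q1 ltac:(unfold qm; lra)); lra).
  assert (b2 : 0 <= t2 + e * q2) by (pose proof (BND q2 ltac:(unfold qm; lra)); lra).
  assert (b3 : 0 <= t3 + e * q3) by (pose proof (BND q3 ltac:(unfold qm; lra)); lra).
  assert (b4 : 0 <= t4 + e * q4) by (pose proof (BND q4 ltac:(unfold qm; lra)); lra).
  assert (b5 : 0 <= t5 + e * q5) by (pose proof (BND q5 ltac:(unfold qm; lra)); lra).
  specialize (VF b1 b2 b3 b4 b5).
  assert (CS : q1 * ucost F (1, 0) + q2 * ucost F (0, 1) + q3 * ucost F (-1, 0) + q4 * ucost F (0, -1) + q5 * ucost F (1, 0) = 0).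
  { unfold ucost; simpl. rewrite Rabs_R0, Rabs_R1, (Rabs_left (-1)) by lra. rewrite EkX, EkY.
    unfold q1, q2, q3, q4, q5. field. lra. }
  specialize (VF CS). lra.
Qed.

(** * Labelled words *)

Definition fw (F : frame) (l : list (R * label)) : list factor :=
  map (fun p => (fst p, gcoef F (snd p))) l.
Definition lv (F : frame) (l : label) : V3 := fv F (gcoef F l).
Definition symp (s : sym) (p : R * label) : R * label := (fst p, sym_label s (snd p)).

Notation lX := (false, BX). Notation lXn := (true, BX).
Notation lY := (false, BY). Notation lYn := (true, BY).
Notation lWp := (false, BWp). Notation lWpn := (true, BWp).
Notation lWm := (false, BWm). Notation lWmn := (true, BWm).

Lemma gcoef_X F : gcoef F lX = (1, 0).
Proof. reflexivity. Qed.
Lemma gcoef_Y F : gcoef F lY = (0, 1).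
Proof. reflexivity. Qed.
Lemma gcoef_Xn F : gcoef F lXn = (-1, 0).
Proof. unfold gcoef, gbase; simpl. f_equal; ring. Qed.
Lemma gcoef_Yn F : gcoef F lYn = (0, -1).
Proof. unfold gcoef, gbase; simpl. f_equal; ring. Qed.
Lemma lv_X F : lv F lX = fX F. Proof. apply fv_10. Qed.
Lemma lv_Y F : lv F lY = fY F. Proof. apply fv_01. Qed.
Lemma lv_neg F n b : lv F (negb n, b) = vneg (lv F (n, b)).
Proof.
  unfold lv. assert (E : gcoef F (negb n, b) = (- fst (gcoef F (n, b)), - snd (gcoef F (n, b)))).
  { destruct n; unfold gcoef; simpl; rewrite ?Ropp_involutive; auto. destruct (gbase F b); reflexivity. }
  rewrite E, fv_neg, <- surjective_pairing. reflexivity.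
Qed.
Lemma lv_Xn F : lv F lXn = vneg (fX F). Proof. rewrite <- lv_X. apply (lv_neg F false). Qed.
Lemma lv_Yn F : lv F lYn = vneg (fY F). Proof. rewrite <- lv_Y. apply (lv_neg F false). Qed.

Lemma fw_sym s F l : fw (symF s F) (map (symp s) l) = symw s (fw F l).
Proof.
  unfold fw, symw. rewrite !map_map. apply map_ext. intros [t b]; simpl. rewrite gcoef_sym. reflexivity.
Qed.
Lemma lv_sym s F l : lv (symF s F) (sym_label s l) = lv F l.
Proof. unfold lv. rewrite gcoef_sym. apply fv_sym. Qed.
Lemma gcoef_Nu F l : gcoef (symF Nu F) l = gcoef F l.
Proof. unfold gcoef, gbase. rewrite cc_sym. reflexivity. Qed.
Lemma fw_Nu F l : fw (symF Nu F) l = fw F l.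
Proof. unfold fw. apply map_ext. intros; rewrite gcoef_Nu; reflexivity. Qed.
Lemma fw_rev F l : fw F (rev l) = rev (fw F l).
Proof. unfold fw. apply map_rev. Qed.
Lemma fw_app F l1 l2 : fw F (l1 ++ l2) = fw F l1 ++ fw F l2.
Proof. apply map_app. Qed.
Lemma fw_cons F t l r : fw F ((t, l) :: r) = (t, gcoef F l) :: fw F r.
Proof. reflexivity. Qed.

Lemma lword_fw F w : lword F w -> exists l, w = fw F l.
Proof.
  induction 1 as [|f w [lab E] _ [l ->]]; [exists []; reflexivity|].
  exists ((fst f, lab) :: l). rewrite fw_cons, <- E. destruct f; reflexivity.
Qed.

Definition sg (n : bool) (k : R) : R := if n then - k else k.
(** Where the momentum must be while a letter runs: on an edge for X and Y, at rest in a corner with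
    z = 0 for W_+ and W_-. It holds at both ends of a letter of positive time. *)
Definition Lst (F : frame) (l : label) (B : M3) : Prop :=
  let (n, b) := l in
  match b with
  | BX => sx F B = sg n (kx F)
  | BY => sy F B = sg n (ky F)
  | BWm => sx F B = sg n (kx F) /\ sy F B = sg n (ky F) /\ sz F B = 0
  | BWp => sx F B = sg n (kx F) /\ sy F B = sg (negb n) (ky F) /\ sz F B = 0
  end.

Lemma Lst_sym s F l B : Lst (symF s F) (sym_label s l) B -> Lst F l B.
Proof.
  destruct s, l as [[] []]; unfold Lst; cbn [sym_label negb]; rewrite ?sx_sym, ?sy_sym, ?sz_sym;
  cbn [symF kx ky sg]; intros; intuition lra.
Qed.

Lemma OptW_fw_sym s F B l : OptW F B (fw F l) -> OptW (symF s F) B (fw (symF s F) (map (symp s) l)).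
Proof. rewrite fw_sym. apply OptW_sym. Qed.

Lemma Wm_coef_pos F : gframe F -> 0 < kx F - ky F * cc F /\ 0 < ky F - kx F * cc F.
Proof.
  intros G. pose proof (gcy F G). pose proof (gcx F G). pose proof (Rle_abs (cc F)).
  pose proof (gkx F G). pose proof (gky F G). split; nra.
Qed.
Lemma Wp_coef_pos F : gframe F -> 0 < kx F + ky F * cc F /\ 0 < ky F + kx F * cc F.
Proof.
  intros G. pose proof (Wm_coef_pos _ (gframe_sym Rho F G)) as H. rewrite cc_sym in H. simpl in H. lra.
Qed.

Lemma label_start F B t l r : gframe F -> OptW F B (fw F ((t, l) :: r)) -> 0 < t -> Lst F l B.
Proof.
  assert (CX : forall F B t r, gframe F -> OptW F B (fw F ((t, lX) :: r)) -> 0 < t -> Lst F lX B).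
  { clear. intros F B t r G H Ht. rewrite fw_cons, gcoef_X in H.
    pose proof (OptW_letter _ _ _ _ _ _ H Ht) as E. rewrite dot_fv, ucost_10 in E. unfold Lst, sx; simpl. lra. }
  assert (CW : forall F B t r, gframe F -> OptW F B (fw F ((t, lWm) :: r)) -> 0 < t -> Lst F lWm B).
  { clear. intros F B t r G H Ht. destruct (Wm_coef_pos F G) as [Pu Pv].
    rewrite fw_cons in H. unfold gcoef, gbase in H; simpl in H.
    pose proof (OptW_letter _ _ _ _ _ _ H Ht) as E. destruct (OptW_bd _ _ _ H) as [Bx By].
    pose proof (OptW_start _ _ _ _ _ _ G H Ht) as (S1 & _ & S3 & _).
    set (u := kx F - ky F * cc F) in *. set (v := ky F - kx F * cc F) in *.
    rewrite dot_fv in E. unfold ucost in E; simpl in E. rewrite !Rabs_right in E by lra.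
    fold (sx F B) (sy F B) in E.
    pose proof (Rle_abs (sx F B)); pose proof (Rle_abs (sy F B)).
    assert (0 <= u * (kx F - sx F B)) by nra. assert (0 <= v * (ky F - sy F B)) by nra.
    assert (X : sx F B = kx F) by nra. assert (Y : sy F B = ky F) by nra.
    (* Both coefficients of W_- are positive, so the two boundary conditions bound z from both sides
       by 0. *)
    specialize (S1 X). specialize (S3 Y). unfold Lst; simpl. repeat split; auto. nra. }
  assert (C1 : forall F B t r b, gframe F -> OptW F B (fw F ((t, (false, b)) :: r)) -> 0 < t -> Lst F (false, b) B).
  { intros F0 B0 t0 r0 b G H Ht. destruct b.
    - eapply CX; eauto.
    - apply (Lst_sym Vs). eapply CX; eauto using gframe_sym. apply (OptW_fw_sym Vs) in H. exact H.
    - apply (Lst_sym Rho). eapply CW; eauto using gframe_sym. apply (OptW_fw_sym Rho) in H. exact H.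
    - eapply CW; eauto. }
  intros G H Ht. destruct l as [[] b]; [|eapply C1; eauto].
  apply (Lst_sym Nu). eapply C1; eauto using gframe_sym. apply (OptW_fw_sym Nu) in H. exact H.
Qed.

Lemma label_end F B t l r : gframe F -> OptW F B (fw F ((t, l) :: r)) -> 0 < t ->
  Lst F l (mconj B (rot t (lv F l))).
Proof.
  intros G H Ht. rewrite fw_cons in H. apply (OptW_init F B [_]) in H. apply OptW_revnu in H.
  rewrite wp_single in H. fold (lv F l) in H. set (B' := mconj B (rot t (lv F l))) in *.
  simpl rev in H. rewrite <- (gcoef_Nu F l) in H.
  pose proof (label_start _ _ _ _ [] (gframe_sym Nu F G) H Ht) as Q.
  destruct (state_revnu F B') as (E1 & E2 & E3).
  destruct l as [n []]; unfold Lst in *; rewrite ?E1, ?E2, ?E3 in Q; cbn [symF kx ky] in Q; auto; intuition lra.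
Qed.

(** * Words with the least number of letters *)

(** Comparing only words of equal product makes minimality hereditary to windows, symmetries and
    reversal. It rules out zero times and equal neighbours, and lets the merging of two W-letters be
    a contradiction although it does not lower the cost. *)
Definition Min (F : frame) (B : M3) (l : list (R * label)) : Prop :=
  OptW F B (fw F l) /\ forall l', nnw (fw F l') -> wp F (fw F l') = wp F (fw F l) ->
    wc F (fw F l') <= wc F (fw F l) -> (length l <= length l')%nat.

Lemma Min_window F B l1 l2 l3 : Min F B (l1 ++ l2 ++ l3) -> Min F (mconj B (wp F (fw F l1))) l2.
Proof.
  intros [H M]. split.
  - rewrite !fw_app in H. apply OptW_window in H. exact H.
  - intros l' N E C. specialize (M (l1 ++ l' ++ l3)).
    rewrite !fw_app, !wp_app, !wc_app, E in M. rewrite !length_app in M.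
    pose proof (proj1 H) as NN. rewrite !fw_app in NN. apply nnw_app in NN. destruct NN as [N1 NN]. apply nnw_app in NN.
    assert (length l1 + (length l2 + length l3) <= length l1 + (length l' + length l3))%nat; [|lia].
    apply M; auto; [|lra]. apply nnw_app; split; auto. apply nnw_app; tauto.
Qed.
Lemma Min_drop F B l1 l2 : Min F B (l1 ++ l2) -> Min F (mconj B (wp F (fw F l1))) l2.
Proof. intros H. apply (Min_window F B l1 l2 []). rewrite app_nil_r. exact H. Qed.
Lemma Min_init F B l1 l2 : Min F B (l1 ++ l2) -> Min F B l1.
Proof.
  intros H. pose proof (Min_window F B [] l1 l2 H) as W. simpl in W. change (wp F []) with mid3 in W.
  unfold mconj in W. rewrite mtrans_1, mmul_1l, mmul_1r in W. exact W.
Qed.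
Lemma Min_tail F B t l r : Min F B ((t, l) :: r) -> Min F (mconj B (rot t (lv F l))) r.
Proof.
  intros H. apply (Min_drop F B [(t, l)]) in H. rewrite fw_cons in H. simpl fw in H. rewrite wp_single in H. exact H.
Qed.
Lemma map_symp_inv s l : map (symp s) (map (symp s) l) = l.
Proof.
  rewrite map_map. rewrite <- (map_id l) at 2. apply map_ext. intros [t b]. unfold symp; simpl. rewrite sym_label_inv. reflexivity.
Qed.
Lemma nnw_fw_sym s F l : nnw (fw (symF s F) l) -> nnw (fw F (map (symp s) l)).
Proof.
  unfold nnw, fw. rewrite map_map, !Forall_map. apply Forall_impl. auto.
Qed.
Lemma Min_sym s F B l : Min F B l -> Min (symF s F) B (map (symp s) l).
Proof.
  intros [H M]. split; [apply OptW_fw_sym; auto|]. intros l' N E C. rewrite length_map.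
  rewrite fw_sym, wp_sym in E. rewrite fw_sym, wc_sym in C.
  assert (El : fw (symF s F) l' = symw s (fw F (map (symp s) l'))).
  { rewrite <- fw_sym, map_symp_inv. reflexivity. }
  specialize (M (map (symp s) l')). rewrite length_map in M. apply M.
  - apply nnw_fw_sym; auto.
  - rewrite El, wp_sym in E. exact E.
  - rewrite El, wc_sym in C. exact C.
Qed.
Lemma wp_revNu F w : wp (symF Nu F) (rev w) = mtrans (wp F w).
Proof.
  rewrite <- wp_wrev, <- (wp_sym Nu F (wrev w)). f_equal.
  unfold symw, wrev. rewrite map_map. rewrite <- (map_id (rev w)) at 1. apply map_ext.
  intros [t [a b]]. unfold fneg; simpl. rewrite !Ropp_involutive. reflexivity.
Qed.
Lemma wc_revNu F w : wc (symF Nu F) (rev w) = wc F w.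
Proof.
  rewrite <- (wc_wrev F w), <- (wc_sym Nu F (wrev w)). f_equal.
  unfold symw, wrev. rewrite map_map. rewrite <- (map_id (rev w)) at 1. apply map_ext.
  intros [t [a b]]. unfold fneg; simpl. rewrite !Ropp_involutive. reflexivity.
Qed.
Lemma Min_revnu F B l : Min F B l -> Min (symF Nu F) (mtrans (mconj B (wp F (fw F l)))) (rev l).
Proof.
  intros [H M]. split; [rewrite fw_Nu, fw_rev; apply OptW_revnu; auto|].
  intros l' N E C. rewrite length_rev. rewrite !fw_Nu in *.
  specialize (M (rev l')). rewrite length_rev in M. rewrite fw_rev in M. rewrite fw_rev, wp_revNu in E. rewrite fw_rev, wc_revNu in C.
  apply M.
  - apply Forall_rev; auto.
  - rewrite <- (mtrans_inv (wp F (rev (fw F l')))), <- wp_revNu, rev_involutive, E, mtrans_inv. reflexivity.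
  - rewrite <- wc_revNu, rev_involutive. exact C.
Qed.
Lemma Min_pos F B t l r : Min F B ((t, l) :: r) -> 0 < t.
Proof.
  intros [[N H] M]. inversion N as [|f w N1 N2]; subst. simpl in N1. destruct N1 as [|E]; auto. exfalso.
  specialize (M r). simpl length in M. assert (S (length r) <= length r)%nat; [|lia].
  rewrite fw_cons, wp_cons, wc_cons in M. cbn [fst snd] in M. rewrite <- E, rot_0, mmul_1l in M. apply M; auto; lra.
Qed.
Lemma Min_adj F B t1 t2 l r : Min F B ((t1, l) :: (t2, l) :: r) -> False.
Proof.
  intros [[N H] M]. inversion N as [|f w N1 N']; subst. inversion N' as [|f w N2 N3]; subst. simpl in N1, N2.
  specialize (M ((t1 + t2, l) :: r)). simpl length in M. assert (S (S (length r)) <= S (length r))%nat; [|lia].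
  rewrite !fw_cons, !wp_cons, !wc_cons in M. cbn [fst snd] in M. apply M.
  - constructor; auto; simpl; lra.
  - rewrite rot_add, mmul_assoc. reflexivity.
  - lra.
Qed.

Lemma lt_pi_X F B t r : gframe F -> OptW F B (fw F ((t, lX) :: r)) -> t <= PI.
Proof.
  intros G H. rewrite fw_cons, gcoef_X in H.
  pose proof (OptW_le_pi F B t 1 0 _ G H) as P. rewrite ucost_10, fv_10, (vnorm_unit _ (gX F G)) in P.
  assert (fX F <> mkV 0 0 0).
  { intros E. pose proof (gX F G) as Q. rewrite E in Q. unfold dot in Q; simpl in Q. lra. }
  specialize (P (gkx F G) H0). lra.
Qed.

(** * Corners of the momentum polygon *)

Lemma vec_ext F u v : gframe F -> dot u (fX F) = dot v (fX F) -> dot u (fY F) = dot v (fY F) ->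
  dot u (fN F) = dot v (fN F) -> u = v.
Proof.
  intros G H1 H2 H3. pose proof (gcc F G). set (d := vadd u (vneg v)).
  assert (D : forall w, dot d w = dot u w - dot v w) by (unfold d; clear; mring).
  pose proof (gram F d G) as E. rewrite !D, H1, H2, H3 in E.
  assert (Z : dot d d = 0).
  { apply Rmult_eq_reg_r with (1 - cc F * cc F); [|nra]. rewrite D, E. ring. }
  apply dot_self_0 in Z. unfold d in Z. destruct u, v; unfold vadd, vneg, vscale in Z; simpl in Z.
  injection Z; intros. f_equal; lra.
Qed.

Lemma fv_coords F a b : gframe F -> dot (fv F (a, b)) (fX F) = a + b * cc F /\
  dot (fv F (a, b)) (fY F) = a * cc F + b /\ dot (fv F (a, b)) (fN F) = 0.
Proof.
  intros [H1 H2 _ _ _ _]. unfold fv, fvec, cc, fN; simpl. repeat split.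
  - transitivity (a * dot (fX F) (fX F) + b * dot (fX F) (fY F)); [generalize (fX F) (fY F); mring | rewrite H1; ring].
  - transitivity (a * dot (fX F) (fY F) + b * dot (fY F) (fY F)); [generalize (fX F) (fY F); mring | rewrite H2; ring].
  - generalize (fX F) (fY F); mring.
Qed.

(** Expansion in the dual basis of X and Y. In the corner (kx, -ky, 0) the coefficients are those of
    W_+, so there the momentum itself is a positive multiple of W_+. *)
Lemma corner_vec F B : gframe F -> sz F B = 0 ->
  vee B = vscale (/ (1 - cc F * cc F)) (fv F (sx F B - cc F * sy F B, sy F B - cc F * sx F B)).
Proof.
  intros G Hz. pose proof (gcc F G). assert (D : 1 - cc F * cc F <> 0) by nra.
  assert (DS : forall a u v, dot (vscale a u) v = a * dot u v) by (clear; mring).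
  destruct (fv_coords F (sx F B - cc F * sy F B) (sy F B - cc F * sx F B) G) as (E1 & E2 & E3).
  apply (vec_ext F); auto; rewrite DS, ?E1, ?E2, ?E3.
  - fold (sx F B). field. auto.
  - fold (sy F B). field. auto.
  - fold (sz F B). rewrite Hz; ring.
Qed.

Lemma Qs_const F B P : gframe F -> inSO3 P ->
  Qf (cc F) (sx F (mconj B P)) (sy F (mconj B P)) (sz F (mconj B P)) = Qf (cc F) (sx F B) (sy F B) (sz F B).
Proof.
  intros G S. unfold Qf, sx, sy, sz. rewrite <- !(gram F _ G). f_equal.
  unfold mconj. rewrite (vee_conj P B S). apply dot_SO3, SO3_trans, S.
Qed.

Lemma N_nonzero F : gframe F -> fN F <> mkV 0 0 0.
Proof.
  intros G E. pose proof (gcc F G).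
  assert (Q : dot (fN F) (fN F) = 1 - cc F * cc F).
  { transitivity (dot (fX F) (fX F) * dot (fY F) (fY F) - cc F * cc F).
    - unfold fN, cc. generalize (fX F) (fY F); mring.
    - rewrite (gX F G), (gY F G). ring. }
  rewrite E in Q. unfold dot in Q; simpl in Q. nra.
Qed.

(** The reversed momentum has the direction -W_+, a positive combination of the last letter Y and
    the next letter -X; the combination also adds up the costs, so [half_loop_end] applies. *)
Lemma half_loop_turn F B t1 t2 t3 w : gframe F ->
  OptW F B ((t1, (1, 0)) :: (t2, (0, 1)) :: (t3, (-1, 0)) :: w) -> 0 < t2 -> 0 < t3 ->
  sx F B = kx F -> sy F B = - ky F -> sz F B = 0 ->
  vee (mconj B (wp F [(t1, (1, 0)); (t2, (0, 1))])) = vneg (vee B) -> False.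
Proof.
  intros G H H2 H3 X Y Z V. destruct (Wp_coef_pos F G) as [Pa Pb]. pose proof (gcc F G) as C.
  assert (D : 0 < 1 - cc F * cc F) by nra.
  pose proof (corner_vec F B G Z) as CV. rewrite X, Y in CV.
  assert (mu0 : 0 < / (1 - cc F * cc F)) by (apply Rinv_0_lt_compat; auto).
  apply (half_loop_end F B t1 (1, 0) t2 (0, 1) t3 (-1, 0) w (ky F + kx F * cc F) (kx F + ky F * cc F) (/ (1 - cc F * cc F))); auto.
  - unfold ucost; cbn [fst snd]. rewrite !Rmult_0_r, !Rmult_1_r, Rplus_0_l, Rplus_0_r, Rabs_R0, Rabs_R1.
    rewrite (Rabs_left (-1)) by lra. rewrite (Rabs_right (ky F + _)) by lra.
    replace ((kx F + ky F * cc F) * -1) with (- (kx F + ky F * cc F)) by ring. rewrite Rabs_Ropp, Rabs_right by lra. ring.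
  - rewrite V, CV. cbn [fst snd]. unfold fv, fvec; cbn [fst snd]. generalize (fX F) (fY F) (/ (1 - cc F * cc F)). mring.
  - rewrite CV. cbn [fst snd]. unfold fv, fvec; cbn [fst snd]. generalize (fX F) (fY F) (/ (1 - cc F * cc F)). mring.
  - intros E. apply (N_nonzero F G). rewrite fv_01, fv_m10 in E. rewrite <- E. unfold fN. generalize (fX F) (fY F). mring.
Qed.

(** Here the letters around the corner are parallel and cannot be combined to -W_+. But the half
    loop is an involution, hence equal to its inverse -Y, -X read backwards at the same cost; with
    it the letters at the corner are -X and Y. *)
Lemma half_loop_straight F B t1 t2 t3 w : gframe F ->
  OptW F B ((t1, (1, 0)) :: (t2, (0, 1)) :: (t3, (0, 1)) :: w) -> 0 < t1 -> 0 < t2 -> 0 < t3 ->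
  sx F B = kx F -> sy F B = - ky F -> sz F B = 0 ->
  vee (mconj B (wp F [(t1, (1, 0)); (t2, (0, 1))])) = vneg (vee B) -> False.
Proof.
  intros G H H1 H2 H3 X Y Z V.
  set (h := wp F [(t1, (1, 0)); (t2, (0, 1))]) in *. assert (Sh : inSO3 h) by apply wp_SO3.
  assert (Vn : vee B <> mkV 0 0 0).
  { intros E. unfold sx in X. rewrite E in X. unfold dot in X; simpl in X. pose proof (gkx F G). lra. }
  (* A rotation that reverses a nonzero vector is a half turn, hence symmetric. *)
  assert (SYM : h = mtrans h).
  { rewrite <- (mtrans_inv h) at 1. apply (SO3_involution (mtrans h) (vee B)); auto using SO3_trans.
    rewrite <- V. symmetry. unfold mconj. apply vee_conj; auto. }
  assert (WH : wp F [(t2, (0, -1)); (t1, (-1, 0))] = h).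
  { rewrite SYM. unfold h. rewrite !wp_cons. cbn [fst snd]. change (wp F []) with mid3.
    rewrite !mmul_1r, mtrans_mul, fv_m10, fv_0m1, fv_10, fv_01, !rot_vneg, !rot_opp. reflexivity. }
  assert (O : OptW F B ((t2, (0, -1)) :: (t1, (-1, 0)) :: (t3, (0, 1)) :: w)).
  { apply (OptW_eq F B ((t1, (1, 0)) :: (t2, (0, 1)) :: (t3, (0, 1)) :: w)); auto.
    - destruct H as [N _]. do 3 (inversion N as [|? ? ? N']; subst; clear N; rename N' into N).
      repeat (constructor; [simpl; lra|]). exact N.
    - change ((t1, (1, 0)) :: (t2, (0, 1)) :: (t3, (0, 1)) :: w) with ([(t1, (1, 0)); (t2, (0, 1))] ++ (t3, (0, 1)) :: w).
      change ((t2, (0, -1)) :: (t1, (-1, 0)) :: (t3, (0, 1)) :: w) with ([(t2, (0, -1)); (t1, (-1, 0))] ++ (t3, (0, 1)) :: w).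
      rewrite !wp_app, WH. reflexivity.
    - rewrite !wc_cons. cbn [fst snd]. unfold ucost; cbn [fst snd]. rewrite Rabs_R0, Rabs_R1, (Rabs_left (-1)) by lra. lra. }
  destruct (Wp_coef_pos F G) as [Pa Pb]. pose proof (gcc F G) as C.
  assert (D : 0 < 1 - cc F * cc F) by nra.
  pose proof (corner_vec F B G Z) as CV. rewrite X, Y in CV.
  assert (mu0 : 0 < / (1 - cc F * cc F)) by (apply Rinv_0_lt_compat; auto).
  apply (half_loop_end F B t2 (0, -1) t1 (-1, 0) t3 (0, 1) w (kx F + ky F * cc F) (ky F + kx F * cc F) (/ (1 - cc F * cc F))); auto.
  - unfold ucost; cbn [fst snd]. rewrite !Rmult_0_r, !Rmult_1_r, Rplus_0_l, Rplus_0_r, Rabs_R0, Rabs_R1.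
    rewrite (Rabs_left (-1)) by lra. rewrite (Rabs_right (ky F + _)) by lra.
    replace ((kx F + ky F * cc F) * -1) with (- (kx F + ky F * cc F)) by ring. rewrite Rabs_Ropp, Rabs_right by lra. ring.
  - rewrite WH, V, CV. cbn [fst snd]. unfold fv, fvec; cbn [fst snd]. generalize (fX F) (fY F) (/ (1 - cc F * cc F)). mring.
  - rewrite CV. cbn [fst snd]. unfold fv, fvec; cbn [fst snd]. generalize (fX F) (fY F) (/ (1 - cc F * cc F)). mring.
  - intros E. apply (N_nonzero F G). rewrite fv_01, fv_m10 in E.
    replace (fN F) with (vneg (cross (vneg (fX F)) (fY F))) by (unfold fN; generalize (fX F) (fY F); mring).
    rewrite E. mring.
Qed.

(** Stable under [Nu] and [Vs] only, since [Rho] negates [cc]; this is why the patterns with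
    W-letters come with the group of four symmetries. *)
Definition cf (F : frame) : Prop := gframe F /\ 0 < cc F.
Lemma cf_Nu F : cf F -> cf (symF Nu F).
Proof. intros [G C]. split; [apply gframe_sym; auto | rewrite cc_sym; auto]. Qed.
Lemma cf_Vs F : cf F -> cf (symF Vs F).
Proof. intros [G C]. split; [apply gframe_sym; auto | rewrite cc_sym; auto]. Qed.

Lemma cos_lt_1 t : 0 < t <= PI -> cos t < 1.
Proof. intros H. rewrite <- cos_0. apply cos_decreasing_1; lra. Qed.

Lemma Lst_sy F l B : gframe F -> Lst F l B -> snd l <> BX -> Rabs (sy F B) = ky F.
Proof.
  intros G H N. pose proof (gky F G). destruct l as [n []]; simpl in *; try congruence;
  destruct n; simpl in *; try (destruct H as (_ & H & _)); rewrite H; unfold Rabs; destruct Rcase_abs; lra.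
Qed.

(** An X-letter between two corners joins different ones. At its start z points inwards, so with t
    <= pi the term z sin t moves y away from the corner, and so does the factor cos t < 1 of the
    term y - c x. *)
Lemma X_interior F B t r : gframe F -> OptW F B (fw F ((t, lX) :: r)) -> 0 < t ->
  let B' := mconj B (rot t (lv F lX)) in
  Rabs (sy F B) = ky F -> Rabs (sy F B') = ky F ->
  (sy F B = - ky F /\ sy F B' = ky F /\ 0 <= sz F B /\ 0 <= sz F B') \/
  (sy F B = ky F /\ sy F B' = - ky F /\ sz F B <= 0 /\ sz F B' <= 0).
Proof.
  intros G H Ht B' Y0 Y1. pose proof (lt_pi_X _ _ _ _ G H) as Hpi.
  pose proof (label_start _ _ _ _ _ G H Ht) as X0. simpl in X0.
  rewrite fw_cons, gcoef_X in H.
  destruct (OptW_start _ _ _ _ _ _ G H Ht) as (_ & _ & S3 & S4).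
  pose proof (OptW_end _ _ _ _ _ _ G H Ht) as (_ & _ & E3 & E4). rewrite fv_10 in E3, E4. rewrite <- lv_X in E3, E4. fold B' in E3, E4.
  destruct (flowX F B t G) as (_ & FY & FZ). rewrite <- lv_X in FY, FZ. fold B' in FY, FZ. rewrite X0 in FY, FZ.
  pose proof (cos_lt_1 t ltac:(lra)) as C1. pose proof (sin_ge_0 t ltac:(lra) ltac:(lra)) as S0.
  destruct (Wm_coef_pos F G) as [_ U]. destruct (Wp_coef_pos F G) as [_ V].
  destruct (Rabs_cases _ _ Y0) as [h0|h0], (Rabs_cases _ _ Y1) as [h1|h1]; rewrite h0, h1 in *.
  - exfalso. specialize (S3 eq_refl). nra.
  - right. specialize (S3 eq_refl). specialize (E4 eq_refl). repeat split; lra.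
  - left. specialize (S4 eq_refl). specialize (E3 eq_refl). repeat split; lra.
  - exfalso. specialize (S4 eq_refl). nra.
Qed.

(** * Tails leaving a corner of type (kx, -ky, 0) *)

(** The time an X-letter takes from the corner (kx, -ky, 0) to y = ky, from c kx - (ky + c kx) cos t
    = ky. For the weights of the theorem [hX] and [hY] are the two hatted times. *)
Definition hX (F : frame) : R := acos ((cc F * kx F - ky F) / (cc F * kx F + ky F)).
Definition hY (F : frame) : R := hX (symF Vs F).

Lemma hX_spec F : cf F -> 0 < hX F < PI /\ cos (hX F) = (cc F * kx F - ky F) / (cc F * kx F + ky F) /\ 0 < sin (hX F).
Proof.
  intros [G C]. pose proof (gkx F G) as Kx. pose proof (gky F G) as Ky.
  destruct (Wp_coef_pos F G) as [_ V]. destruct (Wm_coef_pos F G) as [_ U].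
  set (q := (cc F * kx F - ky F) / (cc F * kx F + ky F)).
  assert (ck : 0 < cc F * kx F) by nra.
  assert (q1 : -1 < q).
  { unfold q. apply Rmult_lt_reg_r with (cc F * kx F + ky F); [lra|]. unfold Rdiv. rewrite Rmult_assoc, Rinv_l; lra. }
  assert (q2 : q < 1).
  { unfold q. apply Rmult_lt_reg_r with (cc F * kx F + ky F); [lra|]. unfold Rdiv. rewrite Rmult_assoc, Rinv_l; lra. }
  assert (B : 0 < hX F < PI) by (unfold hX; fold q; apply acos_bound_lt; lra).
  split; auto. split; [unfold hX; fold q; apply cos_acos; lra|]. apply sin_gt_0; lra.
Qed.
Lemma acos_uniq t x : 0 <= t <= PI -> cos t = x -> t = acos x.
Proof. intros H <-. symmetry. apply acos_cos; auto. Qed.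

Lemma hX_uniq F t : cf F -> 0 <= t <= PI -> ky F - kx F * cc F = - ((ky F + kx F * cc F) * cos t) -> t = hX F.
Proof.
  intros [G C] Ht E. unfold hX. apply acos_uniq; auto. destruct (Wp_coef_pos F G) as [_ V].
  apply Rmult_eq_reg_r with (cc F * kx F + ky F); [|lra]. unfold Rdiv. rewrite Rmult_assoc, Rinv_l; lra.
Qed.

(** For the positive sign of [tailw], the tails leaving (kx, -ky, 0) are X, Y (i = false) and -Y, -X
    (i = true). The second letter occurs only after a full first one; written as b = 0 or a = c1,
    this is a closed condition. *)
Definition tail_ok (F : frame) (i : bool) (a b : R) : Prop :=
  let c1 := if i then hY F else hX F in let c2 := if i then hX F else hY F in
  0 <= a <= c1 /\ 0 <= b <= c2 /\ (b = 0 \/ a = c1).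
Definition tailw (i n : bool) (a b : R) : list (R * label) :=
  if i then [(a, (negb n, BY)); (b, (negb n, BX))] else [(a, (n, BX)); (b, (n, BY))].
Definition weq (F : frame) (l l' : list (R * label)) : Prop :=
  wp F (fw F l) = wp F (fw F l') /\ wc F (fw F l) = wc F (fw F l').

(** After full letters X and Y the momentum is reversed. The two half-loop lemmas forbid going on
    with -X or Y, and only -W_+ remains, which is the second alternative. *)
Lemma tail_X F B t R : cf F -> Min F B ((t, lX) :: R) ->
  sx F B = kx F -> sy F B = - ky F -> sz F B = 0 ->
  (exists b, tail_ok F false t b /\ ((R = [] /\ b = 0) \/ R = [(b, lY)])) \/
  (exists t2 t3 R', R = (t2, lY) :: (t3, lWpn) :: R' /\
     vee (mconj B (wp F (fw F [(t, lX); (t2, lY)]))) = vneg (vee B)).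
Proof.
  intros HF HM X0 Y0 Z0. pose proof HF as [G C]. pose proof (gkx F G) as Kx. pose proof (gky F G) as Ky.
  set (c := cc F) in *.
  pose proof (Min_pos _ _ _ _ _ HM) as Ht. pose proof (proj1 HM) as HO.
  pose proof (lt_pi_X _ _ _ _ G HO) as Hpi.
  destruct (hX_spec F HF) as (hb & hc & hs). destruct (hX_spec (symF Vs F) (cf_Vs F HF)) as (hb' & hc' & hs').
  fold (hY F) in hb', hc', hs'. rewrite cc_sym in hc'. cbn [symF kx ky] in hc'. fold c in hc, hc'.
  destruct (Wp_coef_pos F G) as [V' V]. fold c in V, V'. destruct (Wm_coef_pos F G) as [U' U]. fold c in U, U'.
  set (B1 := mconj B (rot t (lv F lX))).
  pose proof (Min_tail _ _ _ _ _ HM) as HM1. fold B1 in HM1.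
  destruct (flowX F B t G) as (_ & FY & FZ). rewrite <- lv_X in FY, FZ. fold B1 c in FY, FZ. rewrite X0, Y0, Z0 in FY, FZ.
  (* At time [hX] the momentum has y = ky and z > 0, so a longer X-letter would leave the
     rectangle. *)
  assert (INS : t <= hX F).
  { apply Rnot_lt_le; intros Hlt.
    rewrite fw_cons, gcoef_X in HO. pose proof (OptW_inside _ _ _ _ _ (hX F) HO ltac:(lra)) as HI.
    destruct (OptW_start _ _ _ _ _ _ G HI ltac:(lra)) as (_ & _ & S3 & _).
    destruct (flowX F B (hX F) G) as (_ & FY' & FZ'). rewrite <- (fv_10 F) in FY', FZ'. fold c in FY', FZ'.
    rewrite X0, Y0, Z0 in FY', FZ'.
    assert (Yk : sy F (mconj B (rot (hX F) (fv F (1, 0)))) = ky F).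
    { rewrite FY', hc. field. lra. }
    specialize (S3 Yk). rewrite FZ' in S3. nra. }
  destruct R as [|[t2 l2] R2].
  { left. exists 0. split; [|left; auto]. unfold tail_ok; simpl. lra. }
  pose proof (Min_pos _ _ _ _ _ HM1) as Ht2. pose proof (proj1 HM1) as HO1.
  pose proof (label_start _ _ _ _ _ G HO1 Ht2) as L2.
  pose proof (label_end _ _ _ _ _ G HO Ht) as LE. fold B1 in LE. simpl in LE.
  assert (N2 : snd l2 <> BX).
  { destruct l2 as [n b]; simpl; intros ->. destruct n; simpl in L2; [lra|]. apply (Min_adj _ _ _ _ _ _ HM). }
  pose proof (Lst_sy F l2 B1 G L2 N2) as A1.
  assert (A0 : Rabs (sy F B) = ky F) by (rewrite Y0, Rabs_Ropp, Rabs_right; lra).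
  destruct (X_interior F B t _ G HO Ht A0 A1) as [(_ & Y1 & _ & Z1)|(Y0' & _)]; [|lra]. fold B1 in Y1, Z1.
  (* The conserved form has the mixed term +2 c kx ky in the corner with z = 0 and -2 c kx ky in the
     next one. Here c > 0 makes z positive, and the Y-letter can follow. *)
  assert (QZ : sz F B1 * sz F B1 = 4 * c * kx F * ky F).
  { pose proof (Qs_const F B (rot t (lv F lX)) G (rot_SO3 _ _)) as Q. fold B1 c in Q. unfold Qf in Q.
    rewrite X0, Y0, Z0, LE, Y1 in Q. lra. }
  assert (Z1p : 0 < sz F B1) by (assert (0 < 4 * c * kx F * ky F) by (repeat apply Rmult_lt_0_compat; lra); nra).
  assert (T1 : t = hX F).
  { apply hX_uniq; auto; [lra|]. fold c. lra. }
  assert (E2 : l2 = lY).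
  { destruct l2 as [[] []]; simpl in L2, N2; try congruence; lra. }
  subst l2. clear L2 N2.
  set (B2 := mconj B1 (rot t2 (lv F lY))).
  pose proof (Min_tail _ _ _ _ _ HM1) as HM2. fold B2 in HM2.
  assert (WP : wp F (fw F [(t, lX); (t2, lY)]) = mmul (rot t (lv F lX)) (rot t2 (lv F lY))).
  { rewrite !fw_cons, !wp_cons. cbn [fst snd fw map]. change (wp F []) with mid3. rewrite mmul_1r. reflexivity. }
  assert (sinY : sin (hY F) = sz F B1 / (c * ky F + kx F)).
  { assert (P : 0 < c * ky F + kx F) by lra.
    assert (SQ : sin (hY F) * sin (hY F) = (sz F B1 / (c * ky F + kx F)) * (sz F B1 / (c * ky F + kx F))).
    { rewrite sin2_cos2', hc'. replace (sz F B1 / (c * ky F + kx F) * (sz F B1 / (c * ky F + kx F))) with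
        ((sz F B1 * sz F B1) / ((c * ky F + kx F) * (c * ky F + kx F))) by (field; lra). rewrite QZ. field. lra. }
    assert (0 < sz F B1 / (c * ky F + kx F)) by (apply Rdiv_lt_0_compat; lra). nra. }
  assert (FLY : forall s, sx F (mconj B1 (rot s (fv F (0, 1)))) = c * ky F + (kx F - c * ky F) * cos s - sz F B1 * sin s /\
     sz F (mconj B1 (rot s (fv F (0, 1)))) = sz F B1 * cos s + (kx F - c * ky F) * sin s /\ sy F (mconj B1 (rot s (fv F (0, 1)))) = ky F).
  { intros s. rewrite fv_01. destruct (flowY F B1 s G) as (Q1 & Q2 & Q3). fold c in Q2, Q3. rewrite LE, Y1 in Q2, Q3. rewrite Y1 in Q1. auto. }
  assert (NEG : forall P, inSO3 P -> sx F (mconj B P) = - kx F -> sy F (mconj B P) = ky F -> sz F (mconj B P) = 0 ->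
    vee (mconj B P) = vneg (vee B)).
  { intros P SP E1 E2 E3.
    assert (DN : forall u v, dot (vneg u) v = - dot u v) by (clear; mring).
    apply (vec_ext F); auto; rewrite DN.
    - fold (sx F (mconj B P)) (sx F B). lra.
    - fold (sy F (mconj B P)) (sy F B). lra.
    - fold (sz F (mconj B P)) (sz F B). lra. }
  destruct R2 as [|[t3 l3] R3].
  - left. exists t2. split; [|right; auto]. unfold tail_ok; simpl. split; [lra|]. split; [|auto]. split; [lra|].
    (* A longer Y-letter would run straight through the corner with reversed momentum; it is cut at
       [hY] to apply [half_loop_straight]. *)
    apply Rnot_lt_le; intros Hlt.
    destruct (FLY (hY F)) as (Q1 & Q2 & Q3). rewrite hc', sinY in Q1, Q2.
    assert (R1 : sx F (mconj B1 (rot (hY F) (fv F (0, 1)))) = - kx F).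
    { rewrite Q1. replace (sz F B1 * (sz F B1 / (c * ky F + kx F))) with ((sz F B1 * sz F B1) / (c * ky F + kx F)) by (field; lra).
      rewrite QZ. field. lra. }
    assert (R2 : sz F (mconj B1 (rot (hY F) (fv F (0, 1)))) = 0) by (rewrite Q2; field; lra).
    apply (half_loop_straight F B t (hY F) (t2 - hY F) []); auto; try lra.
    + rewrite !fw_cons, gcoef_X, gcoef_Y in HO. simpl fw in HO.
      apply (OptW_eq F B [(t, (1, 0)); (t2, (0, 1))]); auto.
      * repeat (constructor; [simpl; lra|]). constructor.
      * rewrite !wp_cons. cbn [fst snd]. rewrite <- (mmul_assoc (rot (hY F) _)), <- rot_add. do 3 f_equal. ring.
      * rewrite !wc_cons. cbn [fst snd wc]. lra.
    + rewrite !wp_cons. cbn [fst snd]. change (wp F []) with mid3. rewrite mmul_1r.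
      apply NEG; [apply SO3_mul; apply rot_SO3| | |]; rewrite mconj_mul; change (fv F (1, 0)) with (lv F lX); fold B1; auto.
  - pose proof (Min_pos _ _ _ _ _ HM2) as Ht3. pose proof (proj1 HM2) as HO2.
    pose proof (label_start _ _ _ _ _ G HO2 Ht3) as L3.
    pose proof (label_end _ _ _ _ _ G HO1 Ht2) as LE2. fold B2 in LE2. simpl in LE2.
    assert (N3 : snd l3 <> BY).
    { destruct l3 as [n b]; simpl; intros ->. destruct n; simpl in L3; [lra|]. apply (Min_adj _ _ _ _ _ _ HM1). }
    assert (A2 : sx F B2 = - kx F).
    { pose proof (OptW_fw_sym Vs F B1 _ HO1) as OV. simpl map in OV.
      assert (LSV : Lst (symF Vs F) (sym_label Vs l3) B2) by (apply (Lst_sym Vs); rewrite symF_inv, sym_label_inv; exact L3).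
      assert (NV : snd (sym_label Vs l3) <> BX) by (destruct l3 as [n []]; simpl in *; congruence).
      pose proof (Lst_sy _ _ _ (gframe_sym Vs F G) LSV NV) as AV.
      pose proof (X_interior (symF Vs F) B1 t2 _ (gframe_sym Vs F G) OV Ht2) as XI. cbv zeta in XI.
      change (lv (symF Vs F) lX) with (lv (symF Vs F) (sym_label Vs lY)) in XI. rewrite lv_sym in XI. fold B2 in XI.
      rewrite !sy_sym in XI, AV. cbn [symF kx ky] in XI, AV. rewrite LE in XI.
      assert (AK : Rabs (kx F) = kx F) by (apply Rabs_right; lra).
      destruct (XI AK AV) as [(q & _)|(_ & q & _)]; [lra|exact q]. }
    assert (Z2 : sz F B2 = 0).
    { pose proof (Qs_const F B1 (rot t2 (lv F lY)) G (rot_SO3 _ _)) as Q. fold B2 c in Q. unfold Qf in Q.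
      rewrite A2, LE2, LE, Y1 in Q. nra. }
    assert (T2 : t2 = hY F).
    { assert (P2 : t2 <= PI).
      { pose proof (OptW_fw_sym Vs F B1 _ HO1) as OV. simpl map in OV. apply (lt_pi_X (symF Vs F) B1 t2 _ (gframe_sym Vs F G) OV). }
      unfold hY. apply hX_uniq; auto using cf_Vs; [lra|]. rewrite cc_sym. cbn [symF kx ky]. fold c.
      destruct (FLY t2) as (Q1 & Q2 & _). change (fv F (0, 1)) with (lv F lY) in Q1, Q2. fold B2 in Q1, Q2.
      rewrite A2 in Q1. rewrite Z2 in Q2. pose proof (sin2_cos2' t2) as SC.
      assert (K1 : (kx F - c * ky F) * (cos t2 * cos t2 + sin t2 * sin t2) = (- kx F - c * ky F) * cos t2).
      { replace ((kx F - c * ky F) * (cos t2 * cos t2 + sin t2 * sin t2)) with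
          (((kx F - c * ky F) * cos t2 - sz F B1 * sin t2) * cos t2 + (sz F B1 * cos t2 + (kx F - c * ky F) * sin t2) * sin t2) by ring.
        rewrite <- Q2. replace ((kx F - c * ky F) * cos t2 - sz F B1 * sin t2) with (- kx F - c * ky F) by lra. ring. }
      rewrite SC in K1. lra. }
    assert (VN : vee (mconj B (wp F (fw F [(t, lX); (t2, lY)]))) = vneg (vee B)).
    { rewrite WP. apply NEG; [apply SO3_mul; apply rot_SO3| | |]; rewrite mconj_mul; fold B1 B2; auto. }
    (* The momentum is at (-kx, ky, 0). Of the letters that may start there, Y would be a repetition
       and -X is excluded by [half_loop_turn]. *)
    destruct l3 as [n3 b3]; destruct b3; simpl in L3, N3; try congruence.
    + destruct n3; simpl in L3; [|lra]. exfalso.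
      rewrite !fw_cons, gcoef_X, gcoef_Y, gcoef_Xn in HO.
      apply (half_loop_turn F B t t2 t3 (fw F R3)); auto.
    + destruct n3; simpl in L3; [|lra]. right. exists t2, t3, R3. split; auto.
    + exfalso. destruct n3; simpl in L3; destruct L3 as (L31 & L32 & L33); lra.
Qed.

(** * Both sides of a corner of type (kx, -ky, 0) *)

Lemma weq_refl F l : weq F l l.
Proof. split; reflexivity. Qed.
Lemma weq_app F l1 l2 l1' l2' : weq F l1 l1' -> weq F l2 l2' -> weq F (l1 ++ l2) (l1' ++ l2').
Proof.
  intros [H1 H2] [H3 H4]. split; rewrite !fw_app, ?wp_app, ?wc_app; congruence.
Qed.
Lemma weq_cons F t l r r' : weq F r r' -> weq F ((t, l) :: r) ((t, l) :: r').
Proof. apply (weq_app F [(t, l)] r [(t, l)] r'), weq_refl. Qed.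
Lemma weq_trans F l1 l2 l3 : weq F l1 l2 -> weq F l2 l3 -> weq F l1 l3.
Proof. intros [] []; split; congruence. Qed.
Lemma weq_sym s F l l' : weq (symF s F) (map (symp s) l) (map (symp s) l') <-> weq F l l'.
Proof. unfold weq. rewrite !fw_sym, !wp_sym, !wc_sym. tauto. Qed.
Lemma weq_revNu F l l' : weq F l l' -> weq (symF Nu F) (rev l) (rev l').
Proof.
  intros [H1 H2]. split; rewrite !fw_Nu, !fw_rev, ?wp_revNu, ?wc_revNu; congruence.
Qed.
Lemma weq_revNu' F l l' : weq (symF Nu F) (rev l) (rev l') -> weq F l l'.
Proof.
  intros H. apply weq_revNu in H. rewrite !rev_involutive, symF_inv in H. exact H.
Qed.
Lemma weq_zero F l r : weq F r ((0, l) :: r).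
Proof. split; rewrite fw_cons, ?wp_cons, ?wc_cons; cbn [fst snd]; [rewrite rot_0, mmul_1l; auto | ring]. Qed.
Lemma weq_zero_end F l r : weq F r (r ++ [(0, l)]).
Proof. rewrite <- (app_nil_r r) at 1. apply weq_app; [apply weq_refl | apply weq_zero]. Qed.

Lemma hX_Nu F : hX (symF Nu F) = hX F.
Proof. unfold hX. rewrite cc_sym. reflexivity. Qed.

(** The letters that can start in this corner are X, -Y and W_+. The composition of [Nu] and [Vs]
    fixes the corner and sends -Y to X, so [tail_X] covers both edges. *)
Lemma tail_corner F B R : cf F -> Min F B R -> sx F B = kx F -> sy F B = - ky F -> sz F B = 0 ->
  (exists i a b, tail_ok F i a b /\ weq F R (tailw i false a b)) \/
  (exists t R', R = (t, lWp) :: R') \/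
  (exists h t R', R = h ++ (t, lWpn) :: R' /\ vee (mconj B (wp F (fw F h))) = vneg (vee B)).
Proof.
  assert (CX : forall F B t R, cf F -> Min F B ((t, lX) :: R) -> sx F B = kx F -> sy F B = - ky F -> sz F B = 0 ->
    (exists a b, tail_ok F false a b /\ weq F ((t, lX) :: R) (tailw false false a b)) \/
    (exists h t' R', (t, lX) :: R = h ++ (t', lWpn) :: R' /\ vee (mconj B (wp F (fw F h))) = vneg (vee B))).
  { clear. intros F B t R HF HM X0 Y0 Z0.
    destruct (tail_X F B t R HF HM X0 Y0 Z0) as [(b & OK & [[-> ->]| ->])|(t2 & t3 & R' & -> & V)].
    - left. exists t, 0. split; auto. apply (weq_zero_end F lY [(t, lX)]).
    - left. exists t, b. split; auto. apply weq_refl.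
    - right. exists [(t, lX); (t2, lY)], t3, R'. auto. }
  intros HF HM X0 Y0 Z0. pose proof HF as [G C]. pose proof (gkx F G) as Kx. pose proof (gky F G) as Ky.
  destruct R as [|[t l] R].
  { left. destruct (hX_spec F HF) as (h1 & _). destruct (hX_spec _ (cf_Vs F HF)) as (h2 & _). fold (hY F) in h2.
    exists false, 0, 0. split; [unfold tail_ok; cbn; lra|].
    eapply weq_trans; [apply (weq_zero F lY)|apply weq_zero]. }
  pose proof (Min_pos _ _ _ _ _ HM) as Ht.
  pose proof (label_start _ _ _ _ _ G (proj1 HM) Ht) as L0.
  destruct l as [[] []]; cbn [Lst sg negb] in L0.
  - lra.
  - pose proof (Min_sym Nu _ _ _ (Min_sym Vs _ _ _ HM)) as HM'. set (F' := symF Nu (symF Vs F)) in *.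
    assert (HF' : cf F') by (apply cf_Nu, cf_Vs, HF).
    assert (INV : map (symp Vs) (map (symp Nu) (map (symp Nu) (map (symp Vs) ((t, lYn) :: R)))) = (t, lYn) :: R)
      by (rewrite !map_symp_inv; auto).
    cbn [map] in HM', INV. change (symp Nu (symp Vs (t, lYn))) with (t, lX) in HM', INV.
    set (R2 := map (symp Nu) (map (symp Vs) R)) in *.
    assert (X' : sx F' B = kx F') by (unfold F'; rewrite !sx_sym; cbn [symF kx ky]; lra).
    assert (Y' : sy F' B = - ky F') by (unfold F'; rewrite !sy_sym; cbn [symF kx ky]; lra).
    assert (Z' : sz F' B = 0) by (unfold F'; rewrite !sz_sym; lra).
    assert (E1 : hX F' = hY F) by (unfold F'; rewrite hX_Nu; auto).
    assert (E2 : hY F' = hX F) by (unfold F', hY, hX; rewrite !cc_sym; reflexivity).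
    destruct (CX F' B t R2 HF' HM' X' Y' Z') as [(a & b & OK & W)|(h & t' & R' & E & V)].
    + left. exists true, a, b. split.
      * unfold tail_ok in *. rewrite E1, E2 in OK. exact OK.
      * apply (weq_sym Vs), (weq_sym Nu). exact W.
    + right; right. exists (map (symp Vs) (map (symp Nu) h)), t', (map (symp Vs) (map (symp Nu) R')). split.
      * etransitivity; [symmetry; exact INV|]. change (symp Vs (symp Nu (t, lX)) :: map (symp Vs) (map (symp Nu) R2)) with
          (map (symp Vs) (map (symp Nu) ((t, lX) :: R2))). rewrite E, !map_app. reflexivity.
      * rewrite <- V. do 2 f_equal. rewrite <- (wp_sym Vs F), <- (wp_sym Nu (symF Vs F)), <- !fw_sym, !map_symp_inv. reflexivity.
  - exfalso; destruct L0 as (L1 & L2 & L3); lra.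
  - exfalso; destruct L0 as (L1 & L2 & L3); lra.
  - destruct (CX F B t R HF HM X0 Y0 Z0) as [(a & b & OK & W)|Q]; [left; exists false, a, b; auto | right; right; auto].
  - lra.
  - right; left; eauto.
  - exfalso; destruct L0 as (L1 & L2 & L3); lra.
Qed.

Lemma lWp_vec F B : gframe F -> sx F B = kx F -> sy F B = - ky F -> sz F B = 0 ->
  lv F lWp = vscale (1 - cc F * cc F) (vee B).
Proof.
  intros G X Y Z. pose proof (gcc F G). rewrite (corner_vec F B G Z), X, Y. unfold lv, gcoef, gbase, fv, fvec; cbn [fst snd].
  assert (D : 1 - cc F * cc F <> 0) by nra.
  generalize (fX F) (fY F). intros u v. destruct u, v. apply V3_eq; cbn; field; auto.
Qed.

(* A half loop h reverses the momentum and is an involution, so a following W-rotation slides through it and merges. *)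
Lemma Wp_right F B t R : cf F -> Min F B ((t, lWp) :: R) ->
  exists i a b, tail_ok F i a b /\ weq F R (tailw i false a b).
Proof.
  intros HF HM. pose proof HF as [G C]. pose proof (gkx F G) as Kx.
  pose proof (Min_pos _ _ _ _ _ HM) as Ht.
  destruct (label_end _ _ _ _ _ G (proj1 HM) Ht) as (X & Y & Z). cbn [sg negb] in X, Y.
  pose proof (Min_tail _ _ _ _ _ HM) as HM1. set (B1 := mconj B (rot t (lv F lWp))) in *.
  destruct (tail_corner F B1 R HF HM1 X Y Z) as [H|[(t' & R' & ->)|(h & t3 & R' & -> & V)]]; auto; exfalso.
  { exact (Min_adj _ _ _ _ _ _ HM). }
  set (P := wp F (fw F h)) in *. assert (SP : inSO3 P) by apply wp_SO3.
  assert (Vn : vee B1 <> mkV 0 0 0).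
  { intros E. unfold sx in X. rewrite E in X. unfold dot in X; simpl in X. lra. }
  assert (VP : mv (mtrans P) (vee B1) = vneg (vee B1)).
  { rewrite <- V. symmetry. apply vee_conj; auto. }
  assert (SYM : P = mtrans P).
  { rewrite <- (mtrans_inv P) at 1. apply (SO3_involution (mtrans P) (vee B1)); auto using SO3_trans. }
  assert (SL : mmul P (rot t3 (lv F lWpn)) = mmul (rot t3 (lv F lWp)) P).
  { rewrite (rot_comm_through P t3 _ SP). do 2 f_equal.
    change lWpn with (negb false, BWp) at 1. rewrite (lv_neg F false BWp), (lWp_vec F B1 G X Y Z). rewrite <- SYM in VP.
    transitivity (vscale (- (1 - cc F * cc F)) (mv P (vee B1))).
    - generalize P (vee B1) (1 - cc F * cc F). mring.
    - rewrite VP. generalize (vee B1) (1 - cc F * cc F). mring. }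
  pose proof (Min_init F B (((t, lWp) :: h) ++ [(t3, lWpn)]) R') as HI. rewrite <- app_assoc in HI. specialize (HI HM).
  destruct HI as [[N _] M]. rewrite fw_app in N. apply nnw_app in N. destruct N as [N1 N2].
  inversion N1 as [|? ? N3 N4]; subst. inversion N2 as [|? ? N5 _]; subst. cbn [fst] in N3, N5.
  specialize (M ((t + t3, lWp) :: h)).
  assert (length (((t, lWp) :: h) ++ [(t3, lWpn)]) <= length (((t + t3)%R, lWp) :: h))%nat.
  { apply M.
    - constructor; auto. cbn [fst]; lra.
    - rewrite fw_app, wp_app, !fw_cons, !wp_cons. cbn [fst snd fw map]. change (wp F []) with mid3. rewrite mmul_1r.
      fold P (lv F lWp) (lv F lWpn). rewrite mmul_assoc, SL, <- mmul_assoc, rot_add. reflexivity.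
    - rewrite fw_app, wc_app, !fw_cons, !wc_cons. cbn [fst snd fw map wc].
      assert (E : ucost F (gcoef F lWpn) = ucost F (gcoef F lWp)).
      { unfold gcoef, ucost; cbn [fst snd]. rewrite !Rabs_Ropp. reflexivity. }
      rewrite E. lra. }
  rewrite length_app in H. simpl in H. lia.
Qed.

Lemma tail_ok_Nu F i a b : tail_ok (symF Nu F) i a b <-> tail_ok F i a b.
Proof. unfold tail_ok, hY, hX. rewrite !cc_sym. reflexivity. Qed.

Lemma Wp_split F B L t R : cf F -> Min F B (L ++ (t, lWp) :: R) ->
  exists i j a1 b1 a2 b2, tail_ok F i a1 b1 /\ tail_ok F j a2 b2 /\
    weq F (L ++ (t, lWp) :: R) (rev (tailw i false a1 b1) ++ (t, lWp) :: tailw j false a2 b2).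
Proof.
  intros HF HM. pose proof (Min_drop _ _ _ _ HM) as HR.
  destruct (Wp_right _ _ _ _ HF HR) as (j & a2 & b2 & OK2 & W2).
  pose proof (Min_revnu _ _ _ HM) as HL. rewrite rev_app_distr in HL. simpl rev in HL. rewrite <- app_assoc in HL.
  apply Min_drop in HL. destruct (Wp_right _ _ _ _ (cf_Nu F HF) HL) as (i & a1 & b1 & OK1 & W1).
  apply (proj1 (tail_ok_Nu _ _ _ _)) in OK1. rewrite <- (rev_involutive (tailw i false a1 b1)) in W1. apply weq_revNu' in W1.
  exists i, j, a1, b1, a2, b2. split; auto. split; auto. apply weq_app; auto. apply weq_cons; auto.
Qed.

(** A passage through the corner without rest is brought to the same form, with a W_+ letter of time
    zero; the last two hypotheses exclude the other alternatives of [tail_corner] on both sides. *)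
Lemma corner_split F B L R : cf F -> Min F B (L ++ R) ->
  let B' := mconj B (wp F (fw F L)) in sx F B' = kx F -> sy F B' = - ky F -> sz F B' = 0 ->
  (forall t, ~ In (t, lWp) (L ++ R)) -> (forall t, ~ In (t, lWpn) (L ++ R)) ->
  exists i j a1 b1 a2 b2, tail_ok F i a1 b1 /\ tail_ok F j a2 b2 /\
    weq F (L ++ R) (rev (tailw i false a1 b1) ++ (0, lWp) :: tailw j false a2 b2).
Proof.
  intros HF HM B' X Y Z N1 N2.
  pose proof (Min_drop _ _ _ _ HM) as HR. fold B' in HR.
  assert (HL : Min (symF Nu F) (mtrans B') (rev L)) by (apply Min_revnu, (Min_init _ _ _ _ HM)).
  destruct (state_revnu F B') as (E1 & E2 & E3).
  destruct (tail_corner F B' R HF HR X Y Z) as [(j & a2 & b2 & OK2 & W2)|[(t' & R' & ->)|(h & t3 & R' & -> & V)]].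
  2:{ exfalso. apply (N1 t'). apply in_or_app. right. left. reflexivity. }
  2:{ exfalso. apply (N2 t3). apply in_or_app. right. apply in_or_app. right. left. reflexivity. }
  destruct (tail_corner (symF Nu F) (mtrans B') (rev L) (cf_Nu F HF) HL) as [(i & a1 & b1 & OK1 & W1)|[(t' & R' & E)|(h & t3 & R' & E & V)]];
    try (rewrite ?E1, ?E2, ?E3; cbn [symF kx ky]; lra).
  2:{ exfalso. apply (N1 t'). apply in_or_app. left. apply in_rev. rewrite E. left. reflexivity. }
  2:{ exfalso. apply (N2 t3). apply in_or_app. left. apply in_rev. rewrite E. apply in_or_app. right. left. reflexivity. }
  apply (proj1 (tail_ok_Nu _ _ _ _)) in OK1. rewrite <- (rev_involutive (tailw i false a1 b1)) in W1. apply weq_revNu' in W1.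
  exists i, j, a1, b1, a2, b2. split; auto. split; auto. apply weq_app; auto.
  eapply weq_trans; [exact W2 | apply weq_zero].
Qed.

(** * Cycles around the rectangle *)

Definition dbl (q : R) : R := 2 * atan q.
Lemma dbl_cos q : cos (dbl q) = (1 - q * q) / (1 + q * q).
Proof.
  unfold dbl. rewrite cos_2a, cos_atan, sin_atan. unfold Rsqr.
  assert (E : sqrt (1 + q * q) * sqrt (1 + q * q) = 1 + q * q) by (apply sqrt_sqrt; nra).
  assert (N : sqrt (1 + q * q) <> 0) by (intros Z; rewrite Z in E; nra).
  replace (1 / sqrt (1 + q * q) * (1 / sqrt (1 + q * q)) - q / sqrt (1 + q * q) * (q / sqrt (1 + q * q)))
    with ((1 - q * q) / (sqrt (1 + q * q) * sqrt (1 + q * q))) by (field; auto). rewrite E. reflexivity.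
Qed.
Lemma dbl_sin q : sin (dbl q) = 2 * q / (1 + q * q).
Proof.
  unfold dbl. rewrite sin_2a, cos_atan, sin_atan. unfold Rsqr.
  assert (E : sqrt (1 + q * q) * sqrt (1 + q * q) = 1 + q * q) by (apply sqrt_sqrt; nra).
  assert (N : sqrt (1 + q * q) <> 0) by (intros Z; rewrite Z in E; nra).
  replace (2 * (q / sqrt (1 + q * q)) * (1 / sqrt (1 + q * q)))
    with (2 * q / (sqrt (1 + q * q) * sqrt (1 + q * q))) by (field; auto). rewrite E. reflexivity.
Qed.
Lemma dbl_bd q : 0 < q -> 0 < dbl q < PI.
Proof.
  intros H. unfold dbl. pose proof (atan_bound q). pose proof (atan_increasing 0 q H) as A. rewrite atan_0 in A. lra.
Qed.
Lemma dbl_half p q : 0 < p -> 0 < q -> q * (sin (dbl p / 2) * cos (dbl q / 2)) = p * (cos (dbl p / 2) * sin (dbl q / 2)).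
Proof.
  intros Hp Hq. unfold dbl. replace (2 * atan p / 2) with (atan p) by lra. replace (2 * atan q / 2) with (atan q) by lra.
  rewrite !cos_atan, !sin_atan. unfold Rsqr.
  assert (forall x, sqrt (1 + x * x) <> 0).
  { intros x Z. apply sqrt_eq_0 in Z; nra. }
  field. auto.
Qed.

(** The hypothesis says that (k - w, b) and (-k - w, a) have the same length; the angle between them
    has half-angle tangent 2k / (a + b). With k = kx and w = c ky this is the time of a full
    Y-letter, and 2 ky / (a + b) gives that of an X-letter: hence the tangent relation of pattern
    I. *)
Lemma turn_flow k w a b : 0 < k -> 0 < a -> 0 < b -> b * b - a * a = 4 * k * w ->
  let T := dbl (2 * k / (a + b)) in
  (k - w) * cos T - b * sin T = - k - w /\ b * cos T + (k - w) * sin T = a.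
Proof.
  intros Hk Ha Hb E T. unfold T. rewrite dbl_cos, dbl_sin.
  assert (W : w = (b * b - a * a) / (4 * k)) by (rewrite E; field; lra). rewrite W.
  assert ((a + b) * (a + b) + 2 * k * (2 * k) <> 0) by nra.
  split; field; repeat split; try lra; nra.
Qed.

(** After the time T the momentum has x = -kx with z = a > 0, and going on along Y would push x
    beyond -kx. *)
Lemma capY F B t R a b : gframe F -> OptW F B (fw F ((t, lY) :: R)) ->
  sx F B = kx F -> sy F B = ky F -> sz F B = b -> 0 < a -> 0 < b -> b * b - a * a = 4 * cc F * kx F * ky F ->
  t <= dbl (2 * kx F / (a + b)).
Proof.
  intros G HO X Y Z Ha Hb E. pose proof (gkx F G) as Kx. set (T := dbl (2 * kx F / (a + b))).
  assert (Tp : 0 < T < PI) by (apply dbl_bd, Rdiv_lt_0_compat; lra).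
  apply Rnot_lt_le; intros Hlt. rewrite fw_cons, gcoef_Y in HO.
  pose proof (OptW_inside _ _ _ _ _ T HO ltac:(lra)) as HI.
  destruct (OptW_start _ _ _ _ _ _ G HI ltac:(lra)) as (_ & S2 & _).
  destruct (flowY F B T G) as (_ & FX & FZ). rewrite X, Y, Z in FX, FZ.
  destruct (turn_flow (kx F) (cc F * ky F) a b) as [T1 T2]; auto; [lra|]. fold T in T1, T2.
  rewrite fv_01 in S2. rewrite FX, FZ in S2. specialize (S2 ltac:(lra)). lra.
Qed.

(** A further letter can only start in a corner, so the Y-letter ends exactly in the next one and
    has full time; with z = a > 0 there, the letter that follows is -X. *)
Lemma stepY F B t t' l R a b : gframe F -> Min F B ((t, lY) :: (t', l) :: R) ->
  (exists n, l = (n, BX) \/ l = (n, BY)) ->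
  sx F B = kx F -> sy F B = ky F -> sz F B = b -> 0 < a -> 0 < b -> b * b - a * a = 4 * cc F * kx F * ky F ->
  let B' := mconj B (rot t (fY F)) in
  t = dbl (2 * kx F / (a + b)) /\ l = lXn /\ sx F B' = - kx F /\ sy F B' = ky F /\ sz F B' = a.
Proof.
  intros G HM [n Hl] X Y Z Ha Hb E B'. pose proof (gkx F G) as Kx. pose proof (gky F G) as Ky.
  set (T := dbl (2 * kx F / (a + b))).
  assert (Tp : 0 < T < PI) by (apply dbl_bd, Rdiv_lt_0_compat; lra).
  pose proof (Min_pos _ _ _ _ _ HM) as Ht. pose proof (Min_tail _ _ _ _ _ HM) as HM1.
  rewrite lv_Y in HM1. fold B' in HM1. pose proof (Min_pos _ _ _ _ _ HM1) as Ht'.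
  pose proof (label_start _ _ _ _ _ G (proj1 HM1) Ht') as L1.
  destruct (flowY F B t G) as (FY & FX & FZ). fold B' in FY, FX, FZ. rewrite Y in FY.
  assert (Hx : l = (n, BX)).
  { destruct Hl as [|Hl]; auto. exfalso. rewrite Hl in *. destruct n; cbn in L1; [lra|]. exact (Min_adj _ _ _ _ _ _ HM). }
  clear Hl. rewrite Hx in *. cbn in L1.
  assert (OV : OptW (symF Vs F) B (fw (symF Vs F) ((t, lX) :: map (symp Vs) ((t', l) :: R)))).
  { rewrite Hx. apply (OptW_fw_sym Vs F B ((t, lY) :: (t', (n, BX)) :: R)), HM. }
  pose proof (lt_pi_X _ _ _ _ (gframe_sym Vs F G) OV) as Hpi.
  pose proof (X_interior (symF Vs F) B t _ (gframe_sym Vs F G) OV Ht) as XI. cbv zeta in XI.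
  rewrite lv_X in XI. change (fX (symF Vs F)) with (fY F) in XI. fold B' in XI.
  rewrite (sy_sym Vs F B), (sy_sym Vs F B'), (sz_sym Vs F B), (sz_sym Vs F B') in XI. change (ky (symF Vs F)) with (kx F) in XI.
  rewrite X, Z in XI.
  destruct XI as [(q & _)|(_ & X1 & _ & Z1)]; [rewrite Rabs_right; lra | rewrite L1; destruct n; cbn; rewrite ?Rabs_Ropp, Rabs_right; lra | lra |].
  assert (n = true) as -> by (destruct n; auto; cbn in L1; lra).
  assert (Q : sz F B' = a).
  { pose proof (Qs_const F B (rot t (fY F)) G (rot_SO3 _ _)) as Q. fold B' in Q. unfold Qf in Q. rewrite X, Y, Z, X1, FY in Q. nra. }
  repeat split; auto. rewrite X, Y, Z in FX, FZ.
  destruct (turn_flow (kx F) (cc F * ky F) a b) as [T1 T2]; auto; [lra|]. fold T in T1, T2.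
  destruct (trig_unique (kx F - cc F * ky F) b (cos t) (sin t) (cos T) (sin T) (- kx F - cc F * ky F) a) as [CE _]; try lra; [nra|].
  apply cos_inj; auto; lra.
Qed.

(** The values b and a of z alternate from corner to corner, so all full X-times agree and all full
    Y-times agree. Each letter is capped, and a fifth one contradicts [five_cycle]. *)
Lemma cycle_class F B t1 t2 t3 l3 R a b : gframe F -> cc F <> 0 ->
  Min F B ((t1, lX) :: (t2, lY) :: (t3, l3) :: R) ->
  (forall t l, In (t, l) ((t3, l3) :: R) -> exists n, l = (n, BX) \/ l = (n, BY)) ->
  let B1 := mconj B (rot t1 (fX F)) in
  sx F B1 = kx F -> sy F B1 = ky F -> sz F B1 = b -> 0 < a -> 0 < b -> b * b - a * a = 4 * cc F * kx F * ky F ->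
  let T1 := dbl (2 * ky F / (a + b)) in let T2 := dbl (2 * kx F / (a + b)) in
  exists t4, 0 <= t1 <= T1 /\ t2 = T2 /\ 0 <= t3 <= T1 /\ 0 <= t4 <= T2 /\ (t3 = T1 \/ t4 = 0) /\
    weq F ((t1, lX) :: (t2, lY) :: (t3, l3) :: R) [(t1, lX); (t2, lY); (t3, lXn); (t4, lYn)].
Proof.
  intros G C HM HL B1 X1 Y1 Z1 Ha Hb E T1 T2. pose proof (gkx F G) as Kx. pose proof (gky F G) as Ky.
  pose proof (Min_pos _ _ _ _ _ HM) as p1.
  pose proof (Min_tail _ _ _ _ _ HM) as HM1. rewrite lv_X in HM1. fold B1 in HM1. pose proof (Min_pos _ _ _ _ _ HM1) as p2.
  pose proof (Min_tail _ _ _ _ _ HM1) as HM2. rewrite lv_Y in HM2. pose proof (Min_pos _ _ _ _ _ HM2) as p3.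
  set (B2 := mconj B1 (rot t2 (fY F))) in *.
  assert (c1 : t1 <= T1).
  (* The first letter starts anywhere on its edge but ends in a corner; read backwards it is a
     letter leaving that corner. *)
  { pose proof (Min_init F B [(t1, lX)] _ HM) as HI. apply Min_revnu in HI.
    rewrite fw_cons in HI. simpl fw in HI. rewrite wp_single in HI. fold (lv F lX) in HI. rewrite lv_X in HI. fold B1 in HI.
    apply (Min_sym Vs) in HI. cbn in HI. change (symp Vs (t1, lX)) with (t1, lY) in HI.
    destruct (state_revnu F B1) as (e1 & e2 & e3).
    pose proof (capY (symF Vs (symF Nu F)) (mtrans B1) t1 [] a b) as CP.
    rewrite (sx_sym Vs), (sy_sym Vs), (sz_sym Vs), e1, e2, e3, !cc_sym in CP.
    change (kx (symF Vs (symF Nu F))) with (ky F) in CP. change (ky (symF Vs (symF Nu F))) with (kx F) in CP.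
    apply CP; auto; try lra; [apply gframe_sym, gframe_sym, G|apply HI]. }
  destruct (stepY F B1 t2 t3 l3 R a b G HM1) as (e2 & -> & X2 & Y2 & Z2); auto. { apply (HL t3). left; auto. }
  fold B2 in X2, Y2, Z2. fold T2 in e2.
  (* A quarter turn of the rectangle: (x, y, z) becomes (y, -x, z), [cc] changes sign, and a and b
     exchange their roles. It carries the letter -X to Y. *)
  set (G' := symF Rho (symF Vs F)).
  assert (GG : gframe G') by (apply gframe_sym, gframe_sym, G).
  assert (SX : forall M, sx G' M = sy F M) by (intros; unfold G'; rewrite !sx_sym; auto).
  assert (SY : forall M, sy G' M = - sx F M) by (intros; unfold G'; rewrite !sy_sym; auto).
  assert (SZ : forall M, sz G' M = sz F M) by (intros; unfold G'; rewrite !sz_sym; lra).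
  assert (CG : cc G' = - cc F) by (unfold G'; rewrite !cc_sym; auto).
  pose proof (Min_sym Rho _ _ _ (Min_sym Vs _ _ _ HM2)) as HM2'. fold G' in HM2'. cbn [map] in HM2'.
  change (symp Rho (symp Vs (t3, lXn))) with (t3, lY) in HM2'.
  assert (TG : dbl (2 * kx G' / (b + a)) = T1) by (unfold T1; rewrite Rplus_comm; reflexivity).
  assert (c3 : t3 <= T1).
  { rewrite <- TG. apply (capY G' B2 t3 _ b a GG (proj1 HM2')); auto; rewrite ?SX, ?SY, ?SZ, ?CG; cbn [G' symF kx ky]; lra. }
  destruct R as [|[t4 l4] R].
  { assert (0 < T2) by (apply dbl_bd, Rdiv_lt_0_compat; lra).
    exists 0. split; [lra|]. split; [auto|]. split; [lra|]. split; [lra|]. split; [auto|]. apply (weq_zero_end F lYn [(t1, lX); (t2, lY); (t3, lXn)]). }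
  cbn [map] in HM2'.
  assert (S3 : exists n, sym_label Rho (sym_label Vs l4) = (n, BX) \/ sym_label Rho (sym_label Vs l4) = (n, BY)).
  { destruct (HL t4 l4) as [n [-> | ->]]; [right; left; auto| |]; cbn; eauto. }
  destruct (stepY G' B2 t3 t4 (sym_label Rho (sym_label Vs l4)) _ b a GG HM2' S3) as (e3 & El4 & X3 & Y3 & Z3); auto;
    rewrite ?SX, ?SY, ?SZ, ?CG; cbn [G' symF kx ky]; try lra.
  rewrite TG in e3. rewrite SX in X3. rewrite SY in Y3. rewrite SZ in Z3.
  change (fY G') with (vneg (fX F)) in *. change (kx G') with (ky F) in X3. change (ky G') with (kx F) in Y3.
  assert (El : l4 = lYn). { rewrite <- (sym_label_inv Vs l4), <- (sym_label_inv Rho (sym_label Vs l4)), El4. reflexivity. }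
  rewrite El in *. clear El El4 S3 HM2'.
  pose proof (Min_tail _ _ _ _ _ HM2) as HM3. rewrite lv_Xn in HM3. set (B3 := mconj B2 (rot t3 (vneg (fX F)))) in *.
  pose proof (Min_pos _ _ _ _ _ HM3) as p4.
  pose proof (Min_sym Nu _ _ _ HM3) as HM3'. cbn [map] in HM3'. change (symp Nu (t4, lYn)) with (t4, lY) in HM3'.
  assert (GN : gframe (symF Nu F)) by (apply gframe_sym, G).
  assert (c4 : t4 <= T2).
  { apply (capY (symF Nu F) B3 t4 _ a b GN (proj1 HM3')); auto; rewrite ?(sx_sym Nu), ?(sy_sym Nu), ?(sz_sym Nu), ?cc_sym; cbn [symF kx ky]; try lra. }
  destruct R as [|[t5 l5] R].
  { exists t4. split; [lra|]. split; [auto|]. split; [lra|]. split; [lra|]. split; [auto|]. apply weq_refl. }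
  exfalso. cbn [map] in HM3'.
  assert (S4 : exists n, sym_label Nu l5 = (n, BX) \/ sym_label Nu l5 = (n, BY)).
  { destruct (HL t5 l5) as [n [-> | ->]]; [right; right; left; auto| |]; cbn; eauto. }
  destruct (stepY (symF Nu F) B3 t4 t5 (sym_label Nu l5) _ a b GN HM3' S4) as (e4 & El5 & X4 & Y4 & Z4); auto;
    rewrite ?(sx_sym Nu), ?(sy_sym Nu), ?(sz_sym Nu), ?cc_sym; cbn [symF kx ky]; try lra.
  rewrite (sx_sym Nu) in X4. rewrite (sy_sym Nu) in Y4. rewrite (sz_sym Nu) in Z4.
  change (fY (symF Nu F)) with (vneg (fY F)) in *. change (kx (symF Nu F)) with (kx F) in X4. change (ky (symF Nu F)) with (ky F) in Y4.
  assert (El : l5 = lX). { rewrite <- (sym_label_inv Nu l5), El5. reflexivity. }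
  rewrite El in *.
  pose proof (Min_tail _ _ _ _ _ HM3) as HM4. pose proof (Min_pos _ _ _ _ _ HM4) as p5.
  (* The word has gone around all four corners and begun a fifth letter X. *)
  pose proof (proj1 HM) as HO. rewrite !fw_cons, gcoef_X, gcoef_Y, gcoef_Xn, gcoef_Yn in HO.
  apply (five_cycle F B t1 t2 t3 t4 t5 (fw F R) a b G C HO); auto; fold B1 B2 B3; lra.
Qed.

(** The corner (kx, ky, 0) has the smaller value of the conserved form: a letter reaching a
    neighbouring corner would need z^2 = -4 c kx ky there. So the first letter after W_- is the
    last. If there is none, a letter of time zero is supplied. *)
Lemma Wm_right F B t R : cf F -> Min F B ((t, lWm) :: R) ->
  exists e b, (e = BX \/ e = BY) /\ 0 <= b <= PI /\ weq F R [(b, (false, e))].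
Proof.
  assert (CX : forall F B t R, cf F -> Min F B ((t, lX) :: R) -> sx F B = kx F -> sy F B = ky F -> sz F B = 0 -> 0 <= t <= PI /\ R = []).
  { clear. intros F B t R [G C] HM X Y Z. pose proof (gkx F G) as Kx. pose proof (gky F G) as Ky.
    pose proof (Min_pos _ _ _ _ _ HM) as Ht. pose proof (lt_pi_X _ _ _ _ G (proj1 HM)) as Hpi. split; [lra|].
    destruct R as [|[t2 l2] R]; auto. exfalso.
    pose proof (Min_tail _ _ _ _ _ HM) as HM1. pose proof (Min_pos _ _ _ _ _ HM1) as Ht2.
    set (B1 := mconj B (rot t (lv F lX))) in *.
    pose proof (label_start _ _ _ _ _ G (proj1 HM1) Ht2) as L2.
    pose proof (label_end _ _ _ _ _ G (proj1 HM) Ht) as LE. fold B1 in LE. cbn in LE.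
    assert (N2 : snd l2 <> BX).
    { destruct l2 as [n b]; simpl; intros ->. destruct n; simpl in L2; [lra|]. apply (Min_adj _ _ _ _ _ _ HM). }
    pose proof (Lst_sy F l2 B1 G L2 N2) as A1.
    destruct (X_interior F B t _ G (proj1 HM) Ht) as [(q & _)|(_ & Y1 & _ & Z1)]; [rewrite Y, Rabs_right; lra | exact A1 | lra |].
    fold B1 in Y1, Z1.
    pose proof (Qs_const F B (rot t (lv F lX)) G (rot_SO3 _ _)) as Q. fold B1 in Q. unfold Qf in Q.
    rewrite X, Y, Z, LE, Y1 in Q. assert (0 < cc F * kx F * ky F) by (repeat apply Rmult_lt_0_compat; lra). nra. }
  intros HF HM. pose proof HF as [G C]. pose proof (gkx F G) as Kx. pose proof (gky F G) as Ky.
  pose proof (Min_pos _ _ _ _ _ HM) as Ht.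
  destruct (label_end _ _ _ _ _ G (proj1 HM) Ht) as (X & Y & Z). cbn [sg negb] in X, Y.
  pose proof (Min_tail _ _ _ _ _ HM) as HM1. set (B1 := mconj B (rot t (lv F lWm))) in *.
  pose proof PI_RGT_0.
  destruct R as [|[t2 l2] R].
  { exists BX, 0. split; auto. split; [lra|]. apply weq_zero. }
  pose proof (Min_pos _ _ _ _ _ HM1) as Ht2.
  pose proof (label_start _ _ _ _ _ G (proj1 HM1) Ht2) as L0.
  destruct l2 as [[] []]; cbn [Lst sg negb] in L0; try (exfalso; lra); try (exfalso; destruct L0 as (L1 & L2 & L3); lra).
  - destruct (CX F B1 t2 R HF HM1 X Y Z) as [Q ->]. exists BX, t2. split; auto. split; auto. apply weq_refl.
  - destruct (CX (symF Vs F) B1 t2 (map (symp Vs) R) (cf_Vs F HF) (Min_sym Vs _ _ _ HM1)) as [Q ER];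
      rewrite ?(sx_sym Vs), ?(sy_sym Vs), ?(sz_sym Vs); cbn [symF kx ky]; try lra.
    destruct R; [|discriminate]. exists BY, t2. split; auto. split; auto. apply weq_refl.
  - exfalso. exact (Min_adj _ _ _ _ _ _ HM).
Qed.

Lemma Wm_split F B L t R : cf F -> Min F B (L ++ (t, lWm) :: R) ->
  exists e1 e2 a b, (e1 = BX \/ e1 = BY) /\ (e2 = BX \/ e2 = BY) /\ 0 <= a <= PI /\ 0 <= b <= PI /\
    weq F (L ++ (t, lWm) :: R) [(a, (false, e1)); (t, lWm); (b, (false, e2))].
Proof.
  intros HF HM. pose proof (Min_drop _ _ _ _ HM) as HR.
  destruct (Wm_right _ _ _ _ HF HR) as (e2 & b & H2 & B2 & W2).
  pose proof (Min_revnu _ _ _ HM) as HL. rewrite rev_app_distr in HL. simpl rev in HL. rewrite <- app_assoc in HL.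
  apply Min_drop in HL. destruct (Wm_right _ _ _ _ (cf_Nu F HF) HL) as (e1 & a & H1 & B1 & W1).
  change [(a, (false, e1))] with (rev [(a, (false, e1))]) in W1. apply weq_revNu' in W1.
  exists e1, e2, a, b. do 4 (split; [auto|]). apply (weq_app F L _ [(a, (false, e1))]); auto. apply weq_cons; auto.
Qed.

(** * The finitely many shapes and the classification *)

Inductive kind := KI | KW | KM.
(** [KI] stands for pattern I, [KW] for IV and V, [KM] for VI and VII. The booleans are the signs of
    the two letters and whether Y comes first; the sign and the two kinds of tail; the sign and the
    two outer letters. The type is finite, as the pigeonhole argument requires. *)
Definition shape := (kind * (bool * bool * bool))%type.
Definition xy (b : bool) : base := if b then BY else BX.
Definition kxy (F : frame) (b : bool) : R := if b then ky F else kx F.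

Definition sword (s : shape) (p : nat -> R) : list (R * label) :=
  match s with
  | (KI, (b1, b2, b3)) => [(p 0%nat, (b1, xy b3)); (p 1%nat, (b2, xy (negb b3)));
                           (p 2%nat, (negb b1, xy b3)); (p 3%nat, (negb b2, xy (negb b3)))]
  | (KW, (n, i, j)) => rev (tailw i n (p 0%nat) (p 1%nat)) ++ (p 2%nat, (n, BWp)) :: tailw j n (p 3%nat) (p 4%nat)
  | (KM, (n, e1, e2)) => [(p 0%nat, (n, xy e1)); (p 1%nat, (n, BWm)); (p 2%nat, (n, xy e2))]
  end.

(* In the first kind p 4 and p 5 are the times of the full letters of the pattern. *)
Definition Sok (F : frame) (s : shape) (p : nat -> R) : Prop :=
  match s with
  | (KI, (b1, b2, b3)) =>
      0 <= p 0%nat <= p 4%nat /\ p 4%nat <= PI /\ 0 <= p 1%nat <= p 5%nat /\ p 5%nat <= PI /\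
      0 <= p 2%nat <= p 4%nat /\ 0 <= p 3%nat <= p 5%nat /\
      (p 1%nat = p 5%nat \/ p 2%nat = 0) /\ (p 1%nat = p 5%nat \/ p 3%nat = 0) /\ (p 2%nat = p 4%nat \/ p 3%nat = 0) /\
      kxy F b3 * (sin (p 4%nat / 2) * cos (p 5%nat / 2)) = kxy F (negb b3) * (cos (p 4%nat / 2) * sin (p 5%nat / 2))
  | (KW, (n, i, j)) => tail_ok F i (p 0%nat) (p 1%nat) /\ tail_ok F j (p 3%nat) (p 4%nat) /\
      0 <= p 2%nat /\ p 2%nat * vnorm (lv F (n, BWp)) <= PI
  | (KM, (n, e1, e2)) => 0 <= p 0%nat <= PI /\ 0 <= p 2%nat <= PI /\
      0 <= p 1%nat /\ p 1%nat * vnorm (lv F (n, BWm)) <= PI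
  end.

Definition Shape (F : frame) (l : list (R * label)) : Prop :=
  exists s p, Sok F s p /\ weq F l (sword s p).

Definition seqp (l : list R) (i : nat) : R := nth i l 0.

Definition sym_shape (s : sym) (x : shape) : shape :=
  match s, x with
  | Nu, (KI, (b1, b2, b3)) => (KI, (negb b1, negb b2, b3))
  | Nu, (k, (n, i, j)) => (k, (negb n, i, j))
  | Vs, (KI, (b1, b2, b3)) => (KI, (b1, b2, negb b3))
  | Vs, (KW, (n, i, j)) => (KW, (negb n, negb i, negb j))
  | Vs, (KM, (n, i, j)) => (KM, (n, negb i, negb j))
  | Rho, (k, (b1, b2, b3)) => (k, if b3 then (negb b1, b2, b3) else (b1, negb b2, b3))
  end.

Lemma tail_ok_Vs F i a b : tail_ok (symF Vs F) i a b -> tail_ok F (negb i) a b.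
Proof.
  unfold tail_ok. assert (E1 : hX (symF Vs F) = hY F) by reflexivity.
  assert (E2 : hY (symF Vs F) = hX F) by (unfold hY; rewrite symF_inv; reflexivity).
  rewrite E1, E2. destruct i; auto.
Qed.

Lemma Shape_sym s F l : (forall x p, Sok (symF s F) x p -> weq (symF s F) (map (symp s) l) (sword x p) -> s <> Rho \/ fst x = KI) ->
  Shape (symF s F) (map (symp s) l) -> Shape F l.
Proof.
  intros HS (x & p & OK & W). specialize (HS x p OK W). exists (sym_shape s x), p. split.
  - destruct s, x as [[] [[b1 b2] b3]]; cbn [sym_shape fst] in *; try (destruct HS; congruence);
    unfold Sok in *; rewrite ?Bool.negb_involutive in *.
    + exact OK.
    + rewrite !tail_ok_Nu in OK. rewrite <- (lv_sym Nu F (negb b1, BWp)). cbn [sym_label]. rewrite Bool.negb_involutive. exact OK.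
    + rewrite <- (lv_sym Nu F (negb b1, BWm)). cbn [sym_label]. rewrite Bool.negb_involutive. exact OK.
    + destruct b3; exact OK.
    + destruct b3; exact OK.
    + destruct OK as (O1 & O2 & O3). apply tail_ok_Vs in O1, O2. split; auto. split; auto.
      rewrite <- (lv_sym Vs F (negb b1, BWp)). cbn [sym_label]. rewrite Bool.negb_involutive. exact O3.
    + rewrite <- (lv_sym Vs F (b1, BWm)). exact OK.
  - apply (proj1 (weq_sym s F l _)). replace (map (symp s) (sword (sym_shape s x) p)) with (sword x p); auto.
    destruct s, x as [[] [[[] []] []]]; cbn [fst] in HS; try (destruct HS; congruence); reflexivity.
Qed.
Lemma Shape_Nu F l : Shape (symF Nu F) (map (symp Nu) l) -> Shape F l.
Proof. apply Shape_sym. intros; left; congruence. Qed.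
Lemma Shape_Vs F l : Shape (symF Vs F) (map (symp Vs) l) -> Shape F l.
Proof. apply Shape_sym. intros; left; congruence. Qed.

Lemma fv_nz F a b : gframe F -> a <> 0 -> fv F (a, b) <> mkV 0 0 0.
Proof.
  intros G Ha E. destruct (fv_coords F a b G) as (E1 & E2 & _). rewrite E in E1, E2. unfold dot in E1, E2; cbn in E1, E2.
  pose proof (gcc F G). assert (a * (1 - cc F * cc F) = 0) by nra. apply Rmult_integral in H0. nra.
Qed.
Lemma lv_nz F l : gframe F -> lv F l <> mkV 0 0 0.
Proof.
  assert (P : forall F b, gframe F -> b <> BY -> lv F (false, b) <> mkV 0 0 0).
  { clear. intros F b G Hb. destruct (Wp_coef_pos F G) as [W1 W2]. destruct (Wm_coef_pos F G) as [W3 W4].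
    destruct b; try congruence; apply fv_nz; auto; lra. }
  assert (P' : forall b, gframe F -> lv F (false, b) <> mkV 0 0 0).
  { intros b G. destruct b; try (apply P; auto; congruence).
    rewrite <- (lv_sym Vs F). apply P; auto using gframe_sym; congruence. }
  intros G. destruct l as [[] b]; auto.
  change (true, b) with (negb false, b). rewrite lv_neg. intros E. apply (P' b G).
  destruct (lv F (false, b)) as [x y z]. unfold vneg, vscale in E; cbn in E. injection E; intros. f_equal; lra.
Qed.
Lemma ucost_gcoef_pos F l : gframe F -> 0 < ucost F (gcoef F l).
Proof.
  intros G. pose proof (gkx F G) as Kx. pose proof (gky F G) as Ky.
  destruct (Wp_coef_pos F G) as [W1 W2]. destruct (Wm_coef_pos F G) as [W3 W4].
  assert (A : forall a b, (a <> 0 \/ b <> 0) -> 0 < ucost F (a, b)).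
  { intros a b H. unfold ucost; cbn [fst snd]. pose proof (Rabs_pos a); pose proof (Rabs_pos b).
    destruct H as [H|H]; apply Rabs_pos_lt in H; nra. }
  destruct l as [[] []]; cbn; apply A; lra.
Qed.
Lemma Min_time F B t l R : gframe F -> Min F B ((t, l) :: R) -> t * vnorm (lv F l) <= PI.
Proof.
  intros G [HO _]. rewrite fw_cons in HO. unfold lv. destruct (gcoef F l) as [a b] eqn:E.
  apply (OptW_le_pi F B t a b (fw F R)); auto; [rewrite <- E; apply ucost_gcoef_pos; auto|].
  rewrite <- E. apply (lv_nz F l G).
Qed.
Lemma Min_time_xy F B t n e R : gframe F -> Min F B ((t, (n, xy e)) :: R) -> 0 <= t <= PI.
Proof.
  intros G HM. pose proof (Min_pos _ _ _ _ _ HM) as Ht. pose proof (Min_time _ _ _ _ _ G HM) as P.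
  assert (V : vnorm (lv F (n, xy e)) = 1).
  { apply vnorm_unit. assert (NN : forall v, dot (vneg v) (vneg v) = dot v v) by (clear; mring).
    destruct n, e; cbn [xy]; rewrite ?lv_X, ?lv_Y, ?lv_Xn, ?lv_Yn, ?NN; apply G. }
  rewrite V in P. lra.
Qed.

Definition noW (l : list (R * label)) : Prop := forall t x, In (t, x) l -> exists n, x = (n, BX) \/ x = (n, BY).

Lemma Shape_W F B L t n R : cf F -> Min F B (L ++ (t, (n, BWp)) :: R) -> Shape F (L ++ (t, (n, BWp)) :: R).
Proof.
  assert (P : forall F B L t R, cf F -> Min F B (L ++ (t, lWp) :: R) -> Shape F (L ++ (t, lWp) :: R)).
  { clear. intros F B L t R HF HM. destruct (Wp_split F B L t R HF HM) as (i & j & a1 & b1 & a2 & b2 & O1 & O2 & W).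
    exists (KW, (false, i, j)), (seqp [a1; b1; t; a2; b2]). split; [|exact W].
    apply Min_drop in HM. pose proof (Min_pos _ _ _ _ _ HM) as Ht. apply Min_time in HM; [|apply HF].
    cbn. split; auto. split; auto. split; auto. lra. }
  intros HF HM. destruct n; [|eapply P; eauto]. apply Shape_Nu. rewrite map_app. cbn [map].
  apply (P _ B); [apply cf_Nu, HF|]. apply (Min_sym Nu) in HM. rewrite map_app in HM. exact HM.
Qed.
Lemma Shape_M F B L t n R : cf F -> Min F B (L ++ (t, (n, BWm)) :: R) -> Shape F (L ++ (t, (n, BWm)) :: R).
Proof.
  assert (P : forall F B L t R, cf F -> Min F B (L ++ (t, lWm) :: R) -> Shape F (L ++ (t, lWm) :: R)).
  { clear. intros F B L t R HF HM. destruct (Wm_split F B L t R HF HM) as (e1 & e2 & a & b & H1 & H2 & O1 & O2 & W).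
    assert (X1 : exists x, e1 = xy x) by (destruct H1; [exists false | exists true]; auto). destruct X1 as [x1 ->].
    assert (X2 : exists x, e2 = xy x) by (destruct H2; [exists false | exists true]; auto). destruct X2 as [x2 ->].
    exists (KM, (false, x1, x2)), (seqp [a; t; b]). split; [|exact W].
    apply Min_drop in HM. pose proof (Min_pos _ _ _ _ _ HM) as Ht. apply Min_time in HM; [|apply HF].
    cbn. split; auto. split; auto. split; auto. lra. }
  intros HF HM. destruct n; [|eapply P; eauto]. apply Shape_Nu. rewrite map_app. cbn [map].
  apply (P _ B); [apply cf_Nu, HF|]. apply (Min_sym Nu) in HM. rewrite map_app in HM. exact HM.
Qed.

Lemma Shape_cycle F B t1 t2 t3 l3 R a b : gframe F -> cc F <> 0 ->
  Min F B ((t1, lX) :: (t2, lY) :: (t3, l3) :: R) -> noW ((t1, lX) :: (t2, lY) :: (t3, l3) :: R) ->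
  let B1 := mconj B (rot t1 (fX F)) in
  sx F B1 = kx F -> sy F B1 = ky F -> sz F B1 = b -> 0 < a -> 0 < b -> b * b - a * a = 4 * cc F * kx F * ky F ->
  exists p, Sok F (KI, (false, false, false)) p /\
    weq F ((t1, lX) :: (t2, lY) :: (t3, l3) :: R) (sword (KI, (false, false, false)) p).
Proof.
  intros G C HM HN B1 X1 Y1 Z1 Ha Hb E. pose proof (gkx F G) as Kx. pose proof (gky F G) as Ky.
  destruct (cycle_class F B t1 t2 t3 l3 R a b G C HM) as (t4 & H1 & H2 & H3 & H4 & H5 & W); auto.
  { intros t l Hl. apply (HN t). right; right; auto. }
  set (T1 := dbl (2 * ky F / (a + b))) in *. set (T2 := dbl (2 * kx F / (a + b))) in *.
  pose proof (dbl_bd (2 * ky F / (a + b)) ltac:(apply Rdiv_lt_0_compat; lra)) as D1. fold T1 in D1.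
  pose proof (dbl_bd (2 * kx F / (a + b)) ltac:(apply Rdiv_lt_0_compat; lra)) as D2. fold T2 in D2.
  exists (seqp [t1; t2; t3; t4; T1; T2]). split; [|exact W].
  unfold Sok, seqp; cbn [nth kxy negb]. do 6 (split; [lra|]). split; [auto|]. split; [auto|]. split; [auto|].
  pose proof (dbl_half (2 * ky F / (a + b)) (2 * kx F / (a + b)) ltac:(apply Rdiv_lt_0_compat; lra) ltac:(apply Rdiv_lt_0_compat; lra)) as D.
  fold T1 T2 in D. apply Rmult_eq_reg_l with (2 / (a + b)); [|apply Rgt_not_eq, Rdiv_lt_0_compat; lra].
  replace (2 / (a + b) * (kx F * (sin (T1 / 2) * cos (T2 / 2)))) with (2 * kx F / (a + b) * (sin (T1 / 2) * cos (T2 / 2))) by (field; lra).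
  rewrite D. field. lra.
Qed.

Lemma noW_sym s l : noW l -> noW (map (symp s) l).
Proof.
  intros H t x Hx. apply in_map_iff in Hx. destruct Hx as ([t' y] & E & Hy). unfold symp in E; cbn in E. injection E as <- <-.
  destruct (H t' y Hy) as [n [-> | ->]]; destruct s; cbn; eauto.
Qed.

(** The X-letter joins two corners. If z vanishes at its end of type (kx, -ky), the word splits
    there into two tails; otherwise z is nonzero at both ends and the word is part of a cycle. *)
Lemma Shape_X F B t1 l1 t2 t3 l3 R : cf F -> Min F B ((t1, l1) :: (t2, lX) :: (t3, l3) :: R) ->
  noW ((t1, l1) :: (t2, lX) :: (t3, l3) :: R) -> Shape F ((t1, l1) :: (t2, lX) :: (t3, l3) :: R).
Proof.
  intros HF HM HN. pose proof HF as [G C]. pose proof (gkx F G) as Kx. pose proof (gky F G) as Ky.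
  pose proof (Min_pos _ _ _ _ _ HM) as p1.
  pose proof (Min_tail _ _ _ _ _ HM) as HM1. pose proof (Min_pos _ _ _ _ _ HM1) as p2.
  set (B1 := mconj B (rot t1 (lv F l1))) in *.
  pose proof (Min_tail _ _ _ _ _ HM1) as HM2. pose proof (Min_pos _ _ _ _ _ HM2) as p3.
  set (B2 := mconj B1 (rot t2 (lv F lX))) in *.
  pose proof (label_end _ _ _ _ _ G (proj1 HM) p1) as L1. fold B1 in L1.
  pose proof (label_start _ _ _ _ _ G (proj1 HM1) p2) as L1'. cbn in L1'.
  pose proof (label_end _ _ _ _ _ G (proj1 HM1) p2) as L2. fold B2 in L2. cbn in L2.
  pose proof (label_start _ _ _ _ _ G (proj1 HM2) p3) as L3.
  destruct (HN t1 l1) as [n1 E1]; [left; auto|]. destruct (HN t3 l3) as [n3 E3]; [right; right; left; auto|].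
  assert (T1 : l1 = (n1, BY)).
  { destruct E1 as [-> |]; auto. exfalso. destruct n1; cbn in L1; [lra|]. exact (Min_adj _ _ _ _ _ _ HM). }
  assert (T3 : l3 = (n3, BY)).
  { destruct E3 as [-> |]; auto. exfalso. destruct n3; cbn in L3; [lra|]. exact (Min_adj _ _ _ _ _ _ HM1). }
  clear E1 E3. pose proof (X_interior F B1 t2 _ G (proj1 HM1) p2) as XI. cbv zeta in XI. fold B2 in XI.
  assert (P4 : 0 < cc F * kx F * ky F) by (repeat apply Rmult_lt_0_compat; lra).
  pose proof (Qs_const F B1 (rot t2 (lv F lX)) G (rot_SO3 _ _)) as Q. fold B2 in Q. unfold Qf in Q. rewrite L1', L2 in Q.
  assert (NW : forall n t, ~ In (t, (n, BWp)) ((t1, l1) :: (t2, lX) :: (t3, l3) :: R)).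
  { intros n t Hin. destruct (HN _ _ Hin) as [m [|]]; congruence. }
  rewrite T1 in L1. rewrite T3 in L3. cbn in L1, L3.
  destruct XI as [(Y1 & Y2 & Z1 & Z2)|(Y1 & Y2 & Z1 & Z2)].
  { rewrite L1. destruct n1; cbn; rewrite ?Rabs_Ropp, Rabs_right; lra. }
  { rewrite L3. destruct n3; cbn; rewrite ?Rabs_Ropp, Rabs_right; lra. }
  - assert (n1 = true) as -> by (destruct n1; auto; cbn in L1; lra).
    assert (n3 = false) as -> by (destruct n3; auto; cbn in L3; lra). subst l1 l3.
    rewrite Y1, Y2 in Q.
    (* Conservation gives z2^2 = z1^2 + 4 c kx ky, so only z1 can vanish. *)
    destruct Z1 as [Z1|Z1].
    (* This composition turns -Y, X, Y into X, Y, -X. As it contains [Rho] the frame has a negative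
       cosine, which the cycle argument allows; the resulting shape is of the first kind and can be
       carried back. *)
    + set (F' := symF Nu (symF Rho (symF Vs F))).
      assert (G' : gframe F') by (unfold F'; do 3 apply gframe_sym; auto).
      assert (SX : sx F' B1 = kx F') by (unfold F'; rewrite !sx_sym; cbn [symF kx ky]; lra).
      assert (SY : sy F' B1 = ky F') by (unfold F'; rewrite !sy_sym; cbn [symF kx ky]; lra).
      assert (SZ : sz F' B1 = sz F B1) by (unfold F'; rewrite !sz_sym; lra).
      assert (CF : cc F' = - cc F) by (unfold F'; rewrite !cc_sym; auto).
      assert (Bq : B1 = mconj B (rot t1 (fX F'))) by (unfold B1; rewrite lv_Yn; reflexivity).
      assert (z2 : 0 < sz F B2) by nra.
      pose proof (Min_sym Nu _ _ _ (Min_sym Rho _ _ _ (Min_sym Vs _ _ _ HM))) as HM'. fold F' in HM'.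
      pose proof (noW_sym Nu _ (noW_sym Rho _ (noW_sym Vs _ HN))) as HN'. cbn [map] in HM', HN'.
      destruct (Shape_cycle F' B t1 t2 t3 lXn _ (sz F B2) (sz F B1) G' ltac:(rewrite CF; lra) HM' HN') as (p & OK & W); auto;
        rewrite <- ?Bq; auto.
      { rewrite CF. change (kx F') with (ky F). change (ky F') with (kx F). lra. }
      apply Shape_Vs. set (x := (KI, (false, false, false))) in *.
      exists (sym_shape Rho (sym_shape Nu x)), p. split.
      * exact OK.
      * apply (proj1 (weq_sym Rho (symF Vs F) _ (sword (sym_shape Rho (sym_shape Nu x)) p))).
        apply (proj1 (weq_sym Nu (symF Rho (symF Vs F)) _ (map (symp Rho) (sword (sym_shape Rho (sym_shape Nu x)) p)))). exact W.
    +
      assert (HC := corner_split F B [(t1, lYn)] ((t2, lX) :: (t3, lY) :: R) HF HM).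
      cbv zeta in HC. rewrite fw_cons in HC. simpl fw in HC at 1 2 3. rewrite wp_single in HC. fold (lv F lYn) B1 in HC.
      destruct HC as (i & j & a1 & b1 & a2 & b2 & O1 & O2 & W); auto.
      exists (KW, (false, i, j)), (seqp [a1; b1; 0; a2; b2]). split; [|exact W].
      pose proof PI_RGT_0. cbn. split; auto. split; auto. lra.
  - assert (n1 = false) as -> by (destruct n1; auto; cbn in L1; lra).
    assert (n3 = true) as -> by (destruct n3; auto; cbn in L3; lra). subst l1 l3.
    rewrite Y1, Y2 in Q.
    (* Now z1^2 = z2^2 + 4 c kx ky, and the corner that may have z = 0 is at the end of the
       X-letter. *)
    destruct Z2 as [Z2|Z2].
    + set (F' := symF Vs F).
      assert (G' : gframe F') by (apply gframe_sym; auto).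
      assert (SX : sx F' B1 = kx F') by (unfold F'; rewrite !sx_sym; cbn [symF kx ky]; lra).
      assert (SY : sy F' B1 = ky F') by (unfold F'; rewrite !sy_sym; cbn [symF kx ky]; lra).
      assert (SZ : sz F' B1 = - sz F B1) by (unfold F'; rewrite !sz_sym; lra).
      assert (CF : cc F' = cc F) by (unfold F'; rewrite !cc_sym; auto).
      assert (Bq : B1 = mconj B (rot t1 (fX F'))) by (unfold B1; rewrite lv_Y; reflexivity).
      assert (z1 : sz F B1 < 0) by nra.
      pose proof (Min_sym Vs _ _ _ HM) as HM'. fold F' in HM'.
      pose proof (noW_sym Vs _ HN) as HN'. cbn [map] in HM', HN'.
      destruct (Shape_cycle F' B t1 t2 t3 lXn _ (- sz F B2) (- sz F B1) G' ltac:(rewrite CF; lra) HM' HN') as (p & OK & W); auto;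
        rewrite <- ?Bq; auto; try lra.
      { rewrite CF. change (kx F') with (ky F). change (ky F') with (kx F). lra. }
      apply Shape_Vs. exists (KI, (false, false, false)), p. auto.
    + assert (HC := corner_split F B [(t1, lY); (t2, lX)] ((t3, lYn) :: R) HF HM).
      cbv zeta in HC.
      assert (EB : mconj B (wp F (fw F [(t1, lY); (t2, lX)])) = B2).
      { rewrite !fw_cons, !wp_cons. cbn [fst snd fw map]. change (wp F []) with mid3. rewrite mmul_1r, mconj_mul. reflexivity. }
      rewrite EB in HC.
      destruct HC as (i & j & a1 & b1 & a2 & b2 & O1 & O2 & W); auto.
      exists (KW, (false, i, j)), (seqp [a1; b1; 0; a2; b2]). split; [|exact W].
      pose proof PI_RGT_0. cbn. split; auto. split; auto. lra.
Qed.

(** One or two letters carry no relation between their times; they fit pattern I with both full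
    times pi, where the cross-multiplied relation reads 0 = 0. *)
Lemma short_ok F b1 b2 b3 t1 t2 : 0 <= t1 <= PI -> 0 <= t2 <= PI ->
  Sok F (KI, (b1, b2, b3)) (seqp [t1; t2; 0; 0; PI; PI]).
Proof.
  intros H1 H2. unfold Sok, seqp; cbn [nth]. pose proof PI_RGT_0. rewrite cos_PI2, sin_PI2.
  do 6 (split; [lra|]). repeat (split; [auto|]). ring.
Qed.

Theorem classification F B l : cf F -> Min F B l -> Shape F l.
Proof.
  intros HF HM. pose proof HF as [G C]. pose proof (gkx F G) as Kx. pose proof (gky F G) as Ky. pose proof PI_RGT_0.
  destruct (classic (exists t n, In (t, (n, BWp)) l)) as [(t & n & Hin)|N1].
  { apply in_split in Hin. destruct Hin as (L & R & ->). eapply Shape_W; eauto. }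
  destruct (classic (exists t n, In (t, (n, BWm)) l)) as [(t & n & Hin)|N2].
  { apply in_split in Hin. destruct Hin as (L & R & ->). eapply Shape_M; eauto. }
  assert (HN : noW l).
  { intros t [n []] Hin; eauto; exfalso; eauto. }
  clear N1 N2.
  assert (XY : forall t x, In (t, x) l -> exists n e, x = (n, xy e)).
  { intros t x Hin. destruct (HN t x Hin) as [n [-> | ->]]; [exists n, false | exists n, true]; auto. }
  destruct l as [|[t1 l1] [|[t2 l2] [|[t3 l3] R]]].
  - exists (KI, (false, false, false)), (seqp [0; 0; 0; 0; PI; PI]). split; [apply short_ok; lra|].
    cbn. repeat (eapply weq_trans; [|apply weq_zero]). apply weq_refl.
  - destruct (XY t1 l1) as (n & e & ->); [left; auto|].
    exists (KI, (n, false, e)), (seqp [t1; 0; 0; 0; PI; PI]). split.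
    + apply short_ok; [|lra]. eapply Min_time_xy; eauto.
    + cbn. apply weq_cons. repeat (eapply weq_trans; [|apply weq_zero]). apply weq_refl.
  - destruct (XY t1 l1) as (n & e & ->); [left; auto|]. destruct (XY t2 l2) as (n2 & e2 & ->); [right; left; auto|].
    pose proof (Min_tail _ _ _ _ _ HM) as HM1.
    assert (E : e2 = negb e).
    { pose proof (label_end _ _ _ _ _ G (proj1 HM) (Min_pos _ _ _ _ _ HM)) as L1.
      pose proof (label_start _ _ _ _ _ G (proj1 HM1) (Min_pos _ _ _ _ _ HM1)) as L2.
      destruct e, e2; auto; exfalso; destruct n, n2; try exact (Min_adj _ _ _ _ _ _ HM); cbn in L1, L2; lra. }
    subst e2. exists (KI, (n, n2, e)), (seqp [t1; t2; 0; 0; PI; PI]). split.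
    + apply short_ok; eapply Min_time_xy; eauto.
    + cbn. do 2 apply weq_cons. repeat (eapply weq_trans; [|apply weq_zero]). apply weq_refl.
  - destruct (XY t2 l2) as (n & e & ->); [right; left; auto|].
    destruct e, n.
    + apply Shape_Nu, Shape_Vs. cbn [map]. apply (Shape_X _ B); [apply cf_Vs, cf_Nu, HF| |].
      * apply (Min_sym Vs _ _ _ (Min_sym Nu _ _ _ HM)).
      * apply (noW_sym Vs _ (noW_sym Nu _ HN)).
    + apply Shape_Vs. cbn [map]. apply (Shape_X _ B); [apply cf_Vs, HF| |].
      * apply (Min_sym Vs _ _ _ HM).
      * apply (noW_sym Vs _ HN).
    + apply Shape_Nu. cbn [map]. apply (Shape_X _ B); [apply cf_Nu, HF| |].
      * apply (Min_sym Nu _ _ _ HM).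
      * apply (noW_sym Nu _ HN).
    + apply (Shape_X F B); auto.
Qed.

Lemma Min_exists F B l : OptW F B (fw F l) -> exists l', weq F l' l /\ Min F B l'.
Proof.
  remember (length l) as n eqn:En. revert l En. induction n as [n IH] using lt_wf_ind. intros l -> HO.
  destruct (classic (exists l', nnw (fw F l') /\ wp F (fw F l') = wp F (fw F l) /\ wc F (fw F l') <= wc F (fw F l) /\ (length l' < length l)%nat))
    as [(l' & H1 & H2 & H3 & H4)|N].
  - assert (HO' : OptW F B (fw F l')) by (apply (OptW_eq F B (fw F l)); auto).
    destruct (IH (length l') H4 l' eq_refl HO') as (l2 & W & M). exists l2. split; auto.
    eapply weq_trans; [exact W|]. split; auto. apply Rle_antisym; auto.
    destruct HO as [_ HO]. specialize (HO (fw F l') H1). rewrite H2 in HO.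
    rewrite (SO3_rinv _ (wp_SO3 _ _)), mmul_1r in HO. lra.
  - exists l. split; [apply weq_refl|]. split; auto. intros l' H1 H2 H3. apply not_gt. intros H4. apply N. exists l'. auto.
Qed.

(** * Limits of words of a fixed shape *)

Lemma tends_cv u l : tends u l -> Un_cv u l.
Proof.
  intros H e He. destruct (H (e / 2)) as [N HN]; [lra|]. exists N. intros n Hn. specialize (HN n Hn). unfold Rdist. lra.
Qed.
Lemma cv_const c : Un_cv (fun _ => c) c.
Proof. intros e He. exists 0%nat. intros. unfold Rdist. rewrite Rminus_diag, Rabs_R0. exact He. Qed.
Lemma cv_cos u l : Un_cv u l -> Un_cv (fun n => cos (u n)) (cos l).
Proof. apply continuity_seq, continuity_cos. Qed.
Lemma cv_sin u l : Un_cv u l -> Un_cv (fun n => sin (u n)) (sin l).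
Proof. apply continuity_seq, continuity_sin. Qed.
Lemma cv_opp u l : Un_cv u l -> Un_cv (fun n => - u n) (- l).
Proof. apply CV_opp. Qed.
Ltac cvt := repeat first [assumption | apply cv_const | apply CV_plus | apply CV_minus | apply CV_mult | apply cv_opp | apply cv_cos | apply cv_sin].

Lemma cv_le u v a b : Un_cv u a -> Un_cv v b -> (forall n, u n <= v n) -> a <= b.
Proof. intros H1 H2 H. eapply Rle_cv_lim; eauto. Qed.
Lemma cv_eq u v a b : Un_cv u a -> Un_cv v b -> (forall n, u n = v n) -> a = b.
Proof. intros H1 H2 H. apply Rle_antisym; eapply cv_le; eauto; intros; rewrite H; lra. Qed.
(** A disjunction of two equations is closed because it is the single equation that their product
    vanishes. *)
Lemma cv_or u v w z a b c d : Un_cv u a -> Un_cv v b -> Un_cv w c -> Un_cv z d ->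
  (forall n, u n = v n \/ w n = z n) -> a = b \/ c = d.
Proof.
  intros H1 H2 H3 H4 H.
  assert (E : (a - b) * (c - d) = 0).
  { apply (cv_eq (fun n => (u n - v n) * (w n - z n)) (fun _ => 0)); cvt.
    intros n. destruct (H n) as [-> | ->]; ring. }
  apply Rmult_integral in E. lra.
Qed.

Lemma Sok_closed F s q l : (forall i, (i < 6)%nat -> Un_cv (fun n => q n i) (l i)) ->
  (forall n, Sok F s (q n)) -> Sok F s l.
Proof.
  intros HC H.
  pose proof (HC 0%nat ltac:(lia)) as c0. pose proof (HC 1%nat ltac:(lia)) as c1. pose proof (HC 2%nat ltac:(lia)) as c2.
  pose proof (HC 3%nat ltac:(lia)) as c3. pose proof (HC 4%nat ltac:(lia)) as c4. pose proof (HC 5%nat ltac:(lia)) as c5. clear HC.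
  assert (TO : forall i (u v : nat -> R) a b, Un_cv u a -> Un_cv v b -> (forall n, tail_ok F i (u n) (v n)) -> tail_ok F i a b).
  { clear. intros i u v a b Hu Hv H. unfold tail_ok in *. set (k1 := if i then hY F else hX F) in *. set (k2 := if i then hX F else hY F) in *.
    split; [split|split; [split|]].
    - apply (cv_le (fun _ => 0) u); cvt. intros; apply H.
    - apply (cv_le u (fun _ => k1)); cvt. intros; apply H.
    - apply (cv_le (fun _ => 0) v); cvt. intros; apply H.
    - apply (cv_le v (fun _ => k2)); cvt. intros; apply H.
    - apply (cv_or v (fun _ => 0) u (fun _ => k1)); cvt. intros; apply H. }
  destruct s as [[] [[b1 b2] b3]]; unfold Sok in *.
  - repeat match goal with |- _ /\ _ => split end.
    + apply (cv_le (fun _ => 0) (fun n => q n 0%nat)); cvt. intros; apply H.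
    + apply (cv_le (fun n => q n 0%nat) (fun n => q n 4%nat)); cvt. intros; apply H.
    + apply (cv_le (fun n => q n 4%nat) (fun _ => PI)); cvt. intros; apply H.
    + apply (cv_le (fun _ => 0) (fun n => q n 1%nat)); cvt. intros; apply H.
    + apply (cv_le (fun n => q n 1%nat) (fun n => q n 5%nat)); cvt. intros; apply H.
    + apply (cv_le (fun n => q n 5%nat) (fun _ => PI)); cvt. intros; apply H.
    + apply (cv_le (fun _ => 0) (fun n => q n 2%nat)); cvt. intros; apply H.
    + apply (cv_le (fun n => q n 2%nat) (fun n => q n 4%nat)); cvt. intros; apply H.
    + apply (cv_le (fun _ => 0) (fun n => q n 3%nat)); cvt. intros; apply H.
    + apply (cv_le (fun n => q n 3%nat) (fun n => q n 5%nat)); cvt. intros; apply H.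
    + apply (cv_or (fun n => q n 1%nat) (fun n => q n 5%nat) (fun n => q n 2%nat) (fun _ => 0)); cvt. intros; apply H.
    + apply (cv_or (fun n => q n 1%nat) (fun n => q n 5%nat) (fun n => q n 3%nat) (fun _ => 0)); cvt. intros; apply H.
    + apply (cv_or (fun n => q n 2%nat) (fun n => q n 4%nat) (fun n => q n 3%nat) (fun _ => 0)); cvt. intros; apply H.
    + apply (cv_eq (fun n => kxy F b3 * (sin (q n 4%nat / 2) * cos (q n 5%nat / 2)))
                   (fun n => kxy F (negb b3) * (cos (q n 4%nat / 2) * sin (q n 5%nat / 2)))); unfold Rdiv; cvt. intros; apply H.
  - split; [|split; [|split]].
    + apply (TO b2 (fun n => q n 0%nat) (fun n => q n 1%nat)); auto. intros; apply H.
    + apply (TO b3 (fun n => q n 3%nat) (fun n => q n 4%nat)); auto. intros; apply H.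
    + apply (cv_le (fun _ => 0) (fun n => q n 2%nat)); cvt. intros; apply H.
    + apply (cv_le (fun n => q n 2%nat * vnorm (lv F (b1, BWp))) (fun _ => PI)); cvt. intros; apply H.
  - repeat match goal with |- _ /\ _ => split end.
    + apply (cv_le (fun _ => 0) (fun n => q n 0%nat)); cvt. intros; apply H.
    + apply (cv_le (fun n => q n 0%nat) (fun _ => PI)); cvt. intros; apply H.
    + apply (cv_le (fun _ => 0) (fun n => q n 2%nat)); cvt. intros; apply H.
    + apply (cv_le (fun n => q n 2%nat) (fun _ => PI)); cvt. intros; apply H.
    + apply (cv_le (fun _ => 0) (fun n => q n 1%nat)); cvt. intros; apply H.
    + apply (cv_le (fun n => q n 1%nat * vnorm (lv F (b1, BWm))) (fun _ => PI)); cvt. intros; apply H.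
Qed.

(* Coordinates that do not occur in a shape are reset to 0 to make the parameters bounded. *)
Definition trim (s : shape) (p : nat -> R) (i : nat) : R :=
  if Nat.ltb i (match fst s with KI => 6 | KW => 5 | KM => 3 end) then p i else 0.
Lemma trim_ok F s p : Sok F s p -> Sok F s (trim s p).
Proof. destruct s as [[] [[b1 b2] b3]]; exact (fun H => H). Qed.
Lemma trim_word s p : sword s (trim s p) = sword s p.
Proof. destruct s as [[] [[b1 b2] b3]]; reflexivity. Qed.

Lemma Sok_bounded F : cf F -> exists M, forall s p, Sok F s p -> forall i, Rabs (trim s p i) <= M.
Proof.
  intros HF. pose proof HF as [G C]. destruct (hX_spec F HF) as (h1 & _). destruct (hX_spec _ (cf_Vs F HF)) as (h2 & _). fold (hY F) in h2.
  set (iv := fun l => PI / vnorm (lv F l)).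
  assert (IV : forall l t, 0 <= t -> t * vnorm (lv F l) <= PI -> t <= iv l).
  { intros l t Ht H. unfold iv. pose proof (vnorm_pos _ (lv_nz F l G)) as P.
    apply Rmult_le_reg_r with (vnorm (lv F l)); auto. unfold Rdiv. rewrite Rmult_assoc, Rinv_l; lra. }
  pose proof PI_RGT_0.
  assert (IP : forall l, 0 < iv l) by (intros l; apply Rdiv_lt_0_compat; auto; apply vnorm_pos, lv_nz, G).
  set (M := PI + iv lWp + iv lWpn + iv lWm + iv lWmn).
  pose proof (IP lWp); pose proof (IP lWpn); pose proof (IP lWm); pose proof (IP lWmn).
  assert (IM : forall n b, b = BWp \/ b = BWm -> iv (n, b) <= M) by (intros [] b [-> | ->]; unfold M; lra).
  assert (PM : PI <= M) by (unfold M; lra).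
  assert (Z : Rabs 0 <= M) by (rewrite Rabs_R0; lra).
  assert (A : forall x, 0 <= x <= M -> Rabs x <= M) by (intros; rewrite Rabs_right; lra).
  exists M. intros s p OK i.
  assert (TO : forall i a b, tail_ok F i a b -> (0 <= a <= M) /\ (0 <= b <= M)).
  { intros i' a b. unfold tail_ok. destruct i'; lra. }
  destruct s as [[] [[b1 b2] b3]]; unfold Sok in OK.
  - do 6 (destruct i as [|i]; [apply A; cbn; lra|]). exact Z.
  - destruct OK as (O1 & O2 & O3 & O4). apply TO in O1, O2. apply IV in O4; auto. pose proof (IM b1 BWp ltac:(auto)).
    do 5 (destruct i as [|i]; [apply A; cbn; lra|]). exact Z.
  - destruct OK as (O1 & O2 & O3 & O4). apply IV in O4; auto. pose proof (IM b1 BWm ltac:(auto)).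
    do 3 (destruct i as [|i]; [apply A; cbn; lra|]). exact Z.
Qed.

Lemma pigeonhole (f : nat -> shape) : exists s, forall N, exists n, (N <= n)%nat /\ f n = s.
Proof.
  apply NNPP. intros H.
  assert (A : forall s, exists N, forall n, (N <= n)%nat -> f n <> s).
  { intros s. apply NNPP. intros H1. apply H. exists s. intros N. apply NNPP. intros H2. apply H1.
    exists N. intros n Hn E. apply H2. exists n. auto. }
  set (bs := [false; true]).
  set (all := list_prod [KI; KW; KM] (list_prod (list_prod bs bs) bs)).
  assert (ALL : forall s, In s all).
  { intros [k [[b1 b2] b3]]. assert (BS : forall b, In b bs) by (intros []; simpl; auto).
    repeat apply in_prod; auto. destruct k; simpl; auto. }
  assert (Q : forall L, exists N, forall s, In s L -> forall n, (N <= n)%nat -> f n <> s).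
  { induction L as [|s L [N HN]]; [exists 0%nat; intros ? []|]. destruct (A s) as [N' HN'].
    exists (N + N')%nat. intros s' [<- | Hs] n Hn; [apply HN'; lia | apply HN; auto; lia]. }
  destruct (Q all) as [N HN]. apply (HN (f N) (ALL _) N); auto.
Qed.

Definition ecv (u : nat -> M3) (A : M3) : Prop :=
  (Un_cv (fun n => m11 (u n)) (m11 A) /\ Un_cv (fun n => m12 (u n)) (m12 A) /\ Un_cv (fun n => m13 (u n)) (m13 A)) /\
  (Un_cv (fun n => m21 (u n)) (m21 A) /\ Un_cv (fun n => m22 (u n)) (m22 A) /\ Un_cv (fun n => m23 (u n)) (m23 A)) /\
  (Un_cv (fun n => m31 (u n)) (m31 A) /\ Un_cv (fun n => m32 (u n)) (m32 A) /\ Un_cv (fun n => m33 (u n)) (m33 A)).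
Lemma ecv_const A : ecv (fun _ => A) A.
Proof. unfold ecv. repeat match goal with |- _ /\ _ => split end; apply cv_const. Qed.
Lemma ecv_mul u v A B : ecv u A -> ecv v B -> ecv (fun n => mmul (u n) (v n)) (mmul A B).
Proof.
  intros ((?&?&?)&(?&?&?)&(?&?&?)) ((?&?&?)&(?&?&?)&(?&?&?)). unfold ecv, mmul; cbn [m11 m12 m13 m21 m22 m23 m31 m32 m33].
  repeat match goal with |- _ /\ _ => split end; cvt.
Qed.
Lemma ecv_mtr u A : ecv u A -> Un_cv (fun n => mtr (u n)) (mtr A).
Proof. intros ((?&?&?)&(?&?&?)&(?&?&?)). unfold mtr. cvt. Qed.
Lemma ecv_rot t l v : Un_cv t l -> ecv (fun n => rot (t n) v) (rot l v).
Proof.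
  intros H. unfold ecv, rot, rot_unit; cbn [m11 m12 m13 m21 m22 m23 m31 m32 m33].
  repeat match goal with |- _ /\ _ => split end; cvt.
Qed.

(** Separates the labels of a shape from its parameters, so that continuity in the parameters is one
    induction on a list instead of an analysis of the shapes. *)
Definition inst (L : list (nat * label)) (p : nat -> R) : list (R * label) := map (fun x => (p (fst x), snd x)) L.
Definition slots (s : shape) : list (nat * label) :=
  let tl (i n : bool) (a b : nat) := if i then [(a, (negb n, BY)); (b, (negb n, BX))] else [(a, (n, BX)); (b, (n, BY))] in
  match s with
  | (KI, (b1, b2, b3)) => [(0, (b1, xy b3)); (1, (b2, xy (negb b3))); (2, (negb b1, xy b3)); (3, (negb b2, xy (negb b3)))]%nat
  | (KW, (n, i, j)) => (rev (tl i n 0 1) ++ (2, (n, BWp)) :: tl j n 3 4)%nat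
  | (KM, (n, e1, e2)) => [(0, (n, xy e1)); (1, (n, BWm)); (2, (n, xy e2))]%nat
  end.
Lemma sword_inst s p : sword s p = inst (slots s) p.
Proof. destruct s as [[] [[n []] []]]; reflexivity. Qed.
Lemma slots_lt s i x : In (i, x) (slots s) -> (i < 6)%nat.
Proof.
  intros H. apply (in_map fst) in H. cbn in H. revert H.
  assert (A : Forall (fun i => (i < 6)%nat) (map fst (slots s))).
  { destruct s as [[] [[n []] []]]; cbn; repeat constructor. }
  rewrite Forall_forall in A. apply A.
Qed.

Lemma inst_cv F L q l : (forall i x, In (i, x) L -> Un_cv (fun n => q n i) (l i)) ->
  ecv (fun n => wp F (fw F (inst L (q n)))) (wp F (fw F (inst L l))) /\
  Un_cv (fun n => wc F (fw F (inst L (q n)))) (wc F (fw F (inst L l))).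
Proof.
  induction L as [|[i x] L IH]; intros H.
  - split; [exact (ecv_const mid3) | exact (cv_const 0)].
  - destruct IH as [I1 I2]; [intros; apply (H i0 x0); right; auto|]. pose proof (H i x ltac:(left; auto)) as Hi. split.
    + change (ecv (fun n => mmul (rot (q n i) (lv F x)) (wp F (fw F (inst L (q n)))))
                  (mmul (rot (l i) (lv F x)) (wp F (fw F (inst L l))))).
      apply ecv_mul; auto. apply ecv_rot; auto.
    + change (Un_cv (fun n => q n i * ucost F (gcoef F x) + wc F (fw F (inst L (q n))))
                  (l i * ucost F (gcoef F x) + wc F (fw F (inst L l)))). cvt.
Qed.

(** * Maxima of the trace on SO(3) and the limit word *)

Lemma rot_trace B t u : mtr (mmul B (rot_unit t u)) =
  cos t * mtr B + sin t * dot (vee B) u + (1 - cos t) * dot u (mv B u).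
Proof. unfold rot_unit. generalize (cos t) (sin t). intros c s. revert B u. mring. Qed.

(** With q the tangent of t/2 the condition becomes q (D - A q) <= 0 for all q, which forces D = 0
    and A >= 0. *)
Lemma axis_max B u : (forall t, mtr (mmul B (rot_unit t u)) <= mtr B) ->
  dot (vee B) u = 0 /\ dot u (mv B u) <= mtr B.
Proof.
  intros H. set (A := mtr B - dot u (mv B u)). set (D := dot (vee B) u).
  assert (P : forall q, q * (D - A * q) <= 0).
  { intros q. specialize (H (dbl q)). rewrite rot_trace, dbl_cos, dbl_sin in H. fold D in H.
    assert (E : (1 - q * q) / (1 + q * q) * mtr B + 2 * q / (1 + q * q) * D + (1 - (1 - q * q) / (1 + q * q)) * dot u (mv B u)
      = mtr B + 2 * / (1 + q * q) * (q * (D - A * q))) by (unfold A; field; nra).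
    rewrite E in H. assert (0 < / (1 + q * q)) by (apply Rinv_0_lt_compat; nra). nra. }
  assert (HA : 0 <= A).
  { pose proof (P 1); pose proof (P (-1)). lra. }
  split; [|unfold A in HA; lra].
  pose proof (P (D / (1 + A))) as Q.
  assert (E : D / (1 + A) * (D - A * (D / (1 + A))) = (D / (1 + A)) * (D / (1 + A))) by (field; lra).
  rewrite E in Q. assert (Z : D / (1 + A) = 0) by nra.
  replace D with (D / (1 + A) * (1 + A)) by (field; lra). rewrite Z. ring.
Qed.

Lemma SO3_tr_le A : inSO3 A -> mtr A <= 3.
Proof.
  intros H. destruct (SO3_sqsum A H) as (E1 & E2 & E3). unfold mtr.
  pose proof (sq_le1 (m11 A) 1). pose proof (sq_le1 (m22 A) 1). pose proof (sq_le1 (m33 A) 1).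
  pose proof (Rle_abs (m11 A)). pose proof (Rle_abs (m22 A)). pose proof (Rle_abs (m33 A)).
  pose proof (pow2_ge_0 (m12 A)); pose proof (pow2_ge_0 (m13 A)); pose proof (pow2_ge_0 (m21 A));
  pose proof (pow2_ge_0 (m23 A)); pose proof (pow2_ge_0 (m31 A)); pose proof (pow2_ge_0 (m32 A)). lra.
Qed.

(** A symmetric rotation is the identity or a half turn; the entries give (tr B - 3)(tr B + 1) =
    0. *)
Lemma SO3_sym_trace B : inSO3 B -> vee B = mkV 0 0 0 -> B = mid3 \/ mtr B = -1.
Proof.
  intros S V. pose proof (SO3_sqsum B S) as (E1 & E2 & E3). pose proof (SO3_adj B S) as AD.
  destruct B as [a b c d e f g h i]. unfold vee, mtrans, madj in *; cbn in *.
  injection V; intros V1 V2 V3. injection AD; intros.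
  assert (d = b) by lra. assert (g = c) by lra. assert (h = f) by lra. subst d g h.
  unfold mtr; cbn.
  assert (T : (a + e + i - 3) * (a + e + i + 1) = 0) by nra.
  apply Rmult_integral in T. destruct T as [T|T]; [left|right; lra].
  assert (a <= 1) by nra. assert (e <= 1) by nra. assert (i <= 1) by nra.
  assert (a = 1) by lra. assert (e = 1) by lra. assert (i = 1) by lra. subst a e i.
  assert (b = 0) by nra. assert (c = 0) by nra. assert (f = 0) by nra. unfold mid3. f_equal; lra.
Qed.

(** Maximality along three independent axes makes B symmetric. A half turn is then excluded: trace
    -1 would force B to reverse all three axes, while B preserves cross products. *)
Lemma trace_max F B : gframe F -> inSO3 B -> (forall w, nnw w -> mtr (mmul B (wp F w)) <= mtr B) -> B = mid3.
Proof.
  intros G S H.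
  assert (HX : forall v ab, fv F ab = v -> dot v v = 1 -> forall t, exists w, nnw w /\ wp F w = rot_unit t v).
  { intros v [a b] E U t. rewrite <- (rot_unit_eq t v U), <- E. destruct (Rle_lt_dec 0 t).
    - exists [(t, (a, b))]. split; [constructor; [exact r|constructor]|]. apply wp_single.
    - exists [(- t, (- a, - b))]. split; [constructor; [cbn; lra|constructor]|]. rewrite wp_single, fv_neg, rot_vneg, Ropp_involutive. reflexivity. }
  pose proof (HX _ _ (fv_10 F) (gX F G)) as PX. pose proof (HX _ _ (fv_01 F) (gY F G)) as PY.
  (* A third axis within reach of words: conjugating Y-rotations by a quarter turn about X gives
     rotations about u = c X + X x Y. *)
  set (Q := rot (PI / 2) (fX F)). assert (SQ : inSO3 Q) by apply rot_SO3.
  set (u := mv Q (fY F)). assert (Uu : dot u u = 1) by (unfold u; rewrite dot_SO3; auto; apply G).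
  assert (PU : forall t, exists w, nnw w /\ wp F w = rot_unit t u).
  { intros t. destruct (PX (PI / 2)) as (w1 & N1 & E1). destruct (PX (- (PI / 2))) as (w3 & N3 & E3). destruct (PY t) as (w2 & N2 & E2).
    exists (w1 ++ w2 ++ w3). split; [repeat (apply nnw_app; split; auto)|].
    rewrite !wp_app, E1, E2, E3, <- (rot_unit_eq t u Uu). rewrite <- !rot_unit_eq by apply G.
    rewrite rot_opp. fold Q. unfold u. rewrite <- (rot_conj Q t (fY F) SQ), !mmul_assoc. reflexivity. }
  assert (AX : forall v, (forall t, exists w, nnw w /\ wp F w = rot_unit t v) -> dot (vee B) v = 0 /\ dot v (mv B v) <= mtr B).
  { intros v Hv. apply axis_max. intros t. destruct (Hv t) as (w & N & <-). auto. }
  destruct (AX _ PX) as [X1 X2]. destruct (AX _ PY) as [Y1 Y2]. destruct (AX _ PU) as [U1 U2].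
  destruct (mv_rotX_dotY F (vee B) (PI / 2) G) as (_ & E2 & _).
  unfold u in U1. rewrite dot_mv in U1. fold Q in E2. rewrite U1, X1, Y1, sin_PI2, cos_PI2 in E2.
  assert (V : vee B = mkV 0 0 0).
  { apply (vec_ext F); auto; [rewrite X1 | rewrite Y1 |]; try (unfold dot; cbn; ring). transitivity 0; [lra | unfold dot; cbn; ring]. }
  destruct (SO3_sym_trace B S V) as [|T]; auto. exfalso. rewrite T in *.
  assert (NG : forall v, dot v v = 1 -> dot v (mv B v) <= -1 -> mv B v = vneg v).
  { intros v Uv Hv. set (d := vadd (mv B v) v).
    assert (EX : forall x y, dot (vadd x y) (vadd x y) = dot x x + 2 * dot y x + dot y y) by (clear; mring).
    pose proof (EX (mv B v) v) as E. fold d in E.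
    rewrite dot_SO3, Uv in E by auto. assert (Z : dot d d = 0).
    { apply Rle_antisym; [lra|]. unfold dot. nra. }
    apply dot_self_0 in Z. unfold d in Z. destruct (mv B v), v; unfold vadd, vneg, vscale in *; cbn in *. injection Z; intros. f_equal; lra. }
  pose proof (NG _ (gX F G) X2) as BX. pose proof (NG _ (gY F G) Y2) as BY. pose proof (NG _ Uu U2) as BU.
  assert (Eu : u = vadd (vscale (cc F) (fX F)) (fN F)).
  { unfold u, Q. rewrite rot_unit_eq by apply G. rewrite mv_rot_unit, sin_PI2, cos_PI2. unfold cc, fN.
    generalize (fX F) (fY F). mring. }
  assert (BN : mv B (fN F) = fN F).
  { unfold fN. rewrite <- SO3_cross, BX, BY by auto. generalize (fX F) (fY F). mring. }
  rewrite Eu, mv_add, mv_scale, BX, BN in BU. apply (N_nonzero F G).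
  revert BU. generalize (fN F) (fX F) (cc F). intros n x c. destruct n, x. unfold vadd, vneg, vscale; cbn.
  intros E; injection E; intros. f_equal; lra.
Qed.

(** The penalty with weight n rewards closeness to g without enforcing it. One shape occurs for
    infinitely many n, its parameters are bounded, and a limit of them is taken. *)
Theorem limit_shape F g : cf F -> inSO3 g -> exists s p, Sok F s p /\ wp F (fw F (sword s p)) = g /\
  forall w, nnw w -> wp F w = g -> wc F (fw F (sword s p)) <= wc F w.
Proof.
  intros HF Sg. pose proof HF as [G C].
  assert (ST : forall n : nat, exists sp : shape * (nat -> R), Sok F (fst sp) (snd sp) /\
    forall w, nnw w -> wc F (fw F (sword (fst sp) (snd sp))) - INR n * mtr (mmul (mtrans g) (wp F (fw F (sword (fst sp) (snd sp)))))
      <= wc F w - INR n * mtr (mmul (mtrans g) (wp F w))).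
  { intros n. destruct (penalised_minimum F (mscale (INR n) (mtrans g)) G) as (w & LW & HO & HP).
    destruct (lword_fw F w LW) as (l & ->). destruct (Min_exists F _ l HO) as (l' & [W1 W2] & HM).
    destruct (classification F _ l' HF HM) as (s & p & OK & [W3 W4]). exists (s, p). cbn [fst snd]. split; auto.
    intros w' N. specialize (HP w' N). rewrite !mmul_scalel, !mtr_scale in HP. rewrite <- W3, <- W4, W1, W2. exact HP. }
  set (f := fun n => proj1_sig (constructive_indefinite_description _ (ST n))).
  assert (Hf : forall n, Sok F (fst (f n)) (snd (f n)) /\
    forall w, nnw w -> wc F (fw F (sword (fst (f n)) (snd (f n)))) - INR n * mtr (mmul (mtrans g) (wp F (fw F (sword (fst (f n)) (snd (f n))))))
      <= wc F w - INR n * mtr (mmul (mtrans g) (wp F w))) by (intros n; apply (proj2_sig (constructive_indefinite_description _ (ST n)))).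
  clearbody f. clear ST.
  destruct (pigeonhole (fun n => fst (f n))) as [s Hs].
  set (phi := fun N => proj1_sig (constructive_indefinite_description _ (Hs N))).
  assert (Hphi : forall N, (N <= phi N)%nat /\ fst (f (phi N)) = s) by (intros N; apply (proj2_sig (constructive_indefinite_description _ (Hs N)))).
  clearbody phi. clear Hs.
  destruct (Sok_bounded F HF) as [M HM].
  destruct (bounded_subseq_fam 6 (fun n => trim s (snd (f (phi n)))) M) as (psi & l & Hpsi & Hl).
  { intros n i. apply HM. rewrite <- (proj2 (Hphi n)). apply Hf. }
  set (m := fun k => phi (psi k)). set (q := fun k => trim s (snd (f (m k)))).
  assert (Hm : forall k, (k <= m k)%nat) by (intros k; unfold m; pose proof (Hpsi k); pose proof (proj1 (Hphi (psi k))); lia).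
  assert (Hq : forall k, Sok F s (q k) /\
    forall w, nnw w -> wc F (fw F (sword s (q k))) - INR (m k) * mtr (mmul (mtrans g) (wp F (fw F (sword s (q k)))))
      <= wc F w - INR (m k) * mtr (mmul (mtrans g) (wp F w))).
  { intros k. unfold q. rewrite trim_word. destruct (Hf (m k)) as [H1 H2]. unfold m in *. rewrite (proj2 (Hphi (psi k))) in H1, H2.
    split; auto. apply trim_ok; auto. }
  assert (Hc : forall i, (i < 6)%nat -> Un_cv (fun k => q k i) (l i)) by (intros i Hi; apply tends_cv, Hl, Hi).
  clearbody q m. clear f Hf phi Hphi psi Hpsi Hl HM.
  assert (OK : Sok F s l) by (apply (Sok_closed F s q); auto; intros; apply Hq).
  assert (NQ : forall k, nnw (fw F (sword s (q k)))).
  { intros k. destruct (Hq k) as [O _]. revert O. generalize (q k). clear. intros p O.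
    destruct s as [[] [[n []] []]]; unfold Sok, tail_ok in O; cbn; unfold nnw; repeat (apply Forall_cons; [cbn; lra|]); apply Forall_nil. }
  destruct (inst_cv F (slots s) q l) as [CW CC]. { intros i x Hi. apply Hc. eapply slots_lt; eauto. }
  exists s, l. split; auto. rewrite sword_inst. set (h := wp F (fw F (inst (slots s) l))) in *. set (c := wc F (fw F (inst (slots s) l))) in *.
  assert (Sh : inSO3 h) by apply wp_SO3.
  assert (HI : mmul (mtrans g) h = mid3).
  { apply (trace_max F); auto; [apply SO3_mul; auto using SO3_trans|]. intros w Nw. apply Rnot_lt_le. intros Hlt.
    (* If w raised the trace at the limit by D > 0, appending w to the minimiser of weight m k would
       gain more than m k D / 2 for large k and cost only [wc F w]. *)
    set (d := fun k => mtr (mmul (mmul (mtrans g) (wp F (fw F (inst (slots s) (q k))))) (wp F w)) - mtr (mmul (mtrans g) (wp F (fw F (inst (slots s) (q k)))))).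
    set (D := mtr (mmul (mmul (mtrans g) h) (wp F w)) - mtr (mmul (mtrans g) h)).
    assert (CD : Un_cv d D).
    { unfold d, D. apply CV_minus; apply ecv_mtr; repeat apply ecv_mul; auto using ecv_const. }
    destruct (CD (D / 2)) as [N HN]; [unfold D; lra|].
    assert (DP : 0 < D) by (unfold D; lra).
    destruct (INR_unbounded (2 * wc F w / D)) as [N2 HN2].
    set (k := (N + N2)%nat). specialize (HN k ltac:(unfold k; lia)). unfold Rdist in HN.
    assert (dk : D / 2 < d k) by (pose proof (Rabs_def2 _ _ HN); lra).
    assert (mk : 2 * wc F w / D < INR (m k)) by (eapply Rlt_le_trans; [exact HN2|]; apply le_INR; specialize (Hm k); unfold k in *; lia).
    destruct (Hq k) as [_ HP]. specialize (HP (fw F (sword s (q k)) ++ w)). rewrite wp_app, wc_app, <- mmul_assoc, sword_inst in HP.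
    assert (NN : nnw (fw F (inst (slots s) (q k)) ++ w)) by (apply nnw_app; split; auto; rewrite <- sword_inst; auto).
    specialize (HP NN).
    assert (U1 : INR (m k) * d k <= wc F w) by (unfold d; lra).
    pose proof (wc_ge0 F w G Nw).
    assert (U2 : wc F w < INR (m k) * (D / 2)).
    { replace (wc F w) with (2 * wc F w / D * (D / 2)) by (field; lra). apply Rmult_lt_compat_r; lra. }
    assert (0 <= INR (m k)) by apply pos_INR. nra. }
  split.
  - transitivity (mmul g (mmul (mtrans g) h)); [|rewrite HI, mmul_1r; auto].
    rewrite <- mmul_assoc, SO3_rinv, mmul_1l; auto.
  (* A word with product g has the largest possible trace term, 3, so already before the limit each
     minimiser costs at most as much as w. *)
  - intros w Nw Ew. apply (cv_le (fun k => wc F (fw F (inst (slots s) (q k)))) (fun _ => wc F w)); auto using cv_const.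
    intros k. destruct (Hq k) as [_ HP]. specialize (HP w Nw). rewrite Ew, SO3_linv, sword_inst in HP by auto.
    pose proof (SO3_tr_le (mmul (mtrans g) (wp F (fw F (inst (slots s) (q k))))) ltac:(apply SO3_mul; auto using SO3_trans, wp_SO3)).
    change (mtr mid3) with (1 + 1 + 1) in HP. pose proof (pos_INR (m k)). nra.
Qed.

(** * From shapes to subwords of the patterns *)

Lemma subword_fw2 F l1 m l2 t1 t1' x1 t2 t2' x2 : 0 <= t1' <= t1 -> 0 <= t2' <= t2 ->
  subword (fw F ((t1', x1) :: m ++ [(t2', x2)])) (fw F (l1 ++ (t1, x1) :: m ++ (t2, x2) :: l2)).
Proof.
  intros H1 H2. right. exists (fw F l1), (fw F m), (fw F l2), t1, t1', (gcoef F x1), t2, t2', (gcoef F x2).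
  rewrite fw_app, !fw_cons, !fw_app, fw_cons. auto.
Qed.
Lemma subword_fw1 F l1 l2 t t' x : 0 <= t' <= t -> subword (fw F [(t', x)]) (fw F (l1 ++ (t, x) :: l2)).
Proof.
  intros H. left. exists (fw F l1), (fw F l2), t, t', (gcoef F x). rewrite fw_app, fw_cons. auto.
Qed.

Definition F0 (X Y : V3) (kappa : R) : frame := mkF X Y 1 kappa.

Lemma label_coef_gcoef X Y kappa l : label_coef kappa (dot X Y) l = gcoef (F0 X Y kappa) l.
Proof.
  unfold label_coef, gcoef, F0. destruct l as [n b]; cbn [fst snd].
  assert (E : base_coef kappa (dot X Y) b = gbase (mkF X Y 1 kappa) b).
  { destruct b; unfold gbase, cc; cbn; rewrite ?Rmult_1_l; reflexivity. }
  rewrite E. reflexivity.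
Qed.
Lemma eval_pattern_fw X Y kappa tX tY t p :
  eval_pattern kappa (dot X Y) tX tY t p = fw (F0 X Y kappa) (map (fun st => (tval tX tY t (fst st), snd st)) p).
Proof.
  unfold eval_pattern, fw. rewrite map_map. apply map_ext. intros [s l]; cbn. rewrite label_coef_gcoef. reflexivity.
Qed.
Lemma word_cost_wc X Y kappa w : word_cost kappa w = wc (F0 X Y kappa) w.
Proof.
  induction w as [|f w IH]; [reflexivity|]. rewrite wc_cons, <- IH.
  change (word_cost kappa (f :: w)) with (fcost kappa f + word_cost kappa w). unfold fcost, ucost; cbn [F0 kx ky]. ring.
Qed.

Lemma F0_cf X Y kappa : dot X X = 1 -> dot Y Y = 1 -> 0 < dot X Y -> dot X Y < kappa -> kappa <= 1 -> cf (F0 X Y kappa).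
Proof.
  intros HX HY C1 C2 C3. split; [|exact C1]. constructor; unfold F0, cc; cbn; auto; try lra; rewrite Rabs_right by lra; nra.
Qed.
Lemma hat_tX_hX X Y kappa : hat_tX kappa (dot X Y) = hX (F0 X Y kappa).
Proof. unfold hat_tX, hX, F0, cc; cbn. rewrite Rmult_1_r. reflexivity. Qed.
Lemma hat_tY_hY X Y kappa : 0 < kappa * dot X Y -> dot X Y = dot Y X -> hat_tY kappa (dot X Y) = hY (F0 X Y kappa).
Proof.
  intros H E. unfold hat_tY, hY, hX, F0, cc; cbn. rewrite <- E. f_equal. field. lra.
Qed.

(** Recovers the tangent relation from its cross-multiplied form, which survives limits. If one of
    the cosines vanishes so does the other, and this is the case where both times are pi. *)
Lemma rel_I_half kappa tX tY : 0 < kappa -> 0 < tX <= PI -> 0 < tY <= PI ->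
  sin (tX / 2) * cos (tY / 2) = kappa * (cos (tX / 2) * sin (tY / 2)) -> rel_I kappa tX tY.
Proof.
  intros K HX HY E. unfold rel_I.
  assert (PZ : forall t, 0 < t <= PI -> cos (t / 2) = 0 -> t = PI).
  { intros t Ht Z. destruct (Rle_lt_or_eq_dec t PI) as [L|L]; [lra| |auto]. pose proof (cos_gt_0 (t / 2)). lra. }
  assert (SP : forall t, 0 < t <= PI -> 0 < sin (t / 2)) by (intros; apply sin_gt_0; lra).
  pose proof (SP tX HX) as S1. pose proof (SP tY HY) as S2.
  destruct (Req_dec (cos (tX / 2)) 0) as [Z|Z].
  - right. split; auto. rewrite Z in E. apply PZ; auto. nra.
  - destruct (Req_dec (cos (tY / 2)) 0) as [Z'|Z'].
    { exfalso. rewrite Z' in E. assert (kappa * sin (tY / 2) <> 0) by nra. apply Z.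
      apply Rmult_eq_reg_l with (kappa * sin (tY / 2)); auto. lra. }
    left. assert (N : forall t, cos (t / 2) <> 0 -> t <> PI) by (intros t Zt ->; apply Zt, cos_PI2).
    split; [pose proof (N tX Z); lra|]. split; [pose proof (N tY Z'); lra|].
    unfold tan. apply Rmult_eq_reg_r with (cos (tX / 2) * cos (tY / 2)); [|auto].
    transitivity (sin (tX / 2) * cos (tY / 2)); [field; auto|]. rewrite E. field. auto.
Qed.

Definition nnl (l : list (R * label)) : Prop := Forall (fun x => 0 <= fst x) l.

(** Passing to an equivalent l' allows the zero letters of a shape to be dropped: a subword has
    arbitrary times only at its two ends. *)
Definition convertible (X Y : V3) (kappa : R) (l : list (R * label)) : Prop :=
  let F := F0 X Y kappa in exists l', weq F l' l /\ nnl l' /\ exists p, allowed_word kappa (dot X Y) p /\ subword (fw F l') p.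

Lemma pattern_I X Y kappa b1 b2 b3 T1 T2 : let F := F0 X Y kappa in 0 < kappa -> 0 < T1 <= PI -> 0 < T2 <= PI ->
  kxy F b3 * (sin (T1 / 2) * cos (T2 / 2)) = kxy F (negb b3) * (cos (T1 / 2) * sin (T2 / 2)) ->
  allowed_word kappa (dot X Y) (fw F [(T1, (b1, xy b3)); (T2, (b2, xy (negb b3))); (T1, (negb b1, xy b3)); (T2, (negb b2, xy (negb b3)))]).
Proof.
  intros F K H1 H2 E. left.
  (* The eight choices of the booleans are the eight images of pattern I; when Y comes first, [Vs]
     also exchanges the two times. *)
  exists (if b3 then (if b1 then (if b2 then [Nu; Vs] else [Rho; Vs]) else (if b2 then [Nu; Rho; Vs] else [Vs]))
          else (if b1 then (if b2 then [Nu] else [Nu; Rho]) else (if b2 then [Rho] else []))),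
    (if b3 then T2 else T1), (if b3 then T1 else T2).
  split; [exact I|]. split; [destruct b3; auto|]. split; [destruct b3; auto|]. split.
  - destruct b3; apply rel_I_half; auto; try lra; cbn in E; unfold F, F0 in E; cbn in E; lra.
  - rewrite (eval_pattern_fw X Y). destruct b1, b2, b3; reflexivity.
Qed.

Lemma convert_I X Y kappa b1 b2 b3 p : let F := F0 X Y kappa in 0 < dot X Y -> 0 < kappa -> Sok F (KI, (b1, b2, b3)) p -> convertible X Y kappa (sword (KI, (b1, b2, b3)) p).
Proof.
  intros F C K. unfold Sok, sword. generalize (p 0%nat) (p 1%nat) (p 2%nat) (p 3%nat) (p 4%nat) (p 5%nat).
  intros t1 t2 t3 t4 T1 T2 (B1 & B2 & B3 & B4 & B5 & B6 & D1 & D2 & D3 & E).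
  set (l1 := (b1, xy b3)). set (l2 := (b2, xy (negb b3))). set (l1' := (negb b1, xy b3)). set (l2' := (negb b2, xy (negb b3))).
  pose proof PI_RGT_0.
  assert (KP : forall b, 0 < kxy F b) by (intros []; cbn; lra).
  assert (SN : forall t, 0 < t <= PI -> 0 < sin (t / 2)) by (intros; apply sin_gt_0; lra).
  (* The pattern requires positive full times, while a limit may have full time 0. By the relation
     both are then 0, and the trivial word is a subword of the pattern with times pi. *)
  destruct (Req_dec T1 0) as [Z|Z]; [|destruct (Req_dec T2 0) as [Z'|Z']].
  1,2: assert (t1 = 0 /\ t2 = 0 /\ t3 = 0 /\ t4 = 0) as (-> & -> & -> & ->).
  1:{ destruct (Req_dec T2 0); [lra|]. exfalso. rewrite Z in E. replace (0 / 2) with 0 in E by field. rewrite sin_0, cos_0 in E.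
      pose proof (SN T2 ltac:(lra)). pose proof (KP (negb b3)). nra. }
  2:{ exfalso. rewrite Z' in E. replace (0 / 2) with 0 in E by field. rewrite sin_0, cos_0 in E.
      pose proof (SN T1 ltac:(lra)). pose proof (KP b3). nra. }
  1,2: exists [(0, l1)]; split; [exact (weq_trans _ _ _ _ (weq_zero_end F l2 [(0, l1)]) (weq_trans _ _ _ _ (weq_zero_end F l1' [(0, l1); (0, l2)]) (weq_zero_end F l2' [(0, l1); (0, l2); (0, l1')])))|];
    split; [constructor; [cbn; lra|constructor]|];
    exists (fw F [(PI, l1); (PI, l2); (PI, l1'); (PI, l2')]); split;
    [apply pattern_I; try lra; rewrite cos_PI2; ring | apply (subword_fw1 F [] [(PI, l2); (PI, l1'); (PI, l2')]); lra].
  assert (AW : allowed_word kappa (dot X Y) (fw F [(T1, l1); (T2, l2); (T1, l1'); (T2, l2')])) by (apply pattern_I; auto; lra).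
  destruct (Req_dec t2 T2) as [Q|Q].
  - destruct (Req_dec t3 T1) as [Q'|Q'].
    + exists [(t1, l1); (t2, l2); (t3, l1'); (t4, l2')]. split; [apply weq_refl|].
      split; [repeat (apply Forall_cons; [cbn; lra|]); apply Forall_nil|]. eexists. split; [exact AW|]. rewrite Q, Q'.
      apply (subword_fw2 F [] [(T2, l2); (T1, l1')] []); lra.
    + destruct D3 as [|D3]; [contradiction|]. rewrite D3.
      exists [(t1, l1); (t2, l2); (t3, l1')]. split; [apply (weq_zero_end F l2' [(t1, l1); (t2, l2); (t3, l1')])|].
      split; [repeat (apply Forall_cons; [cbn; lra|]); apply Forall_nil|]. eexists. split; [exact AW|]. rewrite Q.
      apply (subword_fw2 F [] [(T2, l2)] [(T2, l2')]); lra.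
  - destruct D1 as [|D1]; [contradiction|]. destruct D2 as [|D2]; [contradiction|]. rewrite D1, D2.
    exists [(t1, l1); (t2, l2)].
    split; [exact (weq_trans _ _ _ _ (weq_zero_end F l1' [(t1, l1); (t2, l2)]) (weq_zero_end F l2' [(t1, l1); (t2, l2); (0, l1')]))|].
    split; [repeat (apply Forall_cons; [cbn; lra|]); apply Forall_nil|]. eexists. split; [exact AW|].
    apply (subword_fw2 F [] [] [(T1, l1'); (T2, l2')]); lra.
Qed.

Definition cap1 (F : frame) (i : bool) : R := if i then hY F else hX F.
Definition cap2 (F : frame) (i : bool) : R := if i then hX F else hY F.

(** Tails of equal kind give pattern IV, of different kind pattern V. [Nu] after [Vs] fixes W_+ and
    exchanges the two kinds of tail, so it accounts for i. *)
Lemma pattern_W X Y kappa n i j t : let F := F0 X Y kappa in 0 < dot X Y -> 0 < kappa -> 0 <= t -> allowed_word kappa (dot X Y)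
  (fw F (rev (tailw i n (cap1 F i) (cap2 F i)) ++ (t, (n, BWp)) :: tailw j n (cap1 F j) (cap2 F j))).
Proof.
  intros F C K Ht. right.
  assert (EY : hat_tY kappa (dot X Y) = hY F) by (apply hat_tY_hY; [nra | unfold dot; ring]).
  pose proof (hat_tX_hX X Y kappa : _ = hX F) as EX.
  assert (G4 : in_G4 ((if n then [Nu] else []) ++ (if i then [Nu; Vs] else []))).
  { unfold in_G4. destruct n, i; repeat apply Forall_cons; try apply Forall_nil; auto. }
  destruct (xorb i j) eqn:XJ; [right|]; left;
    exists ((if n then [Nu] else []) ++ (if i then [Nu; Vs] else [])), t; split; auto; split; auto;
    rewrite (eval_pattern_fw X Y), EX, EY; destruct n, i, j; try discriminate; reflexivity.
Qed.

Lemma convert_W X Y kappa n i j p : let F := F0 X Y kappa in 0 < dot X Y -> 0 < kappa -> Sok F (KW, (n, i, j)) p -> convertible X Y kappa (sword (KW, (n, i, j)) p).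
Proof.
  intros F C K. unfold Sok, sword. generalize (p 0%nat) (p 1%nat) (p 2%nat) (p 3%nat) (p 4%nat). clear p.
  intros a1 b1 t a2 b2 (O1 & O2 & Ht & _). pose proof (pattern_W X Y kappa n i j t C K Ht) as AW. cbv zeta in AW. fold F in AW.
  assert (TS : forall i a b, exists x y, tailw i n a b = [(a, x); (b, y)] /\ tailw i n (cap1 F i) (cap2 F i) = [(cap1 F i, x); (cap2 F i, y)]).
  { clear. intros [] a b; cbn; eauto. }
  destruct (TS i a1 b1) as (x1 & y1 & E1 & E1'). destruct (TS j a2 b2) as (x2 & y2 & E2 & E2').
  rewrite E1, E2. rewrite E1', E2' in AW. cbn [rev app] in *. clear E1 E2 E1' E2' TS.
  unfold tail_ok in O1, O2. fold (cap1 F i) (cap2 F i) in O1. fold (cap1 F j) (cap2 F j) in O2.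
  destruct O1 as (U1 & U2 & U3). destruct O2 as (V1 & V2 & V3). set (w := (n, BWp)) in *.
  (* A tail whose first letter is not full has an outer letter of time zero; this is dropped, so
     that the incomplete letter becomes an end of the subword. *)
  destruct (Req_dec a1 (cap1 F i)) as [P|P]; destruct (Req_dec a2 (cap1 F j)) as [Q|Q].
  - exists [(b1, y1); (a1, x1); (t, w); (a2, x2); (b2, y2)]. split; [apply weq_refl|].
    split; [repeat (apply Forall_cons; [cbn; lra|]); apply Forall_nil|]. eexists. split; [exact AW|]. rewrite P, Q.
    apply (subword_fw2 F [] [(cap1 F i, x1); (t, w); (cap1 F j, x2)] []); lra.
  - destruct V3 as [-> |]; [|contradiction].
    exists [(b1, y1); (a1, x1); (t, w); (a2, x2)]. split; [apply (weq_zero_end F y2 [(b1, y1); (a1, x1); (t, w); (a2, x2)])|].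
    split; [repeat (apply Forall_cons; [cbn; lra|]); apply Forall_nil|]. eexists. split; [exact AW|]. rewrite P.
    apply (subword_fw2 F [] [(cap1 F i, x1); (t, w)] [(cap2 F j, y2)]); lra.
  - destruct U3 as [-> |]; [|contradiction].
    exists [(a1, x1); (t, w); (a2, x2); (b2, y2)]. split; [apply weq_zero|].
    split; [repeat (apply Forall_cons; [cbn; lra|]); apply Forall_nil|]. eexists. split; [exact AW|]. rewrite Q.
    apply (subword_fw2 F [(cap2 F i, y1)] [(t, w); (cap1 F j, x2)] []); lra.
  - destruct U3 as [-> |]; [|contradiction]. destruct V3 as [-> |]; [|contradiction].
    exists [(a1, x1); (t, w); (a2, x2)].
    split; [eapply weq_trans; [apply (weq_zero_end F y2 [(a1, x1); (t, w); (a2, x2)]) | apply weq_zero]|].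
    split; [repeat (apply Forall_cons; [cbn; lra|]); apply Forall_nil|]. eexists. split; [exact AW|].
    apply (subword_fw2 F [(cap2 F i, y1)] [(t, w)] [(cap2 F j, y2)]); lra.
Qed.

(** Equal outer letters give pattern VI, different ones VII; [Vs] fixes W_- and exchanges X and
    Y. *)
Lemma pattern_M X Y kappa n e1 e2 t : let F := F0 X Y kappa in 0 < dot X Y -> 0 < kappa -> 0 <= t -> allowed_word kappa (dot X Y)
  (fw F [(PI, (n, xy e1)); (t, (n, BWm)); (PI, (n, xy e2))]).
Proof.
  intros F C K Ht. right; right; right.
  assert (G4 : in_G4 ((if n then [Nu] else []) ++ (if e2 then [] else [Vs]))).
  { unfold in_G4. destruct n, e2; repeat apply Forall_cons; try apply Forall_nil; auto. }
  destruct (xorb e1 e2) eqn:XJ; [right|left];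
    exists ((if n then [Nu] else []) ++ (if e2 then [] else [Vs])), t; split; auto; split; auto;
    rewrite (eval_pattern_fw X Y); destruct n, e1, e2; try discriminate; reflexivity.
Qed.

Lemma convert_M X Y kappa n e1 e2 p : let F := F0 X Y kappa in 0 < dot X Y -> 0 < kappa -> Sok F (KM, (n, e1, e2)) p -> convertible X Y kappa (sword (KM, (n, e1, e2)) p).
Proof.
  intros F C K (H1 & H2 & H3 & _). eexists. split; [apply weq_refl|]. cbn [sword].
  split; [repeat (apply Forall_cons; [cbn; lra|]); apply Forall_nil|].
  eexists. split; [apply (pattern_M X Y kappa n e1 e2 (p 1%nat)); auto|].
  apply (subword_fw2 F [] [(p 1%nat, (n, BWm))] []); auto.
Qed.

Theorem theorem2p2 (X Y : V3) (kappa : R) :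
  dot X X = 1 -> dot Y Y = 1 ->
  0 < dot X Y -> dot X Y < kappa -> kappa <= 1 ->
  forall g : M3, inSO3 g ->
  exists w : list factor,
    optimal X Y kappa g w /\
    exists p, allowed_word kappa (dot X Y) p /\ subword w p.
Proof.
  intros HX HY C1 C2 C3 g Sg. pose proof (F0_cf X Y kappa HX HY C1 C2 C3) as HF.
  destruct (limit_shape _ g HF Sg) as (s & q & OK & E & OPT).
  assert (CV : convertible X Y kappa (sword s q)).
  { destruct s as [[] [[b1 b2] b3]]; [apply convert_I | apply convert_W | apply convert_M]; auto; lra. }
  destruct CV as (l & [W1 W2] & NN & p & AW & SW). exists (fw (F0 X Y kappa) l). split; [|exists p; auto].
  split.
  - split.
    + unfold fw. apply Forall_map. revert NN. apply Forall_impl. intros [t x] Ht. split; [exact Ht|].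
      apply (lv_nz (F0 X Y kappa) x), HF.
    + change (wp (F0 X Y kappa) (fw (F0 X Y kappa) l) = g). rewrite W1. exact E.
  - intros w' [N' E']. rewrite !(word_cost_wc X Y), W2. apply OPT; [|exact E'].
    revert N'. apply Forall_impl. tauto.
Qed.
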